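(* Let $\hat\theta=(\hat\theta_1,\hat\theta_2)$ be the two-step M-estimator based on the first $n$ data pairs, and suppose that $\hat\theta\to\theta^*$ in $P^*$-probability as $n\to\infty$, where $\theta^*=(\theta_1^*,\theta_2^* )$ is the (two-step) pseudo-true parameter, and that $\theta^*$ lies in the interior of $\Theta_1\times\Theta_2$. Assume: (i) $\pi_1$ is continuous at $\theta_1^*$ with $\pi_1(\theta_1^* )>0$; $\pi_2$ is continuously differentiable at $\theta_2^*$ with $\pi_2(\theta_2^* )>0$. (ii) For all $\delta_1>0$ there is $\gamma_1>0$ with $$\lim_{n\to\infty}\mathbb P\Big[\sup_{\theta_1\in\Theta_1,\ \|\theta_1-\hat\theta_1\|\ge\delta_1}\tfrac1n\big(L_1(\theta_1|X_1)-L_1(\hat\theta_1|X_1)\big)\le-\gamma_1\Big]=1,$$ and for all $\delta_2>0$ there are $\delta_1>0,\gamma_2>0$ with $$\lim_{n\to\infty}\mathbb P\Big[\sup_{\|\theta_1-\hat\theta_1\|<\delta_1,\ \|\theta_2-\hat\theta_2\|\ge\delta_2}\tfrac1n\big(L_2(\theta_1,\theta_2|X_1,X_2)-L_2(\hat\theta_1,\hat\theta_2|X_1,X_2)\big)\le-\gamma_2\Big]=1$$ (with $\theta_1\in\Theta_1$, $\theta_2\in\Theta_2$). (iii) $L_2,L$ are three times differentiable in a neighbourhood of $\hat\theta$, almost surely, and there is $\delta>0$ such that, almost surely, for all sufficiently large $n$, the maximum of $$\sup_{0<\|s\|\le\delta}\frac{\|L''(\hat\theta+s)-L''(\hat\theta)\|_{op}}{n\|s\|},\quad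 \sup_{0<\|s\|\le\delta}\frac{|L_2(\hat\theta+s)-L_2(\hat\theta)|}{n\|s\|},\quad \sup_{0<\|s\|\le\delta}\frac{\|\partial_{22}L_2(\hat\theta_1,\hat\theta_2+s)-\partial_{22}L_2(\hat\theta_1,\hat\theta_2)\|_{op}}{n\|s\|}$$ is at most $M_1(X_1,X_2)$, where for some fixed deterministic $K>0$, $\lim_{n\to\infty}\mathbb P[M_1(X_1,X_2)<K]=1$. (iv) For all $\theta=(\theta_1,\theta_2)$ in some open ball around $\theta^*$ and all $x_1,x_2$: $|\partial_{[jk]}\log f_1(x_1|\theta_1)|\le M_2(x_1)$ for $1\le j\le k\le d_1$ and $|\partial_{[jk]}\log f_2(x_2|\theta_1,\theta_2,x_1)|\le M_3(x_1,x_2)$ for $1\le j\le k\le d_1+d_2$, where $\partial_{[jk]}$ is the second partial derivative with respect to the $j$-th and $k$-th coordinates of $\theta$, $M_2,M_3$ do not depend on $\theta$, and $\mathbb E_{p_1^*}M_2(X_{1,1})<\infty$, $\mathbb E_{p^*}M_3(X_{1,1},X_{2,1})<\infty$. (v) For all $(\theta_1,\theta_2)$ in some open ball around $\theta^*$ the matrices $-\mathbb E_{p_1^*}[\partial_{11}\log f_1(X_{1,1}|\theta_1)]$ and $-\mathbb E_{p^*}[\partial_{22}\log f_2(X_{2,1}|\theta_1,\theta_2,X_{1,1})]$ are positive definite. (vi) There is $\delta>0$, independent of $n$, such that, almost surely, for sufficiently large $n$, the quantities $$\sup_{\|s\|\le\delta}\tfrac{\|\partial_{11}L_2(\hat\theta_1,\hat\theta_2+s)\|_{op}}{n},\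 \ \sup_{\|s\|\le\delta}\tfrac{\|\partial_{12}L_2(\hat\theta_1,\hat\theta_2+s)\|_{op}}{n},\ \ \sup_{\|s\|\le\delta}\tfrac{\|\partial_1L_2(\hat\theta+s)\|}{n},$$ $$\sup_{0<\|s\|\le\delta}\tfrac{\|\partial_{11}L_2(\hat\theta_1,\hat\theta_2+s)-\partial_{11}L_2(\hat\theta_1,\hat\theta_2)\|_{op}}{n\|s\|},\ \ \sup_{0<\|s\|\le\delta}\tfrac{\|\partial_{12}L_2(\hat\theta_1,\hat\theta_2+s)-\partial_{12}L_2(\hat\theta_1,\hat\theta_2)\|_{op}}{n\|s\|}$$ are all at most $M_4(X_1,X_2)$, which is bounded in probability with respect to $n$. (vii) There is $m>0$, independent of $n$, such that $n^{-m}\int\|\partial_1L_2(\hat\theta_1,\theta_2)\|^2\pi_2(\theta_2)d\theta_2$ and $n^{-m}\int\|\partial_{11}L_2(\hat\theta_1,\theta_2)\|_{op}\pi_2(\theta_2)d\theta_2$ almost surely exist and are both at most some $M_5(X_1,X_2)$ which is bounded in probability with respect to $n$. Moreover, for some $\delta>0$, the integrals $\int\sup_{\|\theta_1-\hat\theta_1\|<\delta}\|\partial_1L_2(\theta_1,\theta_2)\|^2\pi_2(\theta_2)d\theta_2$ and $\int\sup_{\|\theta_1-\hat\theta_1\|<\delta}\|\partial_{11}L_2(\theta_1,\theta_2)\|\pi_2(\theta_2)d\theta_2$ exist with probability converging to $1$ as $n\to\infty$. Define $$H=\begin{pmatrix}J_1^*+R_J^*(J_2^* )^{-1}(R_J^*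 )^T & R_J^*\\ (R_J^* )^T & J_2^*\end{pmatrix}=\begin{pmatrix}(J_1^* )^{-1}&-(J_1^* )^{-1}R_J^*(J_2^* )^{-1}\\-(J_2^* )^{-1}(R_J^* )^T(J_1^* )^{-1}&(J_2^* )^{-1}+(J_2^* )^{-1}(R_J^* )^T(J_1^* )^{-1}R_J^*(J_2^* )^{-1}\end{pmatrix}^{-1}.$$ Let $\tilde\pi_{\rm cut}$ be the law (given the data) of $\sqrt n(\theta-\hat\theta)$ where $\theta\sim\pi_{\rm cut}$. Then $$\mathrm{TV}\big(\tilde\pi_{\rm cut},\mathrm{Normal}(0,H^{-1})\big)\to0\quad\text{in }P^*\text{-probability as }n\to\infty.$$
   Context: Setting. The pairs $(X_{1,j},X_{2,j})$, $j\ge1$, are i.i.d. from a probability distribution $p^*$ with marginals $p_1^*,p_2^*$; $X_1=(X_{1,j})_j$, $X_2=(X_{2,j})_j$, and $P^*$ is the law of $(X_1,X_2)$ (also written $\mathbb P$). Parameter spaces are $\Theta_1\subseteq\mathbb R^{d_1}$, $\Theta_2\subseteq\mathbb R^{d_2}$, with prior probability densities $\pi_1,\pi_2$. Given (measurable) functions $\log f_1(x_1|\theta_1)$, $\log f_2(x_2|\theta_1,\theta_2,x_1)$ (not necessarily true log-likelihoods), $$L_1(\theta_1|X_1)=\sum_{j=1}^n\log f_1(X_{1,j}|\theta_1),\quad L_2(\theta_1,\theta_2|X_1,X_2)=\sum_{j=1}^n\log f_2(X_{2,j}|\theta_1,\theta_2,X_{1,j}),$$ $$F(\theta_1|X_1,X_2)=\log\int\exp[L_2(\theta_1,t|X_1,X_2)]\pi_2(t)dt,\qquad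 L(\theta_1,\theta_2|X_1,X_2)=L_1+L_2-F.$$ The conditioning on data is often dropped from the notation. The cut posterior $\pi_{\rm cut}$ is the probability distribution with density proportional to $\exp[L(\theta_1,\theta_2)]\pi_1(\theta_1)\pi_2(\theta_2)$. Two-step M-estimator: $\hat\theta_1=\arg\max_{\theta_1\in\Theta_1}L_1(\theta_1)$, $\hat\theta_2=\arg\max_{\theta_2\in\Theta_2}L_2(\hat\theta_1,\theta_2)$. Pseudo-true parameter: $\theta_1^*=\arg\max_{\theta_1\in\Theta_1}\mathbb E_{p_1^*}\log f_1(X_{1,1}|\theta_1)$, $\theta_2^*=\arg\max_{\theta_2\in\Theta_2}\mathbb E_{p^*}\log f_2(X_{2,1}|\theta_1^*,\theta_2,X_{1,1})$. Derivatives are with respect to parameters: $\partial_i$ is the gradient in $\theta_i$, $\partial_{ij}=\partial^2/\partial\theta_i\partial\theta_j^T$ (a $d_i\times d_j$ matrix); $L',L''$ are the gradient and Hessian in $\theta=(\theta_1,\theta_2)$. $\|\cdot\|$ is the Euclidean norm, $\|\cdot\|_{op}$ the operator norm. Define $$J_1^*=-\mathbb E_{p_1^*}[\partial_{11}\log f_1(X_{1,1}|\theta_1^* )],\ J_2^*=-\mathbb E_{p^*}[\partial_{22}\log f_2(X_{2,1}|\theta_1^*,\theta_2^*,X_{1,1})],\ R_J^*=-\mathbb E_{p^*}[\partial_{12}\log f_2(X_{2,1}|\theta_1^*,\theta_2^*,X_{1,1})].$$ TV is the total variation distance. *)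

(* Defs.v *)
From HB Require Import structures.
From mathcomp Require Import all_boot all_order all_algebra.
From mathcomp Require Import finmap.
From mathcomp Require Import all_classical all_reals all_analysis.
Set Implicit Arguments.
Unset Strict Implicit.
Unset Printing Implicit Defensive.
Import Order.TTheory GRing.Theory Num.Theory.
Import numFieldNormedType.Exports.
Local Open Scope classical_set_scope.
Local Open Scope ring_scope.

(* Row vectors carry the sigma-algebra generated by the coordinates; over the
   Borel sets of R this is the Borel sigma-algebra of R^n. *)
Definition rV_display : measure_display -> measure_display.
Proof. exact. Qed.

Section measurable_rV.
Context {d} {T : measurableType d} (n : nat).

Let coord : 'I_n -> 'rV[T]_n -> T := fun i v => v ord0 i.

Let rV_set0 : g_sigma_preimage coord set0.
Proof. exact: sigma_algebra0. Qed.

Let rV_setC A : g_sigma_preimage coord A -> g_sigma_preimage coord (~` A).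
Proof. exact: sigma_algebraC. Qed.

Let rV_bigcup (F : _^nat) : (forall i, g_sigma_preimage coord (F i)) ->
  g_sigma_preimage coord (\bigcup_i (F i)).
Proof. exact: sigma_algebra_bigcup. Qed.

HB.instance Definition _ := @isMeasurable.Build (rV_display d)
  'rV[T]_n (g_sigma_preimage coord) rV_set0 rV_setC rV_bigcup.

End measurable_rV.

Section lebesgue_rV.
Context {R : realType}.

Definition rV_cons n (p : measurableTypeR R * 'rV[R]_n) : 'rV[R]_n.+1 :=
  \row_i oapp (fun j => p.2 ord0 j) (p.1 : R) (unlift ord0 i).

Lemma measurable_rV_coord n (i : 'I_n) :
  measurable_fun [set: 'rV[R]_n] (fun v => v ord0 i).
Proof.
move=> _ Y mY; rewrite setTI; apply: sub_sigma_algebra => /=.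
rewrite -bigcup_seq/=; exists i => /=; first by rewrite mem_index_enum.
by exists Y => //; rewrite setTI.
Qed.

Lemma measurable_fun_rV d (T : measurableType d) n (f : T -> 'rV[R]_n) :
  (forall i, measurable_fun [set: T] (fun x => f x ord0 i)) ->
  measurable_fun [set: T] f.
Proof.
move=> mf.
have H : preimage_set_system [set: T] f (measurable : set (set 'rV[R]_n))
    `<=` measurable.
  rewrite -g_sigma_preimage_comp.
  apply: smallest_sub; first exact: sigma_algebra_measurable.
  rewrite -bigcup_seq/=; apply: bigcup_sub => i _ A [B mB <-].
  exact: (mf i).
by move=> _ A mA; apply: H; exists A.
Qed.

Lemma measurable_rV_cons n : measurable_fun setT (@rV_cons n).
Proof.
apply: measurable_fun_rV => i.
rewrite (_ : (fun x => _) = (fun x : measurableTypeR R * 'rV[R]_n =>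
   oapp (fun j => x.2 ord0 j) (x.1 : R) (unlift ord0 i))); last first.
  by apply/funext => x; rewrite mxE.
case: (unlift ord0 i) => [j|] /=.
  exact: (measurableT_comp (measurable_rV_coord j) measurable_snd).
exact: (@measurable_fst _ _ (measurableTypeR R) 'rV[R]_n).
Qed.

Section step.
Variables (n : nat) (mu : {sigma_finite_measure set 'rV[R]_n -> \bar R}).

Definition leb_step : set 'rV[R]_n.+1 -> \bar R :=
  pushforward (lebesgue_measure \x mu)%E (@rV_cons n).


Let leb_step0 : leb_step set0 = 0%E.
Proof. by rewrite /leb_step /pushforward preimage_set0 measure0. Qed.

Let leb_step_ge0 A : (0 <= leb_step A)%E.
Proof. by rewrite /leb_step /pushforward; exact: measure_ge0. Qed.

Let leb_step_sigma_additive : semi_sigma_additive leb_step.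
Proof.
pose f : {mfun (measurableTypeR R * 'rV[R]_n)%type >-> 'rV[R]_n.+1} :=
  HB.pack (@rV_cons n) (isMeasurableFun.Build _ _ _ _ _ (@measurable_rV_cons n)).
exact: (@measure_semi_sigma_additive _ _ _ (pushforward (lebesgue_measure \x mu)%E f)).
Qed.

HB.instance Definition _ := isMeasure.Build _ _ _ leb_step
  leb_step0 leb_step_ge0 leb_step_sigma_additive.

Let leb_step_sigma_finite : sigma_finite setT leb_step.
Proof.
have [F TF Foo] : sigma_finite setT (lebesgue_measure \x mu)%E.
  have /sigma_finiteP[F [TF ndF Foo]] := sigma_finiteT (@lebesgue_measure R).
  have /sigma_finiteP[G [TG ndG Goo]] := sigma_finiteT mu.
  exists (fun k => F k `*` G k).
    rewrite -setXTT TF TG predeqE => -[x y]; split.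
      move=> [/= [k _ Fkx] [l _ Gly]]; exists (maxn k l) => //; split.
      - by move: x Fkx; exact/subsetPset/ndF/leq_maxl.
      - by move: y Gly; exact/subsetPset/ndG/leq_maxr.
    by move=> [k _ []/= ? ?]; split; exists k.
  move=> k; have [? ?] := Foo k; have [? ?] := Goo k.
  split; first exact: measurableX.
  by rewrite product_measure1E// lte_mul_pinfty// ge0_fin_numE.
pose g (v : 'rV[R]_n.+1) : measurableTypeR R * 'rV[R]_n :=
  (v ord0 ord0, \row_j v ord0 (lift ord0 j)).
have fK : cancel (@rV_cons n) g.
  move=> [x v]; rewrite /g /rV_cons !mxE unlift_none /=; congr pair.
  by apply/rowP => j; rewrite !mxE liftK.
have gK : cancel g (@rV_cons n).
  move=> v; apply/rowP => i; rewrite !mxE.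
  by case: unliftP => [j ->|->] //=; rewrite mxE.
have mg : measurable_fun setT g.
  apply: measurable_fun_pair => /=.
    exact: measurable_rV_coord.
  apply: measurable_fun_rV => i.
  rewrite (_ : (fun x => _) = (fun x : 'rV[R]_n.+1 => x ord0 (lift ord0 i))).
    exact: measurable_rV_coord.
  by apply/funext => x; rewrite mxE.
exists (fun k => g @^-1` (F k)).
  by rewrite -preimage_bigcup -TF preimage_setT.
move=> k; have [mFk Fkoo] := Foo k; split.
  by rewrite -[X in measurable X]setTI; exact: mg.
rewrite /leb_step /pushforward (_ : _ @^-1` _ = F k)//.
by apply/seteqP; split => x /=; rewrite fK.
Qed.

HB.instance Definition _ := Measure_isSigmaFinite.Build _ _ _ leb_step
  leb_step_sigma_finite.

End step.

(* Lebesgue measure on R^n, as the n-fold product of one-dimensional Lebesgue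
   measure; see lebesgue_rV_box. *)
Fixpoint lebesgue_rV n : {sigma_finite_measure set 'rV[R]_n -> \bar R} :=
  if n is m.+1 then leb_step (lebesgue_rV m) else \d_ (0 : 'rV[R]_0).

Lemma lebesgue_rV_box n (a b : 'rV[R]_n) : (forall i, a ord0 i <= b ord0 i) ->
  lebesgue_rV n [set v | forall i, v ord0 i \in `[a ord0 i, b ord0 i]] =
  (\prod_(i < n) (b ord0 i - a ord0 i))%:E.
Proof.
elim: n a b => [|n IH] a b ab.
  rewrite big_ord0 /= diracE mem_set//.
  by move=> [].
rewrite big_ord_recl /= /leb_step /pushforward.
pose tl (v : 'rV[R]_n.+1) : 'rV[R]_n := \row_j v ord0 (lift ord0 j).
rewrite (_ : _ @^-1` _ = (`[a ord0 ord0, b ord0 ord0]%classic : set (measurableTypeR R)) `*`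
  [set v : 'rV[R]_n | forall i, v ord0 i \in `[tl a ord0 i, tl b ord0 i]]).
  rewrite product_measure1E//.
  - rewrite IH; last by move=> i; rewrite !mxE; exact: ab.
    rewrite [X in (X * _)%E](_ : _ = (b ord0 ord0 - a ord0 ord0)%:E).
      rewrite EFinM; congr (_ * _%:E)%E.
      by apply: eq_bigr => i _; rewrite /tl !mxE.
    have := @lebesgue_measure_itv R `[a ord0 ord0, b ord0 ord0].
    rewrite /= lte_fin => ->.
    have := ab ord0; rewrite le_eqVlt => /predU1P[->|->]; last by rewrite EFinB.
    by rewrite ltxx subrr.
  - rewrite (_ : mkset _ = \bigcap_i ((fun v : 'rV[R]_n => v ord0 i) @^-1` `[tl a ord0 i, tl b ord0 i])).
      apply: fin_bigcap_measurable => // i _.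
      by rewrite -[X in measurable X]setTI; exact: measurable_rV_coord.
    by apply/seteqP; split => v /= H i; [move=> _|]; exact: H.
apply/seteqP; split => -[x v] /=.
  move=> H; split; first by have := H ord0; rewrite mxE unlift_none.
  by move=> i; have := H (lift ord0 i); rewrite !mxE liftK.
move=> [H1 H2] i; rewrite mxE; case: unliftP => [j ->|->] //=.
by have := H2 j; rewrite !mxE.
Qed.

End lebesgue_rV.

HB.instance Definition _ d1 d2 (T1 : measurableType d1) (T2 : measurableType d2)
  := isMeasurableFun.Build _ _ (T1 * T2)%type T1 fst measurable_fst.

Section linear_algebra.
Context {R : realType}.

(* Euclidean norm; for matrices of other shapes, the Euclidean norm of the
   vector of entries. The library norm `|A| is the maximum norm. *)
Definition enorm m n (A : 'M[R]_(m, n)) : R :=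
  Num.sqrt (\sum_i \sum_j A i j ^+ 2).

Definition opnorm m n (A : 'M[R]_(m, n)) : R :=
  sup [set enorm (A *m x) | x in [set x : 'cV[R]_n | enorm x <= 1]].

Definition posdefmx n (A : 'M[R]_n) : Prop :=
  A^T = A /\ forall x : 'rV[R]_n, x != 0 -> 0 < (x *m A *m x^T) ord0 ord0.

End linear_algebra.

Section derivatives.
Context {R : realType} {n : nat}.
Implicit Types (f : 'rV[R]_n -> R) (x : 'rV[R]_n).

Definition partial (j : 'I_n) f x : R := 'D_(delta_mx ord0 j) f x.

Definition grad f x : 'rV[R]_n := \row_j partial j f x.

Definition hess f x : 'M[R]_n := \matrix_(j, k) partial j (partial k f) x.

(* f is k times (Frechet) differentiable at x: it is k-1 times differentiable
   around x, differentiable at x, and its partial derivatives are k-1 times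
   differentiable at x. *)
Fixpoint ntimes_differentiable (k : nat) f x : Prop :=
  if k is k'.+1 then
    [/\ \forall y \near x, ntimes_differentiable k' f y,
        differentiable f x &
        forall j, ntimes_differentiable k' (partial j f) x]
  else True.

Definition ntimes_differentiable_ereal (k : nat) (f : 'rV[R]_n -> \bar R) x :=
  (\forall y \near x, f y \is a fin_num) /\
  ntimes_differentiable k (fun y => fine (f y)) x.

End derivatives.

Definition sup_at_most {R : realType} {T : Type} (D : set T) (g : T -> R) (c : R) :=
  (ereal_sup [set (g x)%:E | x in D] <= c%:E)%E.

Definition is_argmax {disp} {V : porderType disp} {T : Type} (D : set T)
  (g : T -> V) (x : T) : Prop :=
  D x /\ forall y, D y -> (g y <= g x)%O.

Section probability_notions.
Context {d} {Omega : measurableType d} {R : realType} (P : probability Omega R).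

(* P[E n] --> 1. The events below involve suprema and estimators that need not
   be measurable, so this is convergence of the inner probability; on
   measurable events it is P (E n) --> 1. *)
Definition prob_to1 (E : nat -> set Omega) : Prop :=
  exists A : nat -> set Omega,
    (forall n, measurable (A n) /\ A n `<=` E n) /\
    P (A n) @[n --> \oo] --> 1%E.

Definition cvg_in_prob0 (Y : nat -> Omega -> \bar R) : Prop :=
  forall eps : R, 0 < eps ->
    prob_to1 (fun n => [set w | `|Y n w| < eps%:E]%E).

Definition bounded_in_prob (M : nat -> Omega -> R) : Prop :=
  forall eps : R, 0 < eps -> exists C : R, \forall n \near \oo,
    exists A : set Omega,
      [/\ measurable A, A `<=` [set w | `|M n w| <= C] &
          ((1 - eps)%:E <= P A)%E].

Definition iid d' (T : measurableType d') (Z : nat -> Omega -> T)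
    (mu : probability T R) : Prop :=
  [/\ forall j, measurable_fun setT (Z j),
      forall j B, measurable B -> P (Z j @^-1` B) = mu B &
      forall (J : {fset nat}) (B : nat -> set T), (forall j, measurable (B j)) ->
        P (\bigcap_(j in [set` J]) (Z j @^-1` B j)) =
        (\prod_(j <- J) P (Z j @^-1` B j))%E].

Definition expectation_mx m n (A : Omega -> 'M[R]_(m, n)) : 'M[R]_(m, n) :=
  \matrix_(i, j) fine 'E_P[fun x => A x i j].

End probability_notions.

Section laws.
Context {d} {T : measurableType d} {R : realType}.
Implicit Types mu nu : set T -> \bar R.

Definition is_density mu (D : set T) (f : T -> R) : Prop :=
  [/\ measurable_fun D f, forall x, D x -> 0 <= f x &
      (\int[mu]_(x in D) (f x)%:E = 1)%E].

(* The probability law on D with mu-density proportional to g (meaningful when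
   the normalizing constant is positive and finite). *)
Definition law_prop mu (D : set T) (g : T -> \bar R) : set T -> \bar R :=
  fun A => (\int[mu]_(x in D `&` A) g x *
            ((fine (\int[mu]_(x in D) g x))^-1)%:E)%E.

Definition tv_distance mu nu : \bar R :=
  ereal_sup [set `|mu A - nu A|%E | A in measurable].

End laws.

Section normal.
Context {R : realType} {k : nat}.
Implicit Types (m x : 'rV[R]_k) (S : 'M[R]_k).

Definition mvnormal_pdf m S x : R :=
  (Num.sqrt ((2 * pi) ^+ k * \det S))^-1 *
  expR (- ((x - m) *m invmx S *m (x - m)^T) ord0 ord0 / 2).

Definition mvnormal m S : set 'rV[R]_k -> \bar R :=
  fun A => (\int[lebesgue_rV k]_(x in A) (mvnormal_pdf m S x)%:E)%E.

End normal.

(* The parameter theta = (theta_1, theta_2) is the row vector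
   row_mx theta_1 theta_2. Data are indexed from 0, so that a sample of size n
   consists of the pairs of index j < n; [w] is the outcome. *)
Section cut_model.
Context {d} {Omega : measurableType d} {R : realType} {e1 e2 : measure_display}.
Context {T1 : measurableType e1} {T2 : measurableType e2} {d1 d2 : nat}.
Variables (logf1 : T1 -> 'rV[R]_d1 -> R)
  (logf2 : T1 -> T2 -> 'rV[R]_(d1 + d2) -> R).
Variables (X1 : nat -> Omega -> T1) (X2 : nat -> Omega -> T2).
Variables (Th1 : set 'rV[R]_d1) (Th2 : set 'rV[R]_d2).
Variables (pi1 : 'rV[R]_d1 -> R) (pi2 : 'rV[R]_d2 -> R).

Definition prodTheta : set 'rV[R]_(d1 + d2) :=
  [set th | Th1 (lsubmx th) /\ Th2 (rsubmx th)].

Definition loglik1 (n : nat) (w : Omega) (t1 : 'rV[R]_d1) : R :=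
  \sum_(j < n) logf1 (X1 j w) t1.

Definition loglik2 (n : nat) (w : Omega) (th : 'rV[R]_(d1 + d2)) : R :=
  \sum_(j < n) logf2 (X1 j w) (X2 j w) th.

Definition logmarg (n : nat) (w : Omega) (t1 : 'rV[R]_d1) : \bar R :=
  lne (\int[lebesgue_rV d2]_(t in Th2)
         (expR (loglik2 n w (row_mx t1 t)) * pi2 t)%:E)%E.

(* Extended-real valued because the integral defining logmarg may diverge, in
   which case cut_loglik is -oo and the cut density is 0. *)
Definition cut_loglik (n : nat) (w : Omega) (th : 'rV[R]_(d1 + d2)) : \bar R :=
  ((loglik1 n w (lsubmx th) + loglik2 n w th)%:E - logmarg n w (lsubmx th))%E.

Definition cut_posterior (n : nat) (w : Omega) :
    set 'rV[R]_(d1 + d2) -> \bar R :=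
  law_prop (lebesgue_rV (d1 + d2)) prodTheta
    (fun th => expeR (cut_loglik n w th) *
               (pi1 (lsubmx th) * pi2 (rsubmx th))%:E)%E.

End cut_model.

(* Main.v *)
(* Write [l = L1 + L2 - F] for the cut log-likelihood. Integrating
   [exp (l - l theta_hat)] against [pi_2] over [theta_2] gives
   [exp (L1 - L1 theta_hat_1)] up to a constant, so [theta_1] is governed by [L1]
   alone. By (iii) the second differences of [l] oscillate slowly near [theta*];
   hence [l] is quadratic near [theta_hat] up to [n eta |u|^2]. Its mixed and
   [theta_2] blocks are those of [L2] and are given by the law of large numbers;
   its [theta_1] block and its [theta_1] gradient are at first unknown. Laplace's
   method for the [theta_2] integral turns this into an expansion of [L1], which
   identifies the unknown block as [J1 + RJ J2^-1 RJ^T]; since [theta_hat_1]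
   maximises [L1], it also shows that the gradient is [o (sqrt n)]. Dominated
   convergence, with (ii) for the tails, gives [L^1] convergence of the rescaled
   densities, and Scheffe's inequality concludes. No derivative of [F] is ever
   computed.

   The argument is deterministic along any sequence of sample sizes and outcomes
   that is eventually in each of countably many events of probability tending
   to 1, and this suffices for convergence in probability. *)
Require Import Defs.
From HB Require Import structures.
From mathcomp Require Import all_boot all_order all_algebra.
From mathcomp Require Import finmap ring lra.
From mathcomp Require Import all_classical all_reals all_analysis.
From mathcomp Require Import measurable_realfun.
Set Implicit Arguments.
Unset Strict Implicit.
Unset Printing Implicit Defensive.
Import Order.TTheory GRing.Theory Num.Theory.
Import numFieldNormedType.Exports.
Local Open Scope classical_set_scope.
Local Open Scope ring_scope.

(** * Integration over row vectors *)

(** Second differences replace Hessians because they involve finitely many values of the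
    log-likelihoods. The weak law applies to them at [theta*] with a fixed step, so no law of large
    numbers uniform in the parameter enters, and their oscillation over a ball can be tested at
    rational points, which gives measurable events. The oscillation bound then carries the
    information from [theta*] to the random point [theta_hat].

    Laplace's method is used at two scales. At a fixed distance from [theta_hat] it yields [L1] only
    up to small multiples of [n]; that suffices for the unknown block, which is read off from second
    differences of fixed step. The linear term cancels in those differences, so the gradient is
    treated separately, at distance [n^(-1/2)], where the rescaled integrals converge to Gaussian
    ones.

    Priors and log-likelihoods are extended by 0 outside the parameter spaces, so that integrals run
    over the whole space. Distances are in the maximum norm, and the Euclidean and operator norms of
    the hypotheses are converted where they enter. *)

Section lebesgue_rV_integrals.
Context {R : realType}.
Local Open Scope ereal_scope.

Lemma ge0_integral_rVS n (f : 'rV[R]_n.+1 -> \bar R) :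
  measurable_fun setT f -> (forall v, 0 <= f v) ->
  \int[lebesgue_rV n.+1]_v f v =
  \int[lebesgue_measure]_x \int[lebesgue_rV n]_v f (rV_cons (x, v)).
Proof.
move=> mf f0; rewrite [LHS](ge0_integral_pushforward (@measurable_rV_cons R n))//.
rewrite preimage_setT fubini_tonelli1//.
  exact: measurableT_comp mf (@measurable_rV_cons R n).
by move=> x; exact: f0.
Qed.

(** The first coordinate is integrated innermost, because the induction of [integral_gauss]
    completes the square in it. *)
Lemma ge0_integral_rVS_swap n (f : 'rV[R]_n.+1 -> \bar R) :
  measurable_fun setT f -> (forall v, 0 <= f v) ->
  \int[lebesgue_rV n.+1]_v f v =
  \int[lebesgue_rV n]_v \int[lebesgue_measure]_x f (rV_cons (x, v)).
Proof.
move=> mf f0; rewrite ge0_integral_rVS//.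
rewrite (@fubini_tonelli _ _ _ _ _ lebesgue_measure (lebesgue_rV n) (f \o @rV_cons R n))//=.
exact: measurableT_comp mf (@measurable_rV_cons R n).
Qed.

(** Lebesgue measure is determined by its values on half-open intervals, and the affine preimage of
    such an interval is again one, with its length divided by [c]. *)
Lemma lebesgue_measure_affine (a c : R) (A : set (measurableTypeR R)) : (0 < c)%R ->
  measurable A ->
  lebesgue_measure A =
  c%:E * pushforward lebesgue_measure (fun x => a + c * x : measurableTypeR R)%R A.
Proof.
move=> c0 mA.
have mphi : measurable_fun setT (fun x : measurableTypeR R => a + c * x : measurableTypeR R)%R.
  by apply: measurable_funD => //; apply: measurable_funM.
pose phi : {mfun measurableTypeR R >-> measurableTypeR R} := HB.pack (fun x : measurableTypeR R => a + c * x : measurableTypeR R)%R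
  (isMeasurableFun.Build _ _ _ _ _ mphi).
rewrite (@lebesgue_measure_unique R (mscale (NngNum (ltW c0)) (pushforward lebesgue_measure phi)))//.
move=> _ [[u v] /= _ <-]; rewrite /mscale/= /pushforward.
rewrite (_ : _ @^-1` _ = `]((u - a) / c)%R, ((v - a) / c)%R]%classic); last first.
  apply/seteqP; split => x /=; rewrite !in_itv/= ltr_pdivrMr// ler_pdivlMr//; lra.
rewrite !lebesgue_measure_itv/= !lte_fin ltr_pM2r ?invr_gt0// ltrD2r.
case: ifPn => _; last by rewrite mule0.
by rewrite -!EFinB -EFinM; congr (_%:E); field; rewrite gt_eqF.
Qed.

Lemma ge0_integral_affine1 (a c : R) (f : measurableTypeR R -> \bar R) : (0 < c)%R ->
  measurable_fun setT f -> (forall v, 0 <= f v) ->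
  \int[lebesgue_measure]_x f x = c%:E * \int[lebesgue_measure]_x f (a + c * x)%R.
Proof.
move=> c0 mf f0.
have mphi : measurable_fun setT (fun x : measurableTypeR R => a + c * x : measurableTypeR R)%R.
  by apply: measurable_funD => //; apply: measurable_funM.
pose phi : {mfun measurableTypeR R >-> measurableTypeR R} := HB.pack (fun x : measurableTypeR R => a + c * x : measurableTypeR R)%R
  (isMeasurableFun.Build _ _ _ _ _ mphi).
pose nu : {measure set (measurableTypeR R) -> \bar R} := pushforward lebesgue_measure phi.
rewrite (eq_measure_integral (mscale (NngNum (ltW c0)) (nu mphi))); last first.
  by move=> A mA _; rewrite [LHS](lebesgue_measure_affine a c0 mA).
rewrite ge0_integral_mscale//=.
by rewrite (ge0_integral_pushforward mphi)// preimage_setT.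
Qed.

Lemma rV_cons_affine n (a : 'rV[R]_n.+1) (c : R) p :
  (a + c *: rV_cons p =
   rV_cons ((a ord0 ord0 + c * p.1)%R, \row_j a ord0 (lift ord0 j) + c *: p.2))%R.
Proof.
by apply/rowP => i; rewrite !mxE; case: unliftP => [j ->|->]/=; rewrite ?mxE.
Qed.

Lemma measurable_rV_affine n (a : 'rV[R]_n) (c : R) :
  measurable_fun setT (fun v : 'rV[R]_n => a + c *: v)%R.
Proof.
apply: measurable_fun_rV => i.
rewrite (_ : (fun _ => _) = (fun v : 'rV[R]_n => a ord0 i + c * v ord0 i)%R); last first.
  by apply/funext => v; rewrite !mxE.
apply: measurable_funD => //; apply: measurable_funM => //.
exact: measurable_rV_coord.
Qed.

(** The substitution behind [theta = theta_hat + n^(-1/2) s]; by Tonelli each coordinate contributes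
    one factor [c]. *)
Lemma ge0_integral_affine n (a : 'rV[R]_n) (c : R) (f : 'rV[R]_n -> \bar R) :
  (0 < c)%R -> measurable_fun setT f -> (forall v, 0 <= f v) ->
  \int[lebesgue_rV n]_v f v = (c ^+ n)%:E * \int[lebesgue_rV n]_v f (a + c *: v)%R.
Proof.
move=> c0; elim: n a f => [|n IH] a f mf f0.
  rewrite expr0 mul1e; apply: eq_integral => v _; congr f.
  by apply/rowP; case.
have mfa := measurableT_comp mf (measurable_rV_affine a c).
rewrite ge0_integral_rVS// [in RHS]ge0_integral_rVS//.
set F := fun x => \int[lebesgue_rV n]_v f (rV_cons (x, v)).
have mF : measurable_fun setT F.
  apply: (measurable_fun_fubini_tonelli_F (m2 := lebesgue_rV n) (f \o @rV_cons R n)).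
    exact: measurableT_comp mf (@measurable_rV_cons R n).
  by move=> x; exact: f0.
have F0 x : 0 <= F x by exact: integral_ge0.
rewrite (ge0_integral_affine1 (a ord0 ord0) c0 mF F0) exprS EFinM -muleA.
congr (_ * _); rewrite -ge0_integralZl//; last 3 first.
- apply: (measurable_fun_fubini_tonelli_F (m2 := lebesgue_rV n) ((fun v => f (a + c *: v)%R) \o @rV_cons R n)).
    exact: measurableT_comp mfa (@measurable_rV_cons R n).
  by move=> x; exact: f0.
- by move=> x _; exact: integral_ge0.
- by rewrite lee_fin exprn_ge0// ltW.
apply: eq_integral => x _; rewrite /F (IH (\row_j a ord0 (lift ord0 j))%R).
- by congr (_ * _); apply: eq_integral => v _; rewrite rV_cons_affine.
- apply: (measurableT_comp mf); apply: (measurableT_comp (@measurable_rV_cons R n)).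
  exact: measurable_pair1.
- by move=> v.
Qed.

Lemma measurable_row_mx d1 d2 :
  measurable_fun setT (fun p : 'rV[R]_d1 * 'rV[R]_d2 => row_mx p.1 p.2).
Proof.
apply: measurable_fun_rV => i; case: (splitP i) => j ij.
  rewrite (_ : (fun _ => _) = (fun p : 'rV[R]_d1 * 'rV[R]_d2 => p.1 ord0 j)).
    exact: measurableT_comp (measurable_rV_coord j) measurable_fst.
  apply/funext => p; rewrite (_ : i = lshift d2 j) ?row_mxEl//; exact: val_inj.
rewrite (_ : (fun _ => _) = (fun p : 'rV[R]_d1 * 'rV[R]_d2 => p.2 ord0 j)).
  exact: measurableT_comp (measurable_rV_coord j) measurable_snd.
apply/funext => p; rewrite (_ : i = rshift d1 j) ?row_mxEr//; exact: val_inj.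
Qed.

Lemma measurable_lsubmx d1 d2 :
  measurable_fun setT (fun v : 'rV[R]_(d1 + d2) => lsubmx v).
Proof.
apply: measurable_fun_rV => i.
rewrite (_ : (fun _ => _) = (fun v : 'rV[R]_(d1 + d2) => v ord0 (lshift d2 i))).
  exact: measurable_rV_coord.
by apply/funext => v; rewrite mxE.
Qed.

Lemma measurable_rsubmx d1 d2 :
  measurable_fun setT (fun v : 'rV[R]_(d1 + d2) => rsubmx v).
Proof.
apply: measurable_fun_rV => i.
rewrite (_ : (fun _ => _) = (fun v : 'rV[R]_(d1 + d2) => v ord0 (rshift d1 i))).
  exact: measurable_rV_coord.
by apply/funext => v; rewrite mxE.
Qed.

(** The sizes [d1.+1 + d2] and [(d1 + d2).+1] are convertible, which is what lets
    [ge0_integral_row_mx] proceed by induction on [d1]. *)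
Lemma rV_cons_row_mx d1 d2 x (v : 'rV[R]_d1) (t : 'rV[R]_d2) :
  row_mx (rV_cons (x, v)) t = rV_cons (x, row_mx v t) :> 'rV[R]_(d1.+1 + d2).
Proof.
apply/rowP => i; rewrite mxE [RHS]mxE.
case: splitP => j ij.
  rewrite mxE; case: unliftP => [/= k jk|j0].
    have -> : unlift (ord0 : 'I_(d1 + d2).+1) i = Some (lshift d2 k).
      rewrite (_ : i = lift (ord0 : 'I_(d1 + d2).+1) (lshift d2 k)) ?liftK//.
      by apply: val_inj; rewrite /= ij jk.
    by rewrite /= row_mxEl.
  have -> : i = (ord0 : 'I_(d1 + d2).+1) by apply: val_inj; rewrite /= ij j0.
  by rewrite unlift_none.
have -> : unlift (ord0 : 'I_(d1 + d2).+1) i = Some (rshift d1 j).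
  rewrite (_ : i = lift (ord0 : 'I_(d1 + d2).+1) (rshift d1 j)) ?liftK//.
  by apply: val_inj; rewrite /= ij.
by rewrite /= row_mxEr.
Qed.

Lemma ge0_integral_row_mx d1 d2 (f : 'rV[R]_(d1 + d2) -> \bar R) :
  measurable_fun setT f -> (forall v, 0 <= f v) ->
  \int[lebesgue_rV (d1 + d2)]_v f v =
  \int[lebesgue_rV d1]_x \int[lebesgue_rV d2]_y f (row_mx x y).
Proof.
elim: d1 f => [|d1 IH] f mf f0.
  rewrite integral_dirac//; last first.
    (* There is only one row vector of length 0, so every preimage is full or empty. *)
    by move=> _ B mB; rewrite setTI; case: (pselect (B (\int[lebesgue_rV d2]_y f (row_mx 0 y)))) => h;
      [rewrite (_ : _ @^-1` _ = setT)// | rewrite (_ : _ @^-1` _ = set0)//];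
      apply/seteqP; split => // x /=; rewrite (_ : x = 0%R) //; apply/rowP; case.
  rewrite diracT mul1e; apply: eq_integral => v _; congr f.
  apply/rowP => i; rewrite mxE; case: splitP => [[]//|j ij].
  by congr (v _ _); exact: val_inj.
have mg : measurable_fun setT (fun z : 'rV[R]_(d1.+1) * 'rV[R]_d2 => f (row_mx z.1 z.2)).
  exact: measurableT_comp mf (@measurable_row_mx _ _).
rewrite [LHS](@ge0_integral_rVS (d1 + d2))// ge0_integral_rVS//; last 2 first.
- by apply: (measurable_fun_fubini_tonelli_F (m2 := lebesgue_rV d2) (fun z : 'rV[R]_(d1.+1) * 'rV[R]_d2 => f (row_mx z.1 z.2))).
- by move=> v; exact: integral_ge0.
apply: eq_integral => x _; rewrite IH//; last first.
  apply: (measurableT_comp mf); apply: (measurableT_comp (@measurable_rV_cons R _)).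
  exact: measurable_pair1.
apply: eq_integral => u _; apply: eq_integral => v _.
by rewrite rV_cons_row_mx.
Qed.

End lebesgue_rV_integrals.

(** * Bilinear forms, the maximum norm and positive definiteness *)

Section bilinear_forms.
Context {R : realType}.

Definition bil m n (x : 'rV[R]_m) (A : 'M[R]_(m, n)) (y : 'rV[R]_n) : R :=
  (x *m A *m y^T) ord0 ord0.

Lemma bilE m n (x : 'rV[R]_m) (A : 'M[R]_(m, n)) (y : 'rV[R]_n) :
  bil x A y = \sum_i \sum_j x ord0 i * A i j * y ord0 j.
Proof.
rewrite /bil mxE exchange_big; apply: eq_bigr => j _.
by rewrite !mxE mulr_suml.
Qed.

Lemma bilDl m n x x' (A : 'M[R]_(m, n)) y :
  bil (x + x') A y = bil x A y + bil x' A y.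
Proof. by rewrite /bil !mulmxDl mxE. Qed.

Lemma bilDr m n x (A : 'M[R]_(m, n)) y y' :
  bil x A (y + y') = bil x A y + bil x A y'.
Proof. by rewrite /bil linearD /= mulmxDr mxE. Qed.

Lemma bilZl m n c x (A : 'M[R]_(m, n)) y : bil (c *: x) A y = c * bil x A y.
Proof. by rewrite /bil -!scalemxAl mxE. Qed.

Lemma bilZr m n c x (A : 'M[R]_(m, n)) y : bil x A (c *: y) = c * bil x A y.
Proof. by rewrite /bil linearZ /= -scalemxAr mxE. Qed.

Lemma bil0l m n (A : 'M[R]_(m, n)) y : bil 0 A y = 0.
Proof. by rewrite /bil !mul0mx mxE. Qed.

Lemma bil0r m n x (A : 'M[R]_(m, n)) : bil x A 0 = 0.
Proof. by rewrite /bil trmx0 mulmx0 mxE. Qed.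

Lemma bil_tr m n x (A : 'M[R]_(m, n)) y : bil x A y = bil y A^T x.
Proof.
rewrite /bil -[in RHS](trmxK y) -!trmx_mul mulmxA.
by rewrite [RHS]mxE.
Qed.

Lemma bilD m n x (A B : 'M[R]_(m, n)) y : bil x (A + B) y = bil x A y + bil x B y.
Proof. by rewrite /bil mulmxDr mulmxDl mxE. Qed.

Lemma bilN m n x (A : 'M[R]_(m, n)) y : bil x (- A) y = - bil x A y.
Proof. by rewrite /bil mulmxN mulNmx mxE. Qed.

Lemma bilZ m n c x (A : 'M[R]_(m, n)) y : bil x (c *: A) y = c * bil x A y.
Proof. by rewrite /bil -scalemxAr -scalemxAl mxE. Qed.

Lemma bil_delta m n (A : 'M[R]_(m, n)) i j :
  bil (delta_mx ord0 i) A (delta_mx ord0 j) = A i j.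
Proof. by rewrite /bil trmx_delta -rowE -colE !mxE. Qed.

Lemma bil_row_mx m n p q (x1 : 'rV[R]_m) (x2 : 'rV[R]_n) (y1 : 'rV[R]_p) (y2 : 'rV[R]_q)
    A B C D :
  bil (row_mx x1 x2) (block_mx A B C D) (row_mx y1 y2) =
  bil x1 A y1 + bil x1 B y2 + bil x2 C y1 + bil x2 D y2.
Proof.
rewrite /bil mul_row_block tr_row_mx mul_row_col !mulmxDl !mxE.
by rewrite -!addrA; congr (_ + _); rewrite addrCA.
Qed.

Lemma ler_mx_entry m n (A : 'M[R]_(m, n)) i j : `|A i j| <= `|A|.
Proof.
by rewrite [leRHS]/Num.norm/= mx_normrE; apply: (le_bigmax _ (fun ij => `|A ij.1 ij.2|) (i, j)).
Qed.

Lemma mx_norm_le m n (A : 'M[R]_(m, n)) c :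
  0 <= c -> (forall i j, `|A i j| <= c) -> `|A| <= c.
Proof.
move=> c0 h; rewrite [leLHS]/Num.norm/= mx_normrE; apply/bigmax_leP; split => // -[i j] _.
Qed.

Lemma bil_bound m n x (A : 'M[R]_(m, n)) y :
  `|bil x A y| <= (m * n)%:R * `|A| * `|x| * `|y|.
Proof.
rewrite bilE (le_trans (ler_norm_sum _ _ _))//.
have : \sum_(i < m) `|\sum_j x ord0 i * A i j * y ord0 j|
   <= \sum_(i < m) n%:R * (`|A| * `|x| * `|y|).
  apply: ler_sum => i _; rewrite (le_trans (ler_norm_sum _ _ _))//.
  apply: (@le_trans _ _ (\sum_(j < n) `|A| * `|x| * `|y|)).
    apply: ler_sum => j _; rewrite !normrM (mulrC `|x _ _|).
    by rewrite !ler_pM ?mulr_ge0 ?ler_mx_entry.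
  by rewrite sumr_const card_ord mulr_natl.
move/le_trans; apply; rewrite sumr_const card_ord -mulr_natl natrM; lra.
Qed.

Lemma norm_row_mx m n (x : 'rV[R]_m) (y : 'rV[R]_n) :
  `|row_mx x y| = Num.max `|x| `|y|.
Proof.
apply/eqP; rewrite eq_le; apply/andP; split.
  apply: mx_norm_le; first by rewrite le_max normr_ge0.
  move=> i j; rewrite mxE; case: splitP => k _;
    by rewrite le_max ler_mx_entry ?orbT.
rewrite ge_max; apply/andP; split; apply: mx_norm_le => // i j.
  by rewrite -(row_mxEl x y); exact: ler_mx_entry.
by rewrite -(row_mxEr x y); exact: ler_mx_entry.
Qed.

Lemma cvg_sumr (T I : Type) (F : set_system T) (FF : Filter F) (r : seq I)
    (Q : pred I) (f : I -> T -> R) (l : I -> R) :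
  (forall i, Q i -> f i x @[x --> F] --> l i) ->
  (\sum_(i <- r | Q i) f i x) @[x --> F] --> \sum_(i <- r | Q i) l i.
Proof. by move=> h; apply: cvg_big => //; exact: add_continuous. Qed.

Lemma bil_continuous n (A : 'M[R]_n) : continuous (fun x : 'rV[R]_n => bil x A x).
Proof.
move=> x; rewrite /continuous_at bilE.
rewrite [X in X @ _](_ : _ = fun x : 'rV[R]_n => \sum_i \sum_j x ord0 i * A i j * x ord0 j).
  apply: (@cvg_sumr _ _ (nbhs x)) => i _; apply: (@cvg_sumr _ _ (nbhs x)) => j _.
  apply: cvgM; last exact: coord_continuous.
  by apply: cvgM; [exact: coord_continuous|exact: cvg_cst].
by apply/funext => y; rewrite bilE.
Qed.

(** The form attains a positive minimum on the compact unit sphere of the maximum norm, and both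
    sides are homogeneous of degree 2. *)
Lemma posdefmx_coercive n (A : 'M[R]_n) : posdefmx A ->
  exists2 lam : R, 0 < lam & forall x, lam * `|x| ^+ 2 <= bil x A x.
Proof.
move=> [_ pA]; pose S := [set x : 'rV[R]_n | `|x| = 1].
(* In dimension 0 the sphere is empty and has no minimum, but then [x = 0]. *)
have [[x0 Sx0]|S0] := pselect (S !=set0); last first.
  exists 1 => // x; have [->|x0] := eqVneq x 0.
    by rewrite normr0 bil0l expr0n mulr0.
  exfalso; apply: S0; exists (`|x|^-1 *: x).
  by rewrite /S/= normrZ ger0_norm ?invr_ge0// mulVf// normr_eq0.
have cS : compact S.
  apply: bounded_closed_compact.
    by exists 1; split; [exact: num_real|move=> M M1 x /= ->; exact: ltW].
  rewrite (_ : S = Num.norm @^-1` [set (1:R)])//.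
  apply: closed_comp; last exact: closed_eq.
  by move=> x _; exact: norm_continuous.
have [c cS' hc] := EVT_min_rV (ex_intro _ _ Sx0) cS
  (continuous_subspaceT (@bil_continuous _ A)).
exists (bil c A c).
  rewrite /bil; apply: pA; apply/eqP => c0.
  by move: cS'; rewrite inE /S/= c0 normr0 => /esym/eqP; rewrite oner_eq0.
move=> x; have [->|x0'] := eqVneq x 0.
  by rewrite normr0 bil0l expr0n mulr0.
have nx : 0 < `|x| by rewrite normr_gt0.
have := hc (`|x|^-1 *: x); rewrite bilZl bilZr inE /S/= normrZ.
rewrite ger0_norm ?invr_ge0// mulVf ?gt_eqF// => /(_ erefl).
by rewrite mulrA -invfM ler_pdivlMl ?mulr_gt0// mulrC expr2.
Qed.

Lemma measurable_bil n (A : 'M[R]_n) :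
  measurable_fun setT (fun x : 'rV[R]_n => bil x A x).
Proof.
under eq_fun do rewrite bilE.
apply: measurable_sum => i; apply: measurable_sum => j.
apply: measurable_funM; last exact: measurable_rV_coord.
by apply: measurable_funM => //; exact: measurable_rV_coord.
Qed.

Lemma posdefmx_block_schur m n (A : 'M[R]_m) (B : 'M[R]_(m, n)) (D : 'M[R]_n) :
  posdefmx (block_mx A B B^T D) -> posdefmx A /\ posdefmx D.
Proof.
move=> [+ pH]; rewrite tr_block_mx trmxK => /eq_block_mx[HA _ _ HD].
split; split => // x x0.
  have := pH (row_mx x 0); rewrite -/(bil _ _ _) bil_row_mx !bil0r !bil0l !addr0.
  apply; apply: contra_neq x0 => /(congr1 lsubmx).
  by rewrite row_mxKl => ->; apply/rowP => i; rewrite !mxE.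
have := pH (row_mx 0 x); rewrite -/(bil _ _ _) bil_row_mx !bil0r !bil0l !add0r.
apply; apply: contra_neq x0 => /(congr1 rsubmx).
by rewrite row_mxKr => ->; apply/rowP => i; rewrite !mxE.
Qed.

End bilinear_forms.

(** * Gaussian integrals *)

Section gaussian_integrals.
Context {R : realType}.

Lemma integral_gauss1 (a b : R) : 0 < a ->
  (\int[lebesgue_measure]_x (expR (- (a * x ^+ 2 + 2 * b * x) / 2))%:E =
   (Num.sqrt (2 * pi / a) * expR (b ^+ 2 / a / 2))%:E)%E.
Proof.
(* The integrand is a multiple of the normal density of mean [m = - (b / a)] and variance
   [s ^+ 2 = a^-1]. *)
move=> a0; pose s := Num.sqrt a^-1; pose m := - (b / a).
have s2 : s ^+ 2 = a^-1 by rewrite sqr_sqrtr// invr_ge0 ltW.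
have s0 : s != 0 by rewrite gt_eqF// sqrtr_gt0 invr_gt0.
have p0 : normal_peak s != 0 by rewrite gt_eqF// normal_peak_gt0.
have pk : (normal_peak s)^-1 = Num.sqrt (2 * pi / a).
  by rewrite /normal_peak invrK s2; congr (Num.sqrt _); rewrite -mulr_natr; field; rewrite gt_eqF.
rewrite -pk [X in X%:E](_ : _ = ((normal_peak s)^-1 * expR (b ^+ 2 / a / 2)) * 1); last by rewrite mulr1.
rewrite EFinM -[in X in (_ * X)%E](integral_normal_pdf m s) -ge0_integralZl//; last 3 first.
- by apply/measurable_EFinP; exact: measurable_normal_pdf.
- by move=> x _; rewrite lee_fin normal_pdf_ge0.
- by rewrite lee_fin mulr_ge0 ?expR_ge0// invr_ge0 normal_peak_ge0.
apply: eq_integral => x _; rewrite -EFinM normal_pdfE// /normal_fun s2; congr (_%:E).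
rewrite mulrACA mulVf// mul1r -expRD; congr expR.
by rewrite /m -mulr_natr; field; rewrite gt_eqF.
Qed.

Lemma rV_consE n x (w : 'rV[R]_n) : rV_cons (x, w) = row_mx x%:M w :> 'rV[R]_(1 + n).
Proof.
apply/rowP => i; rewrite mxE [RHS]mxE; case: splitP => j ij.
  rewrite (_ : i = (ord0 : 'I_n.+1)) ?unlift_none/=.
    by rewrite !ord1 mxE mulr1n.
  by apply: val_inj; rewrite /= ij ord1.
rewrite (_ : i = lift (ord0 : 'I_n.+1) j) ?liftK//.
by apply: val_inj; rewrite /= ij.
Qed.

Lemma bil_outer n (b w : 'rV[R]_n) :
  bil w (b^T *m b) w = bil (1%:M : 'rV[R]_1) b w ^+ 2.
Proof.
rewrite expr2 [X in X * _]bil_tr /bil !mulmxA !trmx1 !mulmx1 !mul1mx.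
by rewrite -mulmxA mxE big_ord1.
Qed.

Lemma posdefmx_schur n (a : R) (b : 'rV[R]_n) (C : 'M[R]_n) :
  posdefmx (block_mx a%:M b b^T C : 'M[R]_(1 + n)) ->
  0 < a /\ posdefmx (C - a^-1 *: (b^T *m b)).
Proof.
move=> pH; have [pa pC] := posdefmx_block_schur pH.
have a0 : 0 < a.
  have /pa.2 : (1%:M : 'rV[R]_1) != 0 by rewrite matrix_nonzero1.
  by rewrite mul1mx trmx1 mulmx1 mxE mulr1n.
split => //; split.
  by rewrite linearB/= linearZ/= trmx_mul trmxK pC.1.
(* This [x] minimises the block form in its first coordinate; the minimum is the form of the Schur
   complement at [w]. *)
move=> w w0; pose x := - a^-1 * bil (1%:M : 'rV[R]_1) b w.
have := pH.2 (row_mx x%:M w); rewrite -/(bil _ _ _) bil_row_mx.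
have -> : row_mx x%:M w != 0 by apply: contra_neq w0 => /(congr1 rsubmx); rewrite row_mxKr => ->; apply/rowP => i; rewrite !mxE.
move=> /(_ isT); congr (_ < _).
rewrite -/(bil _ _ _) bilD bilN bilZ (bil_tr w b^T) trmxK.
have -> : x%:M = x *: (1%:M : 'rV[R]_1) by rewrite scalemx1.
rewrite bil_outer !bilZl !bilZr.
have -> : bil (1%:M : 'rV[R]_1) a%:M 1%:M = a by rewrite /bil trmx1 mulmx1 mul1mx mxE mulr1n.
by rewrite /x; field; rewrite gt_eqF.
Qed.

(** Induction on the dimension: completing the square in the first coordinate leaves the form of the
    Schur complement [S], and [\det A = a * \det S]. The sign of the determinant comes out of the
    same induction. *)
Lemma integral_gauss n (A : 'M[R]_n) : posdefmx A -> 0 < \det A /\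
  (\int[lebesgue_rV n]_v (expR (- bil v A v / 2))%:E =
   (Num.sqrt ((2 * pi) ^+ n / \det A))%:E)%E.
Proof.
elim: n A => [|n IH] A pA.
  rewrite det_mx00 ltr01; split => //.
  rewrite integral_dirac//.
    by rewrite diracT mul1e bil0l oppr0 mul0r expR0 expr0 divr1 sqrtr1.
  apply/measurable_EFinP; apply: measurableT_comp => //.
  apply: measurable_funM => //; apply: measurableT_comp => //.
  exact: measurable_bil.
pose a : R := A ord0 ord0; pose b : 'rV[R]_n := ursubmx (A : 'M[R]_(1 + n)).
pose C : 'M[R]_n := drsubmx (A : 'M[R]_(1 + n)).
have EA : A = (block_mx a%:M b b^T C : 'M[R]_(1 + n)).
  rewrite -[LHS](@submxK _ 1 n 1 n); congr (@block_mx _ 1 n 1 n _ _ _ _).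
    apply/matrixP => i j; rewrite !ord1 !mxE mulr1n /a.
    by congr (A _ _); apply: val_inj.
  by rewrite /b trmx_ursub pA.1.
have pA' : posdefmx (block_mx a%:M b b^T C : 'M[R]_(1 + n)) by rewrite -EA.
have [a0 pS] := posdefmx_schur pA'.
have [d0 IHe] := IH _ pS; set S := C - _ in pS d0 IHe.
have dA : \det A = a * \det S.
  transitivity (\det (block_mx a%:M b b^T C)); first by rewrite [in LHS]EA.
  (* Block elimination: a unitriangular factor of determinant 1 leaves the pivot [a] and the Schur
     complement. *)
  rewrite (_ : block_mx _ _ _ _ = (block_mx 1%:M 0 (a^-1 *: b^T) 1%:M : 'M[R]_(1 + n)) *m block_mx a%:M b 0 S).
    rewrite det_mulmx det_lblock det_ublock !det1 !mul1r.
    by rewrite det_scalar1.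
  rewrite mulmx_block !mul1mx !mul0mx !addr0.
  congr block_mx.
    by rewrite mul_mx_scalar scalerA mulfV ?scale1r// gt_eqF.
  by rewrite -scalemxAl addrC /S subrK.
split; first by rewrite dA mulr_gt0.
have mq k (B : 'M[R]_k) : measurable_fun setT (fun v : 'rV[R]_k => (expR (- bil v B v / 2))%:E).
  apply/measurable_EFinP; apply: measurableT_comp => //.
  apply: measurable_funM => //; apply: measurableT_comp => //.
  exact: measurable_bil.
rewrite ge0_integral_rVS_swap//.
rewrite (eq_integral (fun w => (Num.sqrt (2 * pi / a))%:E * (expR (- bil w S w / 2))%:E)%E); last first.
  move=> w _; pose c := bil (1%:M : 'rV[R]_1) b w.
  transitivity (\int[lebesgue_measure]_x ((expR (- bil w C w / 2))%:E *
     (expR (- (a * x ^+ 2 + 2 * c * x) / 2))%:E))%E.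
    apply: eq_integral => x _; rewrite -EFinM -expRD rV_consE.
    rewrite [X in - X](_ : _ = bil (row_mx (x%:M : 'rV[R]_1) w) (block_mx a%:M b b^T C) (row_mx x%:M w)); last by rewrite [in LHS]EA.
    rewrite bil_row_mx (bil_tr w b^T) trmxK.
    have -> : x%:M = x *: (1%:M : 'rV[R]_1) by rewrite scalemx1.
    rewrite !bilZl !bilZr.
    have -> : bil (1%:M : 'rV[R]_1) a%:M 1%:M = a by rewrite /bil trmx1 mulmx1 mul1mx mxE mulr1n.
    by rewrite -/c; congr (expR _)%:E; field.
  rewrite ge0_integralZl//; last first.
  - apply/measurable_EFinP; apply: measurableT_comp => //.
    apply: measurable_funM => //; apply: measurableT_comp => //.
    by apply: measurable_funD => //; apply: measurable_funM => //; apply: measurable_funX.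

  rewrite integral_gauss1// -!EFinM mulrCA -expRD; congr (_ * expR _)%:E.
  rewrite /S bilD bilN bilZ bil_outer -/c.
  by field; rewrite gt_eqF.
rewrite ge0_integralZl//; last exact: mq.
rewrite IHe -EFinM -sqrtrM; last by rewrite mulr_ge0 ?invr_ge0 ?mulr_ge0 ?pi_ge0 ?ltW.
rewrite dA exprS; congr (Num.sqrt _)%:E; field.
by rewrite !gt_eqF.
Qed.

(** In the maximum norm a closed ball is a box. *)
Lemma lebesgue_rV_cube n (a : 'rV[R]_n) (r : R) : 0 <= r ->
  measurable [set v : 'rV[R]_n | `|v - a| <= r] /\
  lebesgue_rV n [set v : 'rV[R]_n | `|v - a| <= r] = ((2 * r) ^+ n)%:E.
Proof.
move=> r0; pose u : 'rV[R]_n := a - const_mx r; pose w : 'rV[R]_n := a + const_mx r.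
have E : [set v : 'rV[R]_n | `|v - a| <= r] =
         [set v | forall i, v ord0 i \in `[u ord0 i, w ord0 i]].
  apply/seteqP; split => v /= h.
    move=> i; have := le_trans (ler_mx_entry (v - a) ord0 i) h.
    rewrite !mxE in_itv/= ler_norml => /andP[? ?]; apply/andP; split; lra.
  apply: mx_norm_le => // i j; rewrite (ord1 i); have := h j.
  rewrite !mxE in_itv/= ler_norml => /andP[? ?]; apply/andP; split; lra.
rewrite E; split.
  rewrite [X in measurable X](_ : _ = \bigcap_i ((fun v : 'rV[R]_n => v ord0 i) @^-1` `[u ord0 i, w ord0 i])).
    apply: fin_bigcap_measurable => // i _.
    by rewrite -[X in measurable X]setTI; exact: measurable_rV_coord.
  by apply/seteqP; split => v /= H i; [move=> _|]; exact: H.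
rewrite lebesgue_rV_box; last by move=> i; rewrite !mxE; lra.
rewrite (eq_bigr (fun=> 2 * r)) ?prodr_const ?card_ord//.
by move=> i _; rewrite !mxE; ring.
Qed.

End gaussian_integrals.

(** * Second differences and Hessians *)

Section second_differences.
Context {R : realType} {n : nat}.
Implicit Types (f : 'rV[R]_n -> R) (x y u v w : 'rV[R]_n).

(** The discrete analogue of [bil v (hess f x) u]. It is defined without any differentiability, is
    linear in [f] and kills affine functions. *)
Definition dd f u v x : R := f (x + u + v) - f (x + u) - f (x + v) + f x.

Definition dotgrad f x u : R := \sum_i u ord0 i * partial i f x.

Lemma diff_eps f x : differentiable f x -> forall eps : R, 0 < eps ->
  exists2 delta, 0 < delta &
    forall w, `|w| < delta -> `|f (x + w) - f x - 'd f x w| <= eps * `|w|.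
Proof.
move=> /diff_locally dfx eps e0.
have /(_ eps e0) := (eqaddoP _ _ _ _).1 dfx.
move=> /nbhs_ballP[delta /= d0 H]; exists delta => // w wd.
have := H w; rewrite -ball_normE /= sub0r normrN => /(_ wd).
rewrite (_ : (f \o _ - _) w = f (x + w) - f x - 'd f x w)//.
by rewrite /= [x + w]addrC -addrA -opprD.
Qed.

Lemma diff_dotgrad f x u : differentiable f x -> 'd f x u = dotgrad f x u.
Proof.
move=> dfx; rewrite {1}(row_sum_delta u) linear_sum; apply: eq_bigr => i _.
by rewrite linearZ/= -deriveE.
Qed.

Lemma dotgradE f x u : differentiable f x -> 'D_u f x = dotgrad f x u.
Proof. by move=> dfx; rewrite deriveE// diff_dotgrad. Qed.

Lemma is_derive_line f x u (t : R) : differentiable f (x + t *: u) ->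
  is_derive t 1 (fun t => f (x + t *: u)) (dotgrad f (x + t *: u) u).
Proof.
move=> dfx.
have E : (fun h : R => h^-1 *: (((fun t => f (x + t *: u)) \o shift t) (h *: (1 : R)) - f (x + t *: u)))
   = (fun h : R => h^-1 *: ((f \o shift (x + t *: u)) (h *: u) - f (x + t *: u))).
  apply/funext => h; rewrite /= /shift /=; congr (_ *: (f _ - _)).
  by rewrite [h *: 1]mulr1 scalerDl addrCA addrA.
apply: DeriveDef.
  have := diff_derivable (v := u) dfx.
  by rewrite /derivable -E.
by rewrite -dotgradE// /derive -E.
Qed.

Lemma MVT01 (g dg : R -> R) :
  (forall t : R, 0 <= t <= 1 -> is_derive t 1 g (dg t)) ->
  exists2 t : R, 0 <= t <= 1 & g 1 - g 0 = dg t.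
Proof.
move=> h; have [||t t01 E] := @MVT_segment R g dg 0 1 ler01.
- move=> t; rewrite in_itv /= => /andP[t0 t1]; apply: h.
  by rewrite (ltW t0) (ltW t1).
- apply: derivable_within_continuous => t; rewrite in_itv /= => t01.
  by case: (h t t01).
exists t; first by move: t01; rewrite in_itv.
by rewrite E subr0 mulr1.
Qed.

Lemma dd_MVT1 f u v x :
  (forall s, 0 <= s <= 1 -> differentiable f (x + s *: u)) ->
  (forall s, 0 <= s <= 1 -> differentiable f (x + v + s *: u)) ->
  exists2 s, 0 <= s <= 1 & dd f u v x =
    \sum_i u ord0 i * (partial i f (x + v + s *: u) - partial i f (x + s *: u)).
Proof.
move=> d1 d2; pose g t := f (x + v + t *: u) - f (x + t *: u).
have [|t t01 E] := @MVT01 g (fun t => dotgrad f (x + v + t *: u) u - dotgrad f (x + t *: u) u).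
  by move=> t t01; apply: is_deriveB; apply: is_derive_line; [exact: d2|exact: d1].
exists t => //; transitivity (g 1 - g 0).
  rewrite /g /dd !scale1r !scale0r !addr0 (addrAC x v u).
  by ring.
by rewrite E /dotgrad -sumrB; apply: eq_bigr => i _; rewrite mulrBr.
Qed.

(** The mean value theorem is applied along [u] and then, with [s] frozen, along [v] to the
    resulting combination of partial derivatives; the intermediate point therefore lies in the
    parallelogram. *)
Lemma dd_MVT2 f u v x :
  (forall s t, 0 <= s <= 1 -> 0 <= t <= 1 ->
     ntimes_differentiable 2 f (x + s *: u + t *: v)) ->
  exists s t, [/\ 0 <= s <= 1, 0 <= t <= 1 &
    dd f u v x = bil v (hess f (x + s *: u + t *: v)) u].
Proof.
move=> d2.
have i0 : 0 <= (0:R) <= 1 by apply/andP.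
have i1 : 0 <= (1:R) <= 1 by apply/andP.
have [s s01|s s01|s s01 ->] := @dd_MVT1 f u v x.
- by have [_ + _] := d2 _ _ s01 i0; rewrite scale0r addr0.
- by have [_ + _] := d2 _ _ s01 i1; rewrite scale1r addrAC.
pose g t := \sum_i u ord0 i * partial i f (x + s *: u + t *: v).
have [t t01|t t01 E] := @MVT01 g
   (fun t => \sum_i u ord0 i * dotgrad (partial i f) (x + s *: u + t *: v) v).
  rewrite /g (_ : (fun _ => _) = \sum_i (fun t => u ord0 i * partial i f (x + s *: u + t *: v))); last first.
    by apply/funext => z; rewrite fct_sumE.
  apply: is_derive_sum => i.
  apply: is_deriveZ.
  apply: is_derive_line.
  by have [_ _ /(_ i)[]] := d2 _ _ s01 t01.
exists s, t; split => //; transitivity (g 1 - g 0).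
  rewrite /g -sumrB; apply: eq_bigr => i _; rewrite scale1r scale0r addr0.
  by rewrite mulrBr (addrAC x v).
rewrite E bilE exchange_big; apply: eq_bigr => i _.
rewrite /dotgrad mulr_sumr; apply: eq_bigr => j _.
by rewrite mxE; ring.
Qed.

(** Second derivatives are available at the single point [x] and are not assumed continuous. Hence
    the mean value theorem is used once only, and the increments of the partial derivatives are
    expanded to first order at [x]. *)
Lemma dd_hess_cvg f x u v : ntimes_differentiable 2 f x ->
  forall eps : R, 0 < eps -> exists2 delta, 0 < delta &
  forall h, 0 < h < delta ->
    `|h^-2 * dd f (h *: u) (h *: v) x - bil v (hess f x) u| <= eps.
Proof.
move=> [near_d dfx dp] eps e0.
pose M := `|u| + `|v| + 1.
have M0 : 0 < M by rewrite ltr_wpDl ?addr_ge0.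
(* Each of the [n] coordinates contributes [h * M] times two first-order errors [e * (h * M)]; the
   [+ 1] keeps the denominator positive. *)
pose e := eps / (2 * n%:R * M ^+ 2 + 1).
have D0 : 0 < 2 * n%:R * M ^+ 2 + 1 by rewrite ltr_wpDl// !mulr_ge0// ltW.
have ee0 : 0 < e by rewrite divr_gt0.
have [dl dl0 Hdl] : exists2 dl, 0 < dl & forall i w, `|w| < dl ->
    `|partial i f (x + w) - partial i f x - dotgrad (partial i f) x w| <= e * `|w|.
  have /choice[dl Hdl] : forall i, exists dl, 0 < dl /\ forall w, `|w| < dl ->
    `|partial i f (x + w) - partial i f x - dotgrad (partial i f) x w| <= e * `|w|.
    move=> i; have [_ di _] := dp i; have [dl dl0 H] := diff_eps di ee0.
    exists dl; split => // w wd; rewrite -diff_dotgrad//; exact: H.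
  exists (\big[Num.min/1]_i dl i).
    by apply: lt_bigmin => // i _; have [] := Hdl i.
  move=> i w wd; apply: (Hdl i).2; apply: lt_le_trans wd _.
  exact: bigmin_le.
have /nbhs_ballP[r /= r0 Hr] := near_d.
exists (Num.min (dl / M) (r / M)); first by rewrite lt_min !divr_gt0.
move=> h /andP[h0]; rewrite lt_min !ltr_pdivlMr// => /andP[h1 h2].
have B s : 0 <= s <= 1 -> `|h *: v + s *: (h *: u)| <= h * M.
  move=> /andP[s0 s1]; rewrite (le_trans (ler_normD _ _))// !normrZ !ger0_norm// ?(ltW h0)//.
  rewrite mulrCA -mulrDr ler_pM2l// /M (addrC `|u|) -addrA lerD2l.
  by rewrite -[leLHS]addr0 lerD// ler_piMl.
have B' s : 0 <= s <= 1 -> `|s *: (h *: u)| <= h * M.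
  move=> /andP[s0 s1]; rewrite !normrZ !ger0_norm// ?(ltW h0)//.
  rewrite mulrCA ler_pM2l// /M -addrA (@le_trans _ _ (`|u|))//.
    by rewrite ler_piMl.
  by rewrite lerDl addr_ge0.
have dr w : `|w| <= h * M -> differentiable f (x + w).
  move=> wM; have /Hr[] // : ball x r (x + w).
  rewrite -ball_normE/= opprD addrA subrr sub0r normrN; exact: le_lt_trans h2.
have [s s01|s s01|s s01 ->] := @dd_MVT1 f (h *: u) (h *: v) x.
- by apply: dr; exact: B'.
- by rewrite -addrA; apply: dr; exact: B.
rewrite (_ : bil v (hess f x) u = h^-2 * \sum_i (h *: u) ord0 i * dotgrad (partial i f) x (h *: v)); last first.
  rewrite bilE exchange_big mulr_sumr; apply: eq_bigr => i _ /=.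
  rewrite /dotgrad !mulr_sumr; apply: eq_bigr => j _.
  by rewrite !mxE; field; rewrite gt_eqF.
rewrite -mulrBr -sumrB normrM ger0_norm ?invr_ge0 ?exprn_ge0 ?(ltW h0)//.
rewrite ler_pdivrMl ?exprn_gt0// (le_trans (ler_norm_sum _ _ _))//.
apply: (@le_trans _ _ (\sum_(i < n) h ^+ 2 * (2 * e * M ^+ 2))); last first.
  rewrite -mulr_sumr sumr_const card_ord -[X in _ * X]mulr_natl ler_pM2l ?exprn_gt0//.
  have -> : n%:R * (2 * e * M ^+ 2) = (2 * n%:R * M ^+ 2) * e by ring.
  rewrite /e mulrA ler_pdivrMr// mulrC ler_pM2l//.
  by rewrite lerDl.
apply: ler_sum => i _; rewrite -mulrBr normrM.
rewrite (_ : h ^+ 2 * (2 * e * M ^+ 2) = (h * M) * (e * (h * M) + e * (h * M))); last by ring.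
apply: ler_pM => //.
  rewrite mxE normrM ger0_norm ?(ltW h0)// ler_pM2l// /M -addrA (le_trans (ler_mx_entry _ _ _))//.
  by rewrite lerDl addr_ge0.
(* Both values of the partial derivative are expanded at [x]; their linear parts differ exactly by
   the [v] step. *)
have L : dotgrad (partial i f) x (h *: v) =
    dotgrad (partial i f) x (h *: v + s *: (h *: u)) - dotgrad (partial i f) x (s *: (h *: u)).
  rewrite /dotgrad -sumrB; apply: eq_bigr => j _; rewrite !mxE; ring.
rewrite L (_ : _ - _ - _ =
  (partial i f (x + (h *: v + s *: (h *: u))) - partial i f x - dotgrad (partial i f) x (h *: v + s *: (h *: u)))
  - (partial i f (x + s *: (h *: u)) - partial i f x - dotgrad (partial i f) x (s *: (h *: u)))); last by rewrite addrA; ring.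
rewrite (le_trans (ler_normB _ _))// lerD//.
  rewrite (le_trans (Hdl _ _ (le_lt_trans (B _ s01) h1)))// ler_pM2l//; exact: B.
rewrite (le_trans (Hdl _ _ (le_lt_trans (B' _ s01) h1)))// ler_pM2l//; exact: B'.
Qed.

Lemma ddC f u v x : dd f u v x = dd f v u x.
Proof. by rewrite /dd (addrAC x u v); ring. Qed.

Lemma ler_addeps (a b : R) : (forall eps, 0 < eps -> a <= b + eps) -> a <= b.
Proof. by move=> h; apply/ler_addgt0Pr. Qed.

(** Young's theorem: the second difference is symmetric in its directions, and its rescaled limit
    computes the two transposed entries. *)
Lemma hess_sym f x : ntimes_differentiable 2 f x -> (hess f x)^T = hess f x.
Proof.
move=> d2; apply/matrixP => i j; rewrite mxE.
rewrite -(bil_delta (hess f x) j i) -(bil_delta (hess f x) i j).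
set u := delta_mx _ _; set v := delta_mx _ _.
apply/eqP; rewrite -subr_eq0 -normr_le0; apply: ler_addeps => eps e0.
have e20 : 0 < eps / 2 by rewrite divr_gt0.
have [d1 d10 H1] := @dd_hess_cvg f x v u d2 _ e20.
have [d2' d20 H2] := @dd_hess_cvg f x u v d2 _ e20.
pose h := Num.min d1 d2' / 2.
have h0 : 0 < h by rewrite divr_gt0// lt_min d10.
have hlt : h < Num.min d1 d2' by rewrite ltr_pdivrMr// ltr_pMr ?ltr1n// lt_min d10.
move: hlt; rewrite lt_min => /andP[l1 l2].
have {}H1 := H1 h; have {}H2 := H2 h.
rewrite h0 l1 in H1; rewrite h0 l2 in H2.
rewrite add0r; move: (H1 isT) (H2 isT); rewrite (ddC f (h *: v)).
move=> A B; rewrite distrC in A.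
have := le_trans (ler_normD _ _) (lerD A B).
by rewrite addrA subrK -splitr.
Qed.

End second_differences.

(** * Functions whose second differences oscillate slowly *)

Section oscillation.
Context {R : realType} {n : nat}.
Implicit Types (f : 'rV[R]_n -> R) (x y u v w c : 'rV[R]_n) (rho C : R).

Definition pgram_in c rho u v x :=
  [/\ `|x - c| <= rho, `|x + u - c| <= rho, `|x + v - c| <= rho & `|x + u + v - c| <= rho].

(** For a twice differentiable [f] this is in substance an oscillation bound for the Hessian on the
    ball. Stated on differences, it can be verified on rational parallelograms, and it compares the
    Hessian at one point with differences of macroscopic step at another. *)
Definition dd_osc f c rho C := forall x y u v,
  pgram_in c rho u v x -> pgram_in c rho u v y ->
  `|dd f u v x - dd f u v y| <= C * (`|u| * `|v|).

Lemma pgram_in_convex c rho u v x (s t : R) :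
  pgram_in c rho u v x -> 0 <= s <= 1 -> 0 <= t <= 1 ->
  `|x + s *: u + t *: v - c| <= rho.
Proof.
move=> [h00 h10 h01 h11] /andP[s0 s1] /andP[t0 t1].
have -> : x + s *: u + t *: v - c = ((1 - s) * (1 - t)) *: (x - c)
    + (s * (1 - t)) *: (x + u - c) + ((1 - s) * t) *: (x + v - c)
    + (s * t) *: (x + u + v - c).
  by apply/rowP => i; rewrite !mxE; ring.
have s1' : 0 <= 1 - s by rewrite subr_ge0.
have t1' : 0 <= 1 - t by rewrite subr_ge0.
have B (a : R) w : 0 <= a -> `|w| <= rho -> `|a *: w| <= a * rho.
  by move=> a0 wr; rewrite normrZ ger0_norm// ler_wpM2l.
apply: le_trans (ler_normD _ _) _.
rewrite (_ : rho = ((1 - s) * (1 - t)) * rho + (s * (1 - t)) * rho + ((1 - s) * t) * rho + (s * t) * rho); last by ring.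
apply: lerD; last by apply: B => //; exact: mulr_ge0.
apply: le_trans (ler_normD _ _) _.
apply: lerD; last by apply: B => //; exact: mulr_ge0.
apply: le_trans (ler_normD _ _) _.
by apply: lerD; apply: B => //; exact: mulr_ge0.
Qed.

(** Second differences are additive when the parallelogram is cut into a grid. *)
Lemma dd_sum f u v x N : dd f (N%:R *: u) (N%:R *: v) x =
  \sum_(i < N) \sum_(j < N) dd f u v (x + i%:R *: u + j%:R *: v).
Proof.
have H1 w k y : dd f (k%:R *: u) w y = \sum_(i < k) dd f u w (y + i%:R *: u).
  elim: k => [|k IH].
    by rewrite big_ord0 /dd scale0r !addr0; ring.
  rewrite big_ord_recr/= -IH -natr1 scalerDl scale1r /dd.
  rewrite !addrA; ring.
have H2 k y : dd f u (k%:R *: v) y = \sum_(i < k) dd f u v (y + i%:R *: v).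
  elim: k => [|k IH].
    by rewrite big_ord0 /dd scale0r !addr0; ring.
  rewrite big_ord_recr/= -IH -natr1 scalerDl scale1r /dd.
  rewrite !addrA (addrAC y u (k%:R *: v)); ring.
by rewrite H1; apply: eq_bigr => i _; rewrite H2.
Qed.

Lemma small_multiple (r : R) x : 0 < r -> exists2 N, (0 < N)%N &
  forall M, (N <= M)%N -> `|(M%:R)^-1 *: x| < r.
Proof.
move=> r0; exists (Num.truncn (`|x| / r)).+1 => // M NM.
have M0 : 0 < M%:R :> R by rewrite ltr0n (leq_trans _ NM).
rewrite normrZ ger0_norm ?invr_ge0 ?ler0n// ltr_pdivrMl//.
rewrite mulrC -ltr_pdivrMl// mulrC.
apply: lt_le_trans (truncnS_gt _) _; by rewrite ler_nat.
Qed.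

(** The parallelogram at [x] is cut into [N * N] translates of a small one. Each has almost the
    second difference of the small parallelogram placed at [y], and [N ^+ 2] times the latter is
    close to the Hessian form at [y]. Second derivatives are used at [y] alone. *)
Lemma dd_osc_hess f c rho C y : ntimes_differentiable 2 f y -> `|y - c| < rho ->
  dd_osc f c rho C -> forall x u v, pgram_in c rho u v x ->
  `|dd f u v x - bil v (hess f y) u| <= C * (`|u| * `|v|).
Proof.
move=> d2 yc osc x u v pg; apply: ler_addeps => eps e0.
have [dl dl0 Hdl] := dd_hess_cvg u v d2 e0.
have r0 : 0 < (rho - `|y - c|) / 2 by rewrite divr_gt0// subr_gt0.
have [N1 N10 H1] := small_multiple u r0.
have [N2 N20 H2] := small_multiple v r0.
have [N3 N30 H3] := @small_multiple dl (const_mx 1) dl0.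
(* With [N] pieces per side the small parallelogram placed at [y] stays in the ball, and [h = N^-1]
   is below [dl]. *)
pose N := (N1 + N2 + N3 + (Num.truncn dl^-1).+1)%N; have N0 : (0 < N)%N by rewrite /N addnS.
have NR : 0 < N%:R :> R by rewrite ltr0n.
set h : R := N%:R^-1.
have h0 : 0 < h by rewrite invr_gt0.
have hd : 0 < h < dl.
  rewrite h0 /= /h invf_plt ?posrE//.
  apply: lt_le_trans (truncnS_gt _) _; rewrite ler_nat /N; exact: leq_addl.
have hu : `|h *: u| < (rho - `|y - c|) / 2.
  by apply: H1; rewrite /N -!addnA leq_addr.
have hv : `|h *: v| < (rho - `|y - c|) / 2.
  by apply: H2; rewrite /N -!addnA (leq_trans _ (leq_addl _ _))// leq_addr.
have py : pgram_in c rho (h *: u) (h *: v) y.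
  have E w : y + w - c = y - c + w by rewrite addrAC.
  split.
  - exact: ltW.
  - rewrite E (le_trans (ler_normD _ _))//; lra.
  - rewrite E (le_trans (ler_normD _ _))//; lra.
  - rewrite -(addrA y) E (le_trans (ler_normD _ _))//.
    have := ler_normD (h *: u) (h *: v); lra.
have Nh w : N%:R *: (h *: w) = w by rewrite scalerA mulfV ?scale1r// gt_eqF.
have -> : dd f u v x = \sum_(i < N) \sum_(j < N) dd f (h *: u) (h *: v) (x + i%:R *: (h *: u) + j%:R *: (h *: v)).
  by rewrite -dd_sum !Nh.
set D := dd f (h *: u) (h *: v) y.
have ED : h ^- 2 * D = \sum_(i < N) \sum_(j < N) D.
  by rewrite !sumr_const card_ord -mulrnA -mulr_natl /h -exprVn invrK natrM expr2.
have A := Hdl h hd; rewrite -/D ED in A.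
set S1 := \sum_(i < N) _; set S2 := (X in `|X - _| <= eps) in A.
have -> : S1 - bil v (hess f y) u = (S1 - S2) + (S2 - bil v (hess f y) u) by ring.
apply: le_trans (ler_normD _ _) _; apply: lerD => //.
rewrite -sumrB (le_trans (ler_norm_sum _ _ _))//.
apply: (@le_trans _ _ (\sum_(i < N) \sum_(j < N) h ^+ 2 * (C * (`|u| * `|v|)))); last first.
  rewrite !sumr_const card_ord -mulrnA -mulr_natl natrM mulrA -expr2 /h -exprMn mulfV ?gt_eqF//.
  by rewrite expr1n mul1r.
apply: ler_sum => i _; rewrite -sumrB (le_trans (ler_norm_sum _ _ _))//.
apply: ler_sum => j _.
have ih (k : 'I_N) : 0 <= k%:R * h <= 1 /\ 0 <= k%:R * h + h <= 1.
  have -> : k%:R * h + h = k.+1%:R * h by rewrite -natr1 mulrDl mul1r.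
  rewrite !mulr_ge0 ?(ltW h0) ?ler0n//= !ler_pdivrMr// !mul1r !ler_nat.
  by rewrite (ltnW (ltn_ord k)) ltn_ord.
have [i1 i2] := ih i; have [j1 j2] := ih j.
have px : pgram_in c rho (h *: u) (h *: v) (x + i%:R *: (h *: u) + j%:R *: (h *: v)).
  rewrite !scalerA; split.
  - exact: pgram_in_convex.
  - rewrite [X in X - c](_ : _ = x + (i%:R * h + h) *: u + (j%:R * h) *: v); last first.
      by apply/rowP => k; rewrite !mxE; ring.
    exact: pgram_in_convex.
  - rewrite [X in X - c](_ : _ = x + (i%:R * h) *: u + (j%:R * h + h) *: v); last first.
      by apply/rowP => k; rewrite !mxE; ring.
    exact: pgram_in_convex.
  - rewrite [X in X - c](_ : _ = x + (i%:R * h + h) *: u + (j%:R * h + h) *: v); last first.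
      by apply/rowP => k; rewrite !mxE; ring.
    exact: pgram_in_convex.
apply: le_trans (osc _ _ _ _ px py) _.
by rewrite !normrZ ger0_norm ?(ltW h0)// le_eqVlt; apply/orP; left; apply/eqP; ring.
Qed.

Lemma dotgradZ f x (a : R) u : dotgrad f x (a *: u) = a * dotgrad f x u.
Proof. by rewrite /dotgrad mulr_sumr; apply: eq_bigr => i _; rewrite mxE mulrA. Qed.

Lemma dotgradD f x u v : dotgrad f x (u + v) = dotgrad f x u + dotgrad f x v.
Proof. by rewrite /dotgrad -big_split; apply: eq_bigr => i _; rewrite mxE mulrDl. Qed.

(** The second differences of the Taylor remainder [r] are those of [f] minus the Hessian form,
    hence controlled by [dd_osc_hess]. Summing them along [N] equal steps gives [r u] up to
    [N * r (h u)], and the latter is negligible because [f] is differentiable at [y]. *)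
Lemma dd_osc_taylor f c rho C y : ntimes_differentiable 2 f y ->
  0 <= C -> `|y - c| < rho -> dd_osc f c rho C -> forall u, `|y + u - c| <= rho ->
  `|f (y + u) - f y - dotgrad f y u - bil u (hess f y) u / 2| <= C * `|u| ^+ 2.
Proof.
move=> d2 C0 yc osc u yu.
have [_ df _] := d2.
pose r w := f (y + w) - f y - dotgrad f y w - bil w (hess f y) w / 2.
rewrite -/(r u).
have sy a b : bil a (hess f y) b = bil b (hess f y) a.
  by rewrite bil_tr (hess_sym d2).
have rdd w z x : dd r w z x = dd f w z (y + x) - bil z (hess f y) w.
  rewrite /dd /r !dotgradD !bilDl !bilDr !addrA.
  by rewrite (sy w z) (sy w x) (sy z x); field.
have g0 : dotgrad f y 0 = 0.
  by rewrite /dotgrad big1// => i _; rewrite mxE mul0r.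
have r00 : r 0 = 0 by rewrite /r addr0 subrr bil0l g0 mul0r !subr0.
apply: ler_addeps => eps e0.
pose e := eps / (`|u| + 1); have u1 : 0 < `|u| + 1 by rewrite ltr_wpDl.
have ee0 : 0 < e by rewrite divr_gt0.
have e20 : 0 < e / 2 by rewrite divr_gt0.
have [dl dl0 Hdl] := diff_eps df e20.
pose M := (n * n)%:R * `|hess f y| + 1.
have M0 : 0 < M by rewrite ltr_wpDl// mulr_ge0 ?ler0n.
have rr : 0 < Num.min dl (e / M) by rewrite lt_min dl0 divr_gt0.
have [N N0 HN] := small_multiple u rr.
have NR : 0 < N%:R :> R by rewrite ltr0n.
set h : R := N%:R^-1.
have h0 : 0 < h by rewrite invr_gt0.
have := HN N (leqnn _); rewrite -/h lt_min => /andP[hu1 hu2].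
have rsmall : `|r (h *: u)| <= e * `|h *: u|.
  rewrite /r (le_trans (ler_normB _ _))// [leRHS](_ : _ = e / 2 * `|h *: u| + e / 2 * `|h *: u|); last by field.
  rewrite lerD//.
    by have := Hdl _ hu1; rewrite diff_dotgrad.
  rewrite normrM [X in _ * X]ger0_norm ?invr_ge0// ler_pdivrMr//.
  rewrite (le_trans (bil_bound _ _ _))//.
  have := ltW hu2; rewrite ler_pdivlMr// => H.
  have : `|h *: u| * ((n * n)%:R * `|hess f y| * `|h *: u|) <= `|h *: u| * e.
    rewrite ler_wpM2l// (le_trans _ H)// mulrC ler_wpM2l//.
    by rewrite /M lerDl.
  rewrite (_ : _ * _ * _ * _ = `|h *: u| * ((n * n)%:R * `|hess f y| * `|h *: u|)); last by ring.
  by move/le_trans; apply; lra.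
(* Passing from [k] to [k + 1] adds [r (h u)] and one second difference, which is at most [C * h]
   times the squared norm of [u] because [k * h <= 1]. *)
have tele k : (k <= N)%N -> `|r ((k%:R * h) *: u) - k%:R * r (h *: u)| <= k%:R * (C * h * `|u| ^+ 2).
  elim: k => [_|k IH kN]; first by rewrite !mul0r scale0r r00 subr0 normr0.
  have dk : dd r (h *: u) ((k%:R * h) *: u) 0 = r ((k.+1%:R * h) *: u) - r ((k%:R * h) *: u) - r (h *: u).
    rewrite /dd !add0r r00 addr0 -scalerDl -natr1 mulrDl mul1r [h + _]addrC; ring.
  rewrite (_ : r _ - _ = dd r (h *: u) ((k%:R * h) *: u) 0 + (r ((k%:R * h) *: u) - k%:R * r (h *: u))); last first.
    by rewrite dk -natr1; ring.
  apply: le_trans (ler_normD _ _) _.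
  rewrite -natr1 mulrDl mul1r addrC lerD//; first by apply: IH; exact: ltnW.
  have kh s : 0 <= s <= 1 -> `|y + s *: u - c| <= rho.
    move=> /andP[s0 s1].
    have -> : y + s *: u - c = (1 - s) *: (y - c) + s *: (y + u - c).
      by apply/rowP => i; rewrite !mxE; ring.
    rewrite (le_trans (ler_normD _ _))// !normrZ !ger0_norm ?subr_ge0//.
    rewrite (_ : rho = (1 - s) * rho + s * rho); last by ring.
    rewrite lerD// ler_wpM2l// ?subr_ge0//; exact: ltW.
  have h1 : h <= 1 by rewrite invf_le1 ?ler1n.
  have kh0 : 0 <= k%:R * h by rewrite mulr_ge0 ?ler0n ?ltW.
  have kh1 : k%:R * h + h <= 1.
    have -> : k%:R * h + h = k.+1%:R * h by rewrite -natr1 mulrDl mul1r.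
    by rewrite ler_pdivrMr// mul1r ler_nat.
  have pg : pgram_in c rho (h *: u) ((k%:R * h) *: u) (y + 0).
    rewrite addr0; split.
    - exact: ltW.
    - by apply: kh; rewrite (ltW h0).
    - by apply: kh; rewrite kh0/=; lra.
    - by rewrite -(addrA y) -scalerDl; apply: kh; rewrite addr_ge0 ?(ltW h0)//= addrC.
  rewrite rdd (le_trans (dd_osc_hess d2 yc osc pg))// !normrZ !ger0_norm ?(ltW h0)//.
  rewrite (_ : _ * _ = C * h * `|u| ^+ 2 * (k%:R * h)); last by ring.
  rewrite ler_piMr ?mulr_ge0 ?(ltW h0)//; lra.
have := tele N (leqnn _); rewrite mulfV ?gt_eqF// scale1r => H.
have -> : r u = (r u - N%:R * r (h *: u)) + N%:R * r (h *: u) by ring.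
apply: le_trans (ler_normD _ _) _; apply: lerD.
  apply: le_trans H _.
  rewrite (_ : N%:R * _ = (N%:R * h) * (C * `|u| ^+ 2)); last by ring.
  by rewrite mulfV ?gt_eqF// mul1r.
rewrite normrM ger0_norm ?ler0n//.
apply: (@le_trans _ _ (N%:R * (e * `|h *: u|))); first by rewrite ler_wpM2l ?ler0n.
rewrite normrZ ger0_norm ?(ltW h0)//.
rewrite (_ : _ * _ = (N%:R * h) * (e * `|u|)); last by ring.
rewrite mulfV ?gt_eqF// mul1r /e mulrAC ler_pdivrMr// ler_wpM2l ?(ltW e0)//.
by rewrite lerDl.
Qed.

End oscillation.

(** * Comparison of the maximum, Euclidean and operator norms *)

Section norms.
Context {R : realType}.

Lemma mx_norm_le_enorm m n (A : 'M[R]_(m, n)) : `|A| <= enorm A.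
Proof.
apply: mx_norm_le => [|i j]; first exact: sqrtr_ge0.
rewrite -sqrtr_sqr ler_wsqrtr// (bigD1 i)//= (bigD1 j)//= -addrA lerDl addr_ge0//.
  by apply: sumr_ge0 => k _; exact: sqr_ge0.
by apply: sumr_ge0 => k _; apply: sumr_ge0 => l _; exact: sqr_ge0.
Qed.

Lemma enorm_le_mx_norm m n (A : 'M[R]_(m, n)) : enorm A <= (m * n)%:R * `|A|.
Proof.
rewrite -[leRHS]ger0_norm ?mulr_ge0// -sqrtr_sqr ler_wsqrtr//.
apply: (@le_trans _ _ (\sum_(i < m) \sum_(j < n) `|A| ^+ 2)).
  apply: ler_sum => i _; apply: ler_sum => j _.
  by rewrite -real_normK ?num_real// lerXn2r ?nnegrE// ler_mx_entry.
rewrite !sumr_const !card_ord -mulrnA -[leLHS]mulr_natl (mulnC n) exprMn ler_wpM2r ?sqr_ge0//.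
by rewrite -natrX ler_nat; case: (m * n)%N => // k; rewrite expnS expn1 leq_pmull.
Qed.

Lemma enorm0 m n : enorm (0 : 'M[R]_(m, n)) = 0.
Proof.
apply/eqP; rewrite eq_le sqrtr_ge0 andbT.
by apply: le_trans (enorm_le_mx_norm _) _; rewrite normr0 mulr0.
Qed.

Lemma enorm_ge0 m n (A : 'M[R]_(m, n)) : 0 <= enorm A.
Proof. exact: sqrtr_ge0. Qed.

Lemma enorm_gt0 m n (A : 'M[R]_(m, n)) : A != 0 -> 0 < enorm A.
Proof. by rewrite -normr_gt0 => /lt_le_trans; apply; exact: mx_norm_le_enorm. Qed.

Lemma mx_norm_le_opnorm m n (A : 'M[R]_(m, n)) : `|A| <= opnorm A.
Proof.
(* The real [sup] dominates its set only if the set is bounded above, so a bound is exhibited first;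
   an entry of [A] is then controlled through the image of a unit vector. *)
have ub : has_ubound [set enorm (A *m x) | x in [set x : 'cV[R]_n | enorm x <= 1]].
  exists ((m * 1)%:R * (n%:R * (`|A| * 1))) => _ [x /= x1 <-].
  apply: le_trans (enorm_le_mx_norm _) _; rewrite ler_wpM2l//.
  apply: mx_norm_le => [|i j]; first by rewrite !mulr_ge0.
  rewrite mxE (le_trans (ler_norm_sum _ _ _))//.
  apply: (@le_trans _ _ (\sum_(k < n) `|A| * 1)).
    apply: ler_sum => k _; rewrite normrM ler_pM// ?ler_mx_entry//.
    exact: le_trans (ler_mx_entry _ _ _) (le_trans (mx_norm_le_enorm _) x1).
  by rewrite sumr_const card_ord mulr_natl.
have op0 : 0 <= opnorm A.
  apply: ub_le_sup => //; exists 0 => /=; first by rewrite enorm0.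
  by rewrite mulmx0 enorm0.
apply: mx_norm_le => // i j.
apply: (@le_trans _ _ (enorm (A *m (delta_mx j 0 : 'cV[R]_n)))).
  rewrite -colE; apply: le_trans (mx_norm_le_enorm _).
  by have := ler_mx_entry (col j A) i 0; rewrite mxE.
apply: ub_le_sup => //; exists (delta_mx j 0) => //=.
rewrite /enorm (bigD1 j)//= big_ord1 mxE !eqxx expr1n big1 ?addr0 ?sqrtr1//.
by move=> k kj; rewrite big_ord1 mxE (negbTE kj) expr0n.
Qed.

End norms.

(** * Measurability and elementary integral estimates *)

Section measurability_tools.
Context {R : realType}.

Lemma measurable_mx_norm n : measurable_fun setT (fun v : 'rV[R]_n => `|v|).
Proof.
have H (s : seq ('I_1 * 'I_n)) :
    measurable_fun setT (fun v : 'rV[R]_n => \big[Num.max/0]_(i <- s) `|v i.1 i.2|).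
  elim: s => [|i s IH].
    by rewrite (_ : (fun _ => _) = cst 0)//; apply/funext => v; rewrite big_nil.
  rewrite (_ : (fun _ => _) = (fun v : 'rV[R]_n => Num.max `|v i.1 i.2|
     (\big[Num.max/0]_(i <- s) `|v i.1 i.2|))); last first.
    by apply/funext => v; rewrite big_cons.
  apply: measurable_maxr => //; apply: measurableT_comp; first exact: normr_measurable.
  by rewrite (ord1 i.1); exact: measurable_rV_coord.
rewrite (_ : (fun _ => _) = fun v : 'rV[R]_n => \big[Num.max/0]_i `|v i.1 i.2|)//.
by apply/funext => v; rewrite {1}/Num.norm/= mx_normrE.
Qed.

Lemma measurable_inv_ge0 d (T : measurableType d) (f : T -> R) :
  (forall x, 0 <= f x) -> measurable_fun setT f ->
  measurable_fun setT (fun x => (f x)^-1).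
Proof.
move=> f0 mf.
(* Where [f] is positive its inverse is the measurable [expR (- ln f)]; where it is 0 the inverse is
   0 by convention. *)
rewrite (_ : (fun _ => _) = (fun x => if f x <= 0 then 0 else expR (- ln (f x)))).
  apply: measurable_fun_ifT => //.
    by apply: measurable_fun_ler.
  apply: measurableT_comp => //; apply: measurableT_comp => //.
  exact: measurableT_comp.
apply/funext => x; case: leP => fx.
  by rewrite (_ : f x = 0) ?invr0//; apply/eqP; rewrite eq_le fx f0.
by rewrite expRN lnK.
Qed.

Lemma ge0_integralZ_EFin d (T : measurableType d) (mu : {measure set T -> \bar R})
    (c : R) (f : T -> R) : 0 <= c -> measurable_fun setT f -> (forall x, 0 <= f x) ->
  (\int[mu]_x (c * f x)%:E = c%:E * \int[mu]_x (f x)%:E)%E.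
Proof.
move=> c0 mf f0; rewrite -ge0_integralZl// ?lee_fin//; first exact/measurable_EFinP.
by move=> x _; rewrite lee_fin.
Qed.

Lemma ge0_le_integral_EFin d (T : measurableType d) (mu : {measure set T -> \bar R})
    (f g : T -> R) : measurable_fun setT f -> measurable_fun setT g ->
  (forall x, 0 <= f x) -> (forall x, f x <= g x) ->
  (\int[mu]_x (f x)%:E <= \int[mu]_x (g x)%:E)%E.
Proof.
move=> mf mg f0 fg; apply: ge0_le_integral => //.
- by move=> x _; rewrite lee_fin.
- exact/measurable_EFinP.
- exact/measurable_EFinP.
- by move=> x _; rewrite lee_fin.
Qed.

Lemma integral_expR_norm_lty n (c : R) : 0 < c ->
  (\int[lebesgue_rV n]_v (expR (- (c * `|v| ^+ 2)))%:E < +oo)%E.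
Proof.
(* The sum of the squared coordinates is at most [n] times the squared maximum norm, so with this
   [a] the Gaussian of matrix [a%:M] dominates; [n.+1] avoids a division by 0. *)
move=> c0; pose a : R := 2 * c / n.+1%:R.
have a0 : 0 < a by rewrite divr_gt0 ?mulr_gt0.
have bE (v : 'rV[R]_n) : bil v a%:M v = a * \sum_i v ord0 i ^+ 2.
  rewrite bilE mulr_sumr; apply: eq_bigr => i _.
  rewrite (bigD1 i)//= big1 => [|j ji]; last by rewrite !mxE eq_sym (negbTE ji) mulr0n mulr0 mul0r.
  by rewrite !mxE eqxx mulr1n addr0; ring.
have pA : posdefmx (a%:M : 'M[R]_n).
  split; first by rewrite tr_scalar_mx.
  move=> v v0; rewrite -/(bil _ _ _) bE mulr_gt0//.
  case/rV0Pn : v0 => i vi; rewrite (bigD1 i)//= ltr_pwDl//.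
    by rewrite lt_neqAle sqr_ge0 andbT eq_sym sqrf_eq0.
  by apply: sumr_ge0 => j _; exact: sqr_ge0.
have [_ I] := integral_gauss pA.
apply: (@le_lt_trans _ _ (\int[lebesgue_rV n]_v (expR (- bil v a%:M v / 2))%:E)%E); last by rewrite I ltry.
apply: ge0_le_integral => //.
- apply/measurable_EFinP; apply: measurableT_comp => //; apply: measurableT_comp => //.
  by apply: measurable_funM => //; apply: measurable_funX; exact: measurable_mx_norm.
- apply/measurable_EFinP; apply: measurableT_comp => //.
  apply: measurable_funM => //; apply: measurableT_comp => //.
  exact: measurable_bil.
move=> v _; rewrite lee_fin ler_expR mulNr lerN2 bE.
have H : \sum_i v ord0 i ^+ 2 <= n.+1%:R * `|v| ^+ 2.
  apply: (@le_trans _ _ (\sum_(i < n) `|v| ^+ 2)).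
    by apply: ler_sum => i _; rewrite -real_normK ?num_real// lerXn2r ?nnegrE// ler_mx_entry.
  by rewrite sumr_const card_ord -[leLHS]mulr_natl ler_wpM2r ?sqr_ge0// ler_nat.
apply: (@le_trans _ _ (a * (n.+1%:R * `|v| ^+ 2) / 2)).
  by rewrite ler_wpM2r// ler_wpM2l// ltW.
by rewrite /a le_eqVlt; apply/orP; left; apply/eqP; field.
Qed.

Lemma integral_gt0_density d (T : measurableType d) (mu : {measure set T -> \bar R})
    (f g : T -> R) : measurable_fun setT f -> measurable_fun setT g ->
  (forall x, 0 <= f x) -> (forall x, 0 < g x) ->
  (0 < \int[mu]_x (f x)%:E)%E -> (0 < \int[mu]_x (g x * f x)%:E)%E.
Proof.
move=> mf mg f0 g0 If; rewrite lt0e integral_ge0 ?andbT; last first.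
  by move=> x _; rewrite lee_fin mulr_ge0// ltW.
apply/negP => /eqP I0.
have mfE : measurable_fun setT (EFin \o f) by exact/measurable_EFinP.
pose gf x := g x * f x.
have mgf : measurable_fun setT (EFin \o gf).
  by apply/measurable_EFinP; exact: measurable_funM.
have /(ae_eq_integral_abs mu measurableT mgf) ae0 :
    (\int[mu]_x `|(EFin \o gf) x| = 0)%E.
  rewrite -I0; apply: eq_integral => x _ /=.
  by rewrite ger0_norm// /gf mulr_ge0// ltW.
have : (\int[mu]_x `|(EFin \o f) x| = 0)%E.
  apply/(ae_eq_integral_abs mu measurableT mfE).
  apply: filterS ae0 => x /= H _; have /eqP := H I.
  by rewrite eqe /gf mulf_eq0 gt_eqF//= => /eqP ->.
move=> I1; move: If; rewrite -(_ : \int[mu]_x `|(EFin \o f) x| = \int[mu]_x (f x)%:E)%E.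
  by rewrite I1 ltxx.
by apply: eq_integral => x _ /=; rewrite ger0_norm.
Qed.

End measurability_tools.

(** * The deterministic Laplace argument *)

Section one_sample.
Context {R : realType} {d1 d2 : nat}.
Variables (Th2 : set 'rV[R]_d2) (p2 : 'rV[R]_d2 -> R).
Variables (l1 : 'rV[R]_d1 -> R) (l2 : 'rV[R]_(d1 + d2) -> R).
Variables (t1 : 'rV[R]_d1) (t2 : 'rV[R]_d2).
Hypothesis mp2 : measurable_fun setT p2.
Hypothesis p2_ge0 : forall t, 0 <= p2 t.
Hypothesis p2_out : forall t, ~ Th2 t -> p2 t = 0.
Hypothesis p2_int : (\int[lebesgue_rV d2]_t (p2 t)%:E = 1)%E.
Hypothesis ml1 : measurable_fun setT l1.
Hypothesis ml2 : measurable_fun setT l2.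
Hypothesis max2 : forall t, Th2 t -> l2 (row_mx t1 t) <= l2 (row_mx t1 t2).

(** This is [exp F], as an integral over the whole space against the prior extended by 0. *)
Definition marg (x : 'rV[R]_d1) : \bar R :=
  (\int[lebesgue_rV d2]_t (expR (l2 (row_mx x t)) * p2 t)%:E)%E.

Definition margr x : R := fine (marg x).

(* [exp (l (x, t) - l (t1, t2))] for the cut log-likelihood [l]; where [marg x] is
   infinite it is 0, because [fine +oo = 0] and [_ / 0 = 0]. *)
Definition reldens x t : R :=
  expR (l1 x - l1 t1 + l2 (row_mx x t) - l2 (row_mx t1 t2)) * margr t1 / margr x.

(** Equal to [exp (F theta_hat_1 - L2 theta_hat)]: the mass that the [theta_2] integral of [reldens]
    carries at [theta_hat_1]. *)
Definition reldens0 : R := margr t1 * expR (- l2 (row_mx t1 t2)).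

Lemma measurable_l2_pair :
  measurable_fun setT (fun z : 'rV[R]_d1 * 'rV[R]_d2 => l2 (row_mx z.1 z.2)).
Proof. exact: measurableT_comp ml2 (@measurable_row_mx _ _ _). Qed.

Lemma measurable_l2_slice x : measurable_fun setT (fun t => l2 (row_mx x t)).
Proof.
exact: (measurableT_comp measurable_l2_pair (measurable_pair1 x)).
Qed.

Lemma marg_ge0 x : (0 <= marg x)%E.
Proof. by apply: integral_ge0 => t _; rewrite lee_fin mulr_ge0 ?expR_ge0. Qed.

Lemma margr_ge0 x : 0 <= margr x.
Proof. exact/fine_ge0/marg_ge0. Qed.

Lemma marg_gt0 x : (0 < marg x)%E.
Proof.
apply: integral_gt0_density => //.
- by apply: measurableT_comp => //; exact: measurable_l2_slice.
- by move=> t; exact: expR_gt0.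
- by rewrite p2_int.
Qed.

Lemma margr_gt0 x : marg x \is a fin_num -> 0 < margr x.
Proof. by move=> mx; rewrite -lte_fin fineK// marg_gt0. Qed.

Lemma marg_le x (c : R) : (forall t, Th2 t -> l2 (row_mx x t) <= c) ->
  (marg x <= (expR c)%:E)%E.
Proof.
move=> H; rewrite -[leRHS]mule1 -p2_int -ge0_integralZ_EFin ?expR_ge0//.
apply: ge0_le_integral_EFin.
- apply: measurable_funM => //.
  by apply: measurableT_comp => //; exact: measurable_l2_slice.
- exact: measurable_funM.
- by move=> t; rewrite mulr_ge0 ?expR_ge0.
move=> t.
have [Tt|nTt] := pselect (Th2 t); last by rewrite p2_out// !mulr0.
by rewrite ler_wpM2r// ler_expR H.
Qed.

Lemma marg_fin_t1 : marg t1 \is a fin_num.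
Proof.
rewrite ge0_fin_numE ?marg_ge0//; apply: le_lt_trans (marg_le max2) _.
by rewrite ltry.
Qed.

Lemma reldens0_gt0 : 0 < reldens0.
Proof. by rewrite mulr_gt0 ?expR_gt0// margr_gt0// marg_fin_t1. Qed.

Lemma reldens0_le1 : reldens0 <= 1.
Proof.
rewrite /reldens0 expRN ler_pdivrMr ?expR_gt0// mul1r -lee_fin fineK ?marg_fin_t1//.
exact: marg_le.
Qed.

Lemma reldens_ge0 x t : 0 <= reldens x t.
Proof. by rewrite !mulr_ge0 ?expR_ge0 ?invr_ge0 ?margr_ge0. Qed.

Lemma measurable_marg : measurable_fun setT marg.
Proof.
apply: (measurable_fun_fubini_tonelli_F (m2 := lebesgue_rV d2)
  (fun z : 'rV[R]_d1 * 'rV[R]_d2 => (expR (l2 (row_mx z.1 z.2)) * p2 z.2)%:E)).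
  apply/measurable_EFinP/measurable_funM.
    by apply: measurableT_comp => //; exact: measurable_l2_pair.
  exact: measurableT_comp mp2 measurable_snd.
by move=> z; rewrite lee_fin mulr_ge0 ?expR_ge0.
Qed.

Lemma measurable_reldens :
  measurable_fun setT (fun z : 'rV[R]_d1 * 'rV[R]_d2 => reldens z.1 z.2).
Proof.
have mi : measurable_fun setT (fun x => (margr x)^-1).
  apply: measurable_inv_ge0; first exact: margr_ge0.
  by apply: measurableT_comp measurable_marg; exact: fine_measurable.
apply: measurable_funM; last exact: measurableT_comp mi measurable_fst.
apply: measurable_funM => //; apply: measurableT_comp => //.
apply: measurable_funB => //; apply: measurable_funD; last exact: measurable_l2_pair.
by apply: measurable_funB => //; exact: measurableT_comp ml1 measurable_fst.
Qed.

(** Integrating over [theta_2] reproduces [marg x], which cancels the denominator of [reldens]. *)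
Lemma reldens_integral x : marg x \is a fin_num ->
  (\int[lebesgue_rV d2]_t (reldens x t * p2 t)%:E = (expR (l1 x - l1 t1) * reldens0)%:E)%E.
Proof.
move=> fx; pose c := expR (l1 x - l1 t1 - l2 (row_mx t1 t2)) * margr t1 / margr x.
rewrite (eq_integral (fun t => (c * (expR (l2 (row_mx x t)) * p2 t))%:E)); last first.
  move=> t _; rewrite /reldens /c addrAC (addrAC _ _ (- l2 _)) expRD; congr (_%:E); ring.
rewrite ge0_integralZ_EFin; last 3 first.
- by rewrite !mulr_ge0 ?expR_ge0 ?invr_ge0 ?margr_ge0.
- apply: measurable_funM => //.
  by apply: measurableT_comp => //; exact: measurable_l2_slice.
- by move=> t; rewrite mulr_ge0 ?expR_ge0.
rewrite -/(marg x) -(fineK fx) -EFinM -/(margr x) /c /reldens0 expRD; congr (_%:E); field.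
by rewrite gt_eqF// margr_gt0.
Qed.

(** Where [marg x] is infinite the left side is 0, so the inequality holds without a finiteness
    condition; the tail estimates rely on this form. *)
Lemma reldens_integral_le x :
  (\int[lebesgue_rV d2]_t (reldens x t * p2 t)%:E <= (expR (l1 x - l1 t1) * reldens0)%:E)%E.
Proof.
have [fx|nfx] := boolP (marg x \is a fin_num); first by rewrite reldens_integral.
rewrite integral0_eq; first by rewrite lee_fin mulr_ge0 ?expR_ge0 ?ltW ?reldens0_gt0.
move=> t _; rewrite /reldens /margr.
have -> : marg x = +oo%E.
  by move: nfx (marg_ge0 x); rewrite fin_numE; case: (marg x).
by rewrite /= invr0 mulr0 mul0r.
Qed.

Lemma reldensE x t : marg x \is a fin_num -> reldens x t =
  expR (l1 x - l1 t1 + l2 (row_mx x t) - l2 (row_mx t1 t2) + ln (margr t1) - ln (margr x)).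
Proof.
move=> fx; rewrite /reldens; set a := _ - l2 _.
by rewrite expRD expRD expRN !lnK// posrE margr_gt0// marg_fin_t1.
Qed.

End one_sample.

(** * Lower bounds over cubes and completion of the square *)

Section core_tools.
Context {R : realType}.

Lemma ler_eqsub (a b c d : R) : b - a = d - c -> a <= b -> c <= d.
Proof. by move=> E; rewrite -subr_ge0 E subr_ge0. Qed.

Lemma ge0_integral_cube_lower n (f : 'rV[R]_n -> R) (a : 'rV[R]_n) (r c : R) :
  0 <= r -> 0 <= c -> measurable_fun setT f -> (forall v, 0 <= f v) ->
  (forall v, `|v - a| <= r -> c <= f v) ->
  ((c * (2 * r) ^+ n)%:E <= \int[lebesgue_rV n]_v (f v)%:E)%E.
Proof.
move=> r0 c0 mf f0 fc; have [mC vC] := lebesgue_rV_cube a r0.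
set C := [set v | _] in mC vC.
pose h v : R := \1_C v.
have mh : measurable_fun setT h by exact: measurable_indic.
have h0 v : 0 <= h v by rewrite /h indicE ler0n.
have hE : (\int[lebesgue_rV n]_v (h v)%:E = ((2 * r) ^+ n)%:E)%E.
  by rewrite -vC -[in RHS](setIT C) -integral_indic.
rewrite EFinM -hE -ge0_integralZ_EFin//.
apply: ge0_le_integral_EFin => //; first exact: measurable_funM.
  by move=> v; rewrite mulr_ge0.
move=> v; rewrite /h indicE; have [vv|] := boolP (v \in C); last by rewrite mulr0.
by rewrite mulr1 fc//; move: vv; rewrite inE.
Qed.

Lemma norm_mulmx_row m n (u : 'rV[R]_m) (A : 'M[R]_(m, n)) :
  `|u *m A| <= (m%:R * `|A|) * `|u|.
Proof.
apply: mx_norm_le => [|i j]; first by rewrite !mulr_ge0.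
rewrite mxE (le_trans (ler_norm_sum _ _ _))//.
apply: (@le_trans _ _ (\sum_(k < m) `|A| * `|u|)).
  by apply: ler_sum => k _; rewrite normrM mulrC ler_pM// ler_mx_entry.
by rewrite sumr_const card_ord -[leLHS]mulr_natl mulrA.
Qed.

Lemma norm_row_mxB m n (x x' : 'rV[R]_m) (y y' : 'rV[R]_n) :
  `|row_mx x y - row_mx x' y'| = Num.max `|x - x'| `|y - y'|.
Proof. by rewrite opp_row_mx add_row_mx norm_row_mx. Qed.

Lemma bil_quad_bound n (A : 'M[R]_n) u :
  `|bil u A u| <= ((n * n)%:R * `|A| + 1) * `|u| ^+ 2.
Proof.
apply: le_trans (bil_bound _ _ _) _.
by rewrite -mulrA -expr2 ler_wpM2r ?sqr_ge0// lerDl.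
Qed.

Lemma posdefmx_unit n (A : 'M[R]_n) : posdefmx A -> A \in unitmx.
Proof.
by move=> /integral_gauss[dA _]; rewrite unitmxE unitfE gt_eqF.
Qed.

Section schur_square.
Variables (d1 d2 : nat) (J1 : 'M[R]_d1) (J2 : 'M[R]_d2) (RJ : 'M[R]_(d1, d2)).
Hypothesis pJ2 : posdefmx J2.

(** The deviation of [u2] from its conditional mean given [u1] in the limiting Gaussian, which is
    [- u1 *m (RJ *m invmx J2)]. *)
Definition shift2 (u1 : 'rV[R]_d1) (u2 : 'rV[R]_d2) := u2 + u1 *m (RJ *m invmx J2).

(** The amount by which the [theta_1] block of [H] exceeds [J1]; completing the square in [theta_2]
    removes it again. *)
Definition schurC := RJ *m invmx J2 *m RJ^T.

Lemma complete_square u1 u2 :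
  2 * bil u1 RJ u2 + bil u2 J2 u2 =
  bil (shift2 u1 u2) J2 (shift2 u1 u2) - bil u1 schurC u1.
Proof.
have uJ := posdefmx_unit pJ2.
have iT : (invmx J2)^T = invmx J2 by rewrite trmx_inv pJ2.1.
have E x : bil (x *m (RJ *m invmx J2)) J2 =1 bil x RJ.
  by move=> y; rewrite /bil !mulmxA -(mulmxA _ (invmx J2) J2) mulVmx// mulmx1.
rewrite /shift2 bilDl !bilDr !E (bil_tr u2 _ (u1 *m _)) pJ2.1 E.
have -> : bil u1 RJ (u1 *m (RJ *m invmx J2)) = bil u1 schurC u1.
  by rewrite /bil /schurC !trmx_mul iT !mulmxA.
ring.
Qed.

End schur_square.
End core_tools.

(** * Convergence of real sequences and of integrals *)

Section convergence_tools.
Context {R : realType}.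

Lemma cvgr_near (f : nat -> R) (l : R) :
  (forall eps : R, 0 < eps -> \forall k \near \oo, `|f k - l| <= eps) -> f @ \oo --> l.
Proof.
move=> H; apply/cvgrPdist_le => eps e0; apply: filterS (H _ e0) => k.
by rewrite distrC.
Qed.

Lemma near_cvgr (f : nat -> R) (l : R) : f @ \oo --> l ->
  forall eps : R, 0 < eps -> \forall k \near \oo, `|f k - l| <= eps.
Proof.
move=> /cvgrPdist_le H eps e0; apply: filterS (H _ e0) => k.
by rewrite distrC.
Qed.

(** Domination is granted for large [k] only, so dominated convergence is applied to the sequence
    shifted by [K] and the index is shifted back. *)
Lemma dominated_near d (T : measurableType d) (mu : {measure set T -> \bar R})
    (f : nat -> T -> R) (F G : T -> R) :
  (forall k, measurable_fun setT (f k)) -> measurable_fun setT F ->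
  measurable_fun setT G -> (forall x, f ^~ x @ \oo --> F x) ->
  (\int[mu]_x (G x)%:E < +oo)%E -> (forall x, 0 <= G x) ->
  (\forall k \near \oo, forall x, `|f k x| <= G x) ->
  forall eps : R, 0 < eps -> \forall k \near \oo,
    (\int[mu]_x (`|f k x - F x|)%:E <= eps%:E)%E.
Proof.
move=> mf mF mG fF Goo G0 [K _ HK] eps e0.
have ig : mu.-integrable setT (EFin \o G).
  apply/integrableP; split; first exact/measurable_EFinP.
  by under eq_integral do rewrite /= ger0_norm//.
have [|||||_ H _] := @dominated_convergence _ _ _ mu setT measurableT
   (fun k => EFin \o f (k + K)%N) (EFin \o F) (EFin \o G).
- by move=> k; apply/measurable_EFinP.
- exact/measurable_EFinP.
- apply: aeW => x _; apply/cvg_EFin; first by apply: nearW.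
  rewrite (_ : fine \o _ = (fun k => f (k + K)%N x))//.
  by have := fF x; rewrite -(cvg_shiftn K).
- exact: ig.
- apply: aeW => x k _; rewrite lee_fin; apply: HK.
  by rewrite /= leq_addl.
have /fine_cvgP[fin_near H1] := H.
have := near_cvgr H1 e0; rewrite /= => -[M _ HM].
have [M' _ HM'] := fin_near.
exists (M + M' + K)%N => // k /= kM.
have kK : (k = (k - K) + K)%N by rewrite subnK// (leq_trans _ kM)// leq_addl.
have Kk : (K <= k)%N by rewrite (leq_trans _ kM)// leq_addl.
have kM1 : (M <= k - K)%N.
  by rewrite -(leq_add2r K) subnK// (leq_trans _ kM)// leq_add2r leq_addr.
have kM2 : (M' <= k - K)%N.
  by rewrite -(leq_add2r K) subnK// (leq_trans _ kM)// leq_add2r leq_addl.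
have := HM (k - K)%N kM1; have := HM' (k - K)%N kM2; rewrite /= -kK.
rewrite subr0 (_ : (\int[mu]_x `|(f k x)%:E - (F x)%:E|)%E = (\int[mu]_x (`|f k x - F x|)%:E)%E)//.
move=> fn; rewrite ger0_norm; last by apply: fine_ge0; exact: integral_ge0.
by rewrite -[X in (X <= _)%E](fineK fn) lee_fin.
Qed.

Lemma integral_le_dist d (T : measurableType d) (mu : {measure set T -> \bar R})
    (f g : T -> R) : measurable_fun setT f -> measurable_fun setT g ->
  (forall x, 0 <= f x) -> (forall x, 0 <= g x) ->
  (\int[mu]_x (f x)%:E <= \int[mu]_x (g x)%:E + \int[mu]_x (`|f x - g x|)%:E)%E.
Proof.
move=> mf mg f0 g0.
have mfg : measurable_fun setT (fun x => `|f x - g x|).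
  by apply: measurableT_comp => //; exact: measurable_funB.
rewrite -ge0_integralD//=.
- apply: ge0_le_integral_EFin => //; first exact: measurable_funD.
  move=> x; rewrite -lerBlDl; exact: ler_norm.
- by move=> x _; rewrite lee_fin.
- exact/measurable_EFinP.
- exact/measurable_EFinP.
Qed.

(** Used to beat the Jacobian [n^(d/2)] of the rescaling by an exponentially small tail. *)
Lemma expR_decay (d : nat) (gam c : R) (n : nat -> R) : 0 < gam -> 0 < c ->
  (forall A : R, \forall k \near \oo, A <= n k) ->
  \forall k \near \oo, Num.sqrt (n k) ^+ d * expR (- gam * n k) <= c.
Proof.
move=> gam0 c0 n_oo.
(* The term of degree [d + 2] of the exponential series grows like [n ^+ (d + 2) / C], two degrees
   above the bound [n ^+ d] for the polynomial factor. *)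
pose C := (d.+2)`!%:R / gam ^+ d.+2.
have C0 : 0 < C by rewrite divr_gt0 ?exprn_gt0// ltr0n fact_gt0.
have := n_oo (1 + C / c); apply: filterS => k nk.
have n1 : 1 <= n k by rewrite (le_trans _ nk)// lerDl ltW// divr_gt0.
have n0 : 0 < n k by apply: lt_le_trans n1.
have s1 : Num.sqrt (n k) <= n k.
  by rewrite -[leRHS]ger0_norm ?(ltW n0)// -sqrtr_sqr ler_wsqrtr// expr2 ler_peMl// ltW.
rewrite mulNr expRN ler_pdivrMr ?expR_gt0//.
apply: (@le_trans _ _ (n k ^+ d)); first by rewrite lerXn2r ?nnegrE ?sqrtr_ge0 ?(ltW n0).
have := expR_ge1Dxn d.+1 (mulr_ge0 (ltW gam0) (ltW n0)) => H.
apply: (@le_trans _ _ (c * ((gam * n k) ^+ d.+2 / (d.+2)`!%:R))); last first.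
  by rewrite ler_wpM2l ?(ltW c0)// (le_trans _ H)// lerDr.
have -> : c * ((gam * n k) ^+ d.+2 / (d.+2)`!%:R) = c * n k ^+ 2 / C * n k ^+ d.
  rewrite /C exprMn -(addn2 d) !exprD; field.
  by rewrite !gt_eqF ?exprn_gt0// ltr0n fact_gt0.
rewrite ler_peMl ?exprn_ge0 ?(ltW n0)// ler_pdivlMr// mul1r -ler_pdivrMl// mulrC.
apply: le_trans (_ : n k <= _); first by rewrite (le_trans _ nk)// lerDr.
by rewrite expr2 ler_peMl// ltW.
Qed.

Lemma posdefmx_ge0 m (A : 'M[R]_m) x : posdefmx A -> 0 <= bil x A x.
Proof.
by move=> pA; have [->|x0] := eqVneq x 0; [rewrite bil0l|exact: ltW (pA.2 _ x0)].
Qed.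

Lemma posdefmx_joint d1 d2 (J1 : 'M[R]_d1) (J2 : 'M[R]_d2) (RJ : 'M[R]_(d1, d2)) :
  posdefmx J1 -> posdefmx J2 ->
  posdefmx (block_mx (J1 + schurC J2 RJ) RJ RJ^T J2).
Proof.
move=> p1 p2; split.
  rewrite tr_block_mx trmxK linearD/= p1.1 p2.1 /schurC !trmx_mul trmxK trmx_inv p2.1.
  by rewrite mulmxA.
move=> x x0; rewrite -(hsubmxK x) -/(bil _ _ _) bil_row_mx.
set u1 := lsubmx x; set u2 := rsubmx x.
rewrite (bil_tr u2 RJ^T) trmxK bilD.
have E := complete_square RJ p2 u1 u2.
have -> : bil u1 J1 u1 + bil u1 (schurC J2 RJ) u1 + bil u1 RJ u2 + bil u1 RJ u2 + bil u2 J2 u2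
   = bil u1 J1 u1 + bil (shift2 J2 RJ u1 u2) J2 (shift2 J2 RJ u1 u2).
  move: E; move: (bil (shift2 _ _ _ _) _ _) => Z E.
  have -> : Z = (2 * bil u1 RJ u2 + bil u2 J2 u2) + bil u1 (schurC J2 RJ) u1 by rewrite E subrK.
  ring.
have [u10|u10] := eqVneq u1 0; last first.
  by rewrite ltr_pwDl ?posdefmx_ge0//; exact: p1.2.
rewrite u10 bil0l add0r /shift2 mul0mx addr0; apply: p2.2.
apply: contra_neq x0 => u20; rewrite -(hsubmxK x) -/u1 -/u2 u10 u20.
by rewrite row_mx0.
Qed.

End convergence_tools.

(** * Laplace's method: from a quadratic expansion to L1 convergence *)

Section laplace.
Context {R : realType} {d1 d2 : nat}.
Variables (Th1 : set 'rV[R]_d1) (Th2 : set 'rV[R]_d2).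
Variables (p1 : 'rV[R]_d1 -> R) (p2 : 'rV[R]_d2 -> R).
Variables (th1s : 'rV[R]_d1) (th2s : 'rV[R]_d2).
Variables (n : nat -> R) (l1 : nat -> 'rV[R]_d1 -> R).
Variables (t1 : nat -> 'rV[R]_d1) (t2 : nat -> 'rV[R]_d2).
Variables (fin : nat -> 'rV[R]_d1 -> Prop).
Variables (e : nat -> 'rV[R]_d1 -> 'rV[R]_d2 -> R) (i0 : nat -> R).
Variables (J1 : 'M[R]_d1) (J2 : 'M[R]_d2) (RJ : 'M[R]_(d1, d2)).
Variables (g : nat -> 'rV[R]_d1) (Bk : nat -> 'M[R]_d1).

(** [g k] is the score in [theta_1] and [b k] the [theta_1] block of the information divided by [n].
    There is no linear term in [u2], since [theta_hat_2] maximises [L2] at [theta_hat_1]. *)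
Definition expquad (b : nat -> 'M[R]_d1) k u1 u2 : R :=
  bil u1 1%:M (g k) - n k / 2 * (bil u1 (b k) u1 + 2 * bil u1 RJ u2 + bil u2 J2 u2).

(** The block [b] is a parameter because the expansion is first known with the unidentified [Bk] and
    only in [quad_lim] with its limit. *)
Definition near_approx (b : nat -> 'M[R]_d1) := forall eta : R, 0 < eta ->
  exists2 rho : R, 0 < rho & \forall k \near \oo, forall u1 u2,
    `|u1| <= rho -> `|u2| <= rho ->
    [/\ fin k (t1 k + u1),
      e k (t1 k + u1) (t2 k + u2) <=
        expR (expquad b k u1 u2 + eta * n k * (`|u1| ^+ 2 + `|u2| ^+ 2)) &
      expR (expquad b k u1 u2 - eta * n k * (`|u1| ^+ 2 + `|u2| ^+ 2))
        <= e k (t1 k + u1) (t2 k + u2)].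

Hypothesis mp1 : measurable_fun setT p1.
Hypothesis p1_ge0 : forall t, 0 <= p1 t.
Hypothesis p1_out : forall t, ~ Th1 t -> p1 t = 0.
Hypothesis p1_int : (\int[lebesgue_rV d1]_t (p1 t)%:E = 1)%E.
Hypothesis mp2 : measurable_fun setT p2.
Hypothesis p2_ge0 : forall t, 0 <= p2 t.
Hypothesis p2_out : forall t, ~ Th2 t -> p2 t = 0.
Hypothesis p2_int : (\int[lebesgue_rV d2]_t (p2 t)%:E = 1)%E.
Hypothesis max1 : forall k x, Th1 x -> l1 k x <= l1 k (t1 k).
Hypothesis n_oo : forall A : R, \forall k \near \oo, A <= n k.
Hypothesis t1_cvg : forall eps : R, 0 < eps -> \forall k \near \oo, `|t1 k - th1s| <= eps.
Hypothesis t2_cvg : forall eps : R, 0 < eps -> \forall k \near \oo, `|t2 k - th2s| <= eps.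
Hypothesis Th1_int : exists2 r : R, 0 < r & forall x, `|x - th1s| <= r -> Th1 x.
Hypothesis p1s : 0 < p1 th1s.
Hypothesis p2s : 0 < p2 th2s.
Hypothesis p1_cont : forall eps : R, 0 < eps -> exists2 r : R, 0 < r &
  forall x, `|x - th1s| <= r -> `|p1 x - p1 th1s| <= eps.
Hypothesis p2_cont : forall eps : R, 0 < eps -> exists2 r : R, 0 < r &
  forall x, `|x - th2s| <= r -> `|p2 x - p2 th2s| <= eps.
Hypothesis sep1 : forall delta : R, 0 < delta -> exists2 gamma : R, 0 < gamma &
  \forall k \near \oo, forall x, Th1 x -> delta <= `|x - t1 k| ->
    l1 k x - l1 k (t1 k) <= - gamma * n k.
Hypothesis me : forall k, measurable_fun setT (fun z => e k z.1 z.2).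
Hypothesis e_ge0 : forall k x t, 0 <= e k x t.
Hypothesis e_int : forall k x, fin k x ->
  (\int[lebesgue_rV d2]_t (e k x t * p2 t)%:E = (expR (l1 k x - l1 k (t1 k)) * i0 k)%:E)%E.
Hypothesis e_int_le : forall k x,
  (\int[lebesgue_rV d2]_t (e k x t * p2 t)%:E <= (expR (l1 k x - l1 k (t1 k)) * i0 k)%:E)%E.
Hypothesis i0_gt0 : forall k, 0 < i0 k.
Hypothesis i0_le1 : forall k, i0 k <= 1.
Hypothesis i0_lower : forall eta : R, 0 < eta ->
  \forall k \near \oo, expR (- eta * n k) <= i0 k.
Hypothesis e_tail : forall rho : R, 0 < rho -> exists rho' gamma : R, [/\ 0 < rho', 0 < gamma &
  \forall k \near \oo, forall x t, Th1 x -> Th2 t -> `|x - t1 k| < rho' ->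
    rho <= `|t - t2 k| -> e k x t <= expR (- gamma * n k) * expR (l1 k x - l1 k (t1 k))].
Hypothesis quadB : near_approx Bk.
Hypothesis B_sym : forall k, (Bk k)^T = Bk k.
Hypothesis pJ1 : posdefmx J1.
Hypothesis pJ2 : posdefmx J2.
Hypothesis lln1 : forall i j (eta h0 : R), 0 < eta -> 0 < h0 -> exists h : R,
  [/\ 0 < h, h < h0 & \forall k \near \oo,
    `|dd (l1 k) (h *: delta_mx ord0 i) (h *: delta_mx ord0 j) th1s / (n k * h ^+ 2)
      + J1 i j| <= eta].

Lemma density_lower d (p : 'rV[R]_d -> R) s : 0 < p s ->
  (forall eps : R, 0 < eps -> exists2 r : R, 0 < r &
     forall x, `|x - s| <= r -> `|p x - p s| <= eps) ->
  exists2 r : R, 0 < r & forall x, `|x - s| <= r -> p s / 2 <= p x.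
Proof.
move=> ps pc; have h : 0 < p s / 2 by rewrite divr_gt0.
have [r r0 H] := pc _ h; exists r => // x /H.
rewrite ler_norml => /andP[+ _]; lra.
Qed.

Lemma expR_small (c gamma : R) : 0 < c -> 0 < gamma ->
  \forall k \near \oo, expR (- gamma * n k) <= c.
Proof.
move=> c0 g0; have := n_oo (- ln c / gamma); apply: filterS => k.
rewrite ler_pdivrMr// => H; rewrite -[leRHS]lnK ?posrE// ler_expR mulNr lerNl.
by rewrite mulrC.
Qed.

Lemma me_slice k x : measurable_fun setT (e k x).
Proof. exact: (measurableT_comp (me k) (measurable_pair1 x)). Qed.

Let Sk k := Bk k - schurC J2 RJ.

Lemma quad_shift b u1 u2 :
  bil u1 b u1 + 2 * bil u1 RJ u2 + bil u2 J2 u2 =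
  bil u1 (b - schurC J2 RJ) u1 + bil (shift2 J2 RJ u1 u2) J2 (shift2 J2 RJ u1 u2).
Proof. by rewrite -addrA complete_square// bilD bilN; ring. Qed.

(* [e_int] recovers [l1] from the integral of [e] over [theta_2], a Gaussian
   integral up to the error of [quadB]. *)
Lemma l1_quad (eta : R) : 0 < eta -> exists2 rho : R, 0 < rho &
  forall eps : R, 0 < eps -> \forall k \near \oo, forall u1, `|u1| <= rho ->
    `|l1 k (t1 k + u1) - l1 k (t1 k) - bil u1 1%:M (g k) + n k / 2 * bil u1 (Sk k) u1|
    <= n k * (eta * `|u1| ^+ 2 + eps).
Proof.
move=> eta0.
have [lam lam0 Hlam] := posdefmx_coercive pJ2.
pose Lam := (d2 * d2)%:R * `|J2| + 1.
have Lam0 : 0 < Lam by rewrite ltr_wpDl// mulr_ge0.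
pose Kc := d1%:R * `|RJ *m invmx J2| + 1.
have Kc0 : 0 < Kc by rewrite ltr_wpDl// mulr_ge0.
have HKc (u : 'rV[R]_d1) : `|u *m (RJ *m invmx J2)| <= Kc * `|u|.
  by apply: le_trans (norm_mulmx_row _ _) _; rewrite ler_wpM2r// lerDl.
pose KK := 1 + 2 * Kc ^+ 2.
have KK0 : 0 < KK by rewrite ltr_pwDl// mulr_ge0// sqr_ge0.
(* The error in [u2] splits between [u1] and [shift2]. The bound [lam / 4] lets half of the [J2]
   form absorb the [shift2] part, and [eta / KK] keeps the [u1] part below [eta]. *)
pose eta' := Num.min (lam / 4) (eta / KK).
have eta'0 : 0 < eta' by rewrite lt_min !divr_gt0.
have [eta'1 eta'2] : eta' <= lam / 4 /\ eta' * KK <= eta.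
  split; first by rewrite /eta' ge_min lexx.
  by rewrite -ler_pdivlMr// /eta' ge_min lexx orbT.
have [rho0 rho00 Hnear] := quadB eta'0.
have [rho1 [gam [rho10 gam0 Htail]]] := e_tail rho00.
have [rp rp0 Hp] := density_lower p2s p2_cont.
have [rT rT0 HT] := Th1_int.
have sq (a c : R) : (a + c) ^+ 2 <= 2 * a ^+ 2 + 2 * c ^+ 2.
  have := sqr_ge0 (a - c); rewrite sqrrB sqrrD; lra.
have u2z u1 u2 : `|u2| ^+ 2 <= 2 * `|shift2 J2 RJ u1 u2| ^+ 2 + 2 * Kc ^+ 2 * `|u1| ^+ 2.
  have : `|u2| <= `|shift2 J2 RJ u1 u2| + Kc * `|u1|.
    have {1}-> : u2 = shift2 J2 RJ u1 u2 - u1 *m (RJ *m invmx J2) by rewrite /shift2 addrK.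
    by apply: le_trans (ler_normB _ _) _; rewrite lerD2l.
  move=> H; apply: le_trans (_ : (`|shift2 J2 RJ u1 u2| + Kc * `|u1|) ^+ 2 <= _).
    by rewrite lerXn2r ?nnegrE// addr_ge0 ?mulr_ge0// ltW.
  by apply: le_trans (sq _ _) _; rewrite exprMn !mulrA.
(* The radius keeps [u1] inside the ranges of the expansion, of the tail bound and of [Th1], and
   moves the conditional centre [a] by at most [rho0 / 2] and [rp / 4]. It must not depend on
   [eps]. *)
pose rho := Num.min (Num.min rho0 (rho1 / 2)) (Num.min (rT / 2) (Num.min (rho0 / (2 * Kc)) (rp / (4 * Kc)))).
have rhoP : 0 < rho by rewrite !lt_min rho00 !divr_gt0// mulr_gt0.
have [hr1 hr2 hr3 hr4 hr5] : [/\ rho <= rho0, rho <= rho1 / 2, rho <= rT / 2,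
    Kc * rho <= rho0 / 2 & Kc * rho <= rp / 4].
  have h4 : rho <= rho0 / (2 * Kc) by rewrite /rho !ge_min lexx !orbT.
  have h5 : rho <= rp / (4 * Kc) by rewrite /rho !ge_min lexx !orbT.
  split; try by rewrite /rho !ge_min lexx ?orbT.
    by move: h4; rewrite ler_pdivlMr ?mulr_gt0//; lra.
  by move: h5; rewrite ler_pdivlMr ?mulr_gt0//; lra.
exists rho => // eps eps0.
have eps2 : 0 < eps / 2 by rewrite divr_gt0.
(* Half-side of the cube used for the lower bound: on it the exponent varies by at most
   [n k * (eps / 2)], and the other half of [eps] pays for the constant [c]. *)
pose r := Num.min (Num.min (rho0 / 2) (rp / 2)) (Num.min 1 (eps / 2 / (Lam / 2 + 2 * eta'))).
have D0 : 0 < Lam / 2 + 2 * eta' by rewrite addr_gt0 ?divr_gt0 ?mulr_gt0.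
have r0 : 0 < r by rewrite !lt_min ltr01 !divr_gt0.
have [r1 r2 r3 r4] : [/\ r <= rho0 / 2, r <= rp / 2, r <= 1 & r * (Lam / 2 + 2 * eta') <= eps / 2].
  have h4 : r <= eps / 2 / (Lam / 2 + 2 * eta') by rewrite /r !ge_min lexx !orbT.
  split; try by rewrite /r !ge_min lexx ?orbT.
  by rewrite -ler_pdivlMr.
have rr : (Lam / 2 + 2 * eta') * r ^+ 2 <= eps / 2.
  apply: le_trans r4; rewrite mulrC ler_wpM2r ?(ltW D0)// expr2 ler_piMr ?(ltW r0)//.
pose c := p2 th2s / 2 * (2 * r) ^+ d2.
have c0 : 0 < c by rewrite mulr_gt0 ?divr_gt0// exprn_gt0// mulr_gt0.
have e30 : 0 < Num.min (eps / 2) (gam / 2) by rewrite lt_min !divr_gt0.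
have h2 : (0 : R) < 2^-1 by rewrite invr_gt0.
have g2 : 0 < gam / 2 by rewrite divr_gt0.
have rT2 : 0 < rT / 2 by rewrite divr_gt0.
have rp4 : 0 < rp / 4 by rewrite divr_gt0.
have := Hnear; apply: filter_app; have := Htail; apply: filter_app.
have := i0_lower e30; apply: filter_app.
have := expR_small h2 g2; apply: filter_app.
have := expR_small h2 eps2; apply: filter_app.
have := expR_small c0 eps2; apply: filter_app.
have := t1_cvg rT2; apply: filter_app.
have := t2_cvg rp4; apply: filter_app.
have := n_oo 0; apply: filterS => k n0 Ht2 Ht1 Hc He2 Hg2 Hi0 {}Htail {}Hnear u1 u1r.
set x := t1 k + u1; set D := l1 k x - l1 k (t1 k).
set S := bil u1 (Sk k) u1; set G := bil u1 1%:M (g k).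
have Tx : Th1 x.
  apply: HT; rewrite /x addrAC (le_trans (ler_normD _ _))//; lra.
have xt : x - t1 k = u1 by rewrite /x addrC addKr.
have h00 : `|0 : 'rV[R]_d2| <= rho0 by rewrite normr0 ltW.
have fx : fin k x.
  by have [] := Hnear u1 0 (le_trans u1r hr1) h00.
have EI := e_int fx; rewrite -/D in EI.
have i0p := i0_gt0 k; have i01 := i0_le1 k.
have mep : measurable_fun setT (fun t => e k x t * p2 t).
  by apply: measurable_funM => //; exact: me_slice.
have e0 := e_ge0 k x.
have [i0a i0b] : expR (- (eps / 2) * n k) <= i0 k /\ expR (- (gam / 2) * n k) <= i0 k.
  split; apply: le_trans Hi0; rewrite ler_expR !mulNr lerN2 ler_wpM2r// ge_min lexx ?orbT//.
have qE u2 : bil u1 (Bk k) u1 + 2 * bil u1 RJ u2 + bil u2 J2 u2 = S + bil (shift2 J2 RJ u1 u2) J2 (shift2 J2 RJ u1 u2).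
  exact: quad_shift.
have su (u2 : 'rV[R]_d2) : eta' * n k * (`|u1| ^+ 2 + `|u2| ^+ 2) <=
   n k * (eta * `|u1| ^+ 2) + n k * (2 * eta' * `|shift2 J2 RJ u1 u2| ^+ 2).
  rewrite -mulrDr mulrAC mulrC ler_wpM2l//.
  have := ler_wpM2l (ltW eta'0) (u2z u1 u2).
  have := ler_wpM2r (sqr_ge0 `|u1|) eta'2; rewrite /KK.
  lra.
rewrite ler_norml; apply/andP; split.
(* Lower bound: only the cube centred at the conditional maximiser [a] is kept. *)
- have low : expR (G - n k / 2 * S - n k * (eta * `|u1| ^+ 2) - n k * (eps / 2)) * c <= expR D * i0 k.
    rewrite -lee_fin -EI.
    pose a := t2 k - u1 *m (RJ *m invmx J2).
    have := @ge0_integral_cube_lower R d2 (fun t => e k x t * p2 t) a r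
      (expR (G - n k / 2 * S - n k * (eta * `|u1| ^+ 2) - n k * (eps / 2)) * (p2 th2s / 2)).
    move=> /(_ (ltW r0)) H; apply: le_trans (H _ mep _ _).
    + by rewrite lee_fin /c !mulrA.
    + by rewrite mulr_ge0 ?expR_ge0// ltW// divr_gt0.
    + by move=> t; rewrite mulr_ge0.
    move=> t ta.
    have E : t = t2 k + (t - t2 k) by rewrite addrC subrK.
    have sE : shift2 J2 RJ u1 (t - t2 k) = t - a by rewrite /shift2 /a opprB addrA addrAC.
    have nu : `|u1 *m (RJ *m invmx J2)| <= Kc * rho.
      by apply: le_trans (HKc _) _; rewrite ler_wpM2l ?(ltW Kc0).
    have tt2 : `|t - t2 k| <= r + Kc * rho.
      have -> : t - t2 k = (t - a) - u1 *m (RJ *m invmx J2) by rewrite -sE /shift2 addrK.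
      by apply: le_trans (ler_normB _ _) _; exact: lerD.
    apply: ler_pM; rewrite ?expR_ge0//.
    + by rewrite ltW// divr_gt0.
    + have tr0 : `|t - t2 k| <= rho0 by lra.
      have [_ _ +] := Hnear u1 (t - t2 k) (le_trans u1r hr1) tr0.
      rewrite -/x -E; apply: le_trans; rewrite ler_expR /expquad qE -/G.
      have := su (t - t2 k); rewrite sE => su'.
      have B1 := bil_quad_bound J2 (t - a); rewrite -/Lam in B1.
      have tar : `|t - a| ^+ 2 <= r ^+ 2 by rewrite lerXn2r ?nnegrE// ltW.
      have := le_trans (ler_norm _) B1 => B2.
      have B3 : n k / 2 * bil (t - a) J2 (t - a) + n k * (2 * eta' * `|t - a| ^+ 2) <= n k * (eps / 2).
        have : bil (t - a) J2 (t - a) / 2 + 2 * eta' * `|t - a| ^+ 2 <= eps / 2.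
          have := ler_wpM2l (ltW Lam0) tar; have := ler_wpM2l (ltW eta'0) tar.
          have := sqr_ge0 `|t - a|; lra.
        move=> /(ler_wpM2l n0); lra.
      lra.
    + apply: Hp; have -> : t - th2s = (t - t2 k) + (t2 k - th2s) by rewrite addrA subrK.
      by apply: le_trans (ler_normD _ _) _; lra.
  have : expR (G - n k / 2 * S - n k * (eta * `|u1| ^+ 2) - n k * (eps / 2)) * expR (- (eps / 2) * n k) <= expR D * 1.
    apply: (@le_trans _ _ (expR D * i0 k)); last by rewrite ler_wpM2l ?expR_ge0.
    by apply: le_trans low; rewrite ler_wpM2l ?expR_ge0.
  rewrite mulr1 -expRD ler_expR; lra.
(* Upper bound: [p2] has total mass 1, so a bound on [e] suffices, from the expansion when [t] is
   near and from the tail estimate otherwise. The tail term is at most half of the left side and is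
   absorbed there. *)
- have up : expR D * i0 k <= expR (G - n k / 2 * S + n k * (eta * `|u1| ^+ 2)) + expR (- gam * n k) * expR D.
    rewrite -lee_fin -EI; set U := (X in (_ <= X%:E)%E).
    have U0 : 0 <= U by rewrite /U addr_ge0 ?mulr_ge0 ?expR_ge0.
    apply: (@le_trans _ _ (\int[lebesgue_rV d2]_t (U * p2 t)%:E)%E); last first.
      by rewrite ge0_integralZ_EFin// p2_int mule1.
    apply: ge0_le_integral_EFin => //; first exact: measurable_funM.
      by move=> t; rewrite mulr_ge0.
    move=> t; have [Tt|nT] := pselect (Th2 t); last by rewrite p2_out// !mulr0.
    rewrite ler_wpM2r//.
    have E : t = t2 k + (t - t2 k) by rewrite addrC subrK.
    have [tn|tf] := leP `|t - t2 k| rho0.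
      have [_ + _] := Hnear u1 (t - t2 k) (le_trans u1r hr1) tn.
      rewrite -/x -E => /le_trans; apply; rewrite /U -[leLHS]addr0 lerD ?mulr_ge0 ?expR_ge0//.
      rewrite ler_expR /expquad qE -/G.
      have := su (t - t2 k); have := Hlam (shift2 J2 RJ u1 (t - t2 k)).
      set Z := bil _ J2 _; set z2 := `|_| ^+ 2 => HZ su'.
      have hz : 2 * eta' * z2 <= Z / 2.
        have := ler_wpM2r (sqr_ge0 `|shift2 J2 RJ u1 (t - t2 k)|) eta'1; rewrite -/z2; lra.
      have := ler_wpM2l n0 hz; move: su'; rewrite -/z2.
      have -> : n k * (Z / 2) = n k / 2 * Z by ring.
      rewrite [n k / 2 * (S + Z)]mulrDr.
      move: (n k * (2 * _ * _)) (n k / 2 * Z) (n k / 2 * S) (eta' * _ * _) (n k * (eta * _)) => a1 a2 a3 a4 a5.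
      move=> X1 X2; rewrite -subr_ge0 (_ : _ - _ = (a2 - a1) + (a5 + a1 - a4)); last by ring.
      by rewrite addr_ge0// subr_ge0.
    have xr : `|x - t1 k| < rho1 by rewrite xt; lra.
    have := Htail x t Tx Tt xr (ltW tf) => /le_trans; apply.
    by rewrite /U lerDr expR_ge0.
  have gg : expR (- gam * n k) <= i0 k / 2.
    have -> : - gam * n k = - (gam / 2) * n k + - (gam / 2) * n k by field.
    by rewrite expRD; apply: ler_pM; rewrite ?expR_ge0.
  have : expR D * expR (- (eps / 2) * n k) * expR (- (eps / 2) * n k) <=
      expR (G - n k / 2 * S + n k * (eta * `|u1| ^+ 2)).
    have : expR D * (i0 k / 2) <= expR (G - n k / 2 * S + n k * (eta * `|u1| ^+ 2)).
      have := ler_wpM2l (expR_ge0 D) gg; lra.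
    apply: le_trans; rewrite -mulrA ler_wpM2l ?expR_ge0//.
    by apply: ler_pM; rewrite ?expR_ge0.
  by rewrite -!expRD ler_expR; lra.
Qed.

Lemma Sk_sym k : (Sk k)^T = Sk k.
Proof.
rewrite /Sk linearB /= B_sym /schurC !trmx_mul trmxK.
by rewrite trmx_inv pJ2.1 mulmxA.
Qed.

(** A second difference of [l1] with fixed step [h] kills the unknown linear term of [l1_quad] and
    leaves [- n h^2] times an entry of [Sk]; the law of large numbers gives the same difference with
    [J1]. *)
Lemma Sk_cvg i j (eta : R) : 0 < eta ->
  \forall k \near \oo, `|Sk k i j - J1 i j| <= eta.
Proof.
(* Each of the four values involved lies within [3 * h] of [t1 k] and has error at most
   [(3 ^+ 2 + 1) * n * eta1 * h ^+ 2]; four times this is [n * h ^+ 2 * (eta / 2)]. *)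
move=> eta0; pose eta1 := eta / 80.
have eta10 : 0 < eta1 by rewrite divr_gt0.
have [rho rho0 Hq] := l1_quad eta10.
have eta2 : 0 < eta / 2 by rewrite divr_gt0.
have rho3 : 0 < rho / 3 by rewrite divr_gt0.
have [h [h0 hrho Hlln]] := lln1 i j eta2 rho3.
have eh : 0 < eta1 * h ^+ 2 by rewrite mulr_gt0// exprn_gt0.
have := Hq _ eh; apply: filter_app; have := Hlln; apply: filter_app.
have := t1_cvg h0; apply: filter_app; have := n_oo 1.
apply: filterS => k n1 Ht {}Hlln {}Hq.
have n0 : 0 < n k by apply: lt_le_trans n1.
set v := h *: delta_mx ord0 i in Hlln; set w := h *: delta_mx ord0 j in Hlln.
have nd (l : 'I_d1) : `|h *: (delta_mx ord0 l : 'rV[R]_d1)| <= h.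
  rewrite normrZ gtr0_norm// ler_piMr ?(ltW h0)//; apply: mx_norm_le => // a b.
  by rewrite mxE ger0_norm ?ler0n// -[leRHS]/(1%:R) ler_nat leq_b1.
pose x := th1s - t1 k; have nx : `|x| <= h by rewrite /x distrC.
pose q (u : 'rV[R]_d1) := bil u 1%:M (g k) - n k / 2 * bil u (Sk k) u.
have Err u : `|u| <= 3 * h ->
    `|l1 k (t1 k + u) - l1 k (t1 k) - q u| <= 10 * n k * eta1 * h ^+ 2.
  move=> uh; have ur : `|u| <= rho by lra.
  have -> : l1 k (t1 k + u) - l1 k (t1 k) - q u =
    l1 k (t1 k + u) - l1 k (t1 k) - bil u 1%:M (g k) + n k / 2 * bil u (Sk k) u by rewrite /q; ring.
  apply: le_trans (Hq _ ur) _.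
  have -> : 10 * n k * eta1 * h ^+ 2 = n k * (eta1 * (3 * h) ^+ 2 + eta1 * h ^+ 2) by ring.
  rewrite ler_wpM2l ?(ltW n0)// lerD2r ler_wpM2l ?(ltW eta10)//.
  by rewrite lerXn2r ?nnegrE// mulr_ge0// ltW.
have E0 := Err x; have E1 := Err (x + v); have E2 := Err (x + w); have E3 := Err (x + v + w).
have nv := nd i; have nw := nd j; rewrite -/v in nv; rewrite -/w in nw.
have hh1 : h <= 3 * h by lra.
have hh2 : h + h <= 3 * h by lra.
have hh3 : h + h + h <= 3 * h by lra.
have {}E0 := E0 (le_trans nx hh1).
have {}E1 := E1 (le_trans (le_trans (ler_normD _ _) (lerD nx nv)) hh2).
have {}E2 := E2 (le_trans (le_trans (ler_normD _ _) (lerD nx nw)) hh2).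
have {}E3 := E3 (le_trans (le_trans (ler_normD _ _) (lerD (le_trans (ler_normD _ _) (lerD nx nv)) nw)) hh3).
have th u : t1 k + (x + u) = th1s + u by rewrite /x addrCA addrA subrK addrC.
have th0 : t1 k + x = th1s by rewrite /x addrC subrK.
rewrite -(addrA x) !th th0 !addrA in E0 E1 E2 E3.
have ddq y : dd q v w y = - (n k * h ^+ 2 * Sk k i j).
  have svw : bil w (Sk k) v = bil v (Sk k) w by rewrite bil_tr Sk_sym.
  have -> : n k * h ^+ 2 * Sk k i j = n k * bil v (Sk k) w.
    by rewrite /v /w bilZl bilZr bil_delta; ring.
  rewrite /dd /q !bilDl !bilDr svw.
  have -> : bil v (Sk k) y = bil y (Sk k) v by rewrite bil_tr Sk_sym.
  have -> : bil w (Sk k) y = bil y (Sk k) w by rewrite bil_tr Sk_sym.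
  by field.
set D := dd (l1 k) v w th1s in Hlln.
have key : `|D + n k * h ^+ 2 * Sk k i j| <= n k * h ^+ 2 * (eta / 2).
  have -> : D + n k * h ^+ 2 * Sk k i j = D - dd q v w x by rewrite ddq opprK.
  have -> : n k * h ^+ 2 * (eta / 2) = 4 * (10 * n k * eta1 * h ^+ 2) by rewrite /eta1; field.
  rewrite /D /dd; move: E0 E1 E2 E3; set bd := 10 * n k * _ * _.
  rewrite !ler_norml => /andP[? ?] /andP[? ?] /andP[? ?] /andP[? ?].
  apply/andP; split; lra.
have nh : 0 < n k * h ^+ 2 by rewrite mulr_gt0// exprn_gt0.
have -> : Sk k i j - J1 i j = (D + n k * h ^+ 2 * Sk k i j) / (n k * h ^+ 2) - (D / (n k * h ^+ 2) + J1 i j).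
  by field; rewrite !gt_eqF.
apply: le_trans (ler_normB _ _) _; rewrite [leRHS]splitr lerD//.
by rewrite normrM [X in _ * X]gtr0_norm ?invr_gt0// ler_pdivrMr// [leRHS]mulrC.
Qed.

(** Half of [eta] pays for replacing [Bk] by its limit. *)
Lemma quad_lim : near_approx (fun=> J1 + schurC J2 RJ).
Proof.
move=> eta eta0; have eta2 : 0 < eta / 2 by rewrite divr_gt0.
have [rho rho0 Hq] := quadB eta2; exists rho => //.
pose e1 : R := eta / (d1 * d1).+1%:R.
have e10 : 0 < e1 by rewrite divr_gt0.
have HS : \forall k \near \oo, forall i j, `|Sk k i j - J1 i j| <= e1.
  by apply: filter_forall => i; apply: filter_forall => j; exact: Sk_cvg.
have := HS; apply: filter_app; have := n_oo 0; apply: filter_app.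
apply: filterS Hq => k {}Hq n0 {}HS u1 u2 h1 h2.
have [fx A1 A2] := Hq _ _ h1 h2.
have N1 : `|Sk k - J1| <= e1.
  apply: mx_norm_le => [|i j]; [exact: ltW|].
  by rewrite [(Sk k - J1) i j]mxE [(- J1) i j]mxE; exact: HS.
have B1 : `|bil u1 (Sk k - J1) u1| <= eta * `|u1| ^+ 2.
  apply: le_trans (bil_bound _ _ _) _; rewrite -mulrA -expr2 ler_wpM2r ?sqr_ge0//.
  apply: (@le_trans _ _ ((d1 * d1)%:R * e1)); first by rewrite ler_wpM2l.
  rewrite /e1 mulrCA ler_piMr ?(ltW eta0)// ler_pdivrMr// mul1r ler_nat; exact: leqnSn.
have E : bil u1 (J1 + schurC J2 RJ) u1 = bil u1 (Bk k) u1 - bil u1 (Sk k - J1) u1.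
  rewrite /Sk !(bilD, bilN); ring.
have B2 : `|n k / 2 * bil u1 (Sk k - J1) u1| <= eta / 2 * n k * `|u1| ^+ 2.
  rewrite normrM ger0_norm ?divr_ge0//.
  by apply: le_trans (ler_wpM2l _ B1) _; rewrite ?divr_ge0// le_eqVlt; apply/orP; left; apply/eqP; field.
have H2 : 0 <= eta / 2 * n k * `|u2| ^+ 2 by rewrite mulr_ge0 ?sqr_ge0// mulr_ge0// ltW.
have Q : expquad (fun=> J1 + schurC J2 RJ) k u1 u2 = expquad Bk k u1 u2 + n k / 2 * bil u1 (Sk k - J1) u1.
  by rewrite /expquad E; field.
have S2 : eta * n k * (`|u1| ^+ 2 + `|u2| ^+ 2) =
    eta / 2 * n k * (`|u1| ^+ 2 + `|u2| ^+ 2) + (eta / 2 * n k * `|u1| ^+ 2 + eta / 2 * n k * `|u2| ^+ 2) by field.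
move: A1 A2 B2 H2; rewrite Q S2; move: (expquad _ _ _ _) (_ / 2 * bil _ _ _) => q y.
move: (eta / 2 * n k * (_ + _)) (_ * `|u1| ^+ 2) (_ * `|u2| ^+ 2) => z1 z2 z3 A1 A2.
rewrite ler_norml => /andP[C1 C2] C3; split => //.
  apply: le_trans A1 _; rewrite ler_expR.
  rewrite -subr_ge0 (_ : _ - _ = (y - - z2) + z3); last by ring.
  by rewrite addr_ge0// subr_ge0.
apply: le_trans A2; rewrite ler_expR.
rewrite -subr_ge0 (_ : _ - _ = (z2 - y) + z3); last by ring.
by rewrite addr_ge0// subr_ge0.
Qed.

Definition joint_info := block_mx (J1 + schurC J2 RJ) RJ RJ^T J2.

Definition qJ (s1 : 'rV[R]_d1) (s2 : 'rV[R]_d2) :=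
  bil (row_mx s1 s2) joint_info (row_mx s1 s2).

Let c k : R := (Num.sqrt (n k))^-1.

(** The score term at the rescaled displacement. It stays unknown until [lin_small], and until then
    it is divided out of every limit. *)
Definition lin k (s1 : 'rV[R]_d1) := bil s1 1%:M (g k) * c k.

Definition ew k s1 s2 := e k (t1 k + c k *: s1) (t2 k + c k *: s2).

Lemma qJE s1 s2 : qJ s1 s2 =
  bil s1 (J1 + schurC J2 RJ) s1 + 2 * bil s1 RJ s2 + bil s2 J2 s2.
Proof.
by rewrite /qJ /joint_info bil_row_mx (bil_tr s2 RJ^T) trmxK; ring.
Qed.

Lemma qJ_square s1 s2 : qJ s1 s2 =
  bil s1 J1 s1 + bil (shift2 J2 RJ s1 s2) J2 (shift2 J2 RJ s1 s2).
Proof. by rewrite qJE -addrA complete_square// bilD; ring. Qed.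

Lemma n_gt0 : \forall k \near \oo, 0 < n k.
Proof. by apply: filterS (n_oo 1) => k; apply: lt_le_trans. Qed.

Lemma c_gt0 k : 0 < n k -> 0 < c k.
Proof. by move=> n0; rewrite invr_gt0 sqrtr_gt0. Qed.

Lemma c_sqr k : 0 < n k -> n k * (c k * c k) = 1.
Proof.
move=> n0; rewrite /c -invfM -expr2 sqr_sqrtr ?(ltW n0)// mulfV//.
by rewrite gt_eqF.
Qed.

Lemma c_small (r : R) : 0 < r -> \forall k \near \oo, c k <= r.
Proof.
move=> r0; have := n_oo (r^-1 ^+ 2); apply: filter_app; apply: filterS n_gt0 => k n0 H.
rewrite /c -[leRHS]invrK lef_pV2 ?posrE ?invr_gt0 ?sqrtr_gt0//.
rewrite -[leLHS]ger0_norm ?invr_ge0 ?(ltW r0)// -sqrtr_sqr ler_wsqrtr//.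
Qed.

Lemma scaled_small d (s : 'rV[R]_d) (r : R) : 0 < r ->
  \forall k \near \oo, `|c k *: s| <= r.
Proof.
move=> r0; have r1 : 0 < r / (`|s| + 1) by rewrite divr_gt0// ltr_wpDl.
have := c_small r1; apply: filter_app; apply: filterS n_gt0 => k n0 H.
rewrite normrZ gtr0_norm ?c_gt0// (le_trans (ler_wpM2r _ H))//.
rewrite mulrAC ler_pdivrMr ?ltr_wpDl// ler_wpM2l ?(ltW r0)//.
by rewrite lerDl.
Qed.

(** Under the rescaling the factors [n] disappear from the quadratic part and from its error. *)
Lemma ew_bounds (eta : R) : 0 < eta -> exists2 rho : R, 0 < rho &
  \forall k \near \oo, forall s1 s2, `|c k *: s1| <= rho -> `|c k *: s2| <= rho ->
    [/\ fin k (t1 k + c k *: s1),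
      ew k s1 s2 * expR (- lin k s1) <=
        expR (- qJ s1 s2 / 2 + eta * (`|s1| ^+ 2 + `|s2| ^+ 2)) &
      expR (- qJ s1 s2 / 2 - eta * (`|s1| ^+ 2 + `|s2| ^+ 2)) <=
        ew k s1 s2 * expR (- lin k s1)].
Proof.
move=> eta0; have [rho rho0 H] := quad_lim eta0; exists rho => //.
move: H; apply: filter_app; apply: filterS n_gt0 => k n0 H s1 s2 h1 h2.
have [fx A1 A2] := H _ _ h1 h2.
have cc := c_sqr n0; have c0 := c_gt0 n0.
have E1 : eta * n k * (`|c k *: s1| ^+ 2 + `|c k *: s2| ^+ 2) = eta * (`|s1| ^+ 2 + `|s2| ^+ 2).
  rewrite !normrZ gtr0_norm// -[RHS]mulr1 -cc; ring.
have E2 : expquad (fun=> J1 + schurC J2 RJ) k (c k *: s1) (c k *: s2) =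
    lin k s1 - qJ s1 s2 / 2.
  rewrite /expquad /lin (_ : qJ s1 s2 / 2 = n k * (c k * c k) * (qJ s1 s2 / 2)); last by rewrite cc mul1r.
  by rewrite qJE !(bilZl, bilZr); field.
rewrite E1 E2 in A1 A2; rewrite /ew; split => //.
  apply: le_trans (ler_wpM2r (expR_ge0 _) A1) _; rewrite -expRD.
  by rewrite le_eqVlt; apply/orP; left; apply/eqP; congr expR; ring.
apply: le_trans (ler_wpM2r (expR_ge0 _) A2); rewrite -expRD.
by rewrite le_eqVlt; apply/orP; left; apply/eqP; congr expR; ring.
Qed.

Lemma ew_cvg s1 s2 :
  (fun k => ew k s1 s2 * expR (- lin k s1)) @ \oo --> expR (- qJ s1 s2 / 2).
Proof.
apply: cvgr_near => eps eps0; set Q := - qJ s1 s2 / 2.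
have [d d0 Hd] : exists2 d : R, 0 < d & forall y, `|y| <= d -> `|expR (Q + y) - expR Q| <= eps.
  have /cvgrPdist_le/(_ eps eps0)/nbhs_ballP[d /= d0 Hd] := @continuous_expR R Q.
  exists (d / 2); first by rewrite divr_gt0.
  move=> y yd; rewrite distrC; apply: Hd; rewrite /ball/= opprD addrA subrr sub0r normrN.
  by apply: le_lt_trans yd _; rewrite ltr_pdivrMr// ltr_pMr// ltr1n.
pose D := `|s1| ^+ 2 + `|s2| ^+ 2; have D0 : 0 <= D by rewrite addr_ge0 ?sqr_ge0.
have D1 : 0 < D + 1 by rewrite ltr_wpDl.
have eta0 : 0 < d / (D + 1) by rewrite divr_gt0.
have [rho rho0 H] := ew_bounds eta0.
have etaD : d / (D + 1) * D <= d.
  by rewrite mulrAC ler_pdivrMr// ler_wpM2l ?(ltW d0)// lerDl.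
have etaD0 : 0 <= d / (D + 1) * D by rewrite mulr_ge0// ltW.
have := H; apply: filter_app; have := scaled_small s1 rho0; apply: filter_app.
apply: filterS (scaled_small s2 rho0) => k h2 h1 {}H.
have [_ A1 A2] := H _ _ h1 h2.
have B1 := Hd _ (le_trans (eq_ind_r (fun z => z <= _) (lexx _) (ger0_norm etaD0)) etaD).
have B2 := Hd (- (d / (D + 1) * D)).
rewrite normrN in B2; have {}B2 := B2 (le_trans (eq_ind_r (fun z => z <= _) (lexx _) (ger0_norm etaD0)) etaD).
move: A1 A2 B1 B2; rewrite -/Q -/D; move: (expR (Q + _)) (expR (Q - _)) (expR Q) (ew _ _ _ * _) => a b q x.
move=> A1 A2; rewrite !ler_norml => /andP[? ?] /andP[? ?]; apply/andP; split; lra.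
Qed.

Lemma prior_cvg d (p : 'rV[R]_d -> R) ps (t : nat -> 'rV[R]_d) s :
  (forall eps : R, 0 < eps -> exists2 r : R, 0 < r &
     forall x, `|x - ps| <= r -> `|p x - p ps| <= eps) ->
  (forall eps : R, 0 < eps -> \forall k \near \oo, `|t k - ps| <= eps) ->
  (fun k => p (t k + c k *: s)) @ \oo --> p ps.
Proof.
move=> pc tc; apply: cvgr_near => eps e0; have [r r0 H] := pc _ e0.
have r2 : 0 < r / 2 by rewrite divr_gt0.
have := tc _ r2; apply: filter_app; apply: filterS (scaled_small s r2) => k h1 h2.
apply: H; rewrite addrAC (le_trans (ler_normD _ _))// (splitr r); exact: lerD.
Qed.

Lemma prior_bound d (p : 'rV[R]_d -> R) ps (t : nat -> 'rV[R]_d) : 0 < p ps ->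
  (forall eps : R, 0 < eps -> exists2 r : R, 0 < r &
     forall x, `|x - ps| <= r -> `|p x - p ps| <= eps) ->
  (forall eps : R, 0 < eps -> \forall k \near \oo, `|t k - ps| <= eps) ->
  exists2 rho : R, 0 < rho & \forall k \near \oo, forall s,
    `|c k *: s| <= rho -> p (t k + c k *: s) <= 2 * p ps.
Proof.
move=> p0 pc tc; have [r r0 H] := pc _ p0.
have r2 : 0 < r / 2 by rewrite divr_gt0.
exists (r / 2) => //; apply: filterS (tc _ r2) => k h2 s h1.
have : `|p (t k + c k *: s) - p ps| <= p ps.
  apply: H; rewrite addrAC (le_trans (ler_normD _ _))// (splitr r); exact: lerD.
by rewrite ler_norml => /andP[_ ?]; lra.
Qed.

Lemma ew_dominated : exists rho lam : R, [/\ 0 < rho, 0 < lam &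
  \forall k \near \oo, forall s1 s2, `|c k *: s1| <= rho -> `|c k *: s2| <= rho ->
    [/\ ew k s1 s2 * expR (- lin k s1) <= expR (- (lam * `|row_mx s1 s2| ^+ 2)),
      p1 (t1 k + c k *: s1) <= 2 * p1 th1s & p2 (t2 k + c k *: s2) <= 2 * p2 th2s]].
Proof.
have [lam lam0 Hlam] := posdefmx_coercive (posdefmx_joint RJ pJ1 pJ2).
(* Half the quadratic form gives decay [lam / 2]; the two error terms cost [lam / 8] each, which
   leaves [lam / 4]. *)
have lam8 : 0 < lam / 8 by rewrite divr_gt0.
have [r1 r10 H1] := ew_bounds lam8.
have [r2 r20 H2] := prior_bound p1s p1_cont t1_cvg.
have [r3 r30 H3] := prior_bound p2s p2_cont t2_cvg.
exists (Num.min r1 (Num.min r2 r3)), (lam / 4).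
split; [by rewrite !lt_min r10 r20|by rewrite divr_gt0|].
have := H1; apply: filter_app; have := H2; apply: filter_app; apply: filterS H3 => k {}H3 {}H2 {}H1 s1 s2.
rewrite !le_min => /and3P[a1 a2 a3] /and3P[b1 b2 b3]; split; [|exact: H2|exact: H3].
have [_ A _] := H1 _ _ a1 b1; apply: le_trans A _; rewrite ler_expR.
have Q := Hlam (row_mx s1 s2); rewrite -/joint_info -/(qJ s1 s2) in Q.
have M1 : `|s1| ^+ 2 <= `|row_mx s1 s2| ^+ 2.
  by rewrite lerXn2r ?nnegrE// norm_row_mx le_max lexx.
have M2 : `|s2| ^+ 2 <= `|row_mx s1 s2| ^+ 2.
  by rewrite lerXn2r ?nnegrE// norm_row_mx le_max lexx orbT.
have := ler_wpM2l (ltW lam8) M1; have := ler_wpM2l (ltW lam8) M2.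
move: Q; move: (qJ s1 s2) (`|s1| ^+ 2) (`|s2| ^+ 2) (`|row_mx s1 s2| ^+ 2) => q a b m Q A B.
lra.
Qed.

Lemma measurable_scaled d (t : 'rV[R]_d) k (p : 'rV[R]_d -> R) : measurable_fun setT p ->
  measurable_fun setT (fun s : 'rV[R]_d => p (t + c k *: s)).
Proof. by move=> mp; exact: (measurableT_comp mp (measurable_rV_affine t (c k))). Qed.

Lemma measurable_ew_slice k s1 : measurable_fun setT (ew k s1).
Proof.
apply: (@measurable_scaled _ (t2 k) k (e k (t1 k + c k *: s1))).
exact: (measurableT_comp (me k) (measurable_pair1 _)).
Qed.

Lemma scaled_integral k s1 : 0 < n k ->
  ((c k ^+ d2)%:E * \int[lebesgue_rV d2]_s2 (ew k s1 s2 * p2 (t2 k + c k *: s2))%:E =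
   \int[lebesgue_rV d2]_t (e k (t1 k + c k *: s1) t * p2 t)%:E)%E.
Proof.
move=> n0; rewrite [RHS](ge0_integral_affine (t2 k) (c_gt0 n0))//.
  apply/measurable_EFinP/measurable_funM => //.
  exact: (measurableT_comp (me k) (measurable_pair1 _)).
by move=> t; rewrite lee_fin mulr_ge0.
Qed.

(** Restricted to the ball of the expansion, where a Gaussian dominates, and freed of the unknown
    linear factor, so that its limit in [k] is explicit. *)
Definition cutw (rho : R) k s1 s2 : R :=
  if `|c k *: s2| <= rho then ew k s1 s2 * expR (- lin k s1) * p2 (t2 k + c k *: s2) else 0.

Lemma measurable_cutw rho k s1 : measurable_fun setT (cutw rho k s1).
Proof.
apply: measurable_fun_ifT => //.
  apply: measurable_fun_ler => //.
  have H : measurable_fun setT (fun s : 'rV[R]_d2 => (0 : 'rV[R]_d2) + c k *: s).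
    exact: measurable_rV_affine.
  rewrite (_ : (fun _ => _) = (fun s : 'rV[R]_d2 => `|(0 : 'rV[R]_d2) + c k *: s|)).
    exact: (measurableT_comp (@measurable_mx_norm _ _) H).
  by apply/funext => s; rewrite add0r.
apply: measurable_funM; last exact: measurable_scaled.
by apply: measurable_funM => //; exact: measurable_ew_slice.
Qed.

Lemma ew_ge0 k s1 s2 : 0 <= ew k s1 s2. Proof. exact: e_ge0. Qed.

Lemma cutw_ge0 rho k s1 s2 : 0 <= cutw rho k s1 s2.
Proof. by rewrite /cutw; case: ifP => // _; rewrite !mulr_ge0 ?expR_ge0 ?ew_ge0. Qed.

Definition limw s1 s2 : R := expR (- qJ s1 s2 / 2) * p2 th2s.

Lemma measurable_limw s1 : measurable_fun setT (limw s1).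
Proof.
apply: measurable_funM => //; apply: measurableT_comp => //; apply: measurable_funM => //.
apply: measurableT_comp => //.
apply: (measurableT_comp (measurable_bil joint_info)).
exact: (measurableT_comp (@measurable_row_mx R d1 d2) (measurable_pair1 s1)).
Qed.

Lemma cutw_limw : exists2 rho : R, 0 < rho & forall s1 (eps : R), 0 < eps ->
  \forall k \near \oo,
    (\int[lebesgue_rV d2]_s2 (`|cutw rho k s1 s2 - limw s1 s2|)%:E <= eps%:E)%E.
Proof.
have [rho [lam [rho0 lam0 H]]] := ew_dominated; exists rho => // s1.
apply: (@dominated_near _ _ _ _ (fun k => cutw rho k s1) (limw s1) (fun s2 => 2 * p2 th2s * expR (- (lam * `|s2| ^+ 2)))).
- by move=> k; exact: measurable_cutw.
- exact: measurable_limw.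
- apply: measurable_funM => //; apply: measurableT_comp => //; apply: measurableT_comp => //.
  by apply: measurable_funM => //; apply: measurable_funX; exact: measurable_mx_norm.
- move=> s2; have C : (fun k => ew k s1 s2 * expR (- lin k s1) * p2 (t2 k + c k *: s2)) @ \oo --> limw s1 s2.
    by apply: cvgM; [exact: ew_cvg|exact: prior_cvg p2_cont t2_cvg].
  apply: cvgr_near => eps e0; have := near_cvgr C e0; apply: filter_app.
  by apply: filterS (scaled_small s2 rho0) => k hk; rewrite /cutw hk.
- rewrite ge0_integralZ_EFin.
  + by rewrite lte_mul_pinfty ?lee_fin ?mulr_ge0 ?ltW ?integral_expR_norm_lty.
  + by rewrite mulr_ge0// ltW.
  + apply: measurableT_comp => //; apply: measurableT_comp => //.
    by apply: measurable_funM => //; apply: measurable_funX; exact: measurable_mx_norm.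
  + by move=> x; exact: expR_ge0.
- by move=> x; rewrite mulr_ge0 ?expR_ge0// mulr_ge0// ltW.
have := H; apply: filter_app; apply: filterS (scaled_small s1 rho0) => k h1 {}H s2.
rewrite ger0_norm ?cutw_ge0// /cutw; case: ifPn => h2; last first.
  by rewrite mulr_ge0 ?expR_ge0// mulr_ge0// ltW.
have [A _ B] := H _ _ h1 h2; rewrite mulrC; apply: ler_pM => //.
  by rewrite mulr_ge0 ?expR_ge0 ?ew_ge0.
apply: le_trans A _; rewrite ler_expR lerN2 ler_wpM2l ?(ltW lam0)//.
by rewrite lerXn2r ?nnegrE// norm_row_mx le_max lexx orbT.
Qed.

Definition gauss2 : R := Num.sqrt ((2 * pi) ^+ d2 / \det J2).

Lemma gauss2_gt0 : 0 < gauss2.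
Proof.
have [d0 _] := integral_gauss pJ2.
by rewrite sqrtr_gt0 divr_gt0// exprn_gt0// mulr_gt0// pi_gt0.
Qed.

Lemma integral_limw s1 : (\int[lebesgue_rV d2]_s2 (limw s1 s2)%:E =
  (p2 th2s * gauss2 * expR (- bil s1 J1 s1 / 2))%:E)%E.
Proof.
pose m := s1 *m (RJ *m invmx J2).
have mh : measurable_fun setT (fun z => expR (- bil z J2 z / 2)).
  apply: measurableT_comp => //; apply: measurable_funM => //.
  by apply: measurableT_comp => //; exact: measurable_bil.
have [_ I] := integral_gauss pJ2.
have mhE : measurable_fun setT (fun z => (expR (- bil z J2 z / 2))%:E) by exact/measurable_EFinP.
have h0 z : (0 <= (expR (- bil z J2 z / 2))%:E)%E by rewrite lee_fin expR_ge0.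
rewrite (ge0_integral_affine m (@ltr01 R) mhE h0) expr1n mul1e in I.
rewrite (eq_integral (fun s2 : 'rV[R]_d2 => (p2 th2s * expR (- bil s1 J1 s1 / 2) *
   expR (- bil (m + 1 *: s2) J2 (m + 1 *: s2) / 2))%:E)); last first.
  move=> s2 _; rewrite /limw qJ_square /shift2 -/m scale1r (addrC m) opprD mulrDl expRD.
  by congr (_%:E); ring.
rewrite ge0_integralZ_EFin.
- by rewrite I -EFinM -/gauss2; congr (_%:E); ring.
- by rewrite mulr_ge0 ?expR_ge0// ltW.
- exact: (measurableT_comp mh (measurable_rV_affine m 1)).
- by move=> x; exact: expR_ge0.
Qed.

(** The full [theta_2] integral at a point of [Th1] is at most [i0], because [t1 k] maximises
    [l1]. *)
Lemma cutw_upper rho k s1 : 0 < n k -> Th1 (t1 k + c k *: s1) ->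
  ((c k ^+ d2)%:E * \int[lebesgue_rV d2]_s2 (cutw rho k s1 s2)%:E <=
   (expR (- lin k s1) * i0 k)%:E)%E.
Proof.
move=> n0 Tx; have cd0 : 0 < c k ^+ d2 by rewrite exprn_gt0// c_gt0.
apply: (@le_trans _ _ ((c k ^+ d2)%:E * ((expR (- lin k s1))%:E *
   \int[lebesgue_rV d2]_s2 (ew k s1 s2 * p2 (t2 k + c k *: s2))%:E))%E).
  rewrite lee_pmul2l ?fin_numE// ?lte_fin// -ge0_integralZ_EFin ?expR_ge0//.
  + apply: ge0_le_integral_EFin; first exact: measurable_cutw.
    * apply: measurable_funM => //; apply: measurable_funM; last exact: measurable_scaled.
      exact: measurable_ew_slice.
    * exact: cutw_ge0.
    move=> s2; rewrite /cutw mulrA (mulrC (expR _)); case: ifP => // _.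
    by rewrite !mulr_ge0 ?expR_ge0 ?ew_ge0.
  + by apply: measurable_funM; [exact: measurable_ew_slice|exact: measurable_scaled].
  + by move=> s2; rewrite mulr_ge0 ?ew_ge0.
rewrite muleCA scaled_integral// EFinM lee_pmul2l ?lte_fin ?expR_gt0//.
apply: le_trans (e_int_le _ _) _; rewrite lee_fin ler_piMl ?(ltW (i0_gt0 _))//.
by rewrite -[leRHS]expR0 ler_expR subr_le0; exact: max1.
Qed.

(** At [s1 = 0] the full integral is exactly [i0], and the mass beyond the cut-off is at most the
    fraction [tau] of it. *)
Lemma cutw_lower rho k (gam tau : R) : 0 < n k -> fin k (t1 k) ->
  (forall t, Th2 t -> rho <= `|t - t2 k| -> e k (t1 k) t <= expR (- gam * n k)) ->
  expR (- gam * n k) <= tau * i0 k ->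
  ((i0 k)%:E <= (c k ^+ d2)%:E * \int[lebesgue_rV d2]_s2 (cutw rho k 0 s2)%:E
    + (tau * i0 k)%:E)%E.
Proof.
move=> n0 fx Htail small; have cd0 : 0 < c k ^+ d2 by rewrite exprn_gt0// c_gt0.
have lin0 : lin k 0 = 0 by rewrite /lin bil0l mul0r.
set A0 := (\int[lebesgue_rV d2]_s2 (cutw rho k 0 s2)%:E)%E.
have := e_int fx; rewrite subrr expR0 mul1r => <-.
have E0 := scaled_integral 0 n0; rewrite scaler0 addr0 in E0.
rewrite -E0.
apply: (@le_trans _ _ ((c k ^+ d2)%:E * (A0 + (expR (- gam * n k))%:E *
    \int[lebesgue_rV d2]_s2 (p2 (t2 k + c k *: s2))%:E))%E).
  rewrite lee_pmul2l ?lte_fin// -ge0_integralZ_EFin ?expR_ge0//; last exact: measurable_scaled.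
  rewrite -ge0_integralD//=.
  + apply: ge0_le_integral_EFin.
    * by apply: measurable_funM; [exact: measurable_ew_slice|exact: measurable_scaled].
    * apply: measurable_funD; first exact: measurable_cutw.
      by apply: measurable_funM => //; exact: measurable_scaled.
    * by move=> s2; rewrite mulr_ge0 ?ew_ge0.
    move=> s2; rewrite /cutw; case: ifPn => hs.
      by rewrite lin0 oppr0 expR0 mulr1 lerDl mulr_ge0 ?expR_ge0.
    rewrite add0r; have [Tt2|nT] := pselect (Th2 (t2 k + c k *: s2)); last first.
      by rewrite p2_out// !mulr0.
    rewrite ler_wpM2r// /ew scaler0 addr0.
    apply: Htail => //; by rewrite addrC addKr ltW// ltNge.
  + by move=> s2 _; rewrite lee_fin cutw_ge0.
  + by apply/measurable_EFinP; exact: measurable_cutw.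
  + by move=> s2 _; rewrite lee_fin mulr_ge0 ?expR_ge0.
  + by apply/measurable_EFinP; apply: measurable_funM => //; exact: measurable_scaled.
rewrite muleDr//; last first.
  by rewrite ge0_adde_def// inE ?mule_ge0 ?lee_fin ?expR_ge0//; apply: integral_ge0 => s2 _; rewrite lee_fin// cutw_ge0.
apply: leeD2l; rewrite muleCA.
have <- : (\int[lebesgue_rV d2]_t (p2 t)%:E = (c k ^+ d2)%:E * \int[lebesgue_rV d2]_s2 (p2 (t2 k + c k *: s2))%:E)%E.
  rewrite (ge0_integral_affine (t2 k) (c_gt0 n0))//; exact/measurable_EFinP.
by rewrite p2_int mule1 lee_fin.
Qed.

(* As [t1 k] maximises [l1], the rescaled [theta_2] integral of [e] at [s1] is at
   most the one at [0]; the limits of both are Gaussian integrals. *)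
Lemma lin_upper s1 (eps : R) : 0 < eps ->
  \forall k \near \oo, lin k s1 <= bil s1 J1 s1 / 2 + eps.
Proof.
move=> eps0; have [rho rho0 Hlim] := cutw_limw.
have [rho' [gam [rho'0 gam0 Htail]]] := e_tail rho0.
pose r := expR (eps / 3).
have r1 : 1 < r by rewrite /r -[ltLHS]expR0 ltr_expR divr_gt0.
have r0 : 0 < r by exact: expR_gt0.
(* Then [1 + tau <= r] and [r^-1 <= 1 - tau]. The comparison loses two factors [1 - tau] and one
   factor [1 + tau], hence at most [r ^+ 3 = expR eps]. *)
pose tau := Num.min (r - 1) (1 - r^-1).
have tau0 : 0 < tau by rewrite lt_min !subr_gt0 r1 invf_lt1.
have tau1 : 1 + tau <= r by rewrite -lerBrDl /tau ge_min lexx.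
have tau2 : r^-1 <= 1 - tau by rewrite lerBrDr -lerBrDl /tau ge_min lexx orbT.
have tau3 : 0 < 1 - tau by apply: lt_le_trans tau2; rewrite invr_gt0.
pose w := expR (- bil s1 J1 s1 / 2).
have w0 : 0 < w by exact: expR_gt0.
pose C := p2 th2s * gauss2; have C0 : 0 < C by rewrite mulr_gt0// gauss2_gt0.
pose ee := tau * C * Num.min w 1.
have ee0 : 0 < ee by apply: mulr_gt0; [exact: mulr_gt0|rewrite lt_min w0 ltr01].
have e1 : ee <= tau * (C * w).
  rewrite /ee -mulrA; apply: ler_wpM2l; first exact: ltW.
  by apply: ler_wpM2l; [exact: ltW|rewrite ge_min lexx].
have e2 : ee <= tau * C.
  by apply: ler_piMr; [rewrite mulr_ge0 ?ltW|rewrite ge_min lexx orbT].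
have [rB rB0 HB] := ew_bounds ltr01.
have [rT rT0 HT] := Th1_int.
have rT2 : 0 < rT / 2 by rewrite divr_gt0.
have gam2 : 0 < gam / 2 by rewrite divr_gt0.
have small : \forall k \near \oo, expR (- gam * n k) <= tau * i0 k.
  have := i0_lower gam2; apply: filter_app.
  have := n_oo (- ln tau / (gam / 2)); apply: filterS => k nk Hi.
  have -> : - gam * n k = - (gam / 2) * n k + - (gam / 2) * n k by field.
  rewrite expRD; apply: ler_pM; rewrite ?expR_ge0//.
  rewrite -[leRHS]lnK ?posrE// ler_expR mulNr lerNl mulrC -ler_pdivrMr//.
have h1 := Hlim s1 _ ee0; have h2 := Hlim 0 _ ee0.
have := h1; apply: filter_app; have := h2; apply: filter_app.
have := small; apply: filter_app; have := Htail; apply: filter_app.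
have := HB; apply: filter_app; have := t1_cvg rT2; apply: filter_app.
have := scaled_small s1 rT2; apply: filter_app; have := scaled_small s1 rB0; apply: filter_app.
apply: filterS n_gt0 => k n0 sB sT tT {}HB {}Htail {}small {}h2 {}h1.
have Tx : Th1 (t1 k + c k *: s1).
  by apply: HT; rewrite addrAC (le_trans (ler_normD _ _))// (splitr rT) lerD.
have Tt : Th1 (t1 k) by apply: HT; apply: le_trans tT _; rewrite ler_pdivrMr// ler_peMr ?(ltW rT0)// ler1n.
have cd0 : 0 < c k ^+ d2 by rewrite exprn_gt0// c_gt0.
set A1 := (\int[lebesgue_rV d2]_s2 (cutw rho k s1 s2)%:E)%E.
set A0 := (\int[lebesgue_rV d2]_s2 (cutw rho k 0 s2)%:E)%E.
have lin0 : lin k 0 = 0 by rewrite /lin bil0l mul0r.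
have low1 : ((C * w - ee)%:E <= A1)%E.
  have := integral_le_dist (lebesgue_rV d2) (measurable_limw s1) (measurable_cutw rho k s1)
    (fun s2 => mulr_ge0 (expR_ge0 _) (p2_ge0 _)) (cutw_ge0 rho k s1).
  rewrite integral_limw -/C -/w -/A1 => H; rewrite EFinB leeBlDr//.
  apply: le_trans H _; apply: leeD2l; apply: le_trans h1.
  by rewrite (eq_integral (fun s2 => (`|cutw rho k s1 s2 - limw s1 s2|)%:E))// => x _; rewrite distrC.
have up0 : (A0 <= (C + ee)%:E)%E.
  have := integral_le_dist (lebesgue_rV d2) (measurable_cutw rho k 0) (measurable_limw 0)
    (cutw_ge0 rho k 0) (fun s2 => mulr_ge0 (expR_ge0 _) (p2_ge0 _)).
  rewrite integral_limw bil0l oppr0 mul0r expR0 mulr1 -/C -/A0 => H.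
  apply: le_trans H _; rewrite EFinD; apply: leeD2l; exact: h2.
have up1 := cutw_upper rho n0 Tx; rewrite -/A1 in up1.
have low0 : ((i0 k)%:E <= (c k ^+ d2)%:E * A0 + (tau * i0 k)%:E)%E.
  apply: (@cutw_lower rho k gam tau n0 _ _ small).
    have h00 : `|c k *: (0 : 'rV[R]_d1)| <= rB by rewrite scaler0 normr0 ltW.
    have h01 : `|c k *: (0 : 'rV[R]_d2)| <= rB by rewrite scaler0 normr0 ltW.
    by have [+ _ _] := HB _ _ h00 h01; rewrite scaler0 addr0.
  move=> t Tt2 ht; have := Htail (t1 k) t Tt Tt2.
  by rewrite !subrr normr0 expR0 mulr1 => /(_ rho'0 ht).
have f1 : c k ^+ d2 * (C * w - ee) <= expR (- lin k s1) * i0 k.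
  rewrite -lee_fin; apply: le_trans up1; rewrite EFinM lee_pmul2l ?lte_fin//.
have f0 : i0 k <= c k ^+ d2 * (C + ee) + tau * i0 k.
  rewrite -lee_fin; apply: le_trans low0 _; rewrite EFinD; apply: leeD2r.
  by rewrite EFinM lee_pmul2l ?lte_fin//.
have {}f0 : (1 - tau) * i0 k <= c k ^+ d2 * (1 + tau) * C.
  have : c k ^+ d2 * ee <= c k ^+ d2 * (tau * C) by rewrite ler_wpM2l ?(ltW cd0).
  move: f0; rewrite mulrBl mul1r mulrDr mulrDr mulr1 mulrDl -(mulrA _ tau).
  move: (c k ^+ d2 * ee) (c k ^+ d2 * (tau * C)) (c k ^+ d2 * C) (tau * i0 k) (i0 k) => ? ? ? ? ?; lra.
have {}f1 : c k ^+ d2 * (1 - tau) * (C * w) <= expR (- lin k s1) * i0 k.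
  apply: le_trans f1; rewrite -mulrA ler_wpM2l ?(ltW cd0)// mulrBl mul1r.
  by rewrite lerD2l lerN2.
have fin1 : (1 - tau) ^+ 2 * w <= expR (- lin k s1) * (1 + tau).
  rewrite -(ler_pM2l (mulr_gt0 cd0 C0)).
  apply: (@le_trans _ _ ((1 - tau) * (expR (- lin k s1) * i0 k))).
    apply: le_trans (ler_wpM2l (ltW tau3) f1); rewrite le_eqVlt; apply/orP; left; apply/eqP; ring.
  apply: le_trans (_ : expR (- lin k s1) * ((1 - tau) * i0 k) <= _).
    by rewrite mulrCA.
  apply: le_trans (ler_wpM2l (expR_ge0 _) f0) _.
  by rewrite le_eqVlt; apply/orP; left; apply/eqP; ring.
have : r^-1 ^+ 2 * w <= expR (- lin k s1) * r.
  apply: (@le_trans _ _ ((1 - tau) ^+ 2 * w)).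
    by rewrite ler_wpM2r ?(ltW w0)// lerXn2r ?nnegrE ?invr_ge0 ?(ltW r0) ?(ltW tau3).
  by apply: le_trans fin1 _; rewrite ler_wpM2l ?expR_ge0.
rewrite /r -expRN -expRM_natl -!expRD ler_expR.
move: (lin k s1) (bil s1 J1 s1) => x y; lra.
Qed.

(** [lin] is linear in [s1] while the bound of [lin_upper] is quadratic: evaluated at plus and minus
    [tau] times a basis vector and divided by [tau], it bounds each coefficient by a multiple of
    [tau]. *)
Lemma lin_small (eta : R) : 0 < eta ->
  \forall k \near \oo, forall s1, `|lin k s1| <= eta * `|s1|.
Proof.
move=> eta0; pose eta' := eta / (d1%:R + 1).
have D0 : 0 < d1%:R + 1 :> R by rewrite ltr_wpDl.
have eta'0 : 0 < eta' by rewrite divr_gt0.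
pose tau := eta' / (`|J1| + 1).
have J0 : 0 < `|J1| + 1 by rewrite ltr_wpDl.
have tau0 : 0 < tau by rewrite divr_gt0.
have tau2 : 0 < tau ^+ 2 by rewrite exprn_gt0.
have linZ k a s : lin k (a *: s) = a * lin k s by rewrite /lin bilZl mulrA.
have H : \forall k \near \oo, forall i : 'I_d1, `|lin k (delta_mx ord0 i)| <= eta'.
  apply: filter_forall => i.
  have := lin_upper (tau *: delta_mx ord0 i) tau2; apply: filter_app.
  apply: filterS (lin_upper (- tau *: delta_mx ord0 i) tau2) => k.
  have Jb : tau * (J1 i i / 2 + 1) <= eta'.
    have := ler_mx_entry J1 i i; rewrite ler_norml => /andP[_ Ji].
    rewrite /tau mulrAC ler_pdivrMr// ler_wpM2l ?(ltW eta'0)//.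
    by have := normr_ge0 J1; move: (`|J1|) (J1 i i) Ji => a b; lra.
  have E a : a ^+ 2 = tau ^+ 2 -> bil (a *: delta_mx ord0 i) J1 (a *: delta_mx ord0 i) / 2 + tau ^+ 2
      = tau * (tau * (J1 i i / 2 + 1)).
    move=> a2; rewrite bilZl bilZr bil_delta mulrA -expr2 a2.
    by move: (J1 i i) => b; field.
  rewrite !E ?sqrrN// !linZ => A B.
  rewrite ler_norml lerNl; apply/andP; split; apply: le_trans Jb.
    by rewrite -(ler_pM2l tau0) mulrN -mulNr.
  by rewrite -(ler_pM2l tau0).
apply: filterS H => k H s1.
have -> : lin k s1 = \sum_i s1 ord0 i * lin k (delta_mx ord0 i).
  rewrite /lin; under [RHS]eq_bigr do rewrite mulrA -bilZl.
  rewrite -mulr_suml; congr (_ * _).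
  rewrite {1}(row_sum_delta s1).
  by elim/big_rec2 : _ => [|i y x _ IH]; rewrite ?bil0l// bilDl IH.
apply: le_trans (ler_norm_sum _ _ _) _.
apply: (@le_trans _ _ (\sum_(i < d1) `|s1| * eta')).
  by apply: ler_sum => i _; rewrite normrM; apply: ler_pM => //; exact: ler_mx_entry.
rewrite sumr_const card_ord -mulr_natl /eta'.
rewrite (_ : d1%:R * (`|s1| * (eta / (d1%:R + 1))) = eta * `|s1| * (d1%:R / (d1%:R + 1))); last by ring.
by rewrite ler_piMr ?mulr_ge0 ?(ltW eta0)// ler_pdivrMr// mul1r lerDl.
Qed.

Definition dens k (th : 'rV[R]_(d1 + d2)) : R :=
  e k (lsubmx th) (rsubmx th) * p1 (lsubmx th) * p2 (rsubmx th).

Definition sdens k s := dens k (row_mx (t1 k) (t2 k) + c k *: s).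

Definition glim (s : 'rV[R]_(d1 + d2)) : R :=
  expR (- bil s joint_info s / 2) * (p1 th1s * p2 th2s).

Lemma sdensE k s : sdens k s = ew k (lsubmx s) (rsubmx s) *
  p1 (t1 k + c k *: lsubmx s) * p2 (t2 k + c k *: rsubmx s).
Proof.
by rewrite /sdens /dens !linearD/= !linearZ/= row_mxKl row_mxKr.
Qed.

Lemma dens_ge0 k th : 0 <= dens k th.
Proof. by rewrite /dens !mulr_ge0. Qed.

Lemma measurable_dens k : measurable_fun setT (dens k).
Proof.
have mr := @measurable_rsubmx R d1 d2; have ml := @measurable_lsubmx R d1 d2.
apply: measurable_funM; last exact: (measurableT_comp mp2 mr).
apply: measurable_funM; last exact: (measurableT_comp mp1 ml).
exact: (measurableT_comp (me k) (measurable_fun_pair ml mr)).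
Qed.

Lemma measurable_sdens k : measurable_fun setT (sdens k).
Proof. by apply: measurable_scaled; exact: measurable_dens. Qed.

Lemma sdens_ge0 k s : 0 <= sdens k s. Proof. exact: dens_ge0. Qed.

Lemma measurable_glim : measurable_fun setT glim.
Proof.
apply: measurable_funM => //; apply: measurableT_comp => //; apply: measurable_funM => //.
by apply: measurableT_comp => //; exact: measurable_bil.
Qed.

Lemma glim_ge0 s : 0 <= glim s.
Proof. by rewrite mulr_ge0 ?expR_ge0// mulr_ge0// ltW. Qed.

Lemma measurable_scaled_norm d k (rho : R) :
  measurable_fun setT (fun s : 'rV[R]_d => `|c k *: s| <= rho).
Proof.
apply: measurable_fun_ler => //.
have H : measurable_fun setT (fun s : 'rV[R]_d => (0 : 'rV[R]_d) + c k *: s).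
  exact: measurable_rV_affine.
rewrite (_ : (fun _ => _) = (fun s : 'rV[R]_d => `|(0 : 'rV[R]_d) + c k *: s|)).
  exact: (measurableT_comp (@measurable_mx_norm _ _) H).
by apply/funext => s; rewrite add0r.
Qed.

Definition cutd (rho : R) k s : R := if `|c k *: s| <= rho then sdens k s else 0.

Lemma measurable_cutd rho k : measurable_fun setT (cutd rho k).
Proof.
apply: measurable_fun_ifT => //; first exact: measurable_scaled_norm.
exact: measurable_sdens.
Qed.

Lemma norm_lsubmx_le d d' (s : 'rV[R]_(d + d')) : `|lsubmx s| <= `|s|.
Proof. by rewrite -[in leRHS](hsubmxK s) norm_row_mx le_max lexx. Qed.

Lemma norm_rsubmx_le d d' (s : 'rV[R]_(d + d')) : `|rsubmx s| <= `|s|.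
Proof. by rewrite -[in leRHS](hsubmxK s) norm_row_mx le_max lexx orbT. Qed.

Lemma cutd_glim : exists2 rho : R, 0 < rho & forall eps : R, 0 < eps ->
  \forall k \near \oo,
    (\int[lebesgue_rV (d1 + d2)]_s (`|cutd rho k s - glim s|)%:E <= eps%:E)%E.
Proof.
have [rho [lam [rho0 lam0 H]]] := ew_dominated; exists rho => //.
(* With this [eta] one has [eta * x <= 1 + lam / 2 * x ^+ 2] for [x >= 0], so half of the Gaussian
   decay absorbs the linear term. *)
pose eta := Num.min 1 (lam / 2).
have eta0 : 0 < eta by rewrite lt_min ltr01 divr_gt0.
(* Each prior is at most twice its value at the limit point, and [expR 1] is what remains of the
   linear term. *)
pose C := 4 * (p1 th1s * p2 th2s) * expR 1.
have C0 : 0 < C by rewrite !mulr_gt0// expR_gt0.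
have lam2 : 0 < lam / 2 by rewrite divr_gt0.
have mG : measurable_fun setT (fun s : 'rV[R]_(d1 + d2) => expR (- (lam / 2 * `|s| ^+ 2))).
  apply: measurableT_comp => //; apply: measurableT_comp => //.
  by apply: measurable_funM => //; apply: measurable_funX; exact: measurable_mx_norm.
apply: (@dominated_near _ _ _ _ (cutd rho) glim (fun s => C * expR (- (lam / 2 * `|s| ^+ 2)))).
- by move=> k; exact: measurable_cutd.
- exact: measurable_glim.
- exact: measurable_funM.
- move=> s; set s1 := lsubmx s; set s2 := rsubmx s.
  have Cl : (fun k => expR (lin k s1)) @ \oo --> (1 : R).
    rewrite -[X in _ --> X]expR0; apply: continuous_cvg; first exact: continuous_expR.
    apply: cvgr_near => eps e0; have e1 : 0 < eps / (`|s1| + 1) by rewrite divr_gt0// ltr_wpDl.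
    apply: filterS (lin_small e1) => k /(_ s1) L; rewrite subr0; apply: le_trans L _.
    by rewrite mulrAC ler_pdivrMr ?ltr_wpDl// ler_wpM2l ?(ltW e0)// lerDl.
  have C1 : (fun k => ew k s1 s2 * expR (- lin k s1) * expR (lin k s1) * p1 (t1 k + c k *: s1)
       * p2 (t2 k + c k *: s2)) @ \oo --> expR (- qJ s1 s2 / 2) * 1 * p1 th1s * p2 th2s.
    apply: cvgM; last exact: prior_cvg p2_cont t2_cvg.
    apply: cvgM; last exact: prior_cvg p1_cont t1_cvg.
    by apply: cvgM => //; exact: ew_cvg.
  have E2 : glim s = expR (- qJ s1 s2 / 2) * 1 * p1 th1s * p2 th2s.
    by rewrite /glim /qJ hsubmxK mulr1 mulrA.
  rewrite E2; apply: cvgr_near => eps e0; have := near_cvgr C1 e0; apply: filter_app.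
  apply: filterS (scaled_small s rho0) => k hk.
  by rewrite /cutd hk sdensE -(mulrA (ew _ _ _)) -expRD addNr expR0 mulr1.
- rewrite ge0_integralZ_EFin.
  + by rewrite lte_mul_pinfty ?lee_fin ?(ltW C0)// integral_expR_norm_lty.
  + exact: ltW.
  + exact: mG.
  + by move=> x; exact: expR_ge0.
- by move=> x; rewrite mulr_ge0 ?expR_ge0// ltW.
have := H; apply: filter_app; apply: filterS (lin_small eta0) => k L {}H s.
rewrite ger0_norm /cutd; last by case: ifP => // _; exact: sdens_ge0.
case: ifPn => hs; last by rewrite mulr_ge0 ?expR_ge0// ltW.
have h1 : `|c k *: lsubmx s| <= rho.
  by apply: le_trans hs; rewrite -linearZ/=; exact: norm_lsubmx_le.
have h2 : `|c k *: rsubmx s| <= rho.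
  by apply: le_trans hs; rewrite -linearZ/=; exact: norm_rsubmx_le.
have [A B1 B2] := H _ _ h1 h2; rewrite hsubmxK in A.
rewrite sdensE.
have E1 : ew k (lsubmx s) (rsubmx s) <= expR 1 * expR (- (lam / 2 * `|s| ^+ 2)).
  have -> : ew k (lsubmx s) (rsubmx s) = ew k (lsubmx s) (rsubmx s) * expR (- lin k (lsubmx s)) * expR (lin k (lsubmx s)).
    by rewrite -mulrA -expRD addNr expR0 mulr1.
  apply: le_trans (ler_wpM2r (expR_ge0 _) A) _; rewrite -!expRD ler_expR.
  have L1 : lin k (lsubmx s) <= eta * `|s|.
    apply: le_trans (le_trans (ler_norm _) (L _)) _.
    by apply: ler_wpM2l; [exact: ltW|exact: norm_lsubmx_le].
  have L2 : eta * `|s| <= 1 + lam / 2 * `|s| ^+ 2.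
    have [s1|s1] := leP `|s| 1.
      apply: ler_wpDr; first by rewrite mulr_ge0 ?(ltW lam2)// sqr_ge0.
      by rewrite (le_trans (ler_wpM2l (ltW eta0) s1))// mulr1 /eta ge_min lexx.
    apply: ler_wpDl => //; rewrite expr2; apply: ler_pM => //; first exact: ltW.
      by rewrite /eta ge_min lexx orbT.
    by rewrite ler_peMl// ltW.
  have := le_trans L1 L2; move: (lin _ _) (`|s| ^+ 2) => a b; lra.
have E2 : ew k (lsubmx s) (rsubmx s) * p1 (t1 k + c k *: lsubmx s) * p2 (t2 k + c k *: rsubmx s)
  <= expR 1 * expR (- (lam / 2 * `|s| ^+ 2)) * (2 * p1 th1s) * (2 * p2 th2s).
  apply: ler_pM => //; first by rewrite mulr_ge0// ew_ge0.
  by apply: ler_pM => //; exact: ew_ge0.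
by apply: le_trans E2 _; rewrite le_eqVlt; apply/orP; left; apply/eqP; rewrite /C; ring.
Qed.

Definition taild (rho : R) k (th : 'rV[R]_(d1 + d2)) : R :=
  if `|th - row_mx (t1 k) (t2 k)| <= rho then 0 else dens k th.

Lemma taild_ge0 rho k th : 0 <= taild rho k th.
Proof. by rewrite /taild; case: ifP => // _; exact: dens_ge0. Qed.

Lemma measurable_taild rho k : measurable_fun setT (taild rho k).
Proof.
apply: measurable_fun_ifT => //; last exact: measurable_dens.
apply: measurable_fun_ler => //.
have H : measurable_fun setT (fun s : 'rV[R]_(d1 + d2) => - row_mx (t1 k) (t2 k) + 1 *: s).
  exact: measurable_rV_affine.
rewrite (_ : (fun _ => _) = (fun s : 'rV[R]_(d1 + d2) => `|- row_mx (t1 k) (t2 k) + 1 *: s|)).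
  exact: (measurableT_comp (@measurable_mx_norm _ _) H).
by apply/funext => s; rewrite scale1r addrC.
Qed.

(** If [theta_1] is far, its [theta_2] integral is at most [exp (L1 - L1 theta_hat_1)], which [sep1]
    makes small. If [theta_1] is near, [theta_2] must be far and [e_tail] bounds the density
    itself. *)
Lemma taild_decay (rho : R) : 0 < rho -> exists2 gam : R, 0 < gam & \forall k \near \oo,
  (\int[lebesgue_rV (d1 + d2)]_th (taild rho k th)%:E <= (expR (- gam * n k))%:E)%E.
Proof.
move=> rho0; have [rho' [gam2 [rho'0 gam20 Htail]]] := e_tail rho0.
have rr : 0 < Num.min rho rho' by rewrite lt_min rho0.
have [gam1 gam10 Hsep] := sep1 rr.
exists (Num.min gam1 gam2); first by rewrite lt_min gam10.
have := Htail; apply: filter_app; have := Hsep; apply: filter_app.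
apply: filterS n_gt0 => k n0 {}Hsep {}Htail; set E := expR _.
have E1 : expR (- gam1 * n k) <= E.
  by rewrite /E ler_expR !mulNr lerN2 ler_wpM2r ?(ltW n0)// ge_min lexx.
have E2 : expR (- gam2 * n k) <= E.
  by rewrite /E ler_expR !mulNr lerN2 ler_wpM2r ?(ltW n0)// ge_min lexx orbT.
have mt : measurable_fun setT (fun z : 'rV[R]_d1 * 'rV[R]_d2 => (taild rho k (row_mx z.1 z.2))%:E).
  by apply/measurable_EFinP; exact: (measurableT_comp (@measurable_taild rho k) (@measurable_row_mx _ _ _)).
rewrite ge0_integral_row_mx; last 2 first.
- by apply/measurable_EFinP; exact: measurable_taild.
- by move=> th; rewrite lee_fin taild_ge0.
rewrite -[leRHS]mule1 -p1_int -ge0_integralZ_EFin ?expR_ge0//.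
apply: ge0_le_integral => //.
- by move=> x _; apply: integral_ge0 => t _; rewrite lee_fin taild_ge0.
- apply: (measurable_fun_fubini_tonelli_F (m2 := lebesgue_rV d2) _ mt).
  by move=> z; rewrite lee_fin taild_ge0.
- by apply/measurable_EFinP; exact: measurable_funM.
move=> x _.
have [Tx|nTx] := pselect (Th1 x); last first.
  rewrite integral0_eq ?p1_out ?mulr0// => t _.
  by rewrite /taild /dens row_mxKl p1_out// mulr0 mul0r if_same.
have mex : measurable_fun setT (fun t => e k x t * p2 t).
  by apply: measurable_funM => //; exact: (measurableT_comp (me k) (measurable_pair1 x)).
have mtx : measurable_fun setT (fun t => taild rho k (row_mx x t)).
  exact: (measurableT_comp (measurableT_comp (@measurable_taild rho k) (@measurable_row_mx _ _ _)) (measurable_pair1 x)).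
have i01 := i0_le1 k.
have l10 : expR (l1 k x - l1 k (t1 k)) <= 1.
  by rewrite -[leRHS]expR0 ler_expR subr_le0; exact: max1.
have [far|close] := leP (Num.min rho rho') `|x - t1 k|.
  apply: (@le_trans _ _ (\int[lebesgue_rV d2]_t (p1 x * (e k x t * p2 t))%:E)%E).
    apply: ge0_le_integral_EFin => //; first exact: measurable_funM.
      by move=> t; exact: taild_ge0.
    move=> t; rewrite /taild /dens row_mxKl row_mxKr; case: ifP => _.
      by rewrite !mulr_ge0.
    by rewrite le_eqVlt; apply/orP; left; apply/eqP; ring.
  rewrite ge0_integralZ_EFin// => [|t]; last by rewrite mulr_ge0.
  apply: (@le_trans _ _ ((p1 x)%:E * (expR (l1 k x - l1 k (t1 k)) * i0 k)%:E)%E).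
    by apply: lee_wpmul2l; rewrite ?lee_fin//; exact: e_int_le.
  rewrite -EFinM lee_fin mulrC ler_wpM2r//.
  apply: (@le_trans _ _ (expR (l1 k x - l1 k (t1 k)) * 1)).
    by apply: ler_wpM2l => //; exact: expR_ge0.
  rewrite mulr1; apply: le_trans E1; rewrite ler_expR; exact: Hsep.
apply: (@le_trans _ _ (\int[lebesgue_rV d2]_t (E * p1 x * p2 t)%:E)%E); last first.
  rewrite ge0_integralZ_EFin ?p2_int ?mule1//.
  by rewrite mulr_ge0 ?expR_ge0.
apply: ge0_le_integral_EFin => //; first exact: measurable_funM.
  by move=> t; exact: taild_ge0.
move=> t; rewrite /taild /dens row_mxKl row_mxKr norm_row_mxB ge_max.
move: close; rewrite lt_min => /andP[cl1 cl2]; rewrite (ltW cl1)/=.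
case: (leP `|t - t2 k| rho) => far; first by rewrite !mulr_ge0 ?expR_ge0.
have [Tt|nTt] := pselect (Th2 t); last by rewrite p2_out// !mulr0.
rewrite ler_wpM2r// ler_wpM2r//.
apply: le_trans (Htail x t Tx Tt cl2 (ltW far)) _.
apply: le_trans E2; rewrite ler_piMr ?expR_ge0//.
Qed.

(** Inside the ball this is [cutd_glim]. Outside, the rescaling multiplies the tail by
    [n^((d1 + d2) / 2)], which its exponential decay outweighs. *)
Lemma sdens_glim (eps : R) : 0 < eps -> \forall k \near \oo,
  (\int[lebesgue_rV (d1 + d2)]_s (`|sdens k s - glim s|)%:E <= eps%:E)%E.
Proof.
move=> eps0; have [rho rho0 H] := cutd_glim.
have eps2 : 0 < eps / 2 by rewrite divr_gt0.
have [gam gam0 Htail] := taild_decay rho0.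
have := H _ eps2; apply: filter_app; have := Htail; apply: filter_app.
have := expR_decay (d1 + d2) gam0 eps2 n_oo; apply: filter_app.
apply: filterS n_gt0 => k n0 small {}Htail {}H.
have c0 := c_gt0 n0.
have cd0 : 0 < c k ^+ (d1 + d2) by rewrite exprn_gt0.
have mts : measurable_fun setT (fun s : 'rV[R]_(d1 + d2) => taild rho k (row_mx (t1 k) (t2 k) + c k *: s)).
  by apply: measurable_scaled; exact: measurable_taild.
have T2 : (\int[lebesgue_rV (d1 + d2)]_s (taild rho k (row_mx (t1 k) (t2 k) + c k *: s))%:E <= (eps / 2)%:E)%E.
  rewrite -(@lee_pmul2l _ (c k ^+ (d1 + d2))%:E)// ?lte_fin//.
  have -> : ((c k ^+ (d1 + d2))%:E *
      \int[lebesgue_rV (d1 + d2)]_s (taild rho k (row_mx (t1 k) (t2 k) + c k *: s))%:E =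
      \int[lebesgue_rV (d1 + d2)]_th (taild rho k th)%:E)%E.
    rewrite [RHS](ge0_integral_affine (row_mx (t1 k) (t2 k)) c0)//.
      by apply/measurable_EFinP; exact: measurable_taild.
    by move=> th; rewrite lee_fin taild_ge0.
  apply: le_trans Htail _; rewrite -EFinM lee_fin.
  apply: le_trans (ler_wpM2l (ltW cd0) small); rewrite mulrA -exprMn mulVf ?expr1n ?mul1r//.
  by rewrite gt_eqF// sqrtr_gt0.
apply: (@le_trans _ _ (\int[lebesgue_rV (d1 + d2)]_s
   (`|cutd rho k s - glim s| + taild rho k (row_mx (t1 k) (t2 k) + c k *: s))%:E)%E).
  apply: ge0_le_integral_EFin.
  - by apply: measurableT_comp => //; apply: measurable_funB; [exact: measurable_sdens|exact: measurable_glim].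
  - apply: measurable_funD => //; apply: measurableT_comp => //.
    by apply: measurable_funB; [exact: measurable_cutd|exact: measurable_glim].
  - by move=> s; exact: normr_ge0.
  move=> s; rewrite /cutd /taild addrAC subrr add0r -/(sdens k s).
  case: ifP => _; first by rewrite addr0.
  rewrite sub0r normrN (ger0_norm (glim_ge0 s)) (le_trans (ler_normB _ _))//.
  by rewrite (ger0_norm (sdens_ge0 k s)) (ger0_norm (glim_ge0 s)) addrC.
under eq_integral do rewrite EFinD.
rewrite ge0_integralD//=.
- by rewrite (splitr eps) EFinD; exact: leeD.
- apply/measurable_EFinP; apply: measurableT_comp => //.
  by apply: measurable_funB; [exact: measurable_cutd|exact: measurable_glim].
- by move=> s _; rewrite lee_fin taild_ge0.
- exact/measurable_EFinP.
Qed.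

End laplace.

(** * The Laplace argument for the relative cut density *)

Section core.
Context {R : realType} {d1 d2 : nat}.
Variables (Th1 : set 'rV[R]_d1) (Th2 : set 'rV[R]_d2).
Variables (p1 : 'rV[R]_d1 -> R) (p2 : 'rV[R]_d2 -> R).
Variables (th1s : 'rV[R]_d1) (th2s : 'rV[R]_d2).
Variables (N : nat -> nat) (l1 : nat -> 'rV[R]_d1 -> R)
  (l2 : nat -> 'rV[R]_(d1 + d2) -> R).
Variables (t1 : nat -> 'rV[R]_d1) (t2 : nat -> 'rV[R]_d2).
Variables (J1 : 'M[R]_d1) (J2 : 'M[R]_d2) (RJ : 'M[R]_(d1, d2)).
Variables (g : nat -> 'rV[R]_d1) (B : nat -> 'M[R]_d1).

Let n k : R := (N k)%:R.
Let that k := row_mx (t1 k) (t2 k).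
Let ths := row_mx th1s th2s.
Let mg k := marg p2 (l2 k).
Let mr k := margr p2 (l2 k).
Let e k := reldens p2 (l1 k) (l2 k) (t1 k) (t2 k).
Let i0 k := reldens0 p2 (l2 k) (t1 k) (t2 k).

Definition quad_approx (b : nat -> 'M[R]_d1) := forall eta : R, 0 < eta ->
  exists2 rho : R, 0 < rho & \forall k \near \oo, forall u1 u2,
    `|u1| <= rho -> `|u2| <= rho ->
    mg k (t1 k + u1) \is a fin_num /\
    `|l1 k (t1 k + u1) - l1 k (t1 k) + l2 k (row_mx (t1 k + u1) (t2 k + u2))
      - l2 k (that k) + ln (mr k (t1 k)) - ln (mr k (t1 k + u1))
      - bil u1 1%:M (g k)
      + n k / 2 * (bil u1 (b k) u1 + 2 * bil u1 RJ u2 + bil u2 J2 u2)|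
    <= eta * n k * (`|u1| ^+ 2 + `|u2| ^+ 2).

Hypothesis mp1 : measurable_fun setT p1.
Hypothesis p1_ge0 : forall t, 0 <= p1 t.
Hypothesis p1_out : forall t, ~ Th1 t -> p1 t = 0.
Hypothesis p1_int : (\int[lebesgue_rV d1]_t (p1 t)%:E = 1)%E.
Hypothesis mp2 : measurable_fun setT p2.
Hypothesis p2_ge0 : forall t, 0 <= p2 t.
Hypothesis p2_out : forall t, ~ Th2 t -> p2 t = 0.
Hypothesis p2_int : (\int[lebesgue_rV d2]_t (p2 t)%:E = 1)%E.
Hypothesis ml1 : forall k, measurable_fun setT (l1 k).
Hypothesis ml2 : forall k, measurable_fun setT (l2 k).
Hypothesis max1 : forall k x, Th1 x -> l1 k x <= l1 k (t1 k).
Hypothesis max2 : forall k t, Th2 t ->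
  l2 k (row_mx (t1 k) t) <= l2 k (row_mx (t1 k) (t2 k)).
Hypothesis N_oo : forall A : R, \forall k \near \oo, A <= n k.
Hypothesis t1_cvg : forall eps : R, 0 < eps -> \forall k \near \oo, `|t1 k - th1s| <= eps.
Hypothesis t2_cvg : forall eps : R, 0 < eps -> \forall k \near \oo, `|t2 k - th2s| <= eps.
Hypothesis Th1_int : exists2 r : R, 0 < r & forall x, `|x - th1s| <= r -> Th1 x.
Hypothesis p1s : 0 < p1 th1s.
Hypothesis p2s : 0 < p2 th2s.
Hypothesis p1_cont : forall eps : R, 0 < eps -> exists2 r : R, 0 < r &
  forall x, `|x - th1s| <= r -> `|p1 x - p1 th1s| <= eps.
Hypothesis p2_cont : forall eps : R, 0 < eps -> exists2 r : R, 0 < r &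
  forall x, `|x - th2s| <= r -> `|p2 x - p2 th2s| <= eps.
Hypothesis sep1 : forall delta : R, 0 < delta -> exists2 gamma : R, 0 < gamma &
  \forall k \near \oo, forall x, Th1 x -> delta <= `|x - t1 k| ->
    l1 k x - l1 k (t1 k) <= - gamma * n k.
Hypothesis sep2 : forall delta2 : R, 0 < delta2 -> exists delta1 gamma : R,
  [/\ 0 < delta1, 0 < gamma & \forall k \near \oo, forall x t,
    Th1 x -> Th2 t -> `|x - t1 k| < delta1 -> delta2 <= `|t - t2 k| ->
    l2 k (row_mx x t) - l2 k (that k) <= - gamma * n k].
Hypothesis osc2 : forall eta : R, 0 < eta -> exists2 rho : R, 0 < rho &
  \forall k \near \oo, forall x y, `|x - ths| <= rho -> `|y - ths| <= rho ->
    `|l2 k x - l2 k y| <= eta * n k.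
Hypothesis quadB : quad_approx B.
Hypothesis B_sym : forall k, (B k)^T = B k.
Hypothesis pJ1 : posdefmx J1.
Hypothesis pJ2 : posdefmx J2.
Hypothesis lln1 : forall i j (eta h0 : R), 0 < eta -> 0 < h0 -> exists h : R,
  [/\ 0 < h, h < h0 & \forall k \near \oo,
    `|dd (l1 k) (h *: delta_mx ord0 i) (h *: delta_mx ord0 j) th1s / (n k * h ^+ 2)
      + J1 i j| <= eta].

(** Only a fixed cube at [th2s] is kept: on it [l2] is within [eta / 2 * n] of its value at the
    estimator, and the other half of [eta] pays for the prior mass of the cube. *)
Lemma marg_lower (eta : R) : 0 < eta -> exists2 rho : R, 0 < rho & \forall k \near \oo,
  forall x, `|x - t1 k| <= rho -> mg k x \is a fin_num ->
    expR (l2 k (that k) - eta * n k) <= mr k x.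
Proof.
move=> eta0; have eta2 : 0 < eta / 2 by rewrite divr_gt0.
have [rho rho0 Hosc] := osc2 eta2.
have [r r0 Hr] := density_lower p2s p2_cont.
pose r' := Num.min rho r.
have r'0 : 0 < r' by rewrite lt_min rho0.
pose c := p2 th2s / 2 * (2 * r') ^+ d2.
have c0 : 0 < c by rewrite mulr_gt0 ?divr_gt0// exprn_gt0// mulr_gt0.
exists (rho / 2); first by rewrite divr_gt0.
have rho2 : 0 < rho / 2 by rewrite divr_gt0.
have := Hosc; apply: filter_app.
have := t1_cvg rho2; apply: filter_app.
have := t2_cvg rho0; apply: filter_app.
have := expR_small N_oo c0 eta2; apply: filterS => k Hc Ht2 Ht1 {}Hosc x xt fx.
rewrite -lee_fin fineK//.
have := @ge0_integral_cube_lower R d2 (fun t => expR (l2 k (row_mx x t)) * p2 t) th2s r'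
  (expR (l2 k (that k) - eta / 2 * n k) * (p2 th2s / 2)).
move/(_ (ltW r'0)) => H; apply: le_trans (H _ _ _ _).
- rewrite lee_fin -mulrA -/c.
  have -> : l2 k (that k) - eta * n k = (l2 k (that k) - eta / 2 * n k) + (- (eta / 2) * n k) by field.
  by rewrite expRD ler_wpM2l// expR_ge0.
- by rewrite mulr_ge0 ?expR_ge0// ltW// divr_gt0.
- apply: measurable_funM => //; apply: measurableT_comp => //.
  exact: measurable_l2_slice.
- by move=> t; rewrite mulr_ge0 ?expR_ge0.
move=> t tr; apply: ler_pM.
- exact: expR_ge0.
- by rewrite ltW// divr_gt0.
- have /Hosc : `|row_mx x t - ths| <= rho.
    rewrite norm_row_mxB ge_max; apply/andP; split.
      have -> : x - th1s = (x - t1 k) + (t1 k - th1s) by rewrite addrA subrK.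
      apply: le_trans (ler_normD _ _) _; lra.
    by apply: le_trans tr _; rewrite /r' ge_min lexx.
  have thr : `|that k - ths| <= rho.
    rewrite norm_row_mxB ge_max Ht2 andbT; lra.
  move=> /(_ _ thr); rewrite ler_norml => /andP[+ _] => H1.
  rewrite ler_expR; move: H1.
  by move: (l2 k (row_mx x t)) (l2 k (that k)) (eta / 2 * n k) => a b m H1; lra.
- by apply: Hr; apply: le_trans tr _; rewrite /r' ge_min lexx orbT.
Qed.

Lemma mg_fin k : mg k (t1 k) \is a fin_num.
Proof. exact: (marg_fin_t1 mp2 p2_ge0 p2_out p2_int (ml2 k) (@max2 k)). Qed.

Lemma i0_lower (eta : R) : 0 < eta -> \forall k \near \oo, expR (- eta * n k) <= i0 k.
Proof.
move=> eta0; have [rho rho0] := marg_lower eta0; apply: filterS => k H.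
have := H (t1 k); rewrite subrr normr0 => /(_ (ltW rho0)).
move=> /(_ (mg_fin k)) {}H; rewrite /i0 /reldens0.
have -> : - eta * n k = (l2 k (that k) - eta * n k) + - l2 k (that k) by ring.
by rewrite expRD ler_wpM2r// expR_ge0.
Qed.

(** [sep2] gives the rate [gam] for the likelihood ratio; the ratio of marginals costs at most half
    of it, by [marg_lower] for the denominator and by maximality of [t2 k] for the numerator. *)
Lemma e_tail (rho : R) : 0 < rho -> exists rho' gamma : R, [/\ 0 < rho', 0 < gamma &
  \forall k \near \oo, forall x t, Th1 x -> Th2 t -> `|x - t1 k| < rho' ->
    rho <= `|t - t2 k| -> e k x t <= expR (- gamma * n k) * expR (l1 k x - l1 k (t1 k))].
Proof.
move=> rho0; have [delta1 [gam [d10 g0 Hsep]]] := sep2 rho0.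
have g2 : 0 < gam / 2 by rewrite divr_gt0.
have [r r0 Hlow] := marg_lower g2.
exists (Num.min delta1 r), (gam / 2); split => //; first by rewrite lt_min d10.
have := Hsep; apply: filter_app; have := Hlow; apply: filterS => k {}Hlow {}Hsep x t Tx Tt.
rewrite lt_min => /andP[xd xr] tr.
have [fx|nfx] := boolP (mg k x \is a fin_num); last first.
  rewrite /e /reldens /margr.
  have -> : marg p2 (l2 k) x = +oo%E.
    have : (0 <= marg p2 (l2 k) x)%E by exact: marg_ge0.
    move: nfx; rewrite /mg fin_numE.
    by case: (marg _ _ _).
  by rewrite /= invr0 mulr0 mulr_ge0 ?expR_ge0.
have H1 := Hlow x (ltW xr) fx.
have H2 := Hsep x t Tx Tt xd tr.
have M0 : 0 < mr k x by exact: margr_gt0.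
have M1 : mr k (t1 k) <= expR (l2 k (that k)).
  rewrite -lee_fin /mr /margr fineK ?mg_fin//.
  exact: (marg_le mp2 p2_ge0 p2_out p2_int (ml2 k) (@max2 k)).
rewrite /e /reldens (ler_pdivrMr _ _ M0).
apply: (@le_trans _ _ (expR (l1 k x - l1 k (t1 k)) * expR (- gam * n k) * expR (l2 k (that k)))).
  apply: ler_pM; [exact: expR_ge0|exact: margr_ge0| |exact: M1].
  by rewrite -expRD ler_expR -addrA lerD2l.
rewrite (mulrC (expR (- (gam / 2) * n k))) -!mulrA ler_wpM2l ?expR_ge0//.
apply: (@le_trans _ _ (expR (- (gam / 2) * n k) * expR (l2 k (that k) - gam / 2 * n k))).
  rewrite -!expRD (_ : - gam * n k + l2 k (that k) = - (gam / 2) * n k + (l2 k (that k) - gam / 2 * n k))//.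
  by move: (l2 k _) (n k) => a b; field.
rewrite ler_wpM2l; [by []|exact: expR_ge0|exact: H1].
Qed.

Lemma e_near b (eta : R) : quad_approx b -> 0 < eta -> exists2 rho : R, 0 < rho &
  \forall k \near \oo, forall u1 u2, `|u1| <= rho -> `|u2| <= rho ->
    [/\ mg k (t1 k + u1) \is a fin_num,
      e k (t1 k + u1) (t2 k + u2) <=
      expR (bil u1 1%:M (g k) - n k / 2 * (bil u1 (b k) u1 + 2 * bil u1 RJ u2 + bil u2 J2 u2)
        + eta * n k * (`|u1| ^+ 2 + `|u2| ^+ 2)) &
      expR (bil u1 1%:M (g k) - n k / 2 * (bil u1 (b k) u1 + 2 * bil u1 RJ u2 + bil u2 J2 u2)
        - eta * n k * (`|u1| ^+ 2 + `|u2| ^+ 2)) <= e k (t1 k + u1) (t2 k + u2)].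
Proof.
move=> qb eta0; have [rho rho0 H] := qb _ eta0; exists rho => //.
apply: filterS H => k H u1 u2 h1 h2; have [fx] := H _ _ h1 h2.
set lg := (X in `|X - _ + _|).
have -> : e k (t1 k + u1) (t2 k + u2) = expR lg.
  exact: (reldensE _ mp2 p2_ge0 p2_out p2_int (ml2 k) (@max2 k)).
clearbody lg; rewrite ler_norml => /andP[A1 A2]; split => //; rewrite ler_expR.
  by apply: ler_eqsub A2; ring.
by apply: ler_eqsub A1; ring.
Qed.

Lemma sdens_reldens_limit (eps : R) : 0 < eps -> \forall k \near \oo,
  (\int[lebesgue_rV (d1 + d2)]_s
     (`|sdens p1 p2 n t1 t2 e k s - glim p1 p2 th1s th2s J1 J2 RJ s|)%:E <= eps%:E)%E.
Proof.
have me k : measurable_fun setT (fun z => e k z.1 z.2).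
  exact: (measurable_reldens (t1 k) (t2 k) mp2 p2_ge0 (ml1 k) (ml2 k)).
have e_ge0 k x t : 0 <= e k x t by exact: reldens_ge0.
have e_int k x : mg k x \is a fin_num -> (\int[lebesgue_rV d2]_t (e k x t * p2 t)%:E =
    (expR (l1 k x - l1 k (t1 k)) * i0 k)%:E)%E.
  by move=> fx; exact: (reldens_integral (l1 k) (t1 k) (t2 k) mp2 p2_ge0 p2_int (ml2 k) fx).
have e_int_le k x : (\int[lebesgue_rV d2]_t (e k x t * p2 t)%:E <=
    (expR (l1 k x - l1 k (t1 k)) * i0 k)%:E)%E.
  by exact: (reldens_integral_le (l1 k) mp2 p2_ge0 p2_out p2_int (ml2 k) (@max2 k)).
have i0_gt0 k : 0 < i0 k.
  by exact: (reldens0_gt0 mp2 p2_ge0 p2_out p2_int (ml2 k) (@max2 k)).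
have i0_le1 k : i0 k <= 1.
  by exact: (reldens0_le1 mp2 p2_ge0 p2_out p2_int (ml2 k) (@max2 k)).
have nB : near_approx n t1 t2 (fun k x => mg k x \is a fin_num) e J2 RJ g B.
  by move=> eta; exact: e_near.
exact: (sdens_glim mp1 p1_ge0 p1_out p1_int mp2 p2_ge0 p2_out p2_int max1 N_oo
  t1_cvg t2_cvg Th1_int p1s p2s p1_cont p2_cont sep1 me e_ge0 e_int e_int_le
  i0_gt0 i0_le1 i0_lower e_tail nB B_sym pJ1 pJ2 lln1).
Qed.

End core.

(** * From densities to total variation *)

Section total_variation.
Context {R : realType}.

Lemma block_info_inv d1 d2 (J1 : 'M[R]_d1) (J2 : 'M[R]_d2) (RJ : 'M[R]_(d1, d2)) :
  J1 \in unitmx -> J2 \in unitmx ->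
  block_mx (J1 + RJ *m invmx J2 *m RJ^T) RJ RJ^T J2 =
  invmx (block_mx (invmx J1)
    (- (invmx J1 *m RJ *m invmx J2))
    (- (invmx J2 *m RJ^T *m invmx J1))
    (invmx J2 + invmx J2 *m RJ^T *m invmx J1 *m RJ *m invmx J2)).
Proof.
move=> u1 u2; set H := block_mx _ _ _ _; set K := block_mx _ _ _ _.
have KH : K *m H = 1%:M.
  rewrite /K /H mulmx_block [RHS]scalar_mx_block; congr block_mx.
  - by rewrite mulmxDr mulVmx// mulNmx !mulmxA addrK.
  - by rewrite mulNmx -(mulmxA _ (invmx J2) J2) mulVmx// mulmx1 subrr.
  - rewrite mulNmx mulmxDr mulmxDl -(mulmxA _ (invmx J1) J1) mulVmx// mulmx1 !mulmxA.
    by rewrite addNr.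
  - rewrite mulNmx mulmxDl mulVmx// -(mulmxA _ (invmx J2) J2) mulVmx// mulmx1.
    by rewrite addrCA addNr addr0.
have [uK uH] := mulmx1_unit KH.
by rewrite -[LHS]mul1mx -(mulVmx uK) -mulmxA KH mulmx1.
Qed.

(** One [eps] comes from the integrals over [A] and one from the normalising constants, whose
    distance is the case [A = setT] of the same estimate. *)
Lemma scheffe d (T : measurableType d) (mu : {measure set T -> \bar R}) (s g : T -> R)
    (G eps : R) (A : set T) : measurable A ->
  measurable_fun setT s -> measurable_fun setT g ->
  (forall x, 0 <= s x) -> (forall x, 0 <= g x) -> 0 < G ->
  (\int[mu]_x (g x)%:E = G%:E)%E ->
  (\int[mu]_x `|s x - g x|%:E <= eps%:E)%E ->
  (`|\int[mu]_(x in A) (s x)%:E * ((fine (\int[mu]_x (s x)%:E))^-1)%:E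
    - \int[mu]_(x in A) (g x)%:E * (G^-1)%:E| <= (2 * eps / G)%:E)%E.
Proof.
move=> mA ms mg s0 g0 G0 IG ID.
have mse : measurable_fun setT (EFin \o s) by exact/measurable_EFinP.
have mge : measurable_fun setT (EFin \o g) by exact/measurable_EFinP.
have mD : measurable_fun setT (fun x => `|s x - g x|).
  by apply: measurableT_comp => //; exact: measurable_funB.
have mDe : measurable_fun setT (EFin \o (fun x => `|s x - g x|)) by exact/measurable_EFinP.
have key B : measurable B ->
    exists a b : R, [/\ (\int[mu]_(x in B) (s x)%:E = a%:E)%E,
      (\int[mu]_(x in B) (g x)%:E = b%:E)%E & `|a - b| <= eps].
  move=> mB.
  have mB' (f : T -> R) : measurable_fun setT f -> measurable_fun B (EFin \o f).
    by move=> mf; apply/measurable_EFinP; exact: measurable_funS mf.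
  have IDB : (\int[mu]_(x in B) `|s x - g x|%:E <= eps%:E)%E.
    apply: le_trans ID; apply: ge0_subset_integral => //=.
  have IGB : (\int[mu]_(x in B) (g x)%:E <= G%:E)%E.
    by rewrite -IG; apply: ge0_subset_integral => //= x _; rewrite lee_fin.
  have gfin : (\int[mu]_(x in B) (g x)%:E \is a fin_num)%E.
    rewrite ge0_fin_numE; first by apply: le_lt_trans IGB _; rewrite ltry.
    by apply: integral_ge0 => x _; rewrite lee_fin.
  have H1 : (\int[mu]_(x in B) (s x)%:E <=
      \int[mu]_(x in B) (g x)%:E + \int[mu]_(x in B) `|s x - g x|%:E)%E.
    rewrite -ge0_integralD//=; [|by move=> x _; rewrite lee_fin|exact: mB'|exact: mB'].
    apply: ge0_le_integral => //=.
    - by move=> x _; rewrite lee_fin.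
    - exact: mB'.
    - by apply: emeasurable_funD; exact: mB'.
    move=> x _; rewrite -EFinD lee_fin -lerBlDl; exact: ler_norm.
  have H2 : (\int[mu]_(x in B) (g x)%:E <=
      \int[mu]_(x in B) (s x)%:E + \int[mu]_(x in B) `|s x - g x|%:E)%E.
    rewrite -ge0_integralD//=; [|by move=> x _; rewrite lee_fin|exact: mB'|exact: mB'].
    apply: ge0_le_integral => //=.
    - by move=> x _; rewrite lee_fin.
    - exact: mB'.
    - by apply: emeasurable_funD; exact: mB'.
    move=> x _; rewrite -EFinD lee_fin -lerBlDl distrC; exact: ler_norm.
  have D0 : (0 <= \int[mu]_(x in B) `|s x - g x|%:E)%E.
    by apply: integral_ge0 => x _; rewrite lee_fin.
  have S0 : (0 <= \int[mu]_(x in B) (s x)%:E)%E.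
    by apply: integral_ge0 => x _; rewrite lee_fin.
  move: gfin H1 H2 IDB D0 S0; move: (integral _ _ (fun x => (s x)%:E)) (integral _ _ (fun x => (g x)%:E))
    (integral _ _ (fun x => `|s x - g x|%:E)) => [a| |] [b| |] [c| |]//= _.
  rewrite -!EFinD !lee_fin => H1 H2 c1 c0 a0; exists a, b; split => //.
  by rewrite ler_norml; apply/andP; split; lra.
have [a [b [Ea Eb ab]]] := key _ mA.
have [z [g' [Ez Eg zg]]] := key _ (@measurableT _ T).
have {Eg}gG : g' = G by move: Eg; rewrite IG => -[].
have a0 : 0 <= a by rewrite -lee_fin -Ea; apply: integral_ge0 => x _; rewrite lee_fin.
have az : a <= z.
  by rewrite -lee_fin -Ea -Ez; apply: ge0_subset_integral => //= x _; rewrite lee_fin.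
rewrite Ea Eb Ez /= lee_fin.
rewrite gG in zg.
have G1 : G^-1 * G = 1 by rewrite mulVf// gt_eqF.
(* If the total mass is 0 the normalised integral is 0 by the convention on inverses; then
   [eps >= G] and the bound is trivial. *)
have [z0|z0] := eqVneq z 0.
  have -> : a = 0 by apply/eqP; rewrite eq_le a0 -z0 az.
  rewrite mul0r sub0r normrN ger0_norm; last first.
    rewrite mulr_ge0 ?invr_ge0 ?(ltW G0)// -lee_fin -Eb.
    by apply: integral_ge0 => x _; rewrite lee_fin.
  rewrite ler_wpM2r ?invr_ge0 ?(ltW G0)//.
  have bG : b <= G.
    by rewrite -lee_fin -Eb -IG; apply: ge0_subset_integral => //= x _; rewrite lee_fin.
  move: zg; rewrite z0 sub0r normrN gtr0_norm// => Ge; lra.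
have zp : 0 < z by rewrite lt_neqAle eq_sym z0 (le_trans a0).
have -> : a / z - b / G = ((a - b) + a / z * (G - z)) / G.
  by field; rewrite z0 gt_eqF.
rewrite normrM (gtr0_norm (_ : 0 < G^-1)) ?invr_gt0// ler_wpM2r ?invr_ge0 ?(ltW G0)//.
apply: le_trans (ler_normD _ _) _; rewrite (_ : 2 * eps = eps + 1 * eps); last by ring.
apply: lerD => //; rewrite normrM; apply: ler_pM => //; last by rewrite distrC.
by rewrite ger0_norm ?divr_ge0 ?(ltW zp)// ler_pdivrMr// mul1r.
Qed.

Lemma mvnormal_glim d (H : 'M[R]_d) (c : R) (A : set 'rV[R]_d) : posdefmx H -> 0 < c ->
  let g s := expR (- bil s H s / 2) * c in
  let G := Num.sqrt ((2 * pi) ^+ d / \det H) * c in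
  [/\ 0 < G, (\int[lebesgue_rV d]_s (g s)%:E = G%:E)%E &
    measurable A -> mvnormal 0 (invmx H) A = (\int[lebesgue_rV d]_(s in A) (g s)%:E * (G^-1)%:E)%E].
Proof.
move=> pH c0 g G; have [dH IH] := integral_gauss pH.
have s0 : 0 < Num.sqrt ((2 * pi) ^+ d / \det H).
  by rewrite sqrtr_gt0 divr_gt0// exprn_gt0// mulr_gt0// pi_gt0.
have mq : measurable_fun setT (fun s => expR (- bil s H s / 2)).
  apply: measurableT_comp => //; apply: measurable_funM => //.
  by apply: measurableT_comp => //; exact: measurable_bil.
have mg : measurable_fun setT g by exact: measurable_funM.
have g0 s : 0 <= g s by rewrite mulr_ge0 ?expR_ge0// ltW.
have G0 : 0 < G by rewrite mulr_gt0.
split => //.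
  under eq_integral do rewrite /g mulrC.
  rewrite ge0_integralZ_EFin// ?(ltW c0)//.
  by rewrite IH -EFinM mulrC.
move=> mA; rewrite muleC -ge0_integralZl//=.
- apply: eq_integral => s _; rewrite -EFinM; congr (_%:E).
  rewrite /mvnormal_pdf subr0 invmxK det_inv -/(bil s H s) /G /g.
  have q0 := lt0r_neq0 s0; have cn := lt0r_neq0 c0; move: (expR _) => E.
  by move: (Num.sqrt _) q0 => q q0; field; rewrite q0 cn.
- by apply/measurable_EFinP; exact: measurable_funS mg.
- by move=> s _; rewrite lee_fin.
- by rewrite lee_fin invr_ge0 ltW.
Qed.

Section cut_density.
Context {d1 d2 : nat}.
Variables (Th1 : set 'rV[R]_d1) (Th2 : set 'rV[R]_d2).
Variables (pi1 : 'rV[R]_d1 -> R) (pi2 : 'rV[R]_d2 -> R).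
Variables (f1 : 'rV[R]_d1 -> R) (f2 : 'rV[R]_(d1 + d2) -> R).
Variables (t1 : 'rV[R]_d1) (t2 : 'rV[R]_d2) (n : R).
Variables (g : 'rV[R]_(d1 + d2) -> R) (G eps : R).

Let Theta := prodTheta Th1 Th2.
(** Since [p1] and [p2] vanish outside the parameter spaces, the value 0 given there to [l1] and
    [l2] does not affect the posterior density. *)
Let p1 := pi1 \_ Th1.
Let p2 := pi2 \_ Th2.
Let l1 := f1 \_ Th1.
Let l2 := f2 \_ Theta.
Let that := row_mx t1 t2.

Hypothesis mp1 : measurable_fun setT p1.
Hypothesis p1_ge0 : forall t, 0 <= p1 t.
Hypothesis mp2 : measurable_fun setT p2.
Hypothesis p2_ge0 : forall t, 0 <= p2 t.
Hypothesis p2_int : (\int[lebesgue_rV d2]_t (p2 t)%:E = 1)%E.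
Hypothesis ml1 : measurable_fun setT l1.
Hypothesis ml2 : measurable_fun setT l2.
Hypothesis max2 : forall t, Th2 t -> l2 (row_mx t1 t) <= l2 (row_mx t1 t2).
Hypothesis n_gt0 : 0 < n.

Definition post_dens (th : 'rV[R]_(d1 + d2)) : R :=
  reldens p2 l1 l2 t1 t2 (lsubmx th) (rsubmx th) * p1 (lsubmx th) * p2 (rsubmx th).

Let L (th : 'rV[R]_(d1 + d2)) : \bar R :=
  ((f1 (lsubmx th) + f2 th)%:E -
   lne (\int[lebesgue_rV d2]_(t in Th2) (expR (f2 (row_mx (lsubmx th) t)) * pi2 t)%:E))%E.

(** The ratio between the unnormalised cut density and [post_dens]; it disappears on
    normalisation. *)
Let C : R := expR (l1 t1 + l2 that) / margr p2 l2 t1.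

Lemma p2_out t : ~ Th2 t -> p2 t = 0.
Proof. by move=> nt; rewrite /p2 patchC// inE. Qed.

Lemma margr_t1_gt0 : 0 < margr p2 l2 t1.
Proof.
apply: margr_gt0 => //.
exact: (marg_fin_t1 mp2 p2_ge0 p2_out p2_int ml2 max2).
Qed.

Lemma marg_patch x : Th1 x -> marg p2 l2 x =
  (\int[lebesgue_rV d2]_(t in Th2) (expR (f2 (row_mx x t)) * pi2 t)%:E)%E.
Proof.
move=> Tx; rewrite [RHS]integral_mkcond; apply: eq_integral => t _.
rewrite /p2 /l2 !patchE; have [|_] := boolP (t \in Th2); last by rewrite mulr0.
by rewrite inE => Tt; rewrite mem_set//; split; rewrite ?row_mxKl ?row_mxKr.
Qed.

Lemma cut_densE th : Theta th ->
  (expeR (L th) * (pi1 (lsubmx th) * pi2 (rsubmx th))%:E = (C * post_dens th)%:E)%E.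
Proof.
move=> [T1 T2]; rewrite /L -marg_patch//.
have E1 : p1 (lsubmx th) = pi1 (lsubmx th) by rewrite /p1 patchE mem_set.
have E2 : p2 (rsubmx th) = pi2 (rsubmx th) by rewrite /p2 patchE mem_set.
have E3 : l1 (lsubmx th) = f1 (lsubmx th) by rewrite /l1 patchE mem_set.
have E4 : l2 th = f2 th by rewrite /l2 patchE mem_set.
rewrite /post_dens /reldens hsubmxK E1 E2 E3 E4.
have m0 := lt0r_neq0 margr_t1_gt0.
(* Where the marginal is infinite both sides are 0: [L] is [-oo] on the left, and on the right
   [margr] is 0 and so is its inverse. *)
have [fx|nfx] := boolP (marg p2 l2 (lsubmx th) \is a fin_num); last first.
  have -> : marg p2 l2 (lsubmx th) = +oo%E.
    by move: nfx (marg_ge0 l2 p2_ge0 (lsubmx th)); rewrite fin_numE; case: (marg _ _ _).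
  rewrite /margr.
  have -> : marg p2 l2 (lsubmx th) = +oo%E.
    by move: nfx (marg_ge0 l2 p2_ge0 (lsubmx th)); rewrite fin_numE; case: (marg _ _ _).
  by rewrite /= invr0 !(mulr0, mul0r) mul0e.
have M0 := margr_gt0 mp2 p2_ge0 p2_int ml2 fx.
rewrite -(fineK fx) -/(margr p2 l2 (lsubmx th)) lne_EFin// -EFinB /= -EFinM; congr (_%:E).
rewrite (expRB _ (ln _)) (lnK (M0 : _ \is Num.pos)) /C.
have -> : expR (f1 (lsubmx th) + f2 th) =
    expR (l1 t1 + l2 that) * expR (f1 (lsubmx th) - l1 t1 + f2 th - l2 that).
  by rewrite -expRD; congr expR; ring.
move: m0 (lt0r_neq0 M0); move: (expR (l1 t1 + _)) (expR (_ - l2 _)) => a b.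
move: (margr p2 l2 t1) (margr p2 l2 (lsubmx th)) (pi1 _) (pi2 _) => c e u v c0 e0.
by field; rewrite c0 e0.
Qed.

Lemma measurable_post_dens : measurable_fun setT post_dens.
Proof.
have mr := @measurable_rsubmx R d1 d2; have ml := @measurable_lsubmx R d1 d2.
apply: measurable_funM; last exact: (measurableT_comp mp2 mr).
apply: measurable_funM; last exact: (measurableT_comp mp1 ml).
exact: (measurableT_comp (measurable_reldens t1 t2 mp2 p2_ge0 ml1 ml2) (measurable_fun_pair ml mr)).
Qed.

Lemma post_dens_ge0 th : 0 <= post_dens th.
Proof. by do 2 apply: mulr_ge0 => //; exact: reldens_ge0. Qed.

Lemma post_dens_out th : ~ Theta th -> post_dens th = 0.
Proof.
move=> nT; apply/eqP; rewrite mulf_eq0 mulf_eq0.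
have [T1|nT1] := pselect (Th1 (lsubmx th)); last first.
  by apply/orP; left; apply/orP; right; apply/eqP; rewrite /p1 patchC// inE.
by apply/orP; right; apply/eqP; apply: p2_out => T2; apply: nT.
Qed.

Let c : R := (Num.sqrt n)^-1.

(** One constant [K], made of [C] and the Jacobian, serves the numerator [B = A] and the normaliser
    [B = setT], so that it cancels in the law. *)
Lemma law_prop_scaled (A : set 'rV[R]_(d1 + d2)) : measurable A ->
  exists2 K : R, 0 < K & forall B, B = A \/ B = setT ->
  (\int[lebesgue_rV (d1 + d2)]_(th in Theta `&` (fun t => Num.sqrt n *: (t - that)) @^-1` B)
     (expeR (L th) * (pi1 (lsubmx th) * pi2 (rsubmx th))%:E) =
   K%:E * \int[lebesgue_rV (d1 + d2)]_(s in B) (post_dens (that + c *: s))%:E)%E.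
Proof.
move=> mA; have r0 : 0 < Num.sqrt n by rewrite sqrtr_gt0.
have c0 : 0 < c by rewrite invr_gt0.
have C0 : 0 < C by rewrite divr_gt0 ?expR_gt0 ?margr_t1_gt0.
exists (C * c ^+ (d1 + d2)); first by rewrite mulr_gt0 ?exprn_gt0.
move=> B HB; have mB : measurable B by case: HB => ->.
have mh : measurable_fun setT (fun t : 'rV[R]_(d1 + d2) => Num.sqrt n *: (t - that)).
  rewrite (_ : (fun _ => _) = (fun t => - (Num.sqrt n *: that) + Num.sqrt n *: t)).
    exact: measurable_rV_affine.
  by apply/funext => t; rewrite scalerBr addrC.
set B' := _ @^-1` B; have mB' : measurable B' by rewrite -[B']setTI; exact: mh.
pose f (th : 'rV[R]_(d1 + d2)) := (post_dens \_ B') th.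
have f0 th : 0 <= f th.
  by rewrite /f patchE; case: ifP => // _; exact: post_dens_ge0.
have mf : measurable_fun setT f.
  by apply/(measurable_restrictT _ mB'); apply: measurable_funS measurable_post_dens.
transitivity (\int[lebesgue_rV (d1 + d2)]_th (C * f th)%:E)%E.
  rewrite integral_mkcond; apply: eq_integral => th _; rewrite patchE /f patchE.
  have [|nB] := boolP (th \in B'); last first.
    rewrite memNset ?mulr0// => -[_ /mem_set]; exact/negP.
  rewrite inE => Bth; case: ifPn; first by rewrite inE => -[Tth _]; exact: cut_densE.
  by rewrite notin_setE => nT; rewrite post_dens_out ?mulr0// => Tth; apply: nT.
rewrite ge0_integralZ_EFin ?(ltW C0)//.
rewrite (ge0_integral_affine that c0); last 2 first.
- exact/measurable_EFinP.
- by move=> v; rewrite lee_fin.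
rewrite (EFinM C) -[RHS]muleA; congr (_ * _)%E; congr (_ * _)%E.
rewrite [RHS]integral_mkcond; apply: eq_integral => s _; rewrite patchE /f patchE.
have E : (that + c *: s \in B') = (s \in B).
  have H : Num.sqrt n *: (that + c *: s - that) = s.
    by rewrite addrAC subrr add0r scalerA mulfV ?scale1r// gt_eqF.
  by apply/idP/idP; rewrite !inE /B' /= H.
by rewrite E; case: ifP.
Qed.

Lemma tv_cut_le : measurable_fun setT g -> (forall s, 0 <= g s) -> 0 < G ->
  (\int[lebesgue_rV (d1 + d2)]_s (g s)%:E = G%:E)%E ->
  (\int[lebesgue_rV (d1 + d2)]_s `|post_dens (that + c *: s) - g s|%:E <= eps%:E)%E ->
  (tv_distance
    (pushforward (law_prop (lebesgue_rV (d1 + d2)) Theta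
       (fun th => expeR (L th) * (pi1 (lsubmx th) * pi2 (rsubmx th))%:E))
       (fun t => Num.sqrt n *: (t - that)))
    (fun A => \int[lebesgue_rV (d1 + d2)]_(s in A) (g s)%:E * (G^-1)%:E)
   <= (2 * eps / G)%:E)%E.
Proof.
move=> mg g0 G0 IG ID; apply: ge_ereal_sup => _ [A mA <-].
have [K K0 HK] := law_prop_scaled mA.
pose s th := post_dens (that + c *: th).
have ms : measurable_fun setT s.
  by apply: measurableT_comp measurable_post_dens _; exact: measurable_rV_affine.
rewrite /pushforward /law_prop HK; last by left.
have -> : (\int[lebesgue_rV (d1 + d2)]_(th in Theta)
   (expeR (L th) * (pi1 (lsubmx th) * pi2 (rsubmx th))%:E) =
   K%:E * \int[lebesgue_rV (d1 + d2)]_th (s th)%:E)%E.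
  by rewrite -HK; [rewrite preimage_setT setIT|right].
have IS : (0 <= \int[lebesgue_rV (d1 + d2)]_th (s th)%:E)%E.
  by apply: integral_ge0 => th _; rewrite lee_fin post_dens_ge0.
have := scheffe mA ms mg (fun th => post_dens_ge0 _) g0 G0 IG ID.
rewrite -/s; congr (`|_ - _| <= _)%E.
rewrite muleAC muleC; congr (_ * _)%E.
(* The mass may be infinite; then [fine] turns it into 0 and both inverses are 0. *)
have := IS; case: (integral _ _ _) => [z| |]// _.
  transitivity ((K * (K * z)^-1)%:E); last by [].
  by rewrite invfM mulVKf// gt_eqF.
by rewrite gt0_muley ?lte_fin//= invr0 mule0.
Qed.

End cut_density.

End total_variation.

(** * Local expansion of the cut log-likelihood *)

Section marginal_continuity.
Context {R : realType} {d1 d2 : nat}.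
Variables (Th2 : set 'rV[R]_d2) (p2 : 'rV[R]_d2 -> R) (l2 : 'rV[R]_(d1 + d2) -> R).
Variables (U : set 'rV[R]_d1) (c : R).
Hypothesis mp2 : measurable_fun setT p2.
Hypothesis p2_ge0 : forall t, 0 <= p2 t.
Hypothesis p2_out : forall t, ~ Th2 t -> p2 t = 0.
Hypothesis p2_int : (\int[lebesgue_rV d2]_t (p2 t)%:E = 1)%E.
Hypothesis ml2 : measurable_fun setT l2.
Hypothesis l2_le : forall x t, U x -> Th2 t -> l2 (row_mx x t) <= c.
Hypothesis l2_cont : {ae lebesgue_rV d2, forall t, 0 < p2 t -> forall x, U x ->
  {for x, continuous (fun y => l2 (row_mx y t))}}.

Lemma marg_fin_bounded x : U x -> marg p2 l2 x \is a fin_num.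
Proof.
move=> Ux; rewrite ge0_fin_numE; last exact: marg_ge0.
have H : (marg p2 l2 x <= (expR c)%:E)%E.
  by apply: (marg_le mp2 p2_ge0 p2_out p2_int ml2) => t Tt; exact: l2_le.
by apply: le_lt_trans H _; rewrite ltry.
Qed.

(** Continuity of the marginal makes the cut log-likelihood continuous, which is what extends
    oscillation bounds from rational points to a ball. The uniform bound [c] provides the dominating
    function [expR c * p2]. *)
Lemma margr_cvg (x : 'rV[R]_d1) (x_ : nat -> 'rV[R]_d1) : U x -> (forall k, U (x_ k)) ->
  x_ @ \oo --> x -> (fun k => margr p2 l2 (x_ k)) @ \oo --> margr p2 l2 x.
Proof.
move=> Ux Ux_ xx.
pose f y t := (expR (l2 (row_mx y t)) * p2 t)%:E.
have mf y : measurable_fun setT (f y).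
  apply/measurable_EFinP/measurable_funM => //; apply: measurableT_comp => //.
  exact: measurable_l2_slice.
have ig : (lebesgue_rV d2).-integrable setT (fun t => (expR c * p2 t)%:E).
  apply/integrableP; split; first by apply/measurable_EFinP; exact: measurable_funM.
  rewrite (eq_integral (fun t => (expR c * p2 t)%:E)); last first.
    by move=> t _; rewrite abse_EFin ger0_norm// mulr_ge0 ?expR_ge0.
  by rewrite ge0_integralZ_EFin ?expR_ge0// p2_int mule1 ltry.
have H : ((\int[lebesgue_rV d2]_t f (x_ k) t)%E @[k --> \oo] --> (\int[lebesgue_rV d2]_t f x t)%E)%E.
  have [|||||_ _ //] := @dominated_convergence _ _ _ (lebesgue_rV d2) setT measurableT
    (fun k => f (x_ k)) (f x) (fun t => (expR c * p2 t)%:E).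
  - by move=> k; exact: mf.
  - exact: mf.
  - apply: filterS l2_cont => t Ht _.
    (* Continuity in the parameter is granted only where the prior is positive; elsewhere the
       integrand is identically 0. *)
    have [p0|p0] := ltP 0 (p2 t); last first.
      have E y : f y t = 0%E.
        have -> : f y t = (expR (l2 (row_mx y t)) * p2 t)%:E by [].
        by rewrite (_ : p2 t = 0) ?mulr0//; apply/eqP; rewrite eq_le p0 p2_ge0.
      by rewrite E; under eq_fun do rewrite E; exact: cvg_cst.
    rewrite /f; apply: cvg_EFin; first exact: nearW.
    apply: cvgM; last exact: cvg_cst.
    apply: (continuous_cvg _ (@continuous_expR R _)).
    exact: (continuous_cvg _ (Ht p0 x Ux)).
  - exact: ig.
  apply: aeW => t k _; rewrite /f abse_EFin lee_fin ger0_norm ?mulr_ge0 ?expR_ge0//.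
  have [Tt|nTt] := pselect (Th2 t); last by rewrite p2_out// !mulr0.
  by rewrite ler_wpM2r// ler_expR l2_le.
have fx := marg_fin_bounded Ux; rewrite /marg -/(f x) in fx.
have := fine_cvg (eq_ind _ (fun z => _ --> z) H _ (esym (fineK fx))).
exact.
Qed.

End marginal_continuity.

(** * Quadratic expansion at the estimator *)

Section quadratic_expansion.
Context {R : realType} {d1 d2 : nat}.
Variables (th1s : 'rV[R]_d1) (th2s : 'rV[R]_d2).
Variables (n : nat -> R) (f l2 : nat -> 'rV[R]_(d1 + d2) -> R).
Variables (t1 : nat -> 'rV[R]_d1) (t2 : nat -> 'rV[R]_d2).
Variables (Hs : 'M[R]_(d1 + d2)).

Let ths := row_mx th1s th2s.
Let that k := row_mx (t1 k) (t2 k).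
Let J2 := - drsubmx Hs.
Let RJ := - ursubmx Hs.

Hypothesis n_oo : forall A : R, \forall k \near \oo, A <= n k.
Hypothesis t1_cvg : forall eps : R, 0 < eps -> \forall k \near \oo, `|t1 k - th1s| <= eps.
Hypothesis t2_cvg : forall eps : R, 0 < eps -> \forall k \near \oo, `|t2 k - th2s| <= eps.
Hypothesis f_l2 : forall k u v x, lsubmx v = 0 -> dd (f k) u v x = dd (l2 k) u v x.
Hypothesis osc : forall eta : R, 0 < eta -> exists2 rho : R, 0 < rho &
  \forall k \near \oo, dd_osc (f k) ths rho (eta * n k).
Hypothesis f_diff : \forall k \near \oo, ntimes_differentiable 2 (f k) (that k).
Hypothesis f_max : \forall k \near \oo, exists2 r : R, 0 < r &
  forall u, `|u| <= r -> f k (that k + row_mx 0 u) <= f k (that k).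
Hypothesis lln2 : forall i j (eta h0 : R), 0 < eta -> 0 < h0 -> exists h : R,
  [/\ 0 < h, h < h0 & \forall k \near \oo,
    `|dd (l2 k) (h *: delta_mx ord0 i) (h *: delta_mx ord0 j) ths / (n k * h ^+ 2)
      - Hs i j| <= eta].

(** A one-sided first-order condition: the maximum need only hold along the ray in direction [u]. *)
Lemma dotgrad_max d (g : 'rV[R]_d -> R) x u (r : R) : differentiable g x -> 0 < r ->
  (forall s : R, 0 <= s <= r -> g (x + s *: u) <= g x) -> dotgrad g x u <= 0.
Proof.
move=> dg r0 H; apply: ler_addeps => eps e0; rewrite add0r.
have U0 : 0 < `|u| + 1 by rewrite ltr_wpDl.
have e1 : 0 < eps / (`|u| + 1) by rewrite divr_gt0.
have [dl dl0 Hd] := diff_eps dg e1.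
pose s := Num.min r (dl / (`|u| + 1) / 2).
have s0 : 0 < s by rewrite lt_min r0 !divr_gt0.
have su : `|s *: u| < dl.
  rewrite normrZ gtr0_norm//.
  apply: (@le_lt_trans _ _ (dl / (`|u| + 1) / 2 * (`|u| + 1))).
    apply: ler_pM => //; [exact: ltW| |by rewrite lerDl].
    by rewrite /s ge_min lexx orbT.
  by rewrite mulrAC divfK ?gt_eqF// ltr_pdivrMr// ltr_pMr// ltr1n.
have sr : 0 <= s <= r by rewrite (ltW s0)/= /s ge_min lexx.
have := Hd _ su; rewrite linearZ/= diff_dotgrad// -[_ *: dotgrad _ _ _]/(s * _).
rewrite normrZ (gtr0_norm s0) => A.
have B : eps / (`|u| + 1) * (s * `|u|) <= eps * s.
  rewrite mulrCA (mulrC eps s) ler_wpM2l ?(ltW s0)//.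
  by rewrite mulrAC ler_pdivrMr// ler_wpM2l ?(ltW e0)// lerDl.
have {}A := le_trans A B; rewrite ler_norml in A; move: A => /andP[A _].
have C := H s sr; rewrite -(ler_pM2l s0) (mulrC s eps).
by move: A C; move: (g _) (g x) (s * _) (eps * s) => a b c e A C; lra.
Qed.

Lemma norm_delta_mx d (i : 'I_d) : `|delta_mx ord0 i : 'rV[R]_d| <= 1.
Proof.
by apply: mx_norm_le => // a j; rewrite mxE; case: (_ && _); rewrite ?normr1 ?normr0.
Qed.

Lemma dotgrad_row_mx0 k (u : 'rV[R]_d2) : ntimes_differentiable 2 (f k) (that k) ->
  (exists2 r : R, 0 < r &
    forall u, `|u| <= r -> f k (that k + row_mx 0 u) <= f k (that k)) ->
  dotgrad (f k) (that k) (row_mx 0 u) = 0.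
Proof.
move=> [_ df _] [r r0 H].
have U0 : 0 < `|u| + 1 by rewrite ltr_wpDl.
have r1 : 0 < r / (`|u| + 1) by rewrite divr_gt0.
have E (v : 'rV[R]_d2) : `|v| = `|u| -> dotgrad (f k) (that k) (row_mx 0 v) <= 0.
  move=> vu; apply: (dotgrad_max df r1) => s /andP[s0 s1].
  rewrite scale_row_mx scaler0; apply: H; rewrite normrZ ger0_norm// vu.
  rewrite (le_trans (ler_wpM2r (normr_ge0 _) s1))// mulrAC ler_pdivrMr//.
  by rewrite ler_wpM2l ?(ltW r0)// lerDl.
apply/eqP; rewrite eq_le E//= -oppr_le0 -mulN1r -dotgradZ scale_row_mx scaler0 scaleN1r.
by apply: E; rewrite normrN.
Qed.

(** The Hessian entry at the estimator is compared through [dd_osc_hess] with a second difference at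
    [ths]; one direction lies in [theta_2], so this is a difference of [l2], to which the law of
    large numbers applies. Both positions of the entry are bounded, so the symmetry of the Hessian
    is not invoked. *)
Lemma hess_block2 i (j : 'I_d2) (eps : R) : 0 < eps -> \forall k \near \oo,
  `|hess (f k) (that k) i (rshift d1 j) - n k * Hs i (rshift d1 j)| <= eps * n k /\
  `|hess (f k) (that k) (rshift d1 j) i - n k * Hs i (rshift d1 j)| <= eps * n k.
Proof.
move=> e0; have e2 : 0 < eps / 2 by rewrite divr_gt0.
have [rho rho0 Hosc] := osc e2.
have rho2 : 0 < rho / 2 by rewrite divr_gt0.
have [h [h0 hrho Hh]] := lln2 i (rshift d1 j) e2 rho2.
have := Hh; apply: filter_app; have := Hosc; apply: filter_app.
have := f_diff; apply: filter_app; have := t1_cvg rho2; apply: filter_app.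
have := t2_cvg rho2; apply: filter_app; apply: filterS (n_oo 1) => k n1 c2 c1 dk {}Hosc {}Hh.
have n0 : 0 < n k by exact: lt_le_trans n1.
set v := h *: delta_mx ord0 (rshift d1 j) in Hh; set u := h *: delta_mx ord0 i in Hh.
have vh : `|v| <= h by rewrite normrZ gtr0_norm// -[leRHS]mulr1 ler_wpM2l ?(ltW h0)// norm_delta_mx.
have uh : `|u| <= h by rewrite normrZ gtr0_norm// -[leRHS]mulr1 ler_wpM2l ?(ltW h0)// norm_delta_mx.
have thr : `|that k - ths| < rho.
  rewrite norm_row_mxB gt_max; apply/andP; split.
    by apply: le_lt_trans c1 _; rewrite ltr_pdivrMr// ltr_pMr// ltr1n.
  by apply: le_lt_trans c2 _; rewrite ltr_pdivrMr// ltr_pMr// ltr1n.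
have pg x y : `|x| <= h -> `|y| <= h -> pgram_in ths rho x y ths.
  have K w : ths + w - ths = w by rewrite addrAC subrr add0r.
  move=> xh yh; split.
  - by rewrite subrr normr0 ltW.
  - by rewrite K; lra.
  - by rewrite K; lra.
  - by rewrite -(addrA ths) K; apply: le_trans (ler_normD _ _) _; lra.
have lv : lsubmx v = 0.
  by apply/rowP => a; rewrite !mxE (_ : (_ == rshift d1 j) = false) ?andbF ?mulr0// eq_lrshift.
have h2 : 0 < h ^+ 2 by rewrite exprn_gt0.
have key z : `|dd (f k) u v ths - z| <= eps / 2 * n k * (h * h) ->
    exists2 a, z = h ^+ 2 * a & `|a - n k * Hs i (rshift d1 j)| <= eps * n k.
  move=> Hz; exists (z / h ^+ 2); first by rewrite mulrC divfK// gt_eqF.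
  rewrite f_l2// in Hz.
  have Hd : `|dd (l2 k) u v ths - n k * h ^+ 2 * Hs i (rshift d1 j)| <= eps / 2 * n k * h ^+ 2.
    have nh : 0 < n k * h ^+ 2 by rewrite mulr_gt0.
    have -> : dd (l2 k) u v ths - n k * h ^+ 2 * Hs i (rshift d1 j) =
        (dd (l2 k) u v ths / (n k * h ^+ 2) - Hs i (rshift d1 j)) * (n k * h ^+ 2).
      by rewrite mulrBl divfK ?gt_eqF// (mulrC (Hs _ _)).
    by rewrite normrM (gtr0_norm nh) -mulrA ler_wpM2r// ltW.
  rewrite -(ler_pM2l h2) -{1}(gtr0_norm h2) -normrM mulrBr.
  rewrite (mulrC _ (z / _)) divfK ?gt_eqF//.
  rewrite (_ : h ^+ 2 * (n k * _) = n k * h ^+ 2 * Hs i (rshift d1 j)); last by ring.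
  rewrite (_ : h ^+ 2 * (eps * n k) = eps / 2 * n k * h ^+ 2 + eps / 2 * n k * h ^+ 2); last by field.
  apply: le_trans (ler_distD (dd (l2 k) u v ths) _ _) _.
  by rewrite distrC; apply: lerD => //; rewrite expr2.
have bilhh (A : 'M[R]_(d1 + d2)) a b : bil (h *: delta_mx ord0 a) A (h *: delta_mx ord0 b) = h ^+ 2 * A a b.
  by rewrite bilZl bilZr bil_delta mulrA expr2.
have uv : eps / 2 * n k * (`|u| * `|v|) <= eps / 2 * n k * (h * h).
  by apply: ler_wpM2l; [rewrite mulr_ge0// ltW|exact: ler_pM].
split.
  have := dd_osc_hess dk thr Hosc (pg _ _ vh uh); rewrite ddC bilhh => H.
  have [|a] := key (h ^+ 2 * hess (f k) (that k) i (rshift d1 j)).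
    by apply: le_trans H _; rewrite (mulrC `|v|).
  by move=> /(mulfI (lt0r_neq0 h2)) ->.
have := dd_osc_hess dk thr Hosc (pg _ _ uh vh); rewrite bilhh => H.
have [|a] := key (h ^+ 2 * hess (f k) (that k) (rshift d1 j) i).
  exact: le_trans H _.
by move=> /(mulfI (lt0r_neq0 h2)) ->.
Qed.

Definition score1 k : 'rV[R]_d1 := \row_i partial (lshift d2 i) (f k) (that k).

(* Only the quadratic form of the Hessian block matters: symmetrising it avoids
   proving it symmetric. *)
Definition info1 k : 'M[R]_d1 :=
  let A := ulsubmx (hess (f k) (that k)) in - ((n k)^-1 / 2) *: (A + A^T).

Lemma info1_sym k : (info1 k)^T = info1 k.
Proof. by rewrite /info1 linearZ/= linearD/= trmxK addrC. Qed.

Lemma dotgrad_score1 k u1 u2 : dotgrad (f k) (that k) (row_mx 0 u2) = 0 ->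
  dotgrad (f k) (that k) (row_mx u1 u2) = bil u1 1%:M (score1 k).
Proof.
move=> H; rewrite -[u1]addr0 -[u2]add0r -add_row_mx dotgradD H !addr0.
rewrite /bil mulmx1 mxE /dotgrad big_split_ord/= [X in _ + X]big1 ?addr0.
  by apply: eq_bigr => i _; rewrite row_mxEl !mxE.
by move=> i _; rewrite row_mxEr mxE mul0r.
Qed.

Lemma bil_info1 k u1 : n k != 0 ->
  n k * bil u1 (info1 k) u1 = - bil u1 (ulsubmx (hess (f k) (that k))) u1.
Proof.
move=> n0; rewrite /info1 bilZ bilD -(bil_tr u1 _ u1).
by move: (bil _ _ _) => b; field.
Qed.

(** Taylor's formula from [dd_osc_taylor]: the [theta_2] gradient vanishes at the maximum, the
    blocks meeting [theta_2] are replaced by their limits, and the [theta_1] block is kept as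
    [info1]. *)
Lemma quad_expansion (eta : R) : 0 < eta -> exists2 rho : R, 0 < rho & \forall k \near \oo,
  forall u1 u2, `|u1| <= rho -> `|u2| <= rho ->
    `|f k (that k + row_mx u1 u2) - f k (that k) - bil u1 1%:M (score1 k)
      + n k / 2 * (bil u1 (info1 k) u1 + 2 * bil u1 RJ u2 + bil u2 J2 u2)|
    <= eta * n k * (`|u1| ^+ 2 + `|u2| ^+ 2).
Proof.
move=> eta0; have eta2 : 0 < eta / 2 by rewrite divr_gt0.
have [rho rho0 Hosc] := osc eta2.
have rho2 : 0 < rho / 2 by rewrite divr_gt0.
(* [D] bounds the number of matrix entries that are replaced, counted with their weights in half the
   quadratic form, so the replacement costs at most [eta / 2]. *)
pose D : R := (d1 * d2)%:R + (d2 * d2)%:R + 1.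
have D0 : 0 < D by rewrite ltr_wpDl.
pose eps := eta / 2 / D; have eps0 : 0 < eps by rewrite divr_gt0.
have HB : \forall k \near \oo, forall i (j : 'I_d2),
    `|hess (f k) (that k) i (rshift d1 j) - n k * Hs i (rshift d1 j)| <= eps * n k /\
    `|hess (f k) (that k) (rshift d1 j) i - n k * Hs i (rshift d1 j)| <= eps * n k.
  by apply: filter_forall => i; apply: filter_forall => j; exact: hess_block2.
exists (rho / 2) => //.
have := HB; apply: filter_app; have := Hosc; apply: filter_app.
have := f_diff; apply: filter_app; have := f_max; apply: filter_app; have := t1_cvg rho2; apply: filter_app.
have := t2_cvg rho2; apply: filter_app; apply: filterS (n_oo 1) => k n1 c2 c1 mk dk {}Hosc {}HB u1 u2 h1 h2.
have n0 : 0 < n k by exact: lt_le_trans n1.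
have rr : rho / 2 < rho by rewrite ltr_pdivrMr// ltr_pMr// ltr1n.
have thr : `|that k - ths| < rho.
  by rewrite norm_row_mxB gt_max (le_lt_trans c1 rr) (le_lt_trans c2 rr).
have ur : `|that k + row_mx u1 u2 - ths| <= rho.
  rewrite addrAC (le_trans (ler_normD _ _))// (splitr rho); apply: lerD.
    by rewrite norm_row_mxB ge_max c1.
  by rewrite norm_row_mx ge_max h1.
have C0 : 0 <= eta / 2 * n k by rewrite mulr_ge0 ?(ltW n0) ?(ltW eta2).
have := dd_osc_taylor dk C0 thr Hosc ur.
rewrite (dotgrad_score1 _ (dotgrad_row_mx0 u2 dk mk)).
set A := hess (f k) (that k) in HB *.
rewrite -{1}(submxK A) bil_row_mx => T.
have Br : `|bil u1 (ursubmx A) u2 + n k * bil u1 RJ u2| <= (d1 * d2)%:R * (eps * n k) * `|u1| * `|u2|.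
  rewrite -bilZ -bilD; apply: le_trans (bil_bound _ _ _) _.
  rewrite ler_wpM2r// ler_wpM2r// ler_wpM2l//; apply: mx_norm_le => [|i j].
    by rewrite mulr_ge0// ltW.
  have [+ _] := HB (lshift d2 i) j; congr (`|_| <= _).
  by rewrite !mxE mulrN.
have Bl : `|bil u2 (dlsubmx A) u1 + n k * bil u1 RJ u2| <= (d1 * d2)%:R * (eps * n k) * `|u1| * `|u2|.
  rewrite (bil_tr u2) -bilZ -bilD; apply: le_trans (bil_bound _ _ _) _.
  rewrite ler_wpM2r// ler_wpM2r// ler_wpM2l//; apply: mx_norm_le => [|i j].
    by rewrite mulr_ge0// ltW.
  have [_ +] := HB (lshift d2 i) j; congr (`|_| <= _).
  by rewrite !mxE mulrN.
have Bd : `|bil u2 (drsubmx A) u2 + n k * bil u2 J2 u2| <= (d2 * d2)%:R * (eps * n k) * `|u2| * `|u2|.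
  rewrite -bilZ -bilD; apply: le_trans (bil_bound _ _ _) _.
  rewrite ler_wpM2r// ler_wpM2r// ler_wpM2l//; apply: mx_norm_le => [|i j].
    by rewrite mulr_ge0// ltW.
  have [+ _] := HB (rshift d1 i) j; congr (`|_| <= _).
  by rewrite !mxE mulrN.
have I1 := bil_info1 u1 (lt0r_neq0 n0); rewrite -/A in I1.
pose S := `|u1| ^+ 2 + `|u2| ^+ 2.
have S0 : 0 <= S by rewrite addr_ge0 ?sqr_ge0.
have u12 : `|u1| * `|u2| <= S.
  have := sqr_ge0 (`|u1| - `|u2|); rewrite sqrrB.
  have := sqr_ge0 `|u1|; have := sqr_ge0 `|u2|; rewrite /S -mulr_natl.
  by move: (_ ^+ 2) (_ ^+ 2) (`|u1| * `|u2|) => a b c; lra.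
have u22 : `|u2| * `|u2| <= S by rewrite -expr2 lerDr sqr_ge0.
have uS : `|row_mx u1 u2| ^+ 2 <= S.
  rewrite norm_row_mx /S; case: (leP `|u1| `|u2|) => _; first by rewrite lerDr sqr_ge0.
  by rewrite lerDl sqr_ge0.
have en : 0 <= eps * n k by rewrite mulr_ge0// ltW.
have W1 : (d1 * d2)%:R * (eps * n k) * `|u1| * `|u2| <= (d1 * d2)%:R * (eps * n k) * S.
  by rewrite -mulrA ler_wpM2l// mulr_ge0.
have W2 : (d2 * d2)%:R * (eps * n k) * `|u2| * `|u2| <= (d2 * d2)%:R * (eps * n k) * S.
  by rewrite -mulrA ler_wpM2l// mulr_ge0.
have W3 := ler_wpM2l C0 uS.
have W4 : (d1 * d2)%:R * (eps * n k) * S + (d2 * d2)%:R * (eps * n k) * S <= eta / 2 * n k * S.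
  have -> : eta / 2 * n k * S = D * (eps * n k) * S.
    by rewrite /eps; field; rewrite gt_eqF.
  rewrite -mulrDl -mulrDl ler_wpM2r// ler_wpM2r// /D lerDl//.
move: T (le_trans Br W1) (le_trans Bl W1) (le_trans Bd W2) I1 W3 W4; rewrite -/S.
move: (bil u1 1%:M _) (bil u1 RJ u2) (bil u2 J2 u2) (bil u1 (info1 k) u1) (bil u1 (ulsubmx A) u1)
  (bil u1 (ursubmx A) u2) (bil u2 (dlsubmx A) u1) (bil u2 (drsubmx A) u2) => b1 b2 b3 b4 b5 b6 b7 b8.
rewrite (_ : n k / 2 * (b4 + 2 * b2 + b3) = (n k * b4 + 2 * (n k * b2) + n k * b3) / 2); last by field.
rewrite (_ : eta * n k * S = eta / 2 * n k * S + eta / 2 * n k * S); last by field.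
move: (f k _) (f k _) (n k * b4) (n k * b2) (n k * b3) (_ * S) (_ * S) (eta / 2 * n k * S) (_ * `|_| ^+ 2) => x y q4 q2 q3 s1 s2 s3 s4.
rewrite !ler_norml => /andP[A1 A2] /andP[B1 B2] /andP[C1 C2] /andP[D1 D2] I1 W3 W4.
by apply/andP; split; lra.
Qed.
End quadratic_expansion.

(** * Probabilities tending to one and laws of large numbers *)

Section convergence_of_probability.
Context {d} {Omega : measurableType d} {R : realType} (P : probability Omega R).

Lemma prob_to1_lim (A E : nat -> set Omega) : (forall n, measurable (A n)) ->
  (forall n, A n `<=` E n) ->
  (forall eps : R, 0 < eps -> \forall n \near \oo, (P (~` A n) <= eps%:E)%E) ->
  prob_to1 P E.
Proof.
move=> mA AE H; exists A; split=> //.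
have fA n : P (A n) \is a fin_num by exact: fin_num_measure.
apply/fine_cvgP; split; first exact: nearW.
apply: cvgr_near => eps e0; apply: filterS (H _ e0) => n /=.
rewrite probability_setC// -(fineK (fA n)) -EFinB lee_fin => Hn.
have A1 : fine (P (A n)) <= 1 by rewrite -lee_fin fineK// probability_le1.
rewrite distrC ger0_norm ?subr_ge0//.
Qed.

Lemma prob_to1_compl (E : nat -> set Omega) : prob_to1 P E ->
  exists A : nat -> set Omega, [/\ forall n, measurable (A n), forall n, A n `<=` E n &
  forall eps : R, 0 < eps -> \forall n \near \oo, (P (~` A n) <= eps%:E)%E].
Proof.
move=> [A [mA PA]]; exists A; split=> [n|n|eps e0]; [by have [] := mA n|by have [] := mA n|].
have fA n : P (A n) \is a fin_num by apply: fin_num_measure; have [] := mA n.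
have /fine_cvgP[_ /near_cvgr/(_ _ e0)] := PA; apply: filterS => n /=.
have [mAn _] := mA n; rewrite probability_setC// -(fineK (fA n)) -EFinB lee_fin.
by rewrite distrC; exact: le_trans (ler_norm _).
Qed.

Lemma prob_to1_sub (E F : nat -> set Omega) : (forall n, E n `<=` F n) ->
  prob_to1 P E -> prob_to1 P F.
Proof.
move=> EF [A [mA PA]]; exists A; split=> // n; have [m s] := mA n.
by split=> //; exact: subset_trans s (EF n).
Qed.

Lemma prob_to1_near (E F : nat -> set Omega) : (\forall n \near \oo, E n `<=` F n) ->
  prob_to1 P E -> prob_to1 P F.
Proof.
move=> [N _ EF] /prob_to1_compl[A [mA AE H]].
apply: (@prob_to1_lim (fun n => if (N <= n)%N then A n else set0)).
- by move=> n; case: ifP.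
- by move=> n; case: ifP => [Nn w /AE/(EF n Nn)|_ w].
move=> eps e0; have := H _ e0; apply: filter_app; exists N => // n /= Nn.
by rewrite Nn.
Qed.

Lemma prob_to1_setI (E F : nat -> set Omega) : prob_to1 P E -> prob_to1 P F ->
  prob_to1 P (fun n => E n `&` F n).
Proof.
move=> /prob_to1_compl[A [mA AE HA]] /prob_to1_compl[B [mB BF HB]].
apply: (@prob_to1_lim (fun n => A n `&` B n)).
- by move=> n; exact: measurableI.
- by move=> n; exact: setISS.
move=> eps e0; have e2 : 0 < eps / 2 by rewrite divr_gt0.
have := HA _ e2; apply: filter_app; apply: filterS (HB _ e2) => n hB hA.
rewrite setCI (splitr eps) EFinD; apply: le_trans (leeD hA hB).
by apply: measureU2; exact: measurableC.
Qed.

Lemma prob_to1_T : prob_to1 P (fun=> setT).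
Proof.
by exists (fun=> setT); split=> //; under eq_fun do rewrite probability_setT; exact: cvg_cst.
Qed.

Lemma prob_to1_forall (I : finType) (E : I -> nat -> set Omega) :
  (forall i, prob_to1 P (E i)) -> prob_to1 P (fun n => [set w | forall i, E i n w]).
Proof.
move=> H; have {}H (s : seq I) : prob_to1 P (fun n => [set w | forall i, i \in s -> E i n w]).
  elim: s => [|i s IH].
    by apply: prob_to1_sub prob_to1_T => n w _ i.
  apply: prob_to1_sub (prob_to1_setI (H i) IH) => n w /= [h1 h2] j.
  by rewrite inE => /predU1P[->//|/h2].
by apply: prob_to1_sub (H (enum I)) => n w /= h i; apply: h; rewrite mem_enum.
Qed.

Lemma prob_to1_ae (E : nat -> set Omega) :
  (forall n, {ae P, forall w, E n w}) -> prob_to1 P E.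
Proof.
move=> H; have [N HN] := choice H.
exists (fun n => ~` N n); split.
  move=> n; have [mN PN sN] := HN n; split; first exact: measurableC.
  by rewrite -[E n]setCK; exact: subsetC.
rewrite (_ : (fun n => P (~` N n)) = cst 1%E); first exact: cvg_cst.
apply/funext => n; have [mN PN _] := HN n.
by rewrite probability_setC// [P (N n)]PN sube0.
Qed.

(** Continuity from below along the intersections of all later events, which increase to a set of
    probability 1. *)
Lemma prob_to1_ae_near (S : nat -> set Omega) : (forall n, measurable (S n)) ->
  {ae P, forall w, \forall n \near \oo, S n w} -> prob_to1 P S.
Proof.
move=> mS HS; pose A n := \bigcap_(m in [set m | (n <= m)%N]) S m.
have mA n : measurable (A n) by apply: bigcap_measurable => //; exists n => /=.
exists A; split.
  by move=> n; split=> // w; apply=> /=.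
have mU : measurable (\bigcup_n A n) by exact: bigcup_measurable.
have <- : P (\bigcup_n A n) = 1%E.
  have : P (~` \bigcup_n A n) = 0%E.
    apply: measure_negligible; first exact: measurableC.
    apply: negligibleS HS => w /= nA nS; apply: nA; case: nS => N _ h.
    by exists N => // m /= Nm; exact: h.
  have fU := fin_num_measure P _ mU; rewrite probability_setC// -(fineK fU) -EFinB.
  by move=> -[/eqP]; rewrite subr_eq0 => /eqP <-.
apply: nondecreasing_cvg_mu => //.
by move=> n m nm; apply/subsetPset => w h k /= mk; apply: h => /=; exact: leq_trans mk.
Qed.

(** If a finite intersection of the events forces [Y] below [eps] for all large [n], its inner
    probability tends to 1 and the claim follows. Otherwise each [j] has an index [n >= j] and an
    outcome in the first [j + 1] events at which this fails; these form a sequence that is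
    eventually in every event and contradicts the deterministic statement. *)
Lemma cvg_in_prob0_seq (E : nat -> nat -> set Omega) (Y : nat -> Omega -> \bar R) :
  (forall m, prob_to1 P (E m)) ->
  (forall (N : nat -> nat) (w : nat -> Omega), (forall k, (k <= N k)%N) ->
     (forall m, \forall k \near \oo, E m (N k) (w k)) ->
     forall eps : R, 0 < eps -> \forall k \near \oo, (`|Y (N k) (w k)| < eps%:E)%E) ->
  cvg_in_prob0 P Y.
Proof.
move=> HE HY eps e0.
pose F j n := [set w | forall m : 'I_j.+1, E m n w].
have HF j : prob_to1 P (F j) by apply: prob_to1_forall => m; exact: HE.
pose good n w := (`|Y n w| < eps%:E)%E.
have [|nH] := pselect (exists j n0, forall n w, (n0 <= n)%N -> F j n w -> good n w).
  move=> [j [n0 H]]; apply: prob_to1_near (HF j).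
  by exists n0 => // n /= n0n w Fw; exact: H Fw.
have H j : exists p : nat * Omega, [/\ (j <= p.1)%N, F j p.1 p.2 & ~ good p.1 p.2].
  apply: contrapT => nj; apply: nH; exists j, j => n w jn Fw.
  by apply: contrapT => ng; apply: nj; exists (n, w).
have [p Hp] := choice H.
have Hk k : (k <= (p k).1)%N by have [] := Hp k.
have [m|K _ HK] := HY (fun k => (p k).1) (fun k => (p k).2) Hk _ _ e0.
  exists m => // k /= mk; have [_ Fk _] := Hp k.
  by have := Fk (Ordinal (mk : (m < k.+1)%N)).
by have [_ _ ng] := Hp K; exfalso; apply: ng; exact: (HK K (leqnn K)).
Qed.

End convergence_of_probability.

(** * The weak law of large numbers *)

Section law_of_large_numbers.
Context {R : realType}.

Lemma bounded_integrable_fin d (T : measurableType d) (nu : {measure set T -> \bar R})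
    (h : T -> R) (C : R) : 0 <= C -> (nu setT < +oo)%E -> measurable_fun setT h ->
  (forall x, `|h x| <= C) -> nu.-integrable setT (EFin \o h).
Proof.
move=> C0 nuT mh hC; apply/integrableP; split; first exact/measurable_EFinP.
apply: (@le_lt_trans _ _ (\int[nu]_x (cst C%:E x))%E).
  apply: ge0_le_integral => //=.
  - by apply/measurable_EFinP; exact: measurableT_comp.
  - by move=> x _; rewrite lee_fin.
by rewrite integral_cst//= lte_mul_pinfty// lee_fin.
Qed.

Lemma markov_ge d (T : measurableType d) (nu : {measure set T -> \bar R}) (Y : T -> R) (c : R) :
  0 < c -> measurable_fun setT Y -> (forall x, 0 <= Y x) ->
  (nu [set x | (c <= Y x)%R] <= (c^-1)%:E * \int[nu]_x (Y x)%:E)%E.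
Proof.
move=> c0 mY Y0; set A := [set x : T | c <= Y x].
have mA : measurable A.
  have := mY measurableT _ (measurable_itv `[c, +oo[); rewrite setTI.
  by congr measurable; apply/seteqP; split => x /=; rewrite in_itv /= andbT.
rewrite -(@lee_pmul2l _ c%:E)// muleA -EFinM mulfV ?gt_eqF// mul1e.
rewrite -(integral_cst nu mA); apply: (@le_trans _ _ (\int[nu]_(x in A) (Y x)%:E)%E).
  apply: ge0_le_integral => //=.
  - by move=> x _; rewrite lee_fin ltW.
  - by apply/measurable_EFinP; exact: measurable_funS mY.
by apply: ge0_subset_integral => //=; [exact/measurable_EFinP|move=> x _; rewrite lee_fin].
Qed.

Section law.
Context {d} {Omega : measurableType d} (P : probability Omega R).
Context {d'} {T : measurableType d'} (nu : {measure set T -> \bar R}) (Z : Omega -> T).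
Hypothesis mZ : measurable_fun setT Z.
Hypothesis lawZ : forall B, measurable B -> P (Z @^-1` B) = nu B.

Let f : {mfun Omega >-> T} := HB.pack Z (isMeasurableFun.Build _ _ _ _ _ mZ).

Lemma ge0_integral_law (h : T -> R) : measurable_fun setT h -> (forall x, 0 <= h x) ->
  (\int[P]_w (h (Z w))%:E = \int[nu]_x (h x)%:E)%E.
Proof.
move=> mh h0.
rewrite -(@eq_measure_integral _ _ _ setT nu (pushforward P f) (EFin \o h)); last first.
  by move=> A mA _; exact: lawZ.
rewrite (ge0_integral_pushforward (mZ : measurable_fun setT f))//.
  exact/measurable_EFinP.
by move=> x _; rewrite lee_fin.
Qed.

Lemma bounded_integral_law (h : T -> R) (C : R) : measurable_fun setT h ->
  0 <= C -> (forall x, `|h x| <= C) ->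
  (\int[P]_w (h (Z w))%:E = \int[nu]_x (h x)%:E)%E.
Proof.
move=> mh C0 hC.
rewrite -(@eq_measure_integral _ _ _ setT nu (pushforward P f) (EFin \o h)); last first.
  by move=> A mA _; exact: lawZ.
rewrite (integral_pushforward (mZ : measurable_fun setT f))//.
  exact/measurable_EFinP.
have P1 : (P setT < +oo)%E by rewrite probability_setT ltry.
exact: (@bounded_integrable_fin _ _ P (h \o Z) C C0 P1 (measurableT_comp mh mZ) (fun w => hC (Z w))).
Qed.

End law.

Section iid_sequence.
Context {d} {Omega : measurableType d} (P : probability Omega R).
Context {d'} {T : measurableType d'} (mu : probability T R) (Z : nat -> Omega -> T).
Hypothesis iidZ : iid P Z mu.

Let mZ j : measurable_fun setT (Z j). Proof. by case: iidZ. Qed.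

Let lawZ j B : measurable B -> P (Z j @^-1` B) = mu B.
Proof. by case: iidZ => _ h _; exact: h. Qed.

Lemma iid_pair i j : i != j -> forall X, measurable X ->
  P ((fun w => (Z i w, Z j w)) @^-1` X) = (mu \x mu)%E X.
Proof.
move=> ij X mX.
have mp : measurable_fun setT (fun w => (Z i w, Z j w)) by exact: measurable_fun_pair.
pose f : {mfun Omega >-> (T * T)%type} := HB.pack (fun w => (Z i w, Z j w))
  (isMeasurableFun.Build _ _ _ _ _ mp).
rewrite (@product_measure_unique _ _ _ _ _ mu mu (pushforward P f))// => A B mA mB.
have [_ _ H] := iidZ.
have ji : (j == i) = false by rewrite eq_sym (negbTE ij).
pose BB k := if k == i then A else B.
have := H [fset i; j]%fset BB; rewrite big_fsetU1/= ?inE// big_seq_fset1.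
have mBB k : measurable (BB k) by rewrite /BB; case: ifP.
rewrite !lawZ// /BB eqxx ji => <-; last by move=> k; case: ifP.
congr (P _); apply/seteqP; split => w /=.
  move=> [wA wB] k /=; rewrite !inE => /orP[/eqP ->|/eqP ->]; rewrite /BB ?eqxx ?ji//.
move=> Hw; split.
  by have := Hw i; rewrite /= !inE /BB !eqxx; exact.
by have := Hw j; rewrite /= !inE /BB !eqxx orbT ji; exact.
Qed.

(** In the expanded square the off-diagonal terms vanish by pairwise independence, Fubini's theorem
    and the zero mean, leaving [n] bounded terms. *)
Lemma iid_second_moment (y : T -> R) (C : R) n : measurable_fun setT y -> 0 <= C ->
  (forall x, `|y x| <= C) -> (\int[mu]_x (y x)%:E = 0)%E ->
  (\int[P]_w ((\sum_(i < n) y (Z i w)) ^+ 2)%:E <= (n%:R * C ^+ 2)%:E)%E.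
Proof.
move=> my C0 yC y0.
have P1 : (P setT < +oo)%E by rewrite probability_setT ltry.
have mu1 : (mu setT < +oo)%E by rewrite probability_setT ltry.
have Iy := @bounded_integrable_fin _ _ mu y C C0 mu1 my yC.
have bb i j w : `|y (Z i w) * y (Z j w)| <= C ^+ 2.
  by rewrite normrM expr2; exact: ler_pM.
have myZ i : measurable_fun setT (fun w => y (Z i w)) by exact: measurableT_comp.
have ib i j : P.-integrable setT (fun w => (y (Z i w) * y (Z j w))%:E).
  apply: (@bounded_integrable_fin _ _ P (fun w => y (Z i w) * y (Z j w)) (C ^+ 2)) => //.
    exact: sqr_ge0.
  exact: measurable_funM.
rewrite (eq_integral (fun w => \sum_(i < n) \sum_(j < n) (y (Z i w) * y (Z j w))%:E)%E); last first.
  move=> w _; rewrite expr2 mulr_suml -sumEFin; apply: eq_bigr => i _.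
  by rewrite mulr_sumr -sumEFin.
rewrite integral_sum//; last by move=> i; apply: integrable_sum => // j.
rewrite (eq_bigr (fun i : 'I_n => \int[P]_w (y (Z i w) * y (Z i w))%:E)%E); last first.
  move=> i _; rewrite integral_sum// (bigD1 i)//= big1 ?adde0// => j ji.
  have mh : measurable_fun setT (fun z : T * T => y z.1 * y z.2).
    apply: measurable_funM; first exact: (measurableT_comp my measurable_fst).
    exact: (measurableT_comp my measurable_snd).
  have hb (z : T * T) : `|y z.1 * y z.2| <= C ^+ 2 by rewrite normrM expr2; exact: ler_pM.
  have ij : nat_of_ord i != nat_of_ord j by rewrite eq_sym.
  have mp : measurable_fun setT (fun w => (Z i w, Z j w)) by exact: measurable_fun_pair.
  have := @bounded_integral_law _ _ P _ _ (mu \x mu)%E _ mp (iid_pair ij)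
    (fun z => y z.1 * y z.2) (C ^+ 2) mh (sqr_ge0 _) hb; rewrite /= => ->.
  have mumu : ((mu \x mu)%E [set: T * T] < +oo)%E.
    by rewrite -setXTT product_measure1E//= !probability_setT mule1 ltry.
  rewrite -(@integral12_prod_meas1 _ _ _ _ _ mu mu (fun z => (y z.1 * y z.2)%:E)); last first.
    exact: (@bounded_integrable_fin _ _ (mu \x mu)%E _ (C ^+ 2) (sqr_ge0 _) mumu mh hb).
  apply: integral0_eq => x _; rewrite /fubini_F /=.
  under eq_integral do rewrite EFinM.
  by rewrite (integralZl measurableT Iy) y0 mule0.
apply: (@le_trans _ _ (\sum_(i < n) (C ^+ 2)%:E)%E); last first.
  by rewrite sumEFin lee_fin sumr_const card_ord -[leLHS]mulr_natl.
apply: lee_sum => i _.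
rewrite -[leRHS]mule1 -(probability_setT P) -integral_cst//.
apply: ge0_le_integral => //=.
- by move=> w _; rewrite lee_fin -expr2 sqr_ge0.
- by apply/measurable_EFinP; exact: measurable_funM.
- by move=> w _; rewrite lee_fin; apply: le_trans (ler_norm _) (bb _ _ _).
Qed.

Lemma truncation_L1 (phi : T -> R) : mu.-integrable setT (EFin \o phi) ->
  forall eps : R, 0 < eps -> exists2 K : nat,
    True & (\int[mu]_x (`|(if `|phi x| <= K%:R then phi x else 0) - phi x|)%:E <= eps%:E)%E.
Proof.
move=> iphi eps e0; have mphi : measurable_fun setT phi.
  by apply/measurable_EFinP; exact: measurable_int iphi.
have mn : measurable_fun setT (fun x => `|phi x|) by exact: measurableT_comp.
pose f (K : nat) x := if `|phi x| <= K%:R then phi x else 0.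
have mf k : measurable_fun setT (f k).
  by apply: measurable_fun_ifT => //; exact: measurable_fun_ler.
have fc x : f ^~ x @ \oo --> phi x.
  apply: cvgr_near => e e1; exists (Num.truncn `|phi x|).+1 => // k /= hk.
  rewrite /f ifT ?subrr ?normr0 ?(ltW e1)//.
  by apply: ltW; apply: lt_le_trans (truncnS_gt _) _; rewrite ler_nat.
have ifin : (\int[mu]_x (`|phi x|)%:E < +oo)%E by have /integrableP[_] := iphi.
have fle : \forall k \near \oo, forall x, `|f k x| <= `|phi x|.
  by apply: nearW => k x; rewrite /f; case: ifP => // _; rewrite normr0.
have [K _ HK] := dominated_near mf mphi mn fc ifin (fun x => normr_ge0 _) fle e0.
by exists K => //; apply: HK => /=.
Qed.

(** Khinchin's weak law, under integrability alone: [phi] is truncated at a level [K], the centred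
    truncation is treated by its second moment, and the remainder by Markov's inequality. *)
Lemma wlln (phi : T -> R) (eps : R) : mu.-integrable setT (EFin \o phi) -> 0 < eps ->
  prob_to1 P (fun n => [set w |
    `|n%:R^-1 * (\sum_(j < n) phi (Z j w)) - fine (\int[mu]_x (phi x)%:E)| <= eps]).
Proof.
move=> iphi e0; have mphi : measurable_fun setT phi.
  by apply/measurable_EFinP; exact: measurable_int iphi.
set m := fine _.
pose A n := [set w | `|n%:R^-1 * (\sum_(j < n) phi (Z j w)) - m| <= eps].
have mA n : measurable (A n).
  have mS : measurable_fun setT (fun w => `|n%:R^-1 * (\sum_(j < n) phi (Z j w)) - m|).
    apply: measurableT_comp => //; apply: measurable_funB => //; apply: measurable_funM => //.
    by apply: measurable_sum => j; exact: measurableT_comp.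
  have := mS measurableT _ (measurable_itv `]-oo, eps]); rewrite setTI.
  by congr measurable; apply/seteqP; split => w /=; rewrite in_itv.
apply: (@prob_to1_lim _ _ _ P A _ mA) => [n w //|delta d0].
(* The first bound limits the shift of the mean by truncation; the second makes Markov's bound
   [3 * tau / eps] for the remainder at most [delta / 2]. *)
pose tau := Num.min (eps / 3) (delta * eps / 6).
have tau0 : 0 < tau by rewrite lt_min !divr_gt0// mulr_gt0.
have [K _ HK] := truncation_L1 iphi tau0.
pose psi x := if `|phi x| <= K%:R then phi x else 0.
have mpsi : measurable_fun setT psi.
  by apply: measurable_fun_ifT => //; apply: measurable_fun_ler => //; exact: measurableT_comp.
have psiK x : `|psi x| <= K%:R by rewrite /psi; case: ifP => // _; rewrite normr0.
have mu1 : (mu setT < +oo)%E by rewrite probability_setT ltry.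
have ipsi := @bounded_integrable_fin _ _ mu psi K%:R (ler0n _ _) mu1 mpsi psiK.
pose chi x := `|psi x - phi x|.
have mchi : measurable_fun setT chi by apply: measurableT_comp => //; exact: measurable_funB.
pose a := fine (\int[mu]_x (psi x)%:E).
have fpsi : (\int[mu]_x (psi x)%:E = a%:E)%E by rewrite fineK//; exact: integrable_fin_num ipsi.
have fphi : (\int[mu]_x (phi x)%:E = m%:E)%E by rewrite fineK//; exact: integrable_fin_num iphi.
have am : `|a - m| <= eps / 3.
  rewrite -lee_fin -abse_EFin EFinB -fpsi -fphi -integralB_EFin//.
  apply: le_trans (le_abse_integral _ _ _) _ => //.
    by apply: emeasurable_funB; exact/measurable_EFinP.
  by apply: le_trans HK _; rewrite lee_fin /tau ge_min lexx.
pose y x := psi x - a.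
have my : measurable_fun setT y by exact: measurable_funB.
pose C := K%:R + `|a|.
have C0 : 0 <= C by rewrite addr_ge0.
have yC x : `|y x| <= C by apply: le_trans (ler_normB _ _) _; rewrite lerD2r.
have y0 : (\int[mu]_x (y x)%:E = 0)%E.
  under eq_integral do rewrite EFinB.
  rewrite integralB_EFin//; last exact: finite_measure_integrable_cst.
  have Ia : (\int[mu]_x (cst a%:E x) = a%:E)%E.
    by rewrite integral_cst // -[RHS]mule1; congr (_ * _)%E; exact: probability_setT.
  by rewrite fpsi Ia subee.
pose B n := [set w | (n%:R * (eps / 3)) ^+ 2 <= (\sum_(j < n) y (Z j w)) ^+ 2].
pose D n := [set w | n%:R * (eps / 3) <= \sum_(j < n) chi (Z j w)].
have mZf (h : T -> R) n : measurable_fun setT h ->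
    measurable_fun setT (fun w => \sum_(j < n) h (Z j w)).
  by move=> mh; apply: measurable_sum => j; exact: measurableT_comp.
have mge (h : Omega -> R) c : measurable_fun setT h -> measurable [set w | c <= h w].
  move=> mh; have := mh measurableT _ (measurable_itv `[c, +oo[); rewrite setTI.
  by congr measurable; apply/seteqP; split => x /=; rewrite in_itv /= andbT.
have mB n : measurable (B n) by apply: mge; apply: measurable_funX; exact: mZf.
have mD n : measurable (D n) by apply: mge; exact: mZf.
have e3 : 0 < eps / 3 by rewrite divr_gt0.
(* The second-moment bound is [9 * C ^+ 2 / (n * eps ^+ 2)], which is at most [delta / 2] from this
   [n] on. *)
pose n0 := (Num.truncn (18 * C ^+ 2 / (eps ^+ 2 * delta))).+1.
exists n0 => // n /= n0n.
have npos : 0 < n%:R :> R by rewrite ltr0n (leq_trans _ n0n).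
have nlarge : 18 * C ^+ 2 / (eps ^+ 2 * delta) <= n%:R.
  by apply: ltW; apply: lt_le_trans (truncnS_gt _) _; rewrite ler_nat.
have sub : ~` A n `<=` B n `|` D n.
  move=> w /= /negP; rewrite -ltNge => Hw.
  have [|nB] := leP (n%:R * (eps / 3)) (`|\sum_(j < n) y (Z j w)|).
    move=> h; left; rewrite /B /= -(real_normK (num_real (\sum_(j < n) _))).
    by rewrite lerXn2r// ?nnegrE// mulr_ge0// ltW.
  right; rewrite /D /= leNgt; apply/negP => nD.
  have E : n%:R^-1 * (\sum_(j < n) phi (Z j w)) - m =
      n%:R^-1 * (\sum_(j < n) y (Z j w)) - n%:R^-1 * (\sum_(j < n) (psi (Z j w) - phi (Z j w))) + (a - m).
    have -> : \sum_(j < n) y (Z j w) = \sum_(j < n) psi (Z j w) - n%:R * a.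
      by rewrite /y sumrB sumr_const card_ord mulr_natl.
    rewrite sumrB; move: (\sum_(j < n) _) (\sum_(j < n) _) => s1 s2.
    by field; rewrite gt_eqF.
  have h1 : `|n%:R^-1 * (\sum_(j < n) y (Z j w))| < eps / 3.
    by rewrite normrM ger0_norm ?invr_ge0// ltr_pdivrMl.
  have h2 : `|n%:R^-1 * (\sum_(j < n) (psi (Z j w) - phi (Z j w)))| < eps / 3.
    rewrite normrM ger0_norm ?invr_ge0// ltr_pdivrMl//.
    exact: le_lt_trans (ler_norm_sum _ _ _) nD.
  move: Hw; rewrite E; apply/negP; rewrite -leNgt.
  apply: le_trans (ler_normD _ _) _; apply: le_trans (lerD (ler_normB _ _) am) _.
  by move: h1 h2; move: (`|_|) (`|_|) => x1 x2; lra.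
apply: le_trans (le_measure P _ _ sub) _; rewrite ?inE//.
- by apply: measurableC.
- exact: measurableU.
apply: le_trans (measureU2 _ _ _) _ => //.
rewrite (splitr delta) EFinD; apply: leeD.
  have c0 : 0 < (n%:R * (eps / 3)) ^+ 2 by rewrite exprn_gt0// mulr_gt0.
  have mS : measurable_fun setT (fun w => (\sum_(j < n) y (Z j w)) ^+ 2).
    by apply: measurable_funX; exact: mZf.
  apply: le_trans (markov_ge P c0 mS (fun w => sqr_ge0 _)) _.
  apply: le_trans (lee_wpmul2l _ (iid_second_moment n my C0 yC y0)) _.
    by rewrite lee_fin invr_ge0 ltW.
  rewrite -EFinM lee_fin mulrC ler_pdivrMr//.
  move: nlarge; rewrite ler_pdivrMr ?mulr_gt0 ?exprn_gt0// => nl.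
  have := ler_wpM2l (ltW npos) nl; rewrite !expr2.
  by move: (C * C) => cc; lra.
have c0 : 0 < n%:R * (eps / 3) by rewrite mulr_gt0.
have S0 w : 0 <= \sum_(j < n) chi (Z j w) by apply: sumr_ge0 => j _; exact: normr_ge0.
apply: le_trans (markov_ge P c0 (mZf chi n mchi) S0) _.
have IS : (\int[P]_w (\sum_(j < n) chi (Z j w))%:E <= (n%:R * tau)%:E)%E.
  under eq_integral do rewrite -sumEFin.
  rewrite ge0_integral_sum//=.
  - rewrite (_ : n%:R * tau = \sum_(j < n) tau); last by rewrite sumr_const card_ord mulr_natl.
    rewrite -sumEFin; apply: lee_sum => j _.
    by rewrite (ge0_integral_law (mZ j) (@lawZ j) mchi (fun x => normr_ge0 _)).
  - by move=> j; apply/measurable_EFinP; exact: (measurableT_comp mchi (mZ j)).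
  - by move=> j w _; rewrite lee_fin; exact: normr_ge0.
apply: (@le_trans _ _ (((n%:R * (eps / 3))^-1)%:E * (n%:R * tau)%:E)%E).
  by apply: lee_wpmul2l => //; rewrite lee_fin invr_ge0 ltW.
rewrite -!EFinM lee_fin mulrC ler_pdivrMr//.
have : tau <= delta * eps / 6 by rewrite /tau ge_min lexx orbT.
by move=> /(ler_wpM2l (ltW npos)); lra.
Qed.

End iid_sequence.

End law_of_large_numbers.

(** * Law of large numbers for second differences *)

Section second_difference_lln.
Context {R : realType} {d0} {Omega : measurableType d0} (P : probability Omega R).
Context {d'} {T : measurableType d'} (mu : probability T R) (Z : nat -> Omega -> T).
Context {d : nat}.
Variables (f : T -> 'rV[R]_d -> R) (ts : 'rV[R]_d) (M : T -> R) (r : R).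
Hypothesis iidZ : iid P Z mu.
Hypothesis r0 : 0 < r.
Hypothesis mf : forall t, `|t - ts| <= r -> measurable_fun setT (f ^~ t).
Hypothesis f_diff : forall t, `|t - ts| <= r -> forall x, ntimes_differentiable 2 (f x) t.
Hypothesis f_hess : forall t, `|t - ts| <= r -> forall x i j, `|hess (f x) t i j| <= M x.
Hypothesis iM : mu.-integrable setT (EFin \o M).

Definition ddq (h : R) (i j : 'I_d) (g : 'rV[R]_d -> R) : R :=
  dd g (h *: delta_mx ord0 i) (h *: delta_mx ord0 j) ts / h ^+ 2.

Lemma norm_two_steps (h s t : R) (i j : 'I_d) : 0 <= h <= r / 2 -> 0 <= s <= 1 -> 0 <= t <= 1 ->
  `|ts + s *: (h *: delta_mx ord0 i) + t *: (h *: delta_mx ord0 j) - ts| <= r.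
Proof.
move=> /andP[h0 hr] /andP[s0 s1] /andP[t0 t1].
have H (a : R) k : 0 <= a -> a <= 1 -> `|a *: (h *: delta_mx ord0 k) : 'rV[R]_d| <= r / 2.
  move=> a0 a1; rewrite !normrZ (ger0_norm a0) (ger0_norm h0).
  apply: le_trans hr; rewrite -[leRHS]mul1r; apply: ler_pM => //; first by rewrite mulr_ge0.
  by rewrite -[leRHS]mulr1 ler_wpM2l// norm_delta_mx.
rewrite -(addrA ts) addrAC subrr add0r (le_trans (ler_normD _ _))// (splitr r).
by apply: lerD; exact: H.
Qed.

Lemma ddq_bound h i j x : 0 < h <= r / 2 -> `|ddq h i j (f x)| <= M x.
Proof.
move=> /andP[h0 hr]; have h01 : 0 <= h <= r / 2 by rewrite (ltW h0).
have [|s [t [s01 t01 E]]] := @dd_MVT2 R d (f x) (h *: delta_mx ord0 i) (h *: delta_mx ord0 j) ts.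
  by move=> s t s01 t01; apply: f_diff; exact: norm_two_steps.
rewrite /ddq E bilZl bilZr bil_delta mulrA -expr2 mulrC mulKf ?gt_eqF ?exprn_gt0//.
by apply: f_hess; exact: norm_two_steps.
Qed.

Lemma measurable_ddq h i j : 0 < h <= r / 2 -> measurable_fun setT (fun x => ddq h i j (f x)).
Proof.
move=> /andP[h0 hr]; have h01 : 0 <= h <= r / 2 by rewrite (ltW h0).
have A s t : 0 <= s <= 1 -> 0 <= t <= 1 -> measurable_fun setT
    (f ^~ (ts + s *: (h *: delta_mx ord0 i) + t *: (h *: delta_mx ord0 j))).
  by move=> s01 t01; apply: mf; exact: norm_two_steps.
have z : 0 <= (0 : R) <= 1 by rewrite lexx ler01.
have o : 0 <= (1 : R) <= 1 by rewrite lexx ler01.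
have := A _ _ o o; have := A _ _ o z; have := A _ _ z o; have := A _ _ z z.
rewrite !scale1r !scale0r !addr0 => m00 m01 m10 m11.
apply: measurable_funM => //; apply: measurable_funD => //; apply: measurable_funB => //.
exact: measurable_funB.
Qed.

(** As the step tends to 0 the difference quotients converge pointwise to the Hessian entry and are
    dominated by [M], so some small step has mean close to the expected Hessian. That step is then
    frozen, and the weak law needs to be applied to one function only. *)
Lemma ddq_expectation i j (eta h0 : R) : 0 < eta -> 0 < h0 -> exists h : R,
  [/\ 0 < h, h < h0, h <= r / 2, mu.-integrable setT (fun x => (ddq h i j (f x))%:E) &
   `|fine (\int[mu]_x (ddq h i j (f x))%:E) - expectation_mx mu (fun x => hess (f x) ts) i j| <= eta].
Proof.
move=> eta0 h00; pose rr := Num.min (r / 2) (h0 / 2).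
have rr0 : 0 < rr by rewrite lt_min !divr_gt0.
pose hk (k : nat) := rr / k.+1%:R.
have hk0 k : 0 < hk k by rewrite divr_gt0.
have hkr k : hk k <= rr by rewrite /hk ler_pdivrMr// ler_peMr ?(ltW rr0)// ler1n.
have hkr2 k : 0 < hk k <= r / 2.
  by rewrite hk0/= (le_trans (hkr k))// /rr ge_min lexx.
have mk k := measurable_ddq i j (hkr2 k).
have ts0 : `|ts - ts| <= r by rewrite subrr normr0 ltW.
have cv x : (fun k => ddq (hk k) i j (f x)) @ \oo --> hess (f x) ts i j.
  apply: cvgr_near => eps e0.
  have [dl dl0 H] := dd_hess_cvg (delta_mx ord0 i) (delta_mx ord0 j) (f_diff ts0 x) e0.
  exists (Num.truncn (rr / dl)).+1 => // k /= hkk.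
  have hkd : 0 < hk k < dl.
    rewrite hk0/= /hk ltr_pdivrMr// -ltr_pdivrMl// mulrC.
    by apply: lt_le_trans (truncnS_gt _) _; rewrite ler_nat leqW.
  have Sx : hess (f x) ts j i = hess (f x) ts i j.
    by rewrite -[in LHS](hess_sym (f_diff ts0 x)) mxE.
  by have := H _ hkd; rewrite bil_delta Sx /ddq (mulrC (dd _ _ _ _)).
(* The Hessian entry is measurable as a pointwise limit of difference quotients. *)
have mH : measurable_fun setT (fun x => hess (f x) ts i j).
  exact: (@measurable_fun_cvg _ _ _ setT (fun k x => ddq (hk k) i j (f x)) _ mk (fun x _ => cv x)).
have mM : measurable_fun setT M by apply/measurable_EFinP; exact: measurable_int iM.
have M0 x : 0 <= M x by apply: le_trans (f_hess ts0 x i j).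
have iMoo : (\int[mu]_x (M x)%:E < +oo)%E.
  have /integrableP[_] := iM; congr (_ < _)%E; apply: eq_integral => x _ /=.
  by rewrite ger0_norm.
have bk : \forall k \near \oo, forall x, `|ddq (hk k) i j (f x)| <= M x.
  by apply: nearW => k x; exact: ddq_bound.
have [K _ HK] := dominated_near mk mH mM cv iMoo M0 bk eta0.
have {}HK := HK K (leqnn K).
have iB (g : T -> R) : measurable_fun setT g -> (forall x, `|g x| <= M x) ->
    mu.-integrable setT (fun x => (g x)%:E).
  move=> mg gM; apply: (le_integrable measurableT _ _ iM); first exact/measurable_EFinP.
  by move=> x _ /=; rewrite lee_fin (le_trans (gM x))// ler_norm.
have ik := iB _ (mk K) (fun x => ddq_bound i j x (hkr2 K)).
have iH := iB _ mH (fun x => f_hess ts0 x i j).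
exists (hk K); split=> //.
- apply: le_lt_trans (hkr K) _; apply: le_lt_trans (_ : rr <= h0 / 2) _.
    by rewrite /rr ge_min lexx orbT.
  by rewrite ltr_pdivrMr// ltr_pMr// ltr1n.
- by have /andP[] := hkr2 K.
rewrite mxE unlock; set fa := fine _; set fb := fine _.
have Ea : (\int[mu]_x (ddq (hk K) i j (f x))%:E = fa%:E)%E.
  by rewrite fineK//; exact: integrable_fin_num ik.
have Eb : (\int[mu]_x (hess (f x) ts i j)%:E = fb%:E)%E.
  by rewrite fineK//; exact: integrable_fin_num iH.
rewrite -lee_fin -abse_EFin EFinB -Ea -Eb -integralB_EFin//.
apply: le_trans HK; apply: le_abse_integral => //.
by apply: emeasurable_funB; exact/measurable_EFinP.
Qed.

Lemma dd_sum_fun (n : nat) (g : 'I_n -> 'rV[R]_d -> R) u v x :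
  dd (fun t => \sum_(j < n) g j t) u v x = \sum_(j < n) dd (g j) u v x.
Proof. by rewrite /dd big_split/= sumrB sumrB. Qed.

Lemma dd_lln i j (eta h0 : R) : 0 < eta -> 0 < h0 -> exists h : R, [/\ 0 < h, h < h0 &
  prob_to1 P (fun n => [set w |
    `|dd (fun t => \sum_(l < n) f (Z l w) t) (h *: delta_mx ord0 i) (h *: delta_mx ord0 j) ts
       / (n%:R * h ^+ 2) - expectation_mx mu (fun x => hess (f x) ts) i j| <= eta])].
Proof.
move=> eta0 h00; have eta2 : 0 < eta / 2 by rewrite divr_gt0.
have [h [hp hh hr ih E]] := ddq_expectation i j eta2 h00.
exists h; split => //.
apply: prob_to1_sub (wlln iidZ ih eta2) => n w /= W.
rewrite dd_sum_fun; set S := (X in X / _).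
have -> : S / (n%:R * h ^+ 2) = n%:R^-1 * \sum_(l < n) ddq h i j (f (Z l w)).
  by rewrite /ddq -mulr_suml -/S invfM; ring.
apply: le_trans (ler_distD (fine (\int[mu]_x (ddq h i j (f x))%:E)) _ _) _.
by rewrite (splitr eta); exact: lerD.
Qed.

End second_difference_lln.

(** * Oscillation bounds as measurable events *)

Section oscillation_events.
Context {R : realType} {d : nat}.
Implicit Types (f : 'rV[R]_d -> R) (c x y u v : 'rV[R]_d).

Definition ratv (q : 'rV[rat]_d) : 'rV[R]_d := map_mx ratr q.

Lemma ratv_dense x (e : R) : 0 < e -> exists q, `|ratv q - x| <= e.
Proof.
move=> e0; have H i : exists q : rat, `|ratr q - x ord0 i| <= e.
  have xe : x ord0 i < x ord0 i + e by rewrite ltrDl.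
  have [q] := rat_in_itvoo xe; rewrite in_itv/= => /andP[q1 q2]; exists q.
  by rewrite ger0_norm ?subr_ge0 ?(ltW q1)// lerBlDl ltW.
have [q Hq] := choice H; exists (\row_i q i).
by apply: mx_norm_le => [|a i]; [exact: ltW|rewrite !mxE (ord1 a)].
Qed.

Lemma ratv_seq x (e : R) : 0 < e -> exists2 q : nat -> 'rV[rat]_d,
  forall k, `|ratv (q k) - x| <= e & (fun k => ratv (q k)) @ \oo --> x.
Proof.
move=> e0; have H (k : nat) : exists q, `|ratv q - x| <= e / k.+1%:R.
  by apply: ratv_dense; rewrite divr_gt0.
have [q Hq] := choice H; exists q.
  by move=> k; rewrite (le_trans (Hq k))// ler_pdivrMr// ler_peMr ?(ltW e0)// ler1n.
apply/cvgrPdist_le => eps eps0; exists (Num.truncn (e / eps)).+1 => // k /= hk.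
rewrite distrC (le_trans (Hq k))// ler_pdivrMr// -ler_pdivrMl// mulrC.
by apply/ltW/(lt_le_trans (truncnS_gt _)); rewrite ler_nat leqW.
Qed.

(** The sequences stay in [U], because nothing is known about [f] outside the ball. *)
Definition seq_cont f (U : set 'rV[R]_d) := forall x (x_ : nat -> 'rV[R]_d),
  U x -> (forall k, U (x_ k)) -> x_ @ \oo --> x -> (fun k => f (x_ k)) @ \oo --> f x.

Definition osc0 f c (rho C : R) := forall x y,
  `|x - c| <= rho -> `|y - c| <= rho -> `|f x - f y| <= C.

Lemma osc0_ratv f c (rho C : R) : 0 < rho -> seq_cont f [set x | `|x - c| <= rho] ->
  (forall p q, `|ratv p - c| <= rho -> `|ratv q - c| <= rho -> `|f (ratv p) - f (ratv q)| <= C) ->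
  osc0 f c (rho / 2) C.
Proof.
move=> rho0 fc H x y xc yc; have r2 : 0 < rho / 2 by rewrite divr_gt0.
have [p pk px] := ratv_seq x r2; have [q qk qy] := ratv_seq y r2.
have near (z a : 'rV[R]_d) : `|z - c| <= rho / 2 -> `|a - z| <= rho / 2 -> `|a - c| <= rho.
  move=> h1 h2; rewrite -(subrK z a) -addrA (le_trans (ler_normD _ _))// (splitr rho).
  exact: lerD.
have r2r : rho / 2 <= rho by rewrite ler_pdivrMr// ler_peMr ?(ltW rho0)// ler1n.
have cx := fc x _ (le_trans xc r2r) (fun k => near _ _ xc (pk k)) px.
have cy := fc y _ (le_trans yc r2r) (fun k => near _ _ yc (qk k)) qy.
have cxy : (fun k => `|f (ratv (p k)) - f (ratv (q k))|) @ \oo --> `|f x - f y|.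
  by apply: cvg_norm; exact: cvgB.
apply: (ler_cvg_to cxy (cvg_cst C)); apply: nearW => k.
by apply: H; [exact: near xc (pk k)|exact: near yc (qk k)].
Qed.

Lemma dd_osc_ratv f c (rho C : R) : 0 < rho -> seq_cont f [set x | `|x - c| <= rho] ->
  (forall p q a b, pgram_in c rho (ratv a) (ratv b) (ratv p) ->
    pgram_in c rho (ratv a) (ratv b) (ratv q) ->
    `|dd f (ratv a) (ratv b) (ratv p) - dd f (ratv a) (ratv b) (ratv q)|
      <= C * (`|ratv a| * `|ratv b|)) ->
  dd_osc f c (rho / 2) C.
Proof.
move=> rho0 fc H x y u v pgx pgy; have r2 : 0 < rho / 2 by rewrite divr_gt0.
(* The far vertex moves by at most three approximation errors, [3 * (rho / 6) = rho / 2], so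
   rational parallelograms stay in the ball of radius [rho]. *)
have r6 : 0 < rho / 6 by rewrite divr_gt0.
have [p pk px] := ratv_seq x r6; have [q qk qy] := ratv_seq y r6.
have [a ak au] := ratv_seq u r6; have [b bk bv] := ratv_seq v r6.
have near (z : 'rV[R]_d) (s w : 'rV[R]_d) : `|z - c| <= rho / 2 -> `|s - z| <= rho / 2 -> `|s - c| <= rho.
  move=> h1 h2; rewrite -(subrK z s) -addrA (le_trans (ler_normD _ _))// (splitr rho).
  exact: lerD.
have r2r : rho / 2 <= rho by rewrite ler_pdivrMr// ler_peMr ?(ltW rho0)// ler1n.
have key (z : 'rV[R]_d) (o : nat -> 'rV[rat]_d) : pgram_in c (rho / 2) u v z ->
    (forall k, `|ratv (o k) - z| <= rho / 6) -> (fun k => ratv (o k)) @ \oo --> z ->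
    (forall k, pgram_in c rho (ratv (a k)) (ratv (b k)) (ratv (o k))) /\
    (fun k => dd f (ratv (a k)) (ratv (b k)) (ratv (o k))) @ \oo --> dd f u v z.
  move=> [z1 z2 z3 z4] ok oz.
  have P1 k : `|ratv (o k) - c| <= rho by apply: near z1 _ => //; apply: le_trans (ok k) _; lra.
  have P2 k : `|ratv (o k) + ratv (a k) - c| <= rho.
    apply: near z2 _ => //; rewrite opprD addrACA.
    by apply: le_trans (ler_normD _ _) _; have := ok k; have := ak k; lra.
  have P3 k : `|ratv (o k) + ratv (b k) - c| <= rho.
    apply: near z3 _ => //; rewrite opprD addrACA.
    by apply: le_trans (ler_normD _ _) _; have := ok k; have := bk k; lra.
  have P4 k : `|ratv (o k) + ratv (a k) + ratv (b k) - c| <= rho.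
    apply: near z4 _ => //; rewrite opprD addrACA.
    apply: le_trans (ler_normD _ _) _.
    have := ler_normD (ratv (o k) - z) (ratv (a k) - u); rewrite addrACA -opprD.
    by have := ok k; have := ak k; have := bk k; lra.
  split; first by move=> k; split.
  rewrite /dd; apply: cvgD; last exact: fc (le_trans z1 r2r) P1 oz.
  apply: cvgB; last by apply: fc (le_trans z3 r2r) P3 _; exact: cvgD.
  apply: cvgB; last by apply: fc (le_trans z2 r2r) P2 _; exact: cvgD.
  by apply: fc (le_trans z4 r2r) P4 _; apply: cvgD => //; exact: cvgD.
have [Px cx] := key x p pgx pk px; have [Py cy] := key y q pgy qk qy.
have cL : (fun k => `|dd f (ratv (a k)) (ratv (b k)) (ratv (p k)) - dd f (ratv (a k)) (ratv (b k)) (ratv (q k))|)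
    @ \oo --> `|dd f u v x - dd f u v y|.
  by apply: cvg_norm; exact: cvgB.
have cR : (fun k => C * (`|ratv (a k)| * `|ratv (b k)|)) @ \oo --> C * (`|u| * `|v|).
  by apply: cvgM; [exact: cvg_cst|apply: cvgM; exact: cvg_norm].
apply: (ler_cvg_to cL cR); apply: nearW => k; exact: H.
Qed.

Context {d0} {Omega : measurableType d0} (P : probability Omega R).

Lemma measurable_forall_count (I : countType) (S : I -> set Omega) :
  (forall i, measurable (S i)) -> measurable [set w | forall i, S i w].
Proof.
move=> mS; rewrite (_ : [set w | _] = \bigcap_(n in [set: nat]) (oapp S setT (@choice.unpickle I n))).
  apply: bigcap_measurable => [|n _]; first by exists 0%N.
  by case: (@choice.unpickle I n) => [i|] /=; [exact: mS|exact: measurableT].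
apply/seteqP; split => w /=.
  by move=> H n _; case: (@choice.unpickle I n) => // i; exact: H.
by move=> H i; have := H (choice.pickle i) Logic.I; rewrite choice.pickleK.
Qed.

Lemma measurable_le (g : Omega -> R) (C : R) (B : Prop) : (B -> measurable_fun setT g) ->
  measurable [set w | B -> g w <= C].
Proof.
move=> mg; have [b|nb] := pselect B; last first.
  by rewrite (_ : [set w | _] = setT)//; apply/seteqP; split => // w _ /nb.
rewrite (_ : [set w | _] = g @^-1` `]-oo, C]).
  by rewrite -[X in measurable X]setTI; exact: mg.
by apply/seteqP; split => w /=; rewrite in_itv/=; [exact|move=> h _].
Qed.

(* An event holding almost surely for all large [n] has probability tending to 1
   only if it is measurable. The oscillation over a ball is not obviously so; its
   restriction to rational points is, and continuity recovers the ball. *)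
Lemma prob_to1_ae_imp (S G : nat -> set Omega) :
  prob_to1 P G -> (forall n, measurable (S n)) ->
  {ae P, forall w, \forall n \near \oo, G n w -> S n w} -> prob_to1 P S.
Proof.
move=> /prob_to1_compl[A [mA AG HA]] mS HS.
have : prob_to1 P (fun n => ~` A n `|` S n).
  apply: prob_to1_ae_near; first by move=> n; apply: measurableU => //; exact: measurableC.
  apply: filterS HS => w; apply: filterS => n h.
  by have [/AG/h|nA] := pselect (A n w); [right|left].
have HA' : prob_to1 P A by apply: (prob_to1_lim mA) HA => n w.
move=> /(prob_to1_setI HA'); apply: prob_to1_sub => n w [Aw [|//]].
by move=> /(_ Aw).
Qed.

Section events.
Variables (f : nat -> Omega -> 'rV[R]_d -> R) (c : 'rV[R]_d) (rho : R).
Variables (G E : nat -> set Omega) (C : nat -> R).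
Hypothesis rho0 : 0 < rho.
Hypothesis mfw : forall n x, `|x - c| <= rho -> measurable_fun setT (fun w => f n w x).
Hypothesis PG : prob_to1 P G.
Hypothesis PE : prob_to1 P E.
Hypothesis Ec : forall n w, E n w -> seq_cont (f n w) [set x | `|x - c| <= rho].

(** In the applications [G] is the event [M1 < K] together with consistency, and [E] provides
    continuity; neither is assumed measurable. *)
Lemma prob_to1_osc0 :
  {ae P, forall w, \forall n \near \oo, G n w -> osc0 (f n w) c rho (C n)} ->
  prob_to1 P (fun n => [set w | osc0 (f n w) c (rho / 2) (C n)]).
Proof.
move=> HG.
pose S n := [set w | forall pq : 'rV[rat]_d * 'rV[rat]_d,
  (`|ratv pq.1 - c| <= rho /\ `|ratv pq.2 - c| <= rho) ->
  `|f n w (ratv pq.1) - f n w (ratv pq.2)| <= C n].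
have PS : prob_to1 P S.
  apply: (prob_to1_ae_imp PG).
    move=> n; apply: measurable_forall_count => -[p q] /=; apply: measurable_le => -[h1 h2].
    by apply: measurableT_comp => //; apply: measurable_funB; exact: mfw.
  by apply: filterS HG => w; apply: filterS => n H Gw [p q] /= [h1 h2]; exact: H.
apply: prob_to1_sub (prob_to1_setI PS PE) => n w [Sw Ew].
apply: osc0_ratv => //; first exact: Ec.
by move=> p q h1 h2; exact: (Sw (p, q)).
Qed.

Lemma prob_to1_dd_osc :
  {ae P, forall w, \forall n \near \oo, G n w -> dd_osc (f n w) c rho (C n)} ->
  prob_to1 P (fun n => [set w | dd_osc (f n w) c (rho / 2) (C n)]).
Proof.
move=> HG.
pose S n := [set w | forall z : ('rV[rat]_d * 'rV[rat]_d) * ('rV[rat]_d * 'rV[rat]_d),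
  (pgram_in c rho (ratv z.2.1) (ratv z.2.2) (ratv z.1.1) /\
   pgram_in c rho (ratv z.2.1) (ratv z.2.2) (ratv z.1.2)) ->
  `|dd (f n w) (ratv z.2.1) (ratv z.2.2) (ratv z.1.1)
    - dd (f n w) (ratv z.2.1) (ratv z.2.2) (ratv z.1.2)|
      <= C n * (`|ratv z.2.1| * `|ratv z.2.2|)].
have PS : prob_to1 P S.
  apply: (prob_to1_ae_imp PG).
    move=> n; apply: measurable_forall_count => -[[p q] [a b]] /=; apply: measurable_le => -[h1 h2].
    have mdd (x u v : 'rV[R]_d) : pgram_in c rho u v x -> measurable_fun setT (fun w => dd (f n w) u v x).
      move=> [*]; apply: measurable_funD; last exact: mfw.
      by apply: measurable_funB; [apply: measurable_funB|]; exact: mfw.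
    by apply: measurableT_comp => //; apply: measurable_funB; exact: mdd.
  by apply: filterS HG => w; apply: filterS => n H Gw [[p q] [a b]] /= [h1 h2]; exact: H.
apply: prob_to1_sub (prob_to1_setI PS PE) => n w [Sw Ew].
apply: dd_osc_ratv => //; first exact: Ec.
by move=> p q a b h1 h2; exact: (Sw ((p, q), (a, b))).
Qed.

End events.
End oscillation_events.

(** * The real-valued cut log-likelihood *)

Section cut_loglikelihood.
Context {R : realType} {d1 d2 : nat}.
Variables (q2 : 'rV[R]_d2 -> R) (g1 : 'rV[R]_d1 -> R) (g2 : 'rV[R]_(d1 + d2) -> R).

(** The subtracted logarithm represents [F] only where the marginal is finite. *)
Definition cut_ll1 x : R := g1 x - ln (margr q2 g2 x).

Definition cut_ll (th : 'rV[R]_(d1 + d2)) : R := cut_ll1 (lsubmx th) + g2 th.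

Lemma cut_ll_row x y : cut_ll (row_mx x y) = cut_ll1 x + g2 (row_mx x y).
Proof. by rewrite /cut_ll row_mxKl. Qed.

(** [L1 - F] depends on [theta_1] alone and takes equal values at the two ends of a step in
    [theta_2], so it cancels. *)
Lemma dd_cut_ll u v x : lsubmx v = 0 -> dd cut_ll u v x = dd g2 u v x.
Proof.
move=> v0; have lD (a b : 'rV[R]_(d1 + d2)) : lsubmx (a + b) = lsubmx a + lsubmx b.
  exact: linearD.
rewrite /dd /cut_ll !lD v0 !addr0; generalize cut_ll1 => a.
by rewrite !opprD; ring.
Qed.

End cut_loglikelihood.

Section cut_posterior_sequence.
Context {R : realType} {d1 d2 : nat}.
Variables (Th1 : set 'rV[R]_d1) (Th2 : set 'rV[R]_d2).
Variables (pi1 : 'rV[R]_d1 -> R) (pi2 : 'rV[R]_d2 -> R).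
Variables (th1s : 'rV[R]_d1) (th2s : 'rV[R]_d2).
Variables (N : nat -> nat) (f1 : nat -> 'rV[R]_d1 -> R) (f2 : nat -> 'rV[R]_(d1 + d2) -> R).
Variables (t1 : nat -> 'rV[R]_d1) (t2 : nat -> 'rV[R]_d2).
Variables (J1 : 'M[R]_d1) (Hs : 'M[R]_(d1 + d2)).

Let Theta := prodTheta Th1 Th2.
Let n k : R := (N k)%:R.
Let that k := row_mx (t1 k) (t2 k).
Let ths := row_mx th1s th2s.
Let p1 := pi1 \_ Th1.
Let p2 := pi2 \_ Th2.
Let l1 k := f1 k \_ Th1.
Let l2 k := f2 k \_ Theta.
Let J2 := - drsubmx Hs.
Let RJ := - ursubmx Hs.

Let ell k := cut_ll p2 (l1 k) (l2 k).

Hypothesis mp1 : measurable_fun setT p1.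
Hypothesis p1_ge0 : forall t, 0 <= p1 t.
Hypothesis p1_int : (\int[lebesgue_rV d1]_t (p1 t)%:E = 1)%E.
Hypothesis mp2 : measurable_fun setT p2.
Hypothesis p2_ge0 : forall t, 0 <= p2 t.
Hypothesis p2_int : (\int[lebesgue_rV d2]_t (p2 t)%:E = 1)%E.
Hypothesis ml1 : forall k, measurable_fun setT (l1 k).
Hypothesis ml2 : forall k, measurable_fun setT (l2 k).
Hypothesis argmax1 : forall k, is_argmax Th1 (f1 k) (t1 k).
Hypothesis argmax2 : forall k, is_argmax Th2 (fun t => f2 k (row_mx (t1 k) t)) (t2 k).
Hypothesis N_oo : forall A : R, \forall k \near \oo, A <= n k.
Hypothesis t1_cvg : forall eps : R, 0 < eps -> \forall k \near \oo, `|t1 k - th1s| <= eps.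
Hypothesis t2_cvg : forall eps : R, 0 < eps -> \forall k \near \oo, `|t2 k - th2s| <= eps.
Hypothesis Theta_int : exists2 r : R, 0 < r & forall x, `|x - ths| <= r -> Theta x.
Hypothesis p1s : 0 < p1 th1s.
Hypothesis p2s : 0 < p2 th2s.
Hypothesis p1_cont : forall eps : R, 0 < eps -> exists2 r : R, 0 < r &
  forall x, `|x - th1s| <= r -> `|p1 x - p1 th1s| <= eps.
Hypothesis p2_cont : forall eps : R, 0 < eps -> exists2 r : R, 0 < r &
  forall x, `|x - th2s| <= r -> `|p2 x - p2 th2s| <= eps.
Hypothesis sep1 : forall delta : R, 0 < delta -> exists2 gamma : R, 0 < gamma &
  \forall k \near \oo, forall x, Th1 x -> delta <= `|x - t1 k| ->
    f1 k x - f1 k (t1 k) <= - gamma * n k.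
Hypothesis sep2 : forall delta2 : R, 0 < delta2 -> exists delta1 gamma : R,
  [/\ 0 < delta1, 0 < gamma & \forall k \near \oo, forall x t,
    Th1 x -> Th2 t -> `|x - t1 k| < delta1 -> delta2 <= `|t - t2 k| ->
    f2 k (row_mx x t) - f2 k (that k) <= - gamma * n k].
Hypothesis osc2 : forall eta : R, 0 < eta -> exists2 rho : R, 0 < rho &
  \forall k \near \oo, osc0 (l2 k) ths rho (eta * n k).
Hypothesis fin_near : exists2 rho : R, 0 < rho & \forall k \near \oo,
  forall x, `|x - th1s| <= rho -> marg p2 (l2 k) x \is a fin_num.
Hypothesis osc_ell : forall eta : R, 0 < eta -> exists2 rho : R, 0 < rho &
  \forall k \near \oo, dd_osc (ell k) ths rho (eta * n k).
Hypothesis ell_diff : \forall k \near \oo, ntimes_differentiable 2 (ell k) (that k).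
Hypothesis pJ1 : posdefmx J1.
Hypothesis pJ2 : posdefmx J2.
Hypothesis lln1 : forall i j (eta h0 : R), 0 < eta -> 0 < h0 -> exists h : R,
  [/\ 0 < h, h < h0 & \forall k \near \oo,
    `|dd (l1 k) (h *: delta_mx ord0 i) (h *: delta_mx ord0 j) th1s / (n k * h ^+ 2)
      + J1 i j| <= eta].
Hypothesis lln2 : forall i j (eta h0 : R), 0 < eta -> 0 < h0 -> exists h : R,
  [/\ 0 < h, h < h0 & \forall k \near \oo,
    `|dd (l2 k) (h *: delta_mx ord0 i) (h *: delta_mx ord0 j) ths / (n k * h ^+ 2)
      - Hs i j| <= eta].

Lemma l1_in k x : Th1 x -> l1 k x = f1 k x.
Proof. by move=> T; rewrite /l1 patchE mem_set. Qed.

Lemma l2_in k x t : Th1 x -> Th2 t -> l2 k (row_mx x t) = f2 k (row_mx x t).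
Proof.
by move=> T T'; rewrite /l2 patchE mem_set//; split; rewrite ?row_mxKl ?row_mxKr.
Qed.

Lemma t_in k : Th1 (t1 k) /\ Th2 (t2 k).
Proof. by have [? _] := argmax1 k; have [? _] := argmax2 k. Qed.

Lemma l2_max k t : Th2 t -> l2 k (row_mx (t1 k) t) <= l2 k (row_mx (t1 k) (t2 k)).
Proof.
by have [T1 T2] := t_in k; move=> Tt; rewrite !l2_in//; have [_] := argmax2 k; apply.
Qed.

Lemma dd_ell k u v x : lsubmx v = 0 -> dd (ell k) u v x = dd (l2 k) u v x.
Proof. exact: dd_cut_ll. Qed.

Lemma quad_cut : quad_approx p2 N l1 l2 t1 t2 J2 RJ
  (fun k => score1 ell t1 t2 k) (fun k => info1 n ell t1 t2 k).
Proof.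
move=> eta eta0; have [r0 r00 Hfin] := fin_near; have [r1 r10 Hint] := Theta_int.
have ell_max : \forall k \near \oo, exists2 r : R, 0 < r &
    forall u : 'rV[R]_d2, `|u| <= r -> ell k (that k + row_mx 0 u) <= ell k (that k).
  have r2 : 0 < r1 / 2 by rewrite divr_gt0.
  have r2r : r1 / 2 <= r1 by rewrite ler_pdivrMr// ler_peMr ?(ltW r10)// ler1n.
  have := t1_cvg r2; apply: filter_app; apply: filterS (t2_cvg r2) => k c2 c1.
  exists (r1 / 2) => // u ur; rewrite add_row_mx addr0 /ell !cut_ll_row lerD2l; apply: l2_max.
  have [_] : Theta (row_mx (t1 k) (t2 k + u)).
    apply: Hint; rewrite norm_row_mxB ge_max (le_trans c1 r2r)/=.
    by rewrite addrAC (le_trans (ler_normD _ _))// (splitr r1) lerD.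
  by rewrite row_mxKr.
have [rho rho0 H] := quad_expansion N_oo t1_cvg t2_cvg dd_ell osc_ell ell_diff ell_max lln2 eta0.
exists (Num.min rho (r0 / 2)); first by rewrite lt_min rho0 divr_gt0.
have r02 : 0 < r0 / 2 by rewrite divr_gt0.
have := H; apply: filter_app; have := Hfin; apply: filter_app; apply: filterS (t1_cvg r02).
move=> k c1 {}Hfin {}H u1 u2; rewrite !le_min => /andP[a1 a2] /andP[b1 b2]; split.
  by apply: Hfin; rewrite addrAC (le_trans (ler_normD _ _))// (splitr r0) lerD.
have := H _ _ a1 b1; rewrite add_row_mx /ell !cut_ll_row /cut_ll1.
move: (ln (margr p2 (l2 k) (t1 k + u1))) (ln (margr p2 (l2 k) (t1 k))) => a b.
move: (l1 k (t1 k + u1)) (l1 k (t1 k)) (l2 k (row_mx (t1 k + u1) _)) (l2 k (row_mx (t1 k) (t2 k))) => c e f g.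
by congr (`|_ - _ + _| <= _); ring.
Qed.

Lemma tv_distance_eqr d (T : measurableType d) (mu nu nu' : set T -> \bar R) :
  (forall A, measurable A -> nu A = nu' A) -> tv_distance mu nu = tv_distance mu nu'.
Proof.
move=> H; congr ereal_sup; apply/seteqP.
by split => _ [A mA <-]; exists A => //; rewrite H.
Qed.

Lemma tv_cut_seq (eps : R) : 0 < eps -> \forall k \near \oo,
  (tv_distance
    (pushforward (law_prop (lebesgue_rV (d1 + d2)) Theta
       (fun th => expeR ((f1 k (lsubmx th) + f2 k th)%:E -
          lne (\int[lebesgue_rV d2]_(t in Th2) (expR (f2 k (row_mx (lsubmx th) t)) * pi2 t)%:E)) *
         (pi1 (lsubmx th) * pi2 (rsubmx th))%:E))
       (fun t => Num.sqrt (n k) *: (t - that k)))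
    (mvnormal 0%R (invmx (joint_info J1 J2 RJ))) < eps%:E)%E.
Proof.
move=> eps0.
have p1_out t : ~ Th1 t -> p1 t = 0 by move=> nt; rewrite /p1 patchC// inE.
have p2_out' t : ~ Th2 t -> p2 t = 0 by move=> nt; rewrite /p2 patchC// inE.
have max1 k x : Th1 x -> l1 k x <= l1 k (t1 k).
  by have [T1 _] := t_in k; move=> Tx; rewrite !l1_in//; have [_] := argmax1 k; apply.
have Th1_int : exists2 r : R, 0 < r & forall x, `|x - th1s| <= r -> Th1 x.
  have [r r0 H] := Theta_int; exists r => // x xr.
  have [] : Theta (row_mx x th2s).
    by apply: H; rewrite norm_row_mxB ge_max xr subrr normr0 ltW.
  by rewrite row_mxKl.
have sep1' (delta : R) : 0 < delta -> exists2 gamma : R, 0 < gamma &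
    \forall k \near \oo, forall x, Th1 x -> delta <= `|x - t1 k| ->
    l1 k x - l1 k (t1 k) <= - gamma * n k.
  move=> /sep1[gamma g0 H]; exists gamma => //; apply: filterS H => k H x Tx xd.
  by have [T1 _] := t_in k; rewrite !l1_in//; exact: H.
have sep2' (delta2 : R) : 0 < delta2 -> exists delta1 gamma : R,
    [/\ 0 < delta1, 0 < gamma & \forall k \near \oo, forall x t,
    Th1 x -> Th2 t -> `|x - t1 k| < delta1 -> delta2 <= `|t - t2 k| ->
    l2 k (row_mx x t) - l2 k (that k) <= - gamma * n k].
  move=> /sep2[delta1 [gamma [dd0 g0 H]]]; exists delta1, gamma; split => //.
  apply: filterS H => k H x t Tx Tt h1 h2.
  by have [T1 T2] := t_in k; rewrite /that !l2_in//; exact: H.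
have pH := posdefmx_joint RJ pJ1 pJ2.
have pp0 : 0 < p1 th1s * p2 th2s by rewrite mulr_gt0.
have [G0 IG Hmv] := mvnormal_glim setT pH pp0.
set G := _ * _ in G0 IG Hmv.
(* The factor [2 / G] of [tv_cut_le] turns this error into [eps / 2]. *)
have e2 : 0 < eps * G / 4 by rewrite divr_gt0// mulr_gt0.
have L := sdens_reldens_limit mp1 p1_ge0 p1_out p1_int mp2 p2_ge0 p2_out' p2_int ml1 ml2
  max1 l2_max N_oo t1_cvg t2_cvg Th1_int p1s p2s p1_cont p2_cont sep1' sep2' osc2 quad_cut
  (fun k => info1_sym n ell t1 t2 k) pJ1 pJ2 lln1 e2.
have := L; apply: filter_app; apply: filterS (N_oo 1) => k n1 {}L.
have n0 : 0 < n k by exact: lt_le_trans n1.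
pose g (s : 'rV[R]_(d1 + d2)) := expR (- bil s (joint_info J1 J2 RJ) s / 2) * (p1 th1s * p2 th2s).
have mg : measurable_fun setT g.
  apply: measurable_funM => //; apply: measurableT_comp => //; apply: measurable_funM => //.
  by apply: measurableT_comp => //; exact: measurable_bil.
have g0 s : 0 <= g s by rewrite mulr_ge0 ?expR_ge0// ltW.
have T := tv_cut_le mp1 p1_ge0 mp2 p2_ge0 p2_int (ml1 k) (ml2 k) (@l2_max k) n0 mg g0 G0 IG L.
rewrite (tv_distance_eqr _ (nu' := fun A => (\int[lebesgue_rV (d1 + d2)]_(s in A) (g s)%:E * (G^-1)%:E)%E)).
  apply: le_lt_trans T _; rewrite lte_fin ltr_pdivrMr//.
  have : 0 < eps * G by rewrite mulr_gt0.
  by move: (eps * G) => z z0; lra.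
by move=> A mA; have [_ _] := mvnormal_glim A pH pp0; apply.
Qed.

End cut_posterior_sequence.

(** * The cut model *)

Section germs.
Context {R : realType} {n : nat}.
Implicit Types (f g : 'rV[R]_n -> R) (x : 'rV[R]_n).

Lemma near_eq_differentiable f g x : (\forall y \near x, f y = g y) ->
  differentiable f x -> differentiable g x.
Proof.
move=> fg /diff_locallyP[cdf ef].
have D := @diff_unique _ _ _ g ('d f x) x cdf.
(* Abstracting over [A] captures the little-o expansion required by [D] without restating it; once
   proved, it yields both the differential of [g] and its differentiability. *)
suff E : forall A : Prop, (A -> 'd g x = 'd f x :> (_ -> _)) ->
    (A = (g \o shift x = cst (g x) + 'd f x +o_ (0 : 'rV[R]_n) (@id 'rV[R]_n))) -> A.
  by have E' := E _ D erefl; apply/diff_locallyP; rewrite (D E').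
move=> A _ ->; apply/eqaddoP => eps e0; have := (eqaddoP _ _ _ _).1 ef _ e0.
have fgx : f x = g x := nbhs_singleton fg.
have fg0 : \forall y \near (0 : 'rV[R]_n), f (y + x) = g (y + x).
  by have := fg; rewrite (near_shift 0 x) /=; apply: filterS => y; rewrite /shift /= subr0.
apply: filter_app; apply: filterS fg0 => y H.
by rewrite /= !fctE /= /shift /= H fgx.
Qed.

Lemma near_eq_ntimes_differentiable k f g x : (\forall y \near x, f y = g y) ->
  ntimes_differentiable k f x -> ntimes_differentiable k g x.
Proof.
elim: k f g x => [//|k IH] f g x fg [n1 df dp]; split.
- by have := n1; apply: filter_app; apply: filterS (near_join fg) => y; exact: IH.
- exact: near_eq_differentiable df.
move=> j; apply: IH (dp j); apply: filterS (near_join fg) => y.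
exact: near_eq_derive.
Qed.

Lemma ntimes_differentiableW k f x :
  ntimes_differentiable k.+1 f x -> ntimes_differentiable k f x.
Proof.
elim: k f x => [//|k IH] f x [n1 df dp]; split => //; last by move=> j; exact: IH.
by apply: filterS n1 => y; exact: IH.
Qed.

Lemma near_closed_ball (A : set 'rV[R]_n) x : (\forall y \near x, A y) ->
  exists2 r : R, 0 < r & forall y, `|y - x| <= r -> A y.
Proof.
move=> /nbhs_ballP[r /= r0 H]; exists (r / 2); first by rewrite divr_gt0.
move=> y yx; apply: H; rewrite -ball_normE /= distrC.
by apply: le_lt_trans yx _; rewrite ltr_pdivrMr// ltr_pMr// ltr1n.
Qed.

Lemma closed_ball_near (A : set 'rV[R]_n) (c x : 'rV[R]_n) (r : R) : `|x - c| < r ->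
  (forall y, `|y - c| <= r -> A y) -> \forall y \near x, A y.
Proof.
move=> xr H; apply/nbhs_ballP; exists (r - `|x - c|); first by rewrite /= subr_gt0.
move=> y; rewrite -ball_normE /= distrC ltrBrDr => h; apply: H.
by rewrite -(subrK x y) -addrA (le_trans (ler_normD _ _))// ltW.
Qed.

Lemma enorm_le_norm (x : 'rV[R]_n) : enorm x <= (n%:R + 1) * `|x|.
Proof.
by apply: le_trans (enorm_le_mx_norm _) _; rewrite mul1n ler_wpM2r// lerDl.
Qed.

End germs.

Section levels.
Context {d} {Omega : measurableType d} {R : realType} (P : probability Omega R).
Variable Q : R -> R -> nat -> Omega -> Prop.

(** [cvg_in_prob0_seq] accepts countably many events, so the real levels are restricted to the
    inverses of positive integers; [level_use] returns to arbitrary levels by monotonicity. *)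
Lemma levels : (forall eta : R, 0 < eta -> exists2 rho : R, 0 < rho &
    prob_to1 P (fun n => [set w | Q eta rho n w])) ->
  exists2 rho : nat -> R, (forall m, 0 < rho m) &
    forall m, prob_to1 P (fun n => [set w | Q (m.+1%:R^-1) (rho m) n w]).
Proof.
move=> H; have H' (m : nat) : exists rho : R, 0 < rho /\
    prob_to1 P (fun n => [set w | Q (m.+1%:R^-1) rho n w]).
  by have [|rho r0 h] := H m.+1%:R^-1; [rewrite invr_gt0|exists rho].
have [rho Hr] := choice H'; exists rho => m; by have [] := Hr m.
Qed.

Lemma level_use (rho : nat -> R) (N : nat -> nat) (w : nat -> Omega) :
  (forall m, 0 < rho m) ->
  (forall eta eta' r n w, 0 < eta -> eta <= eta' -> Q eta r n w -> Q eta' r n w) ->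
  (forall m, \forall k \near \oo, Q (m.+1%:R^-1) (rho m) (N k) (w k)) ->
  forall eta : R, 0 < eta -> exists2 r : R, 0 < r & \forall k \near \oo, Q eta r (N k) (w k).
Proof.
move=> r0 mono H eta eta0; pose m := Num.truncn eta^-1.
exists (rho m) => //; apply: filterS (H m) => k; apply: mono; first by rewrite invr_gt0.
by rewrite -[leRHS]invrK lef_pV2 ?posrE ?invr_gt0// ltW// truncnS_gt.
Qed.

End levels.

(** * Joint measurability in the data and the parameter *)

Section model_measurability.
Context {d} {Omega : measurableType d} {R : realType} {e1 e2 : measure_display}.
Context {T1 : measurableType e1} {T2 : measurableType e2} {d1 d2 : nat}.
Variables (logf1 : T1 -> 'rV[R]_d1 -> R) (logf2 : T1 -> T2 -> 'rV[R]_(d1 + d2) -> R).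
Variables (X1 : nat -> Omega -> T1) (X2 : nat -> Omega -> T2).
Variables (Th1 : set 'rV[R]_d1) (Th2 : set 'rV[R]_d2) (p2 : 'rV[R]_d2 -> R).

Let Theta := prodTheta Th1 Th2.

Definition rlog1 n w := loglik1 logf1 X1 n w \_ Th1.
Definition rlog2 n w := loglik2 logf2 X1 X2 n w \_ Theta.

Hypothesis mX1 : forall j, measurable_fun setT (X1 j).
Hypothesis mX2 : forall j, measurable_fun setT (X2 j).
Hypothesis mTh1 : measurable Th1.
Hypothesis mTh2 : measurable Th2.
Hypothesis mp2 : measurable_fun setT p2.
Hypothesis p2_ge0 : forall t, 0 <= p2 t.
Hypothesis mf1 : measurable_fun (setT `*` Th1)
    (fun z : T1 * 'rV[R]_d1 => logf1 z.1 z.2).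
Hypothesis mf2 : measurable_fun (setT `*` Theta)
    (fun z : (T1 * T2) * 'rV[R]_(d1 + d2) => logf2 z.1.1 z.1.2 z.2).

Lemma measurable_Theta : measurable Theta.
Proof.
rewrite (_ : Theta = lsubmx @^-1` Th1 `&` rsubmx @^-1` Th2)//.
apply: measurableI.
  by rewrite -[X in measurable X]setTI; exact: (@measurable_lsubmx R d1 d2).
by rewrite -[X in measurable X]setTI; exact: (@measurable_rsubmx R d1 d2).
Qed.

Lemma measurable_patch_sum d' (T' : measurableType d') (q : nat) (Th : set 'rV[R]_q)
    (h : T' -> 'rV[R]_q -> R) (Z : nat -> Omega -> T') n : measurable Th ->
  measurable_fun (setT `*` Th) (fun z => h z.1 z.2) -> (forall j, measurable_fun setT (Z j)) ->
  measurable_fun setT (fun z : Omega * 'rV[R]_q =>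
    ((fun x => \sum_(j < n) h (Z j z.1) x) \_ Th) z.2).
Proof.
move=> mTh mh mZ.
have mr : measurable_fun setT ((fun z : T' * 'rV[R]_q => h z.1 z.2) \_ (setT `*` Th)).
  by apply/(measurable_restrictT _ (measurableX measurableT mTh)).
rewrite (_ : (fun z => _) = (fun z : Omega * 'rV[R]_q => \sum_(j < n)
    ((fun z : T' * 'rV[R]_q => h z.1 z.2) \_ (setT `*` Th)) (Z j z.1, z.2))).
  apply: measurable_sum => j; apply: (measurableT_comp mr).
  apply: measurable_fun_pair; last exact: measurable_snd.
  exact: measurableT_comp (mZ j) measurable_fst.
apply/funext => -[w x] /=; rewrite patchE; case: ifPn => xT.
  by apply: eq_bigr => j _; rewrite patchE mem_set//; split => //=; move: xT; rewrite inE.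
rewrite big1// => j _; rewrite patchE memNset//= => -[_ /= xt].
by move: xT; rewrite mem_set.
Qed.

Lemma measurable_rlog1 n : measurable_fun setT (fun z : Omega * 'rV[R]_d1 => rlog1 n z.1 z.2).
Proof. exact: (measurable_patch_sum (h := logf1) (Z := X1) n mTh1 mf1 mX1). Qed.

Lemma measurable_rlog2 n :
  measurable_fun setT (fun z : Omega * 'rV[R]_(d1 + d2) => rlog2 n z.1 z.2).
Proof.
apply: (measurable_patch_sum (h := fun z => logf2 z.1 z.2) (Z := fun j w => (X1 j w, X2 j w)) n
  measurable_Theta mf2) => j.
exact: measurable_fun_pair.
Qed.

(** At a fixed parameter the marginal is measurable in the outcome by Tonelli; the rational-point
    events are built from such functions. *)
Lemma measurable_cut_ll n th :
  measurable_fun setT (fun w => cut_ll p2 (rlog1 n w) (rlog2 n w) th).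
Proof.
have m1 x : measurable_fun setT (fun w => rlog1 n w x).
  exact: (measurableT_comp (measurable_rlog1 n) (measurable_pair2 x)).
have m2 x : measurable_fun setT (fun w => rlog2 n w x).
  exact: (measurableT_comp (measurable_rlog2 n) (measurable_pair2 x)).
apply: measurable_funD => //; apply: measurable_funB => //.
apply: (measurableT_comp (@measurable_ln R)).
apply: (measurableT_comp (@fine_measurable R setT measurableT)).
apply: (measurable_fun_fubini_tonelli_F (m2 := lebesgue_rV d2)
  (fun z : Omega * 'rV[R]_d2 => (expR (rlog2 n z.1 (row_mx (lsubmx th) z.2)) * p2 z.2)%:E)).
  apply/measurable_EFinP/measurable_funM; last exact: measurableT_comp mp2 measurable_snd.
  have mg : measurable_fun setT (fun z : Omega * 'rV[R]_d2 => (z.1, row_mx (lsubmx th) z.2)).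
    apply: measurable_fun_pair => //.
    exact: (measurableT_comp (measurableT_comp (@measurable_row_mx R d1 d2)
      (measurable_pair1 (lsubmx th))) measurable_snd).
  by apply: measurableT_comp => //; exact: (measurableT_comp (measurable_rlog2 n) mg).
by move=> z; rewrite lee_fin mulr_ge0 ?expR_ge0.
Qed.

End model_measurability.

Lemma sup_at_mostP {R : realType} {T : Type} (D : set T) (g : T -> R) (c : R) x :
  sup_at_most D g c -> D x -> g x <= c.
Proof.
move=> H Dx; rewrite -lee_fin; apply: le_trans H; apply: ereal_sup_ubound.
by exists x.
Qed.

Lemma norm_dist2 {R : realType} m p (A B C : 'M[R]_(m, p)) (c : R) :
  `|A - C| <= c -> `|B - C| <= c -> `|A - B| <= c + c.
Proof.
by move=> hA hB; apply: le_trans (ler_distD C _ _) _; rewrite (distrC C); exact: lerD.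
Qed.

(** * Events of the cut model with probability tending to 1 *)

Section cut_model_events.
Context {R : realType} {d : measure_display} {Omega : measurableType d} (P : probability Omega R).
Context {e1 e2 : measure_display} {T1 : measurableType e1} {T2 : measurableType e2}.
Variables (pstar : probability (T1 * T2)%type R).
Variables (X1 : nat -> Omega -> T1) (X2 : nat -> Omega -> T2).
Context {d1 d2 : nat}.
Variables (Th1 : set 'rV[R]_d1) (Th2 : set 'rV[R]_d2) (pi2 : 'rV[R]_d2 -> R).
Variables (logf1 : T1 -> 'rV[R]_d1 -> R) (logf2 : T1 -> T2 -> 'rV[R]_(d1 + d2) -> R).
Variables (th1 : nat -> Omega -> 'rV[R]_d1) (th2 : nat -> Omega -> 'rV[R]_d2).
Variables (th1s : 'rV[R]_d1) (th2s : 'rV[R]_d2).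
Variables (r0 : R) (M2 : T1 -> R) (M3 : T1 * T2 -> R).

Let p1 : probability T1 R := distribution pstar fst.
Let Theta := prodTheta Th1 Th2.
Let L1 := loglik1 logf1 X1.
Let L2 := loglik2 logf2 X1 X2.
Let L := cut_loglik logf1 logf2 X1 X2 Th2 pi2.
Let th n w := row_mx (th1 n w) (th2 n w).
Let ths := row_mx th1s th2s.
Let q2 := pi2 \_ Th2.
Let r1 n w := rlog1 logf1 X1 Th1 n w.
Let r2 n w := rlog2 logf2 X1 X2 Th1 Th2 n w.
Let ell n w := cut_ll q2 (r1 n w) (r2 n w).

Hypothesis iidX : iid P (fun j w => (X1 j w, X2 j w)) pstar.
Hypothesis mTh1 : measurable Th1.
Hypothesis mTh2 : measurable Th2.
Hypothesis mq2 : measurable_fun setT q2.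
Hypothesis q2_ge0 : forall t, 0 <= q2 t.
Hypothesis q2_int : (\int[lebesgue_rV d2]_t (q2 t)%:E = 1)%E.
Hypothesis mf1 : measurable_fun (setT `*` Th1)
    (fun z : T1 * 'rV[R]_d1 => logf1 z.1 z.2).
Hypothesis mf2 : measurable_fun (setT `*` Theta)
    (fun z : (T1 * T2) * 'rV[R]_(d1 + d2) => logf2 z.1.1 z.1.2 z.2).
Hypothesis argmax1 : forall n w, is_argmax Th1 (L1 n w) (th1 n w).
Hypothesis argmax2 : forall n w, is_argmax Th2 (fun t => L2 n w (row_mx (th1 n w) t)) (th2 n w).
Hypothesis consistent : cvg_in_prob0 P (fun n w => (enorm (th n w - ths))%:E).
Hypothesis r00 : 0 < r0.
Hypothesis locT : forall t, `|t - ths| <= r0 -> Theta t.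
Hypothesis loc1 : forall t, `|t - th1s| <= r0 -> forall x1,
  ntimes_differentiable 2 (logf1 x1) t /\ forall j k, `|hess (logf1 x1) t j k| <= M2 x1.
Hypothesis loc2 : forall t, `|t - ths| <= r0 -> forall x1 x2,
  ntimes_differentiable 2 (logf2 x1 x2) t /\ forall j k, `|hess (logf2 x1 x2) t j k| <= M3 (x1, x2).
Hypothesis iM2 : p1.-integrable setT (EFin \o M2).
Hypothesis iM3 : pstar.-integrable setT (EFin \o M3).

Lemma th_Theta n w : Theta (th n w).
Proof.
by have [? _] := argmax1 n w; have [? _] := argmax2 n w; split; rewrite ?row_mxKl ?row_mxKr.
Qed.

Lemma r2E n w t : Theta t -> r2 n w t = L2 n w t.
Proof. by move=> T; rewrite /r2 /rlog2 patchE mem_set. Qed.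

Lemma r1E n w t : Th1 t -> r1 n w t = L1 n w t.
Proof. by move=> T; rewrite /r1 /rlog1 patchE mem_set. Qed.

Lemma loc_Th1 t : `|t - th1s| <= r0 -> Th1 t.
Proof.
move=> h; have [] : Theta (row_mx t th2s).
  by apply: locT; rewrite norm_row_mxB ge_max h subrr normr0 ltW.
by rewrite row_mxKl.
Qed.

Lemma r2_seq_cont n w (rho : R) : rho <= r0 -> seq_cont (r2 n w) [set x | `|x - ths| <= rho].
Proof.
move=> rr x x_ /= xr xkr xx.
have T y : `|y - ths| <= rho -> r2 n w y = \sum_(j < n) logf2 (X1 j w) (X2 j w) y.
  by move=> h; rewrite r2E//; apply: locT; exact: le_trans rr.
rewrite T//; under eq_fun do rewrite T//.
apply: cvg_sumr => j _.
have [[_ df _] _] := loc2 (le_trans xr rr) (X1 j w) (X2 j w).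
exact: (continuous_cvg _ (differentiable_continuous df)).
Qed.

Lemma r1_seq_cont n w (rho : R) : rho <= r0 -> seq_cont (r1 n w) [set x | `|x - th1s| <= rho].
Proof.
move=> rr x x_ /= xr xkr xx.
have T y : `|y - th1s| <= rho -> r1 n w y = \sum_(j < n) logf1 (X1 j w) y.
  by move=> h; rewrite r1E//; apply: loc_Th1; exact: le_trans rr.
rewrite T//; under eq_fun do rewrite T//.
apply: cvg_sumr => j _.
have [[_ df _] _] := loc1 (le_trans xr rr) (X1 j w).
exact: (continuous_cvg _ (differentiable_continuous df)).
Qed.

Lemma prob_to1_consistent (rho : R) : 0 < rho ->
  prob_to1 P (fun n => [set w | `|th n w - ths| <= rho]).
Proof.
move=> /consistent; apply: prob_to1_sub => n w /=.
rewrite lte_fin ger0_norm ?enorm_ge0// => H.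
by apply: le_trans (ltW H); exact: mx_norm_le_enorm.
Qed.

Let mX1 j : measurable_fun setT (X1 j).
Proof. by have [m _ _] := iidX; exact: (measurableT_comp measurable_fst (m j)). Qed.

Let mX2 j : measurable_fun setT (X2 j).
Proof. by have [m _ _] := iidX; exact: (measurableT_comp measurable_snd (m j)). Qed.

Lemma measurable_r2 n w : measurable_fun setT (r2 n w).
Proof.
exact: (measurableT_comp (measurable_rlog2 mX1 mX2 mTh1 mTh2 mf2 n) (measurable_pair1 w)).
Qed.

Lemma measurable_r2w n t : measurable_fun setT (fun w => r2 n w t).
Proof.
exact: (measurableT_comp (measurable_rlog2 mX1 mX2 mTh1 mTh2 mf2 n) (measurable_pair2 t)).
Qed.

(** Condition (iii) concerns the extended-real [L]; this carries its finite values over to the real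
    function [ell]. *)
Lemma ell_fineL n w t : Theta t -> L n w t \is a fin_num -> fine (L n w t) = ell n w t.
Proof.
move=> Tt; have [t1 t2] := Tt.
have m0 : (0 < marg q2 (r2 n w) (lsubmx t))%E by apply: marg_gt0 => //; exact: measurable_r2.
rewrite /ell /cut_ll /cut_ll1 r1E// r2E// /margr.
have -> : L n w t = ((L1 n w (lsubmx t) + L2 n w t)%:E - lne (marg q2 (r2 n w) (lsubmx t)))%E.
  by rewrite [marg _ _ _](marg_patch Th2 pi2 (L2 n w) t1).
move: m0; case: (marg _ _ _) => [z| |]//; rewrite lte_fin => z0.
rewrite lne_EFin//= => _; move: (L1 _ _ _) (L2 _ _ _) (ln z) => a b c; ring.
Qed.

(** Converts a maximum-norm ball at [ths] into the Euclidean displacements from the estimator in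
    which (iii) is stated. *)
Lemma th_near n w (rho : R) t : `|th n w - ths| <= rho -> `|t - ths| <= rho ->
  exists2 s, t = th n w + s & enorm s <= ((d1 + d2)%:R + 1) * (2 * rho).
Proof.
move=> h1 h2; exists (t - th n w); first by rewrite addrC subrK.
apply: le_trans (enorm_le_norm _) _; rewrite ler_wpM2l ?addr_ge0//.
rewrite -(subrK ths t) -addrA (le_trans (ler_normD _ _))//.
by rewrite mulr_natl mulr2n lerD// distrC.
Qed.

Section condition_iii.
Variables (delta K : R) (M1 : nat -> Omega -> R).
Hypothesis delta0 : 0 < delta.
Hypothesis K0 : 0 < K.
Hypothesis PM1 : prob_to1 P (fun n => [set w | M1 n w < K]).

Let DL n w := hess (fun t => fine (L n w t)).

Definition lip_bounds n w := [/\
  forall s, enorm s <= delta -> ntimes_differentiable_ereal 2 (L n w) (th n w + s),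
  sup_at_most [set s | 0 < enorm s <= delta]
    (fun s => opnorm (DL n w (th n w + s) - DL n w (th n w)) / (n%:R * enorm s)) (M1 n w) &
  sup_at_most [set s | 0 < enorm s <= delta]
    (fun s => `|L2 n w (th n w + s) - L2 n w (th n w)| / (n%:R * enorm s)) (M1 n w)].

Hypothesis Hlip : {ae P, forall w, \forall n \near \oo, lip_bounds n w}.

Let D : R := (d1 + d2)%:R + 1.

(** [2 * rho] bounds the distance to the estimator and doubles again for a pair of points. One
    factor [D] converts the norm and [D * D] bounds the number of Hessian entries, whence the final
    oscillation [4 * K * D ^+ 3 * rho]. *)
Lemma rho_exists (eta : R) : 0 < eta -> exists rho : R, [/\ 0 < rho, rho <= r0,
  D * (2 * rho) <= delta & 4 * K * (D * D * D) * rho <= eta].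
Proof.
move=> eta0; have D1 : 1 <= D by rewrite /D lerDr.
have D0 : 0 < D by exact: lt_le_trans D1.
have KD : 0 < 4 * K * (D * D * D) by rewrite !mulr_gt0.
exists (Num.min r0 (Num.min (delta / (2 * D)) (eta / (4 * K * (D * D * D))))); split.
- by rewrite !lt_min r00 !divr_gt0// mulr_gt0.
- by rewrite ge_min lexx.
- rewrite mulrA (mulrC D) (mulrC (2 * D)) -ler_pdivlMr ?mulr_gt0//.
  by rewrite !ge_min lexx !orbT.
by rewrite (mulrC (4 * K * _)) -ler_pdivlMr// !ge_min lexx !orbT.
Qed.

Lemma lip_of n (e : R) (x m : R) : (0 < n)%N -> 0 < e -> m < K ->
  x / (n%:R * e) <= m -> x <= K * (n%:R * e).
Proof.
move=> n0 e0 mK; rewrite ler_pdivrMr ?mulr_gt0 ?ltr0n// => /le_trans; apply.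
by rewrite ler_wpM2r ?(ltW mK)// mulr_ge0// ltW.
Qed.

Lemma enorm_eq0 m p (A : 'M[R]_(m, p)) : ~~ (0 < enorm A) -> A = 0.
Proof. by move=> h; apply: contraNeq h => /enorm_gt0. Qed.

Lemma osc_L2 (eta : R) : 0 < eta -> exists2 rho : R, 0 < rho &
  prob_to1 P (fun n => [set w | osc0 (r2 n w) ths rho (eta * n%:R)]).
Proof.
move=> eta0; have [rho [rho0 rhor rhod rhoe]] := rho_exists eta0.
have D1 : 1 <= D by rewrite /D lerDr.
exists (rho / 2); first by rewrite divr_gt0.
apply: (prob_to1_osc0 rho0 _ (prob_to1_setI PM1 (prob_to1_consistent rho0)) (prob_to1_T P)).
- by move=> n x _; exact: measurable_r2w.
- by move=> n w _; exact: r2_seq_cont.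
apply: filterS Hlip => w; apply: filter_app; exists 1%N => // n /= n0 [_ _ HL2] [mK hth] x y hx hy.
rewrite !r2E; [|by apply: locT; apply: le_trans rhor|by apply: locT; apply: le_trans rhor].
have one t : `|t - ths| <= rho -> `|L2 n w t - L2 n w (th n w)| <= eta / 2 * n%:R.
  move=> ht; have [s -> es] := th_near hth ht.
  have [s0|/enorm_eq0 ->] := boolP (0 < enorm s); last first.
    by rewrite addr0 subrr normr0 mulr_ge0// divr_ge0// ltW.
  have sd : 0 < enorm s <= delta by rewrite s0/= (le_trans es).
  have := lip_of n0 s0 mK (sup_at_mostP HL2 sd); move=> /le_trans; apply.
  rewrite mulrCA mulrC ler_wpM2r//.
  apply: le_trans (_ : K * (D * (2 * rho)) <= _); first by rewrite ler_wpM2l// ltW.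
  have DD : D <= D * D * D.
    by rewrite -[leLHS]mulr1 -mulrA ler_wpM2l ?(le_trans ler01)// -[leLHS]mulr1 ler_pM.
  have : 4 * K * rho * D <= 4 * K * rho * (D * D * D).
    by rewrite ler_wpM2l// !mulr_ge0// ltW.
  by move: rhoe DD; move: (D * D * D) => D3; lra.
have := lerD (one x hx) (one y hy); rewrite -mulrDl -splitr; apply: le_trans.
by rewrite (distrC (L2 n w y)); exact: ler_distD.
Qed.

(** Both second differences are Hessian forms at points of the ball, by the mean value theorem, and
    (iii) compares each Hessian with the one at the estimator. *)
Lemma osc_ell_event (E : nat -> set Omega) (rhoE : R) : 0 < rhoE -> prob_to1 P E ->
  (forall n w, E n w -> seq_cont (ell n w) [set x | `|x - ths| <= rhoE]) ->
  forall eta : R, 0 < eta -> exists2 rho : R, 0 < rho &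
    prob_to1 P (fun n => [set w | dd_osc (ell n w) ths rho (eta * n%:R)]).
Proof.
move=> rhoE0 PE Ec eta eta0; have [rho' [rho'0 rhor' rhod' rhoe']] := rho_exists eta0.
pose rho := Num.min rho' rhoE.
have rho0 : 0 < rho by rewrite lt_min rho'0.
have rr' : rho <= rho' by rewrite ge_min lexx.
have D1 : 1 <= D by rewrite /D lerDr.
have D0 : 0 < D by exact: lt_le_trans D1.
have rhor : rho <= r0 by exact: le_trans rhor'.
have rhod : D * (2 * rho) <= delta.
  by apply: le_trans rhod'; rewrite ler_wpM2l ?(ltW D0)// ler_wpM2l.
have rhoe : 4 * K * (D * D * D) * rho <= eta.
  by apply: le_trans rhoe'; rewrite ler_wpM2l// !mulr_ge0// ltW.
exists (rho / 2); first by rewrite divr_gt0.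
apply: (prob_to1_dd_osc rho0 _ (prob_to1_setI PM1 (prob_to1_consistent rho0)) PE).
- by move=> n x _; exact: (measurable_cut_ll mX1 mX2 mTh1 mTh2 mq2 q2_ge0 mf1 mf2).
- move=> n w /Ec H x x_ /= hx hxk; have rE : rho <= rhoE by rewrite ge_min lexx orbT.
  by apply: H => [|k] /=; [exact: le_trans rE|exact: le_trans (hxk k) rE].
apply: filterS Hlip => w; apply: filter_app; exists 1%N => // n /= n0 [Hd HDL _] [mK hth] x y u v px py.
pose fL t := fine (L n w t).
have dif t : `|t - ths| <= rho -> ntimes_differentiable_ereal 2 (L n w) t.
  by move=> ht; have [s -> es] := th_near hth ht; apply: Hd; exact: le_trans rhod.
have eq_ell t : `|t - ths| <= rho -> ell n w t = fL t.
  move=> ht; rewrite -ell_fineL//; first by apply: locT; exact: le_trans rhor.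
  by have [/nbhs_singleton] := dif _ ht.
have ddE z : pgram_in ths rho u v z -> dd (ell n w) u v z = dd fL u v z.
  by move=> [a b c e]; rewrite /dd !eq_ell.
have hb t : `|t - ths| <= rho -> `|DL n w t - DL n w (th n w)| <= K * (n%:R * (D * (2 * rho))).
  move=> ht; have [s -> es] := th_near hth ht.
  have [s0|/enorm_eq0 ->] := boolP (0 < enorm s); last first.
    by rewrite addr0 subrr normr0 !mulr_ge0// ltW.
  have sd : 0 < enorm s <= delta by rewrite s0/= (le_trans es).
  apply: le_trans (mx_norm_le_opnorm _) _.
  have := lip_of n0 s0 mK (sup_at_mostP HDL sd); move=> /le_trans; apply.
  by rewrite ler_wpM2l ?(ltW K0)// ler_wpM2l.
have mvt z : pgram_in ths rho u v z -> exists2 xi, `|xi - ths| <= rho &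
    dd fL u v z = bil v (DL n w xi) u.
  move=> pz; have [|s [t [s01 t01 E1]]] := @dd_MVT2 _ _ fL u v z.
    by move=> s t s01 t01; have [_] := dif _ (pgram_in_convex pz s01 t01).
  by exists (z + s *: u + t *: v) => //; exact: pgram_in_convex.
have [xi hxi Ex] := mvt x px; have [ze hze Ey] := mvt y py.
rewrite ddE// ddE// Ex Ey -bilN -bilD; apply: le_trans (bil_bound _ _ _) _.
have hd : `|DL n w xi - DL n w ze| <= K * (n%:R * (D * (4 * rho))).
  apply: le_trans (norm_dist2 (hb _ hxi) (hb _ hze)) _.
  by rewrite le_eqVlt; apply/orP; left; apply/eqP; move: (n%:R) => a; ring.
rewrite -mulrA (mulrC `|v|) ler_wpM2r ?mulr_ge0//.
apply: le_trans (_ : D * D * (K * (n%:R * (D * (4 * rho)))) <= _).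
  apply: ler_pM => //; rewrite natrM; apply: ler_pM => //; by rewrite /D lerDl.
rewrite (_ : D * D * _ = 4 * K * (D * D * D) * rho * n%:R); last by ring.
by rewrite ler_wpM2r.
Qed.

End condition_iii.

Lemma ell_differentiable :
  (forall n, {ae P, forall w, \forall t \near th n w, ntimes_differentiable_ereal 3 (L n w) t}) ->
  prob_to1 P (fun n => [set w | ntimes_differentiable 2 (ell n w) (th n w)]).
Proof.
move=> H; have r02 : 0 < r0 / 2 by rewrite divr_gt0.
apply: prob_to1_sub (prob_to1_setI (prob_to1_consistent r02) (prob_to1_ae H)) => n w /= [hth /nbhs_singleton].
move=> [nf nd]; apply: near_eq_ntimes_differentiable (ntimes_differentiableW nd).
have hth' : `|th n w - ths| < r0.
  by apply: le_lt_trans hth _; rewrite ltr_pdivrMr// ltr_pMr// ltr1n.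
have := closed_ball_near hth' locT; apply: filter_app; apply: filterS nf => t ft Tt.
by rewrite ell_fineL.
Qed.

(** The bound [h < eta] sits inside the event so that it survives the passage to countable levels,
    where the level alone controls the step. *)
Lemma lln_r2 i j (eta : R) : 0 < eta -> exists2 h : R, 0 < h &
  prob_to1 P (fun n => [set w | h < eta /\
    `|dd (r2 n w) (h *: delta_mx ord0 i) (h *: delta_mx ord0 j) ths / (n%:R * h ^+ 2)
      - expectation_mx pstar (fun z => hess (logf2 z.1 z.2) ths) i j| <= eta]).
Proof.
move=> eta0.
have mf t : `|t - ths| <= r0 -> measurable_fun setT (fun z : T1 * T2 => logf2 z.1 z.2 t).
  move=> /locT Tt; rewrite -[X in measurable_fun _ X]/((fun z : (T1 * T2) * 'rV[R]_(d1 + d2) => logf2 z.1.1 z.1.2 z.2) \o (fun z => (z, t))).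
  apply: (@measurable_comp _ _ _ _ _ _ (setT `*` Theta) _ _ _ _ _ mf2).
  - by apply: measurableX => //; exact: measurable_Theta.
  - by move=> _ [z _ <-].
  - exact: measurable_pair2.
have h0 : 0 < Num.min eta (r0 / 2) by rewrite lt_min eta0 divr_gt0.
have df t : `|t - ths| <= r0 -> forall z : T1 * T2, ntimes_differentiable 2 (logf2 z.1 z.2) t.
  by move=> ht z; have [] := loc2 ht z.1 z.2.
have hM t : `|t - ths| <= r0 -> forall (z : T1 * T2) a b, `|hess (logf2 z.1 z.2) t a b| <= M3 z.
  by move=> ht [x y] a b; have [_] := loc2 ht x y; apply.
have [h [hp hh PH]] := dd_lln (f := fun z : T1 * T2 => logf2 z.1 z.2) iidX r00 mf df hM iM3 i j eta0 h0.
move: hh; rewrite lt_min => /andP[he hr]; exists h => //.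
apply: prob_to1_sub PH => n w /= H; split => //; move: H; congr (`|_ / _ - _| <= _).
have hb (a b : bool) : `|ths + (if a then h *: delta_mx ord0 i else 0) + (if b then h *: delta_mx ord0 j else 0) - ths| <= r0.
  have nb (c : bool) k : `|(if c then h *: delta_mx ord0 k else 0) : 'rV[R]_(d1 + d2)| <= r0 / 2.
    case: c; last by rewrite normr0 divr_ge0// ltW.
    rewrite normrZ gtr0_norm//; apply: le_trans (ltW hr).
    by rewrite -[leRHS]mulr1 ler_wpM2l ?norm_delta_mx// ltW.
  rewrite -(addrA ths) addrAC subrr add0r (splitr r0) (le_trans (ler_normD _ _))//.
  exact: lerD.
have := hb true true; have := hb true false; have := hb false true; have := hb false false.
rewrite !addr0 => h1 h2 h3 h4.
by rewrite /dd !r2E//; exact: locT.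
Qed.

Lemma lln_r1 i j (eta : R) : 0 < eta -> exists2 h : R, 0 < h &
  prob_to1 P (fun n => [set w | h < eta /\
    `|dd (r1 n w) (h *: delta_mx ord0 i) (h *: delta_mx ord0 j) th1s / (n%:R * h ^+ 2)
      - expectation_mx p1 (fun x => hess (logf1 x) th1s) i j| <= eta]).
Proof.
move=> eta0.
have mf t : `|t - th1s| <= r0 -> measurable_fun setT (fun z : T1 => logf1 z t).
  move=> /loc_Th1 Tt; rewrite -[X in measurable_fun _ X]/((fun z : T1 * 'rV[R]_d1 => logf1 z.1 z.2) \o (fun z => (z, t))).
  apply: (@measurable_comp _ _ _ _ _ _ (setT `*` Th1) _ _ _ _ _ mf1).
  - exact: measurableX.
  - by move=> _ [z _ <-].
  - exact: measurable_pair2.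
have iid1 : iid P X1 p1.
  have [_ lX iX] := iidX; split => //.
    move=> k B mB; have mB' : measurable (fst @^-1` B : set (T1 * T2)).
      by rewrite -[X in measurable X]setTI; exact: measurable_fst.
    exact: (lX k _ mB').
  move=> J B mB; have mB' k : measurable (fst @^-1` (B k) : set (T1 * T2)).
    by rewrite -[X in measurable X]setTI; apply: measurable_fst.
  exact: (iX J _ mB').
have h0 : 0 < Num.min eta (r0 / 2) by rewrite lt_min eta0 divr_gt0.
have df t : `|t - th1s| <= r0 -> forall x, ntimes_differentiable 2 (logf1 x) t.
  by move=> ht x; have [] := loc1 ht x.
have hM t : `|t - th1s| <= r0 -> forall x a b, `|hess (logf1 x) t a b| <= M2 x.
  by move=> ht x; have [] := loc1 ht x.
have [h [hp hh PH]] := dd_lln (f := logf1) iid1 r00 mf df hM iM2 i j eta0 h0.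
move: hh; rewrite lt_min => /andP[he hr]; exists h => //.
apply: prob_to1_sub PH => n w /= H; split => //; move: H; congr (`|_ / _ - _| <= _).
have hb (a b : bool) : `|th1s + (if a then h *: delta_mx ord0 i else 0) + (if b then h *: delta_mx ord0 j else 0) - th1s| <= r0.
  have nb (c : bool) k : `|(if c then h *: delta_mx ord0 k else 0) : 'rV[R]_d1| <= r0 / 2.
    case: c; last by rewrite normr0 divr_ge0// ltW.
    rewrite normrZ gtr0_norm//; apply: le_trans (ltW hr).
    by rewrite -[leRHS]mulr1 ler_wpM2l ?norm_delta_mx// ltW.
  rewrite -(addrA th1s) addrAC subrr add0r (splitr r0) (le_trans (ler_normD _ _))//.
  exact: lerD.
have := hb true true; have := hb true false; have := hb false true; have := hb false false.
rewrite !addr0 => h1 h2 h3 h4.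
by rewrite /dd !r1E//; exact: loc_Th1.
Qed.

Section margin_event.
Hypothesis sep2 : forall delta2 : R, 0 < delta2 -> exists delta1 gamma2 : R,
  [/\ 0 < delta1, 0 < gamma2 & prob_to1 P (fun n => [set w |
    sup_at_most [set t | [/\ Theta t, enorm (lsubmx t - th1 n w) < delta1 &
                              delta2 <= enorm (rsubmx t - th2 n w)]]
      (fun t => n%:R^-1 * (L2 n w t - L2 n w (th n w))) (- gamma2)])].
Hypothesis osc2 : forall eta : R, 0 < eta -> exists2 rho : R, 0 < rho &
  prob_to1 P (fun n => [set w | osc0 (r2 n w) ths rho (eta * n%:R)]).
Hypothesis diff2 : exists dl : R, 0 < dl /\ prob_to1 P (fun n => [set w |
  {ae lebesgue_rV d2, forall t, Th2 t -> 0 < pi2 t ->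
    forall t1, enorm (t1 - th1 n w) < dl ->
      ntimes_differentiable 2 (fun u => L2 n w (row_mx u t)) t1}]).

Lemma ell_seq_cont n w (rho : R) : rho <= r0 ->
  (forall x, `|x - th1s| <= rho -> marg q2 (r2 n w) x \is a fin_num) ->
  seq_cont (margr q2 (r2 n w)) [set x | `|x - th1s| <= rho] ->
  seq_cont (ell n w) [set x | `|x - ths| <= rho].
Proof.
move=> rr mfin mc x x_ /= hx hxk xx.
have hl y : `|y - ths| <= rho -> `|lsubmx y - th1s| <= rho.
  move=> hy; apply: le_trans hy.
  have <- : lsubmx (y - ths) = lsubmx y - th1s by rewrite linearB/= row_mxKl.
  exact: norm_lsubmx_le.
have ll : (fun k => lsubmx (x_ k)) @ \oo --> lsubmx x.
  apply/cvgrPdist_le => eps e0; move/cvgrPdist_le/(_ _ e0): xx; apply: filterS => k.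
  have <- : lsubmx (x - x_ k) = lsubmx x - lsubmx (x_ k) by rewrite linearB.
  exact: le_trans (norm_lsubmx_le _).
rewrite /ell /cut_ll /cut_ll1; apply: cvgD; last exact: (r2_seq_cont rr hx hxk xx).
apply: cvgB.
  exact: (r1_seq_cont rr (hl _ hx) (fun k => hl _ (hxk k)) ll).
have m0 : 0 < margr q2 (r2 n w) (lsubmx x).
  by apply: margr_gt0 => //; [exact: measurable_r2|exact: mfin (hl _ hx)].
apply: (continuous_cvg _ (continuous_ln m0)).
exact: (mc _ _ (hl _ hx) (fun k => hl _ (hxk k)) ll).
Qed.

(** For [theta_1] near [th1s], [L2] is at most its value at the estimator plus [n], uniformly in
    [theta_2]: by (ii) when [theta_2] is far and by oscillation when it is near. This bound makes
    the marginal finite and dominates the integrands; their continuity in [theta_1] comes from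
    (vii). *)
Lemma margin_event : exists2 rho : R, 0 < rho & prob_to1 P (fun n => [set w |
  (forall x, `|x - th1s| <= rho -> marg q2 (r2 n w) x \is a fin_num) /\
  seq_cont (ell n w) [set x | `|x - ths| <= rho]]).
Proof.
have [rho2 rho20 Posc] := osc2 ltr01.
have rho22 : 0 < rho2 / 2 by rewrite divr_gt0.
have [de1 [gam [de10 gam0 Psep]]] := sep2 rho22.
have [dl [dl0 Pdiff]] := diff2.
pose D : R := d1%:R + 1; have D0 : 0 < D by rewrite /D ltr_wpDl.
(* The divisors [4 * D] make the Euclidean distance to [th1 n w], at most [D * (2 * rho)], strictly
   smaller than [de1] and [dl]. *)
pose rho := Num.min (rho2 / 2) (Num.min (r0 / 2) (Num.min (de1 / (4 * D)) (dl / (4 * D)))).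
have rho0 : 0 < rho by rewrite !lt_min rho22 !divr_gt0// mulr_gt0.
have rA : rho <= rho2 / 2 by rewrite ge_min lexx.
have rB : rho <= r0 / 2 by rewrite !ge_min lexx orbT.
have rC : D * (2 * rho) < de1.
  have : rho <= de1 / (4 * D) by rewrite !ge_min lexx !orbT.
  rewrite ler_pdivlMr ?mulr_gt0// => h; have : 0 < rho * D by rewrite mulr_gt0.
  by move: h; rewrite (mulrCA rho) (mulrCA D) (mulrC D); move: (rho * D) => z; lra.
have rD : D * (2 * rho) < dl.
  have : rho <= dl / (4 * D) by rewrite !ge_min lexx !orbT.
  rewrite ler_pdivlMr ?mulr_gt0// => h; have : 0 < rho * D by rewrite mulr_gt0.
  by move: h; rewrite (mulrCA rho) (mulrCA D) (mulrC D); move: (rho * D) => z; lra.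
have rr0 : rho < r0 by apply: le_lt_trans rB _; rewrite ltr_pdivrMr// ltr_pMr// ltr1n.
exists rho => //.
apply: prob_to1_sub (prob_to1_setI (prob_to1_setI Posc Psep)
  (prob_to1_setI Pdiff (prob_to1_consistent rho0))) => n w /= [[osc sep] [dif hth]].
have hth1 : `|th1 n w - th1s| <= rho.
  by apply: le_trans hth; rewrite norm_row_mxB le_max lexx.
have hth2 : `|th2 n w - th2s| <= rho.
  by apply: le_trans hth; rewrite norm_row_mxB le_max lexx orbT.
have en x : `|x - th1s| <= rho -> enorm (x - th1 n w) <= D * (2 * rho).
  move=> hx; apply: le_trans (enorm_le_norm _) _; rewrite ler_wpM2l ?(ltW D0)//.
  rewrite -(subrK th1s x) -addrA (le_trans (ler_normD _ _))//.
  by rewrite mulr_natl mulr2n lerD// distrC.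
pose U := [set x : 'rV[R]_d1 | `|x - th1s| <= rho].
have l2_le x t : U x -> Th2 t -> r2 n w (row_mx x t) <= r2 n w (th n w) + n%:R.
  move=> Ux Tt; have Tx : Th1 x by apply: loc_Th1; exact: le_trans (ltW rr0).
  have Txt : Theta (row_mx x t) by split; rewrite ?row_mxKl ?row_mxKr.
  have [far|close] := leP (rho2 / 2) (enorm (t - th2 n w)).
    have dom : [/\ Theta (row_mx x t), enorm (lsubmx (row_mx x t) - th1 n w) < de1 &
        rho2 / 2 <= enorm (rsubmx (row_mx x t) - th2 n w)].
      by rewrite row_mxKl row_mxKr; split => //; exact: le_lt_trans (en _ Ux) rC.
    have h := sup_at_mostP sep dom; rewrite !r2E//; last exact: th_Theta.
    (* For [n = 0] the averaged difference is 0, which is not at most [- gam], so the event excludes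
       this case. *)
    have [n0|n0] := posnP n.
      have hn : n%:R^-1 = 0 :> R by rewrite n0 invr0.
      by exfalso; move: h; rewrite hn mul0r leNgt oppr_lt0 gam0.
    have np : 0 < n%:R :> R by rewrite ltr0n.
    move: h; rewrite ler_pdivrMl// => h.
    have : 0 <= n%:R * gam by rewrite mulr_ge0// ltW.
    by move: h np; rewrite mulrN; move: (n%:R) (_ * gam) (L2 _ _ _) (L2 _ _ _) => a b c e; lra.
  have h1 : `|row_mx x t - ths| <= rho2.
    rewrite norm_row_mxB ge_max; apply/andP; split.
      by apply: le_trans Ux _; apply: le_trans rA _; lra.
    rewrite -(subrK (th2 n w) t) -addrA (le_trans (ler_normD _ _))// (splitr rho2) lerD//.
      by apply: le_trans (ltW close); exact: mx_norm_le_enorm.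
    exact: le_trans rA.
  have h2 : `|th n w - ths| <= rho2 by apply: le_trans hth _; apply: le_trans rA _; lra.
  have := osc _ _ h1 h2; rewrite mul1r ler_norml => /andP[_].
  by rewrite lerBlDl.
have q2_out t : ~ Th2 t -> q2 t = 0 by move=> nt; rewrite /q2 patchC// inE.
have mfin x : U x -> marg q2 (r2 n w) x \is a fin_num.
  exact: (marg_fin_bounded mq2 q2_ge0 q2_out q2_int (measurable_r2 n w) l2_le).
have l2_cont : {ae lebesgue_rV d2, forall t, 0 < q2 t -> forall x, U x ->
    {for x, continuous (fun y => r2 n w (row_mx y t))}}.
  apply: filterS dif => t H q2t x Ux.
  have Tt : Th2 t by apply: contrapT => /q2_out q0; move: q2t; rewrite q0 ltxx.
  have pt : 0 < pi2 t by move: q2t; rewrite /q2 patchE mem_set.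
  have [_ df _] := H Tt pt x (le_lt_trans (en _ Ux) rD).
  apply: differentiable_continuous; apply: near_eq_differentiable df.
  have Ux' : `|x - th1s| < r0 by exact: le_lt_trans rr0.
  apply: filterS (closed_ball_near Ux' loc_Th1) => y Ty.
  by rewrite r2E//; split; rewrite ?row_mxKl ?row_mxKr.
split; first exact: mfin.
apply: ell_seq_cont; [exact: ltW|exact: mfin|].
move=> x x_ Ux Uxk xx.
exact: (margr_cvg mq2 q2_ge0 q2_out q2_int (measurable_r2 n w) l2_le l2_cont Ux Uxk xx).
Qed.

End margin_event.
End cut_model_events.

Lemma neg_rate {R : realType} (n : nat) (a g : R) : 0 < g -> n%:R^-1 * a <= - g -> a <= - g * n%:R.
Proof.
move=> g0; have [->|n0] := posnP n.
  by rewrite invr0 mul0r leNgt oppr_lt0 g0.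
by rewrite ler_pdivrMl ?ltr0n// mulrC.
Qed.

Lemma tv_distance_ge0 {R : realType} d (T : measurableType d) (mu nu : set T -> \bar R) :
  (0 <= tv_distance mu nu)%E.
Proof.
apply: (@le_trans _ _ `|mu set0 - nu set0|%E); first exact: abse_ge0.
by apply: ereal_sup_ubound; exists set0.
Qed.

Lemma restrict_density {R : realType} k (Th : set 'rV[R]_k) (f : 'rV[R]_k -> R) :
  measurable Th -> is_density (lebesgue_rV k) Th f ->
  [/\ measurable_fun setT (f \_ Th), forall t, 0 <= (f \_ Th) t &
    (\int[lebesgue_rV k]_t ((f \_ Th) t)%:E = 1)%E].
Proof.
move=> mTh [mf f0 f1]; split.
- by apply/(measurable_restrictT _ mTh).
- by move=> t; rewrite patchE; case: ifPn => //; rewrite inE; exact: f0.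
rewrite -f1 [RHS]integral_mkcond; apply: eq_integral => t _.
by rewrite !patchE; case: ifP.
Qed.

Lemma restrict_cont {R : realType} k (Th : set 'rV[R]_k) (f : 'rV[R]_k -> R) s :
  {for s, continuous f} -> (\forall t \near s, Th t) ->
  forall eps : R, 0 < eps -> exists2 r : R, 0 < r &
    forall x, `|x - s| <= r -> `|(f \_ Th) x - (f \_ Th) s| <= eps.
Proof.
move=> /cvgrPdist_le fc nT eps e0.
have [r r0 H] := near_closed_ball (filterI nT (fc _ e0)).
exists r => // x /H[Tx fx]; have Ts := nbhs_singleton nT.
by rewrite !patchE !mem_set// distrC.
Qed.

Theorem theorem1 (R : realType)
  (d : measure_display) (Omega : measurableType d) (P : probability Omega R)
  (e1 e2 : measure_display) (T1 : measurableType e1) (T2 : measurableType e2)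
  (pstar : probability (T1 * T2)%type R)
  (X1 : nat -> Omega -> T1) (X2 : nat -> Omega -> T2)
  (d1 d2 : nat) (Th1 : set 'rV[R]_d1) (Th2 : set 'rV[R]_d2)
  (pi1 : 'rV[R]_d1 -> R) (pi2 : 'rV[R]_d2 -> R)
  (logf1 : T1 -> 'rV[R]_d1 -> R)
  (logf2 : T1 -> T2 -> 'rV[R]_(d1 + d2) -> R)
  (th1 : nat -> Omega -> 'rV[R]_d1) (th2 : nat -> Omega -> 'rV[R]_d2)
  (th1s : 'rV[R]_d1) (th2s : 'rV[R]_d2) :
  let p1 : probability T1 R := distribution pstar fst in
  let Theta := prodTheta Th1 Th2 in
  let L1 := loglik1 logf1 X1 in
  let L2 := loglik2 logf2 X1 X2 in
  let L := cut_loglik logf1 logf2 X1 X2 Th2 pi2 in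
  let th n w := row_mx (th1 n w) (th2 n w) in
  let ths := row_mx th1s th2s in
  (* setting *)
  iid P (fun j w => (X1 j w, X2 j w)) pstar ->
  measurable Th1 -> measurable Th2 ->
  is_density (lebesgue_rV d1) Th1 pi1 ->
  is_density (lebesgue_rV d2) Th2 pi2 ->
  measurable_fun (setT `*` Th1)
    (fun z : T1 * 'rV[R]_d1 => logf1 z.1 z.2) ->
  measurable_fun (setT `*` Theta)
    (fun z : (T1 * T2) * 'rV[R]_(d1 + d2) => logf2 z.1.1 z.1.2 z.2) ->
  (* two-step M-estimator *)
  (forall n w, is_argmax Th1 (L1 n w) (th1 n w)) ->
  (forall n w, is_argmax Th2 (fun t => L2 n w (row_mx (th1 n w) t))
                 (th2 n w)) ->
  (* two-step pseudo-true parameter *)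
  is_argmax Th1 (fun t => 'E_p1[fun x => logf1 x t]%E) th1s ->
  is_argmax Th2
    (fun t => 'E_pstar[fun z => logf2 z.1 z.2 (row_mx th1s t)]%E) th2s ->
  (* consistency *)
  cvg_in_prob0 P (fun n w => (enorm (th n w - ths))%:E) ->
  interior Theta ths ->
  (* (i) *)
  [/\ {for th1s, continuous pi1}, 0 < pi1 th1s,
      (\forall t \near th2s, differentiable pi2 t),
      {for th2s, continuous (grad pi2)} & 0 < pi2 th2s] ->
  (* (ii) *)
  (forall delta1 : R, 0 < delta1 -> exists gamma1 : R, 0 < gamma1 /\
     prob_to1 P (fun n => [set w |
       sup_at_most [set t1 | Th1 t1 /\ delta1 <= enorm (t1 - th1 n w)]
         (fun t1 => n%:R^-1 * (L1 n w t1 - L1 n w (th1 n w)))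
         (- gamma1)])) ->
  (forall delta2 : R, 0 < delta2 -> exists delta1 gamma2 : R,
     [/\ 0 < delta1, 0 < gamma2 &
     prob_to1 P (fun n => [set w |
       sup_at_most [set t | [/\ Theta t,
                          enorm (lsubmx t - th1 n w) < delta1 &
                          delta2 <= enorm (rsubmx t - th2 n w)]]
         (fun t => n%:R^-1 * (L2 n w t - L2 n w (th n w)))
         (- gamma2)])]) ->
  (* (iii) *)
  (forall n, {ae P, forall w, \forall t \near th n w,
     ntimes_differentiable 3 (L2 n w) t /\
     ntimes_differentiable_ereal 3 (L n w) t}) ->
  (exists (delta K : R) (M1 : nat -> Omega -> R),
     [/\ 0 < delta, 0 < K,
         prob_to1 P (fun n => [set w | M1 n w < K]) &
     {ae P, forall w, \forall n \near \oo,
       let DL := hess (fun t => fine (L n w t)) in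
       let D22 t2 := drsubmx (hess (L2 n w) (row_mx (th1 n w) t2)) in
       ((forall s, enorm s <= delta ->
           ntimes_differentiable_ereal 2 (L n w) (th n w + s)) /\
        (forall s, enorm s <= delta ->
           ntimes_differentiable 2 (L2 n w)
             (row_mx (th1 n w) (th2 n w + s)))) /\
       [/\ sup_at_most [set s | 0 < enorm s <= delta]
             (fun s => opnorm (DL (th n w + s) - DL (th n w))
                       / (n%:R * enorm s))
             (M1 n w),
           sup_at_most [set s | 0 < enorm s <= delta]
             (fun s => `|L2 n w (th n w + s) - L2 n w (th n w)|
                       / (n%:R * enorm s))
             (M1 n w) &
           sup_at_most [set s | 0 < enorm s <= delta]
             (fun s => opnorm (D22 (th2 n w + s) - D22 (th2 n w))
                       / (n%:R * enorm s))
             (M1 n w)]}]) ->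
  (* (iv) *)
  (exists (M2 : T1 -> R) (M3 : T1 * T2 -> R),
     [/\ p1.-integrable setT (EFin \o M2),
         pstar.-integrable setT (EFin \o M3) &
     \forall t \near ths,
       (forall x1, ntimes_differentiable 2 (logf1 x1) (lsubmx t) /\
          forall j k : 'I_d1, (j <= k)%N ->
            `|hess (logf1 x1) (lsubmx t) j k| <= M2 x1) /\
       (forall x1 x2, ntimes_differentiable 2 (logf2 x1 x2) t /\
          forall j k : 'I_(d1 + d2), (j <= k)%N ->
            `|hess (logf2 x1 x2) t j k| <= M3 (x1, x2))]) ->
  (* (v) *)
  (\forall t \near ths,
     posdefmx (- expectation_mx p1 (fun x => hess (logf1 x) (lsubmx t))) /\
     posdefmx (- expectation_mx pstar
                   (fun z => drsubmx (hess (logf2 z.1 z.2) t)))) ->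
  (* (vi) *)
  (exists (delta : R) (M4 : nat -> Omega -> R),
     [/\ 0 < delta, bounded_in_prob P M4 &
     {ae P, forall w, \forall n \near \oo,
       let D1 t := lsubmx (grad (L2 n w) t) in
       let D11 t2 := ulsubmx (hess (L2 n w) (row_mx (th1 n w) t2)) in
       let D12 t2 := ursubmx (hess (L2 n w) (row_mx (th1 n w) t2)) in
       ((forall s, enorm s <= delta ->
           ntimes_differentiable 2 (L2 n w)
             (row_mx (th1 n w) (th2 n w + s))) /\
        (forall s, enorm s <= delta ->
           differentiable (L2 n w) (th n w + s))) /\
       [/\ sup_at_most [set s | enorm s <= delta]
             (fun s => opnorm (D11 (th2 n w + s)) / n%:R) (M4 n w),
           sup_at_most [set s | enorm s <= delta]
             (fun s => opnorm (D12 (th2 n w + s)) / n%:R) (M4 n w),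
           sup_at_most [set s | enorm s <= delta]
             (fun s => enorm (D1 (th n w + s)) / n%:R) (M4 n w),
           sup_at_most [set s | 0 < enorm s <= delta]
             (fun s => opnorm (D11 (th2 n w + s) - D11 (th2 n w))
                       / (n%:R * enorm s))
             (M4 n w) &
           sup_at_most [set s | 0 < enorm s <= delta]
             (fun s => opnorm (D12 (th2 n w + s) - D12 (th2 n w))
                       / (n%:R * enorm s))
             (M4 n w)]}]) ->
  (* (vii) *)
  (let d1L2 n w t1 t2 := lsubmx (grad (L2 n w) (row_mx t1 t2)) in
   let d11L2 n w t1 t2 := ulsubmx (hess (L2 n w) (row_mx t1 t2)) in
   (exists (m : R) (M5 : nat -> Omega -> R),
     [/\ 0 < m, bounded_in_prob P M5 &
     forall n, {ae P, forall w,
       let g t := (enorm (d1L2 n w (th1 n w) t) ^+ 2 * pi2 t)%:E in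
       let h t := (opnorm (d11L2 n w (th1 n w) t) * pi2 t)%:E in
       [/\ {ae lebesgue_rV d2, forall t, Th2 t -> 0 < pi2 t ->
              ntimes_differentiable 2 (fun t1 => L2 n w (row_mx t1 t))
                (th1 n w)},
           (lebesgue_rV d2).-integrable Th2 g,
           (lebesgue_rV d2).-integrable Th2 h,
           ((n%:R `^ (- m))%:E * \int[lebesgue_rV d2]_(t in Th2) g t
              <= (M5 n w)%:E)%E &
           ((n%:R `^ (- m))%:E * \int[lebesgue_rV d2]_(t in Th2) h t
              <= (M5 n w)%:E)%E]}]) /\
   (exists delta : R, 0 < delta /\
     prob_to1 P (fun n => [set w |
       let B := [set t1 | enorm (t1 - th1 n w) < delta] in
       [/\ {ae lebesgue_rV d2, forall t, Th2 t -> 0 < pi2 t ->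
              forall t1, B t1 ->
                ntimes_differentiable 2 (fun u => L2 n w (row_mx u t)) t1},
           (lebesgue_rV d2).-integrable Th2 (fun t =>
             (ereal_sup [set (enorm (d1L2 n w t1 t) ^+ 2)%:E | t1 in B]
              * (pi2 t)%:E)%E) &
           (lebesgue_rV d2).-integrable Th2 (fun t =>
             (ereal_sup [set (enorm (d11L2 n w t1 t))%:E | t1 in B]
              * (pi2 t)%:E)%E)]]))) ->
  let J1 : 'M[R]_d1 := - expectation_mx p1 (fun x => hess (logf1 x) th1s) in
  let J2 : 'M[R]_d2 := - expectation_mx pstar
                (fun z => drsubmx (hess (logf2 z.1 z.2) ths)) in
  let RJ : 'M[R]_(d1, d2) := - expectation_mx pstar
                (fun z => ursubmx (hess (logf2 z.1 z.2) ths)) in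
  let H : 'M[R]_(d1 + d2) := block_mx (J1 + RJ *m invmx J2 *m RJ^T) RJ RJ^T J2 in
  H = invmx (block_mx
        (invmx J1)
        (- (invmx J1 *m RJ *m invmx J2))
        (- (invmx J2 *m RJ^T *m invmx J1))
        (invmx J2 + invmx J2 *m RJ^T *m invmx J1 *m RJ *m invmx J2)) /\
  cvg_in_prob0 P (fun n w =>
    tv_distance
      (pushforward
         (cut_posterior logf1 logf2 X1 X2 Th1 Th2 pi1 pi2 n w)
         (fun t => Num.sqrt n%:R *: (t - th n w)))
      (mvnormal 0 (invmx H))).

Proof.
move=> p1 Theta L1 L2 L th ths iidH mTh1 mTh2 den1 den2 mf1 mf2 am1 am2 _ _ cons int
  [c1 p1s d2s _ p2s] sep1 sep2 H3a [delta [K [M1 [de0 K0 PM1 Hlip]]]] [M2 [M3 [iM2 iM3 H4]]]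
  H5 _ [_ [dl [dl0 H7]]] J1 J2 RJ H.
have [mq1 q10 q1int] := restrict_density mTh1 den1.
have [mq2 q20 q2int] := restrict_density mTh2 den2.
have [r0 r00 loc] := near_closed_ball (filterI (int : \forall t \near ths, Theta t) H4).
have locT t : `|t - ths| <= r0 -> Theta t by case/loc.
(* Condition (iv) bounds the entries with [j <= k]; the others follow by symmetry of the Hessian. *)
have hsym k (f : 'rV[R]_k -> R) t (c : R) : ntimes_differentiable 2 f t ->
    (forall i j : 'I_k, (i <= j)%N -> `|hess f t i j| <= c) -> forall i j, `|hess f t i j| <= c.
  move=> df Hc i j; have [ij|/ltnW ij] := leqP i j; first exact: Hc.
  by rewrite -(hess_sym df) mxE; exact: Hc.
have loc1 t : `|t - th1s| <= r0 -> forall x1,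
    ntimes_differentiable 2 (logf1 x1) t /\ forall j k, `|hess (logf1 x1) t j k| <= M2 x1.
  move=> ht x1; have [|_ [+ _]] := loc (row_mx t th2s).
    by rewrite norm_row_mxB ge_max ht subrr normr0 ltW.
  by rewrite row_mxKl => /(_ x1)[df hb]; split => //; exact: hsym.
have loc2 t : `|t - ths| <= r0 -> forall x1 x2,
    ntimes_differentiable 2 (logf2 x1 x2) t /\
    forall j k, `|hess (logf2 x1 x2) t j k| <= M3 (x1, x2).
  by move=> /loc[_ [_ h]] x1 x2; have [df hb] := h x1 x2; split => //; exact: hsym.
have [] := nbhs_singleton H5; rewrite row_mxKl -/J1 -/J2 => pJ1 pJ2.
split; first exact: block_info_inv (posdefmx_unit pJ1) (posdefmx_unit pJ2).
pose Hs := expectation_mx pstar (fun z => hess (logf2 z.1 z.2) ths).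
have EJ2 : J2 = - drsubmx Hs.
  apply/matrixP => i j; rewrite !mxE; congr (- (fine 'E_pstar[_])%E).
  by apply/funext => z; rewrite !mxE.
have ERJ : RJ = - ursubmx Hs.
  apply/matrixP => i j; rewrite !mxE; congr (- (fine 'E_pstar[_])%E).
  by apply/funext => z; rewrite !mxE.
have Hlip' : {ae P, forall w, \forall n \near \oo,
    lip_bounds X1 X2 Th2 pi2 logf1 logf2 th1 th2 delta M1 n w}.
  by apply: filterS Hlip => w; apply: filterS => n /= [[a _] [b c _]].
have osc2 := osc_L2 iidH mTh1 mTh2 mf2 cons r00 locT loc2 de0 K0 PM1 Hlip'.
have Hdiff2 : exists dl : R, 0 < dl /\ prob_to1 P (fun n => [set w |
    {ae lebesgue_rV d2, forall t, Th2 t -> 0 < pi2 t ->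
      forall t1, enorm (t1 - th1 n w) < dl ->
        ntimes_differentiable 2 (fun u => L2 n w (row_mx u t)) t1}]).
  by exists dl; split => //; apply: prob_to1_sub H7 => n w [h _ _].
have [rhoE rhoE0 PE] := margin_event iidH mTh1 mTh2 mq2 q20 q2int mf2 am1 am2 cons
  r00 locT loc1 loc2 sep2 osc2 Hdiff2.
have oscl := osc_ell_event iidH mTh1 mTh2 mq2 q20 q2int mf1 mf2 cons r00 locT de0 K0 PM1 Hlip'
  rhoE0 PE (fun n w h => proj2 h).
have H3a' n : {ae P, forall w, \forall t \near th n w, ntimes_differentiable_ereal 3 (L n w) t}.
  by apply: filterS (H3a n) => w; apply: filterS => t [].
have Pdiff := ell_differentiable iidH mTh1 mTh2 mq2 q20 q2int mf2 cons r00 locT H3a'.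
pose q1 := pi1 \_ Th1; pose q2 := pi2 \_ Th2.
pose l1 n w := rlog1 logf1 X1 Th1 n w.
pose l2 n w := rlog2 logf2 X1 X2 Th1 Th2 n w.
pose ell n w := cut_ll q2 (l1 n w) (l2 n w).
(* Every event is put in the form [Q eta r]: a level, and a rate, radius or step chosen for that
   level. Raising [eta] weakens it, as [level_use] requires. *)
pose Q1 (eta g : R) n w := forall x, Th1 x -> eta <= `|x - th1 n w| ->
  L1 n w x - L1 n w (th1 n w) <= - g * n%:R.
pose Q2 (eta g : R) n w := forall x t, Th1 x -> Th2 t -> `|x - th1 n w| < g ->
  eta <= `|t - th2 n w| -> L2 n w (row_mx x t) - L2 n w (th n w) <= - g * n%:R.
pose Q3 (eta rho : R) n w := osc0 (l2 n w) ths rho (eta * n%:R).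
pose Q4 (eta rho : R) n w := dd_osc (ell n w) ths rho (eta * n%:R).
pose Q5 i j (eta h : R) n w := h < eta /\
    `|dd (l1 n w) (h *: delta_mx ord0 i) (h *: delta_mx ord0 j) th1s / (n%:R * h ^+ 2)
      - expectation_mx p1 (fun x => hess (logf1 x) th1s) i j| <= eta.
pose Q6 i j (eta h : R) n w := h < eta /\
    `|dd (l2 n w) (h *: delta_mx ord0 i) (h *: delta_mx ord0 j) ths / (n%:R * h ^+ 2)
      - Hs i j| <= eta.
have Psep1 (eta : R) : 0 < eta -> exists2 g : R, 0 < g & prob_to1 P (fun n => [set w | Q1 eta g n w]).
  move=> /sep1[g [g0 Pg]]; exists g => //; apply: prob_to1_sub Pg => n w S x Tx xe.
  apply: neg_rate => //; apply: (sup_at_mostP S); split => //.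
  by apply: le_trans xe _; exact: mx_norm_le_enorm.
have Psep2 (eta : R) : 0 < eta -> exists2 g : R, 0 < g & prob_to1 P (fun n => [set w | Q2 eta g n w]).
  move=> /sep2[de1 [g [de10 g0 Pg]]]; have D0 : 0 < d1%:R + 1 :> R by rewrite ltr_wpDl.
  (* One number serves both as the radius and as the rate, to fit the form with a single parameter;
     the divisor converts the Euclidean radius. *)
  exists (Num.min (de1 / (d1%:R + 1)) g); first by rewrite lt_min g0 divr_gt0.
  apply: prob_to1_sub Pg => n w S x t Tx Tt; rewrite lt_min => /andP[xd _] te.
  apply: le_trans (_ : - g * n%:R <= _); last first.
    by rewrite !mulNr lerN2 ler_wpM2r// ge_min lexx orbT.
  apply: neg_rate => //; apply: (sup_at_mostP (x := row_mx x t) S) => /=; rewrite row_mxKl row_mxKr; split.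
  - by split; rewrite ?row_mxKl ?row_mxKr.
  - by apply: le_lt_trans (enorm_le_norm _) _; rewrite mulrC -ltr_pdivlMr.
  - by apply: le_trans te _; exact: mx_norm_le_enorm.
have [g1 g10 Pg1] := levels Psep1.
have [g2 g20 Pg2] := levels Psep2.
have [ro ro0 Pro] := levels (Q := Q3) osc2.
have [rl rl0 Prl] := levels (Q := Q4) oscl.
have HA1 (ij : 'I_d1 * 'I_d1) : exists h : nat -> R, (forall m, 0 < h m) /\
    forall m, prob_to1 P (fun n => [set w | Q5 ij.1 ij.2 m.+1%:R^-1 (h m) n w]).
  by have [h h0 Ph] := levels (lln_r1 iidH mTh1 mf1 r00 locT loc1 iM2 ij.1 ij.2); exists h.
have HA2 (ij : 'I_(d1 + d2) * 'I_(d1 + d2)) : exists h : nat -> R, (forall m, 0 < h m) /\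
    forall m, prob_to1 P (fun n => [set w | Q6 ij.1 ij.2 m.+1%:R^-1 (h m) n w]).
  by have [h h0 Ph] := levels (lln_r2 iidH mTh1 mTh2 mf2 r00 locT loc2 iM3 ij.1 ij.2); exists h.
have [h1 Hh1] := choice HA1; have [h2 Hh2] := choice HA2.
have Pc (m : nat) : prob_to1 P (fun n => [set w | `|th n w - ths| <= m.+1%:R^-1]).
  by apply: (prob_to1_consistent cons); rewrite invr_gt0.
have Pl1 m := prob_to1_forall (fun ij => (Hh1 ij).2 m).
have Pl2 m := prob_to1_forall (fun ij => (Hh2 ij).2 m).
(* One event per level [m], each a finite intersection over conditions and matrix entries. *)
have PEv m := prob_to1_setI (prob_to1_setI (prob_to1_setI (Pg1 m) (Pg2 m))
  (prob_to1_setI (Pro m) (Prl m))) (prob_to1_setI (prob_to1_setI (Pl1 m) (Pl2 m))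
  (prob_to1_setI (Pc m) (prob_to1_setI PE Pdiff))).
apply: (cvg_in_prob0_seq PEv) => N w Nk Ev eps eps0.
have N_oo (A : R) : \forall k \near \oo, A <= (N k)%:R.
  exists (Num.truncn A).+1 => // k /= hk; apply/ltW/(lt_le_trans (truncnS_gt _)).
  by rewrite ler_nat (leq_trans hk).
have small (eta : R) : 0 < eta -> exists m : nat, m.+1%:R^-1 <= eta.
  move=> e0; exists (Num.truncn eta^-1).
  by rewrite -[leRHS]invrK lef_pV2 ?posrE ?invr_gt0// ltW// truncnS_gt.
have th_cvg (eta : R) : 0 < eta -> \forall k \near \oo, `|th (N k) (w k) - ths| <= eta.
  move=> /small[m hm]; apply: filterS (Ev m) => k [_ [_ [h _]]]; exact: le_trans hm.
have t1_cvg (eta : R) : 0 < eta -> \forall k \near \oo, `|th1 (N k) (w k) - th1s| <= eta.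
  by move=> /th_cvg; apply: filterS => k; rewrite norm_row_mxB ge_max => /andP[].
have t2_cvg (eta : R) : 0 < eta -> \forall k \near \oo, `|th2 (N k) (w k) - th2s| <= eta.
  by move=> /th_cvg; apply: filterS => k; rewrite norm_row_mxB ge_max => /andP[].
have E1 m : \forall k \near \oo, Q1 m.+1%:R^-1 (g1 m) (N k) (w k).
  by apply: filterS (Ev m) => k [[[h _] _] _].
have E2 m : \forall k \near \oo, Q2 m.+1%:R^-1 (g2 m) (N k) (w k).
  by apply: filterS (Ev m) => k [[[_ h] _] _].
have E3 m : \forall k \near \oo, Q3 m.+1%:R^-1 (ro m) (N k) (w k).
  by apply: filterS (Ev m) => k [[_ [h _]] _].
have E4 m : \forall k \near \oo, Q4 m.+1%:R^-1 (rl m) (N k) (w k).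
  by apply: filterS (Ev m) => k [[_ [_ h]] _].
have E5 i j m : \forall k \near \oo, Q5 i j m.+1%:R^-1 (h1 (i, j) m) (N k) (w k).
  by apply: filterS (Ev m) => k [_ [[h _] _]]; exact: (h (i, j)).
have E6 i j m : \forall k \near \oo, Q6 i j m.+1%:R^-1 (h2 (i, j) m) (N k) (w k).
  by apply: filterS (Ev m) => k [_ [[_ h] _]]; exact: (h (i, j)).
have sep1' (eta : R) : 0 < eta -> exists2 g : R, 0 < g & \forall k \near \oo, Q1 eta g (N k) (w k).
  by apply: (level_use g10 _ E1) => a b g n v _ ab h x Tx /(le_trans ab); exact: h.
have sep2' (eta : R) : 0 < eta -> exists2 g : R, 0 < g & \forall k \near \oo, Q2 eta g (N k) (w k).
  by apply: (level_use g20 _ E2) => a b g n v _ ab h x t Tx Tt xg /(le_trans ab); exact: h.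
have sep2'' (eta : R) : 0 < eta -> exists de1 g : R, [/\ 0 < de1, 0 < g & \forall k \near \oo,
    forall x t, Th1 x -> Th2 t -> `|x - th1 (N k) (w k)| < de1 -> eta <= `|t - th2 (N k) (w k)| ->
    L2 (N k) (w k) (row_mx x t) - L2 (N k) (w k) (th (N k) (w k)) <= - g * (N k)%:R].
  by move=> /sep2'[g g0 h]; exists g, g.
have osc2' (eta : R) : 0 < eta -> exists2 rho : R, 0 < rho &
    \forall k \near \oo, Q3 eta rho (N k) (w k).
  apply: (level_use ro0 _ E3) => a b rho n v _ ab h x y hx hy.
  by apply: le_trans (h x y hx hy) _; rewrite ler_wpM2r.
have osc_ell' (eta : R) : 0 < eta -> exists2 rho : R, 0 < rho &
    \forall k \near \oo, Q4 eta rho (N k) (w k).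
  apply: (level_use rl0 _ E4) => a b rho n v _ ab h x y u z hx hy.
  by apply: le_trans (h x y u z hx hy) _; rewrite ler_wpM2r ?mulr_ge0// ler_wpM2r.
have lln1' i j (eta h0 : R) : 0 < eta -> 0 < h0 -> exists h : R, [/\ 0 < h, h < h0 &
    \forall k \near \oo, `|dd (l1 (N k) (w k)) (h *: delta_mx ord0 i) (h *: delta_mx ord0 j) th1s
      / ((N k)%:R * h ^+ 2) + J1 i j| <= eta].
  move=> e0 h00; have mn0 : 0 < Num.min eta h0 by rewrite lt_min e0.
  have [|h hp Ph] := level_use (Hh1 (i, j)).1 _ (E5 i j) mn0.
    move=> a b h n v _ ab [ha hb]; split; [exact: lt_le_trans ab|exact: le_trans ab].
  (* The inequality on the step does not involve [k], so it can be read off at any index where the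
     event holds. *)
  have [K' _ HK] := Ph; have [hK _] := HK K' (leqnn K'); exists h; split => //.
    by move: hK; rewrite lt_min => /andP[].
  by apply: filterS Ph => k [_]; rewrite le_min => /andP[+ _]; rewrite [J1 i j]mxE.
have lln2' i j (eta h0 : R) : 0 < eta -> 0 < h0 -> exists h : R, [/\ 0 < h, h < h0 &
    \forall k \near \oo, `|dd (l2 (N k) (w k)) (h *: delta_mx ord0 i) (h *: delta_mx ord0 j) ths
      / ((N k)%:R * h ^+ 2) - Hs i j| <= eta].
  move=> e0 h00; have mn0 : 0 < Num.min eta h0 by rewrite lt_min e0.
  have [|h hp Ph] := level_use (Hh2 (i, j)).1 _ (E6 i j) mn0.
    move=> a b h n v _ ab [ha hb]; split; [exact: lt_le_trans ab|exact: le_trans ab].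
  have [K' _ HK] := Ph; have [hK _] := HK K' (leqnn K'); exists h; split => //.
    by move: hK; rewrite lt_min => /andP[].
  by apply: filterS Ph => k [_]; rewrite le_min => /andP[].
have fin' : exists2 rho : R, 0 < rho & \forall k \near \oo, forall x, `|x - th1s| <= rho ->
    marg q2 (l2 (N k) (w k)) x \is a fin_num.
  by exists rhoE => //; apply: filterS (Ev 0%N) => k [_ [_ [_ [[h _] _]]]].
have diff' : \forall k \near \oo, ntimes_differentiable 2 (ell (N k) (w k)) (th (N k) (w k)).
  by apply: filterS (Ev 0%N) => k [_ [_ [_ [_ h]]]].
have Theta_int : exists2 r : R, 0 < r & forall x, `|x - ths| <= r -> Theta x by exists r0.
have nT1 : \forall t \near th1s, Th1 t.
  by apply: (@closed_ball_near _ _ _ th1s) (loc_Th1 r00 locT); rewrite subrr normr0.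
have nT2 : \forall t \near th2s, Th2 t.
  apply: (@closed_ball_near _ _ _ th2s _ r0); first by rewrite subrr normr0.
  move=> t ht; have [_] : Theta (row_mx th1s t).
    by apply: locT; rewrite norm_row_mxB ge_max ht subrr normr0 (ltW r00).
  by rewrite row_mxKr.
have q1s : 0 < q1 th1s by rewrite /q1 patchE mem_set//; exact: nbhs_singleton nT1.
have q2s : 0 < q2 th2s by rewrite /q2 patchE mem_set//; exact: nbhs_singleton nT2.
have q1c := restrict_cont c1 nT1.
have q2c := restrict_cont (differentiable_continuous (nbhs_singleton d2s)) nT2.
have mX1 j : measurable_fun setT (X1 j).
  by have [m _ _] := iidH; exact: (measurableT_comp measurable_fst (m j)).
have mX2 j : measurable_fun setT (X2 j).
  by have [m _ _] := iidH; exact: (measurableT_comp measurable_snd (m j)).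
have ml1 k : measurable_fun setT (l1 (N k) (w k)).
  exact: (measurableT_comp (measurable_rlog1 mX1 mTh1 mf1 _) (measurable_pair1 _)).
have ml2 k : measurable_fun setT (l2 (N k) (w k)).
  exact: (measurableT_comp (measurable_rlog2 mX1 mX2 mTh1 mTh2 mf2 _) (measurable_pair1 _)).
have pJ2' : posdefmx (- drsubmx Hs) by rewrite -EJ2.
have := tv_cut_seq (f1 := fun k => L1 (N k) (w k)) (f2 := fun k => L2 (N k) (w k))
  mq1 q10 q1int mq2 q20 q2int ml1 ml2 (fun k => am1 _ _) (fun k => am2 _ _) N_oo t1_cvg t2_cvg
  Theta_int q1s q2s q1c q2c sep1' sep2'' osc2' fin' osc_ell' diff' pJ1 pJ2' lln1' lln2' eps0.
rewrite -EJ2 -ERJ; apply: filterS => k; rewrite gee0_abs//; exact: tv_distance_ge0.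
Qed.
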